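(* Let $K_{\rm cr}\in\mathcal L(X_{\rm cr},X)$ be such that $A_{\rm cr}+B_{\rm cr}K_{\rm cr}$ is Hurwitz, with $\|e^{(A_{\rm cr}+B_{\rm cr}K_{\rm cr})t}\|_{\mathcal L(X_{\rm cr})}\le M_{\rm cr}e^{-\omega_{\rm cr}t}$ for all $t\ge0$ ($M_{\rm cr}\ge1$, $\omega_{\rm cr}>0$), and let $A_F=A_n+BK_{\rm cr}P_{\rm cr}$, $D(A_F)=D(A_n)$, with $\|e^{A_Ft}\|_{\mathcal L(X)}\le M_Fe^{-\omega_Ft}$ for all $t\ge 0$, where $0<\omega_F<\min\{\rho,\omega_{\rm cr}\}$ and $M_F\ge1$. Assume that there exists $\mu_v>0$ such that, for almost every $t\ge0$ and all $\phi\in H^1(\Omega)$, $$\epsilon_2\|\phi_x\|_{L^2(\Omega)}^2+\bar\epsilon_2\|\phi_y\|_{L^2(\Omega)}^2-\int_\Omega\alpha_2(x,y,t)|\phi(x,y)|^2\,dx\,dy\ \ge\ \mu_v\|\phi\|_{H^1(\Omega)}^2 .$$ Suppose that, for some $0<\theta<\min\{\omega_F,\mu_v/2\}$, $$\Gamma(\theta):=G_{u\mathfrak d}(\theta)\,G_{\mathfrak du}(\theta)<1 .$$ Then the predictor feedback $U(t)=K_{\rm cr}P_{\rm cr}Y(t)$, $t\ge0$, exponentially stabilizes the delayed coupled system: there exists $M\ge1$ such that, for all $(u_0,v_0)\in\mathcal H$ and $U_0\in L^2(-D,0;X)$, the closed-loop energy solution satisfies $$\|(u(t),v(t),z(t))\|_{\mathcal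 X}\le Me^{-\theta t}\,\mathcal I_0,\qquad t\ge0,$$ where $\mathcal X=\mathcal H\times L^2((0,D);X)$ and $\mathcal I_0=\|(u_0,v_0)\|_{\mathcal H}+\|U_0\|_{L^2(-D,0;X)}$.
   Context: **System.** Let $\ell,d,D>0$, $I=(0,\ell)$, $\Omega=I\times(0,d)$, $X=L^2(I)$, $\epsilon_1,\epsilon_2,\bar\epsilon_2>0$. The coefficients $\alpha_1,\lambda_2\in L^\infty(I\times\mathbb R_+)$ and $\alpha_2,\lambda_1\in L^\infty(\Omega\times\mathbb R_+)$ are real-valued, and $g\in L^\infty(I;\mathbb R)$ satisfies $|\{x\in I: g(x)\ne0\}|>0$. The system is $$\partial_tu=\epsilon_1\partial_{xx}u+\alpha_1(x,t)u-\int_0^d\lambda_1(x,y,t)\partial_xv(x,y,t)\,dy+g(x)U(x,t-D)\quad (x\in I,\ t>0),$$ $$\partial_tv=\epsilon_2\partial_{xx}v+\bar\epsilon_2\partial_{yy}v+\alpha_2(x,y,t)v-\lambda_2(x,t)\partial_xu(x,t)\quad((x,y)\in\Omega,\ t>0),$$ with $u(0,t)=u(\ell,t)=0$, homogeneous Neumann conditions for $v$ on $\partial\Omega$, initial data $u(\cdot,0)=u_0$, $v(\cdot,\cdot,0)=v_0$, and input history $U(\cdot,\tau)=U_0(\cdot,\tau)$ for a.e. $\tau\in(-D,0)$, where $(u_0,v_0)\in\mathcal H$ and $U_0\in L^2(-D,0;X)$. Spaces: $\mathcal H=L^2(I)\times L^2(\Omega)$, $\mathcal V=H_0^1(I)\times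 H^1(\Omega)$ with the product Hilbert norms, and $\mathcal V\hookrightarrow\mathcal H\hookrightarrow\mathcal V'$. Coupling operators: $(C_{12}(t)v)(x)=\int_0^d\lambda_1(x,y,t)\partial_xv(x,y)\,dy$ and $(C_{21}(t)u)(x,y)=\lambda_2(x,t)\partial_xu(x)$. An *energy solution* for an input $U\in L^2_{\rm loc}([-D,\infty);X)$ with $U=U_0$ on $(-D,0)$ is $(u,v)$ belonging, for every $T>0$, to $L^2(0,T;\mathcal V)\cap H^1(0,T;\mathcal V')\cap C([0,T];\mathcal H)$, with $(u,v)(0)=(u_0,v_0)$, satisfying the system and boundary conditions in the variational sense: for a.e. $t>0$ and all $(\phi,\psi)\in\mathcal V$, $$\langle\partial_t(u,v),(\phi,\psi)\rangle_{\mathcal V',\mathcal V}+\epsilon_1\langle u_x,\phi_x\rangle+\epsilon_2\langle v_x,\psi_x\rangle+\bar\epsilon_2\langle v_y,\psi_y\rangle-\langle\alpha_1u,\phi\rangle-\langle\alpha_2v,\psi\rangle+\langle C_{12}(t)v,\phi\rangle+\langle C_{21}(t)u,\psi\rangle=\langle gU(\cdot,t-D),\phi\rangle .$$ **Nominal operator.** Fix $\bar\alpha_1\in L^\infty(I;\mathbb R)$. On $X$ let $A_n\phi=\epsilon_1\phi_{xx}+\bar\alpha_1\phi$, $D(A_n)=H^2(I)\cap H_0^1(I)$ (self-adjoint, compact resolvent, generates an analytic semigroup), and let $B\in\mathcal L(X)$, $(B\psi)(x)=g(x)\psi(x)$. Fix $\rho>0$. $P_{\rm cr}$ is the orthogonal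 spectral projection of $A_n$ associated with the eigenvalues in $(-\rho,\infty)$; $P_{\rm st}=I-P_{\rm cr}$, $X_{\rm cr}=P_{\rm cr}X$ (finite-dimensional), $X_{\rm st}=P_{\rm st}X$, $A_{\rm cr}=A_n|_{X_{\rm cr}}$, $B_{\rm cr}=P_{\rm cr}B\in\mathcal L(X,X_{\rm cr})$. **Predictor.** $z(s,t)=U(t-D+s)$ for $s\in(0,D)$, and $Y(t)=e^{A_nD}u(t)+\int_0^De^{A_n(D-s)}Bz(s,t)\,ds$. The closed loop is the system with $U(t)=K_{\rm cr}P_{\rm cr}Y(t)$ for $t\ge0$ and $U=U_0$ on $(-D,0)$; it has a unique global energy solution. **Weighted norms and gains.** For a Hilbert space $E$ and $\theta>0$, $\|f\|_{L^2_\theta(a,b;E)}=\left(\int_a^be^{2\theta t}\|f(t)\|_E^2\,dt\right)^{1/2}$. Set $$m_\alpha=\|\alpha_1-\bar\alpha_1\|_{L^\infty(I\times\mathbb R_+)},\quad M_{12}=\sqrt d\,\|\lambda_1\|_{L^\infty(\Omega\times\mathbb R_+)},\quad L_2=\|\lambda_2\|_{L^\infty(I\times\mathbb R_+)},\quad b_v=\frac{dL_2^2}{2\mu_v},$$ $$G_{\mathfrak du}(\theta)=m_\alpha\frac{\ell}{\pi}+M_{12}\sqrt{\frac{2b_v}{\mu_v-2\theta}} .$$ Let $C_n>0$, $\omega_n\in\mathbb R$ be constants with $\|e^{A_nr}\phi\|_{H_0^1(I)}\le C_nr^{-1/2}e^{\omega_nr}\|\phi\|_X$ for all $r>0$, $\phi\in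 X$, and set $G_D(\theta)=C_n\int_0^Dr^{-1/2}e^{(\omega_n+\theta)r}\,dr$. Let $C_{Y,1}(\theta),G^{(1)}_{Y\mathfrak d}(\theta)>0$ be constants such that, for every $T>0$, $Y_0\in X$ and $f\in L^2(0,T;X)$, the mild solution of $\dot Y=A_FY+e^{A_nD}f$, $Y(0)=Y_0$, satisfies $$\|Y\|_{L^2_\theta(0,T;H_0^1(I))}\le C_{Y,1}(\theta)\|Y_0\|_X+G^{(1)}_{Y\mathfrak d}(\theta)\|f\|_{L^2_\theta(0,T;X)}$$ (such constants exist for $0<\theta<\omega_F$). Finally, $G_{u\mathfrak d}(\theta)=e^{\theta D}G^{(1)}_{Y\mathfrak d}(\theta)+G_D(\theta)$. *)

(* Defs.v *)
From HB Require Import structures.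
From mathcomp Require Import all_boot all_order all_algebra.
From mathcomp Require Import all_classical all_reals all_analysis.
From mathcomp Require Import ess_sup_inf measurable_realfun.

Set Implicit Arguments.
Unset Strict Implicit.
Unset Printing Implicit Defensive.

Import Order.TTheory GRing.Theory Num.Theory.
Import numFieldNormedType.Exports.

Local Open Scope classical_set_scope.
Local Open Scope ring_scope.

(** All function spaces are real.

    An element of a Lebesgue space is a representative, i.e. an inhabitant of
    [LfunType]; equality of classes is [aeq] below.  Spaces over a domain [O]
    use Lebesgue measure restricted to [O], so the values of a representative
    outside [O] are irrelevant. *)

Section Lebesgue_spaces.
Context {dT : measure_display} {T : measurableType dT} {R : realType}.
Implicit Types (mu : {measure set T -> \bar R}) (f g : T -> R).

Definition L2 mu := LfunType mu (lee1n 2).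
Definition Linf mu := LfunType mu (leey 1).

Definition aeq mu f g : Prop := ae_eq mu setT f g.

Definition Lnrm mu (p : \bar R) f : R := fine ('N[mu]_p[EFin \o f])%E.
Definition nrm mu (f : L2 mu) : R := Lnrm mu 2%:E f.
Definition nrmoo mu (f : Linf mu) : R := Lnrm mu +oo%E f.

Definition dotp mu f g : R := \int[mu]_x (f x * g x).

Lemma Linf_ae_bounded mu (g : Linf mu) :
  exists C : R, {ae mu, forall x, `|g x| <= C}.
Proof.
have : ('N[mu]_+oo[EFin \o g] < +oo)%E by exact: Lfunction_finite.
rewrite unlock /=; case: ifPn => [mu0|]; last first.
  rewrite -leNgt => mu0 _; exists 0; apply: measure0_ae.
  by apply/eqP; rewrite eq_le mu0 measure_ge0.
move=> gfin; exists (fine (ess_sup mu (abse \o (EFin \o g)))).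
have := ess_sup_ge mu (abse \o (EFin \o g)).
apply: filterS => x /=.
by case: (ess_sup _ _) gfin => [r| |]//= _; rewrite leeNy_eq.
Qed.

Lemma Linf_mul_L2 mu (g : Linf mu) (f : L2 mu) :
  (g \* f : T -> R) \in Lfun mu 2%:E.
Proof.
have mg : measurable_fun setT (g : T -> R) by [].
have mf : measurable_fun setT (f : T -> R) by [].
have [C gC] := Linf_ae_bounded g.
have mgf : measurable_fun setT ((g : T -> R) \* f) by exact: measurable_funM.
rewrite inE; apply/andP; split; first by rewrite inE.
rewrite inE /= /finite_norm unlock /=; apply: poweR_lty.
have /integrableP[_ If] := Lfun2_integrable_sqr (LfunP f).
have bnd : (\int[mu]_x ((C ^+ 2)%:E * `|(EFin \o (fun x => f x ^+ 2)%R) x|) < +oo)%E.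
  rewrite ge0_integralZl//; last 2 first.
  - apply: measurableT_comp => //.
    by apply/measurable_EFinP; exact: measurable_funX.
  - by rewrite lee_fin sqr_ge0.
  by rewrite lte_mul_pinfty// lee_fin sqr_ge0.
refine (le_lt_trans _ bnd).
apply: ae_ge0_le_integral => //.
  - apply/measurable_EFinP.
    apply: (@measurableT_comp _ _ _ _ _ _ (fun x : R => x `^ 2)%R) => //.
    exact: measurableT_comp.
  - by move=> x _; rewrite mule_ge0// lee_fin sqr_ge0.
  - apply: measurable_funeM; apply: measurableT_comp => //.
    by apply/measurable_EFinP; exact: measurable_funX.
  - apply: filterS gC => x gxC _ /=.
    rewrite lee_fin powR_mulrn// normrM exprMn normrX.
    by rewrite ler_wpM2r ?sqr_ge0// lerXn2r ?nnegrE ?(le_trans _ gxC).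
Qed.

Definition mulop mu (g : Linf mu) (f : L2 mu) : L2 mu :=
  Lfun_Sub (lee1n 2) (Linf_mul_L2 g f).

End Lebesgue_spaces.

Section domains.
Context {R : realType}.

Notation leb := (@lebesgue_measure R).

Definition muI (a b : R) : {measure set (measurableTypeR R) -> \bar R} :=
  mrestr leb (measurable_itv `]a, b[).

Definition muOmega (l d : R) :
    {measure set (measurableTypeR R * measurableTypeR R) -> \bar R} :=
  mrestr (leb \x leb)%E
    (measurableX (measurable_itv `]0, l[) (measurable_itv `]0, d[)).

(** [I x R_+], with points [(x, t)]. *)
Definition muIt (l : R) :
    {measure set (measurableTypeR R * measurableTypeR R) -> \bar R} :=
  mrestr (leb \x leb)%E
    (measurableX (measurable_itv `]0, l[) (measurable_itv `[0, +oo[)).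

(** [Omega x R_+], with points [((x, y), t)]. *)
Definition muOmegat (l d : R) :
    {measure set (measurableTypeR R * measurableTypeR R * measurableTypeR R)
       -> \bar R} :=
  mrestr (leb \x leb \x leb)%E
    (measurableX (measurableX (measurable_itv `]0, l[) (measurable_itv `]0, d[))
       (measurable_itv `[0, +oo[)).

Definition XI (l : R) := L2 (muI 0 l).
Definition XO (l d : R) := L2 (muOmega l d).

End domains.

Section Bochner.
Context {dT : measure_display} {T : measurableType dT} {R : realType}.
Variable mu : {measure set T -> \bar R}.

Notation leb := (@lebesgue_measure R).

(** Pointwise limit on [D] of simple functions; every Bochner class on [D] has
    such a representative. *)
Definition strongly_measurable (D : set R) (f : R -> L2 mu) : Prop :=
  exists g : nat -> R -> L2 mu,
    (forall n, finite_set (range (g n)) /\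
       forall e, measurable (g n @^-1` [set e] : set (measurableTypeR R))) /\
    (forall t, D t -> nrm (g n t - f t) @[n --> \oo] --> (0 : R)).

Definition wnorm (th a b : R) (f : R -> L2 mu) : \bar R :=
  ((\int[leb]_(t in `]a, b[) (expR (2 * th * t) * nrm (f t) ^+ 2)%:E)
     `^ 2^-1)%E.

Definition Bochner_L2 (a b : R) (f : R -> L2 mu) : Prop :=
  strongly_measurable `]a, b[ f /\ (wnorm 0 a b f < +oo)%E.

(** [y] is the integral of [f] over [(a, b)], tested against [L^2]; this is the
    Bochner integral whenever [f] is Bochner integrable. *)
Definition is_vint (a b : R) (f : R -> L2 mu) (y : L2 mu) : Prop :=
  forall psi : L2 mu,
    leb.-integrable `]a, b[ (fun s => (dotp mu (f s) psi)%:E) /\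
    \int[leb]_(s in `]a, b[) dotp mu (f s) psi = dotp mu y psi.

End Bochner.

Section Sobolev.
Context {R : realType}.
Implicit Types (l d : R).

Definition smooth1 (eta : R -> R) : Prop :=
  forall n x, derivable (derive1n n eta) x 1.

Definition test1 (a b : R) (eta : R -> R) : Prop :=
  smooth1 eta /\ exists K : set R,
    [/\ compact K, K `<=` `]a, b[ & forall x, ~ K x -> eta x = 0].

Definition pdx (f : R * R -> R) (p : R * R) : R :=
  derive1 (fun x : R => f (x, p.2)) p.1.
Definition pdy (f : R * R -> R) (p : R * R) : R :=
  derive1 (fun y : R => f (p.1, y)) p.2.

(** All iterated partial derivatives (indexed by words) exist and are
    continuous. *)
Definition smooth2 (eta : R * R -> R) : Prop :=
  forall w : seq bool,
    let h := foldr (fun (b : bool) f => if b then pdx f else pdy f) eta w in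
    [/\ continuous h,
        forall p, derivable (fun x : R => h (x, p.2)) p.1 1 &
        forall p, derivable (fun y : R => h (p.1, y)) p.2 1].

Definition test2 l d (eta : R * R -> R) : Prop :=
  smooth2 eta /\ exists K : set (R * R),
    [/\ compact K, K `<=` `]0, l[ `*` `]0, d[ &
        forall p, ~ K p -> eta p = 0].

Definition wderiv l (phi dphi : XI l) : Prop :=
  forall eta, test1 0 l eta ->
    dotp (muI 0 l) phi (derive1 eta) = - dotp (muI 0 l) dphi eta.

(** [phi] belongs to [H_0^1(I)], the closure of the test functions in
    [H^1(I)], and [dphi] is its weak derivative. *)
Definition in_H01 l (phi dphi : XI l) : Prop :=
  wderiv phi dphi /\
  forall e : R, 0 < e -> exists2 eta, test1 0 l eta &
    ('N[muI 0 l]_2%:E[EFin \o (phi \- eta)%R] < e%:E)%E /\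
    ('N[muI 0 l]_2%:E[EFin \o (dphi \- derive1 eta)%R] < e%:E)%E.

(** [psi] belongs to [H^1(Omega)] and [(px, py)] is its weak gradient. *)
Definition in_H1 l d (psi px py : XO l d) : Prop :=
  forall eta, test2 l d eta ->
    dotp (muOmega l d) psi (pdx eta) = - dotp (muOmega l d) px eta /\
    dotp (muOmega l d) psi (pdy eta) = - dotp (muOmega l d) py eta.

(** An element of [V = H_0^1(I) x H^1(Omega)] with its weak derivatives. *)
Definition in_V l d (phi dphi : XI l) (psi px py : XO l d) : Prop :=
  in_H01 phi dphi /\ in_H1 psi px py.

(** [H_0^1(I)] is normed by [|dphi|_{L^2}]. *)
Definition Vnorm l d (dphi : XI l) (psi px py : XO l d) : R :=
  Num.sqrt (nrm dphi ^+ 2 + (nrm psi ^+ 2 + nrm px ^+ 2 + nrm py ^+ 2)).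

Definition Hnorm l d (phi : XI l) (psi : XO l d) : R :=
  Num.sqrt (nrm phi ^+ 2 + nrm psi ^+ 2).

End Sobolev.

(** Operators on [L^2] act on representatives, so linearity is required up to
    almost everywhere equality; boundedness makes them well defined on
    classes.  An unbounded operator [A] is given by its graph: [A phi f] means
    that [phi] is in the domain and [A phi = f]. *)
Section operators.
Context {dT : measure_display} {T : measurableType dT} {R : realType}.
Variable mu : {measure set T -> \bar R}.
Implicit Types (E : set (L2 mu)) (A : L2 mu -> L2 mu -> Prop).

Definition bounded_linear E (K : L2 mu -> L2 mu) : Prop :=
  (forall (a : R) phi psi, E phi -> E psi ->
     aeq mu (K (a *: phi + psi)) (a *: K phi + K psi)) /\
  exists C : R, forall phi, E phi -> nrm (K phi) <= C * nrm phi.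

(** [S] is the strongly continuous semigroup on the closed subspace [E] with
    generator [A], i.e. [S t] is [exp(t A)]. *)
Definition is_semigroup E A (S : R -> L2 mu -> L2 mu) : Prop :=
  [/\ forall t, 0 <= t ->
        (forall phi, E phi -> E (S t phi)) /\ bounded_linear E (S t),
      forall phi, E phi -> aeq mu (S 0 phi) phi /\
        forall s t, 0 <= s -> 0 <= t -> aeq mu (S (s + t) phi) (S s (S t phi)),
      forall phi, E phi -> nrm (S h phi - phi) @[h --> 0^'+] --> (0 : R) &
      forall phi f, E phi -> E f ->
        (A phi f <-> nrm (h^-1 *: (S h phi - phi) - f) @[h --> 0^'+] --> (0 : R))].

(** Every eigenvalue [a + i b] of the complexification of the operator has
    [a < 0]; the eigenvector is [phi + i psi]. *)
Definition Hurwitz E A : Prop :=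
  forall (a b : R) phi psi, E phi -> E psi -> 0 < nrm phi + nrm psi ->
    A phi (a *: phi - b *: psi) -> A psi (b *: phi + a *: psi) -> a < 0.

Definition orthogonal_projection E (P : L2 mu -> L2 mu) : Prop :=
  forall phi, E (P phi) /\
    forall psi, E psi -> dotp mu (phi - P phi : L2 mu) psi = 0.

End operators.

Section nominal.
Context {R : realType}.
Variables (l e1 : R).
Notation X := (XI l).
Notation aeqX := (aeq (muI 0 l)).
Variable a1bar : Linf (muI 0 l).

(** [A_n phi = e1 phi_xx + a1bar phi] on [H^2(I)] intersected with
    [H_0^1(I)]. *)
Definition An (phi f : X) : Prop :=
  exists dphi ddphi : X, [/\ in_H01 phi dphi, wderiv dphi ddphi &
    aeqX f (fun x => e1 * ddphi x + a1bar x * phi x)].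

(** Linear span of the eigenfunctions of [A_n] for eigenvalues in
    [(-rho, +oo)]. *)
Definition Xcr (rho : R) (phi : X) : Prop :=
  exists (n : nat) (lam : 'I_n -> R) (e : 'I_n -> X),
    (forall i, - rho < lam i /\ An (e i) (lam i *: e i)) /\
    aeqX phi (\sum_(i < n) e i : X).

Variables (g : Linf (muI 0 l)) (rho : R) (P K : X -> X).

(** [A_cr + B_cr K_cr] on [X_cr]. *)
Definition Acr_cl (phi f : X) : Prop :=
  Xcr rho phi /\ exists2 h, An phi h &
    aeqX f (h + P (mulop g (K phi)) : X).

(** [A_F = A_n + B K_cr P_cr] with the domain of [A_n]. *)
Definition AF (phi f : X) : Prop :=
  exists2 h, An phi h & aeqX f (h + mulop g (K (P phi)) : X).

End nominal.

Section system.
Context {R : realType}.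
Variables (l d D e1 e2 e2b : R).
Notation X := (XI l).
Notation W := (XO l d).
Notation mI := (muI 0 l).
Notation mO := (muOmega l d).
Notation leb := (@lebesgue_measure R).
Variables (al1 : Linf (muIt l)) (al2 : Linf (muOmegat l d)).
Variables (lam1 : Linf (muOmegat l d)) (lam2 : Linf (muIt l)).
Variable g : Linf mI.

(** The coupling operators, as functions of the [x]-derivative of their
    argument. *)
Definition C12 (t : R) (vx : R * R -> R) (x : R) : R :=
  \int[leb]_(y in `]0, d[) (lam1 (x, y, t) * vx (x, y)).
Definition C21 (t : R) (ux : R -> R) (p : R * R) : R :=
  lam2 (p.1, t) * ux p.1.

(** [w], a function of time with values in the functionals on [V], belongs to
    [L^2(0, tau; V')]. *)
Definition L2_dual (tau : R) (w : R -> X -> W -> R) : Prop :=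
  [/\ {ae leb, forall t, 0 < t < tau ->
        forall (a : R) phi1 dphi1 psi1 px1 py1 phi2 dphi2 psi2 px2 py2,
        in_V phi1 dphi1 psi1 px1 py1 -> in_V phi2 dphi2 psi2 px2 py2 ->
        w t (a *: phi1 + phi2) (a *: psi1 + psi2) =
          a * w t phi1 psi1 + w t phi2 psi2},
      forall phi dphi psi px py, in_V phi dphi psi px py ->
        measurable_fun (`]0, tau[ : set (measurableTypeR R))
          (fun t => w t phi psi) &
      exists c : L2 (muI 0 tau), {ae leb, forall t, 0 < t < tau ->
        forall phi dphi psi px py, in_V phi dphi psi px py ->
        `|w t phi psi| <= c t * Vnorm dphi psi px py}].

(** [w] is the distributional time derivative of [(u, v)] on [(0, tau)]. *)
Definition time_derivative (tau : R) (u : R -> X) (v : R -> W)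
    (w : R -> X -> W -> R) : Prop :=
  forall eta phi dphi psi px py,
    test1 0 tau eta -> in_V phi dphi psi px py ->
    \int[leb]_(t in `]0, tau[)
      (derive1 eta t * (dotp mI (u t) phi + dotp mO (v t) psi)) =
    - \int[leb]_(t in `]0, tau[) (eta t * w t phi psi).

Definition energy_solution (u0 : X) (v0 : W) (U0 U : R -> X)
    (u : R -> X) (v : R -> W) : Prop :=
  [/\ (forall tau, 0 < tau -> Bochner_L2 (- D) tau U) /\
      {ae leb, forall s, - D < s < 0 -> aeq mI (U s) (U0 s)},
      (forall t0, 0 <= t0 ->
        nrm (u t - u t0) @[t --> within `[0, +oo[ (nbhs t0)] --> (0 : R) /\
        nrm (v t - v t0) @[t --> within `[0, +oo[ (nbhs t0)] --> (0 : R)) /\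
      (aeq mI (u 0) u0 /\ aeq mO (v 0) v0) &
      exists (ux : R -> X) (vx vy : R -> W) (w : R -> X -> W -> R),
      [/\ (forall tau, 0 < tau ->
            [/\ Bochner_L2 0 tau u, Bochner_L2 0 tau ux, Bochner_L2 0 tau v,
                Bochner_L2 0 tau vx & Bochner_L2 0 tau vy]),
          {ae leb, forall t, 0 < t -> in_V (u t) (ux t) (v t) (vx t) (vy t)},
          (forall tau, 0 < tau -> L2_dual tau w /\ time_derivative tau u v w) &
          {ae leb, forall t, 0 < t ->
            forall phi dphi psi px py, in_V phi dphi psi px py ->
            w t phi psi
            + e1 * dotp mI (ux t) dphi
            + e2 * dotp mO (vx t) px + e2b * dotp mO (vy t) py
            - dotp mI (fun x => al1 (x, t) * u t x) phi
            - dotp mO (fun p => al2 (p, t) * v t p) psi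
            + dotp mI (C12 t (vx t)) phi + dotp mO (C21 t (ux t)) psi
            = dotp mI (mulop g (U (t - D))) phi}]].

Variables (S : R -> X -> X) (P K : X -> X).

Definition zhist (U : R -> X) (t s : R) : X := U (t - D + s).

(** [Y] is the predictor, with [S t = exp(t A_n)]. *)
Definition is_predictor (U u Y : R -> X) : Prop :=
  forall t, 0 <= t -> exists2 J : X,
    is_vint 0 D (fun s => S (D - s) (mulop g (zhist U t s))) J &
    aeq mI (Y t) (S D (u t) + J : X).

Definition closed_loop_solution (u0 : X) (v0 : W) (U0 U : R -> X)
    (u : R -> X) (v : R -> W) : Prop :=
  energy_solution u0 v0 U0 U u v /\
  exists2 Y, is_predictor U u Y &
    {ae leb, forall t, 0 <= t -> aeq mI (U t) (K (P (Y t)))}.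

Definition state_norm (U u : R -> X) (v : R -> W) (t : R) : R :=
  Num.sqrt (Hnorm (u t) (v t) ^+ 2 + fine (wnorm 0 0 D (zhist U t)) ^+ 2).

End system.

Section gains.
Context {R : realType}.
Variables (l d D : R).
Notation leb := (@lebesgue_measure R).
Variables (al1 : Linf (muIt l)) (a1bar : Linf (muI 0 l)).
Variables (lam1 : Linf (muOmegat l d)) (lam2 : Linf (muIt l)).

Definition m_alpha : R := Lnrm (muIt l) +oo%E (fun p => al1 p - a1bar p.1).
Definition M12 : R := Num.sqrt d * nrmoo lam1.
Definition b_v (mu_v : R) : R := d * nrmoo lam2 ^+ 2 / (2 * mu_v).
Definition G_du (mu_v th : R) : R :=
  m_alpha * (l / pi) + M12 * Num.sqrt (2 * b_v mu_v / (mu_v - 2 * th)).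
Definition G_D (Cn omn th : R) : R :=
  Cn * \int[leb]_(r in `]0, D[) ((Num.sqrt r)^-1 * expR ((omn + th) * r)).
Definition G_ud (Cn omn GYd th : R) : R := expR (th * D) * GYd + G_D Cn omn th.

(** [|e^{A_n r} phi|_{H_0^1} <= Cn r^{-1/2} e^{omn r} |phi|]. *)
Definition smoothing_estimate (S : R -> XI l -> XI l) (Cn omn : R) : Prop :=
  forall r phi, 0 < r -> exists2 dphi, in_H01 (S r phi) dphi &
    nrm dphi <= Cn * (Num.sqrt r)^-1 * expR (omn * r) * nrm phi.

(** [Y] is the mild solution on [[0, tau]] of
    [Y' = A_F Y + e^{A_n D} f], [Y(0) = Y0]. *)
Definition mild_solution (S SF : R -> XI l -> XI l) (tau : R) (Y0 : XI l)
    (f Y : R -> XI l) : Prop :=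
  forall t, 0 <= t <= tau -> exists2 J : XI l,
    is_vint 0 t (fun s => SF (t - s) (S D (f s))) J &
    aeq (muI 0 l) (Y t) (SF t Y0 + J : XI l).

(** [|Y|_{L^2_th(0,T;H_0^1)} <= CY1 |Y0| + GYd |f|_{L^2_th(0,T;X)}] for mild
    solutions; [dY] is the [x]-derivative of [Y]. *)
Definition mild_estimate (S SF : R -> XI l -> XI l) (th CY1 GYd : R) : Prop :=
  forall (tau : R) (Y0 : XI l) (f Y : R -> XI l),
    0 < tau -> Bochner_L2 0 tau f -> mild_solution S SF tau Y0 f Y ->
    exists dY : R -> XI l,
      [/\ strongly_measurable `]0, tau[ dY,
          {ae leb, forall t, 0 < t < tau -> in_H01 (Y t) (dY t)} &
          (wnorm th 0 tau dY <=
             (CY1 * nrm Y0)%:E + GYd%:E * wnorm th 0 tau f)%E].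

End gains.

(* Main.v *)
(** The coupling terms of the [u]-equation enter as a forcing [F] with
    [|F| <= m_alpha |u| + M12 |v_x|].  By Duhamel's formula the predictor is a
    mild solution of [Y' = A_F Y + e^{A_n D} F], and
    [u (t) - Y (t - D) = \int_(t - D)^t e^{A_n (t - s)} F (s) ds], so that the
    smoothing estimate and Young's inequality bound [u_x] in weighted [L^2] by
    [G_ud |F|] plus the data.  Conversely, by Poincare's inequality with the
    constant [l / pi] and by the energy inequality of the [v]-equation, [|F|] is
    at most [G_du |u_x|] plus the data.  The small-gain condition closes this
    loop uniformly in the length of the time interval, and weighted energy
    inequalities turn the [L^2] bound into a pointwise one. *)

Require Import Defs.
From HB Require Import structures.
From mathcomp Require Import all_boot all_order all_algebra finmap.
From mathcomp Require Import all_classical all_reals all_analysis.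
From mathcomp Require Import ess_sup_inf measurable_realfun ring lra.

Set Implicit Arguments.
Unset Strict Implicit.
Unset Printing Implicit Defensive.

Import Order.TTheory GRing.Theory Num.Theory.
Import numFieldNormedType.Exports.

Local Open Scope classical_set_scope.
Local Open Scope ring_scope.

(** * The spaces [L2] *)

(** The nominal semigroup is given only by its generator and the smoothing estimate; density of test
    functions, boundedness near time [0] and symmetry of [S] all have to be extracted from these.
    Three obstacles shape the rest. The time derivative of the state is a mere functional on [V], so
    energies are built from increments of scalar pairings. The closed-loop generator is not
    symmetric, so its variation of constants formula cannot be reached by transposition; integral
    identities are instead compared near each tag with Cousin's lemma, where an error
    [e * (L s' - L s)], with [L] the primitive of an integrable function, is small enough. Finally,
    [Y (t - D)] exists only for [t >= D]: on the first window [(0, D)] the gradient is bounded by a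
    Gronwall argument for the energy [kappa |u|^2 + |v|^2], in which [kappa] lets the diffusion of
    [u] pay for its coupling into [v]. The absorption in the small-gain step is legitimate because
    on a bounded interval every weighted norm is finite. *)

Section L2_space.
Context {dT : measure_display} {T : measurableType dT} {R : realType}.
Context {mu : {measure set T -> \bar R}}.
Implicit Types f g h : L2 mu.

Lemma L2_mul_integrable f g : mu.-integrable setT (EFin \o (f \* g)).
Proof. by apply/Lfun1_integrable/Lfun2_mul_Lfun1; exact: LfunP. Qed.

Lemma dotpC (f g : T -> R) : dotp mu f g = dotp mu g f.
Proof. by apply: eq_Rintegral => x _; rewrite mulrC. Qed.

Lemma dotpDl f g h : dotp mu (f + g) h = dotp mu f h + dotp mu g h.
Proof.
rewrite -RintegralD ?L2_mul_integrable//.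
by apply: eq_Rintegral => x _ /=; rewrite mulrDl.
Qed.

Lemma dotpZl a f g : dotp mu (a *: f) g = a * dotp mu f g.
Proof.
rewrite -RintegralZl ?L2_mul_integrable//.
by apply: eq_Rintegral => x _ /=; rewrite mulrA.
Qed.

Lemma dotpDr f g h : dotp mu h (f + g) = dotp mu h f + dotp mu h g.
Proof. by rewrite !(dotpC h) dotpDl. Qed.

Lemma dotpZr a f g : dotp mu g (a *: f) = a * dotp mu g f.
Proof. by rewrite !(dotpC g) dotpZl. Qed.

Lemma dotpNl f g : dotp mu (- f) g = - dotp mu f g.
Proof. by rewrite -scaleN1r dotpZl mulN1r. Qed.

Lemma dotpNr f g : dotp mu g (- f) = - dotp mu g f.
Proof. by rewrite -scaleN1r dotpZr mulN1r. Qed.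

Lemma dotpBl f g h : dotp mu (f - g) h = dotp mu f h - dotp mu g h.
Proof. by rewrite dotpDl dotpNl. Qed.

Lemma dotpBr f g h : dotp mu h (f - g) = dotp mu h f - dotp mu h g.
Proof. by rewrite dotpDr dotpNr. Qed.

Lemma dotp0l f : dotp mu (0 : L2 mu) f = 0.
Proof. by rewrite -(scale0r 0) dotpZl mul0r. Qed.

Lemma dotp0r f : dotp mu f (0 : L2 mu) = 0.
Proof. by rewrite dotpC dotp0l. Qed.

Lemma aeq_refl (f : T -> R) : aeq mu f f.
Proof. exact: ae_eq_refl. Qed.

Lemma aeq_sym (f g : T -> R) : aeq mu f g -> aeq mu g f.
Proof. exact: ae_eq_sym. Qed.

Lemma aeq_trans (f g h : T -> R) : aeq mu f g -> aeq mu g h -> aeq mu f h.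
Proof. exact: ae_eq_trans. Qed.

Lemma aeq_dotpl (f f' g : T -> R) :
  measurable_fun setT f -> measurable_fun setT f' -> measurable_fun setT g ->
  aeq mu f f' -> dotp mu f g = dotp mu f' g.
Proof.
move=> mf mf' mg ff'; congr fine; apply: ae_eq_integral => //.
- by apply/measurable_EFinP; exact: measurable_funM.
- by apply/measurable_EFinP; exact: measurable_funM.
- by apply: filterS ff' => x /= -> .
Qed.

Lemma nrm_ge0 f : 0 <= nrm f.
Proof. by rewrite /nrm/Lnrm fine_ge0// Lnorm_ge0. Qed.

Lemma EFin_nrm f : (nrm f)%:E = 'N[mu]_2%:E[EFin \o f]%E.
Proof. exact: finite_norm_fine. Qed.

Lemma nrm_sqr f : nrm f ^+ 2 = dotp mu f f.
Proof.
rewrite /dotp /Rintegral -[LHS]/(fine (nrm f ^+ 2)%:E); congr fine.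
rewrite -powR_mulrn ?nrm_ge0// -poweR_EFin EFin_nrm powR_Lnorm//.
apply: eq_integral => x _ /=; congr (_%:E).
by rewrite powR_mulrn// real_normK ?num_real// expr2.
Qed.

Lemma nrmE f : nrm f = Num.sqrt (dotp mu f f).
Proof. by rewrite -nrm_sqr sqrtr_sqr ger0_norm// nrm_ge0. Qed.

Lemma dotp_ge0 f : 0 <= dotp mu f f.
Proof. by rewrite -nrm_sqr sqr_ge0. Qed.

Lemma nrm0 : nrm (0 : L2 mu) = 0.
Proof. by rewrite nrmE dotp0l sqrtr0. Qed.

Lemma nrmZ a f : nrm (a *: f) = `|a| * nrm f.
Proof.
by rewrite !nrmE dotpZl dotpZr mulrA -expr2 sqrtrM ?sqr_ge0// sqrtr_sqr.
Qed.

Lemma nrmN f : nrm (- f) = nrm f.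
Proof. by rewrite -scaleN1r nrmZ normrN1 mul1r. Qed.

Lemma nrmBC f g : nrm (f - g) = nrm (g - f).
Proof. by rewrite -nrmN opprB. Qed.

Lemma cauchy_schwarz f g : `|dotp mu f g| <= nrm f * nrm g.
Proof.
rewrite -ler_sqr ?nnegrE ?mulr_ge0 ?nrm_ge0// exprMn !nrm_sqr.
rewrite real_normK ?num_real//.
have h a b : 0 <= a ^+ 2 * dotp mu f f + 2 * a * b * dotp mu f g
    + b ^+ 2 * dotp mu g g.
  have := dotp_ge0 (a *: f + b *: g).
  rewrite dotpDl !dotpDr !dotpZl !dotpZr (dotpC g f).
  by move: (dotp _ _ _) (dotp _ _ _) (dotp _ _ _) => x y z; lra.
have := h (dotp mu g g) (- dotp mu f g).
(* With these coefficients the form equals [|f|^2 (|f|^2 |g|^2 - <f, g>^2)]; the other two choices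
   cover [|f| = 0]. *)
have := h (- dotp mu f g) (dotp mu f f).
have := h 1 (- (dotp mu f g)).
have := dotp_ge0 f; have := dotp_ge0 g.
move: (dotp mu f f) (dotp mu g g) (dotp mu f g) => a b c b0 a0.
have [->|a_neq0] := eqVneq a 0.
  have [->|b_neq0] := eqVneq b 0; first by nra.
  by move=> _ _; nra.
move=> _ h2 _; have {a_neq0} a1 : 0 < a by rewrite lt_neqAle eq_sym a_neq0.
have : 0 <= a * (a * b - c ^+ 2) by nra.
by rewrite pmulr_rge0// subr_ge0.
Qed.

Lemma dotp_le f g : dotp mu f g <= nrm f * nrm g.
Proof. exact: le_trans (ler_norm _) (cauchy_schwarz _ _). Qed.

Lemma nrmD f g : nrm (f + g) <= nrm f + nrm g.
Proof. exact: ler_LnormD. Qed.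

Lemma nrmB f g : nrm (f - g) <= nrm f + nrm g.
Proof. by rewrite (le_trans (nrmD _ _))// nrmN. Qed.

Lemma nrm_le_dist f g : nrm f <= nrm g + nrm (f - g).
Proof. by rewrite -{1}(subrK g f) addrC nrmD. Qed.

Lemma ler_dist_nrm f g : `|nrm f - nrm g| <= nrm (f - g).
Proof.
have := nrm_le_dist f g; have := nrm_le_dist g f; rewrite (nrmBC g f).
by rewrite ler_norml => h1 h2; apply/andP; split; lra.
Qed.

Lemma nrm_dist_trans g f h : nrm (f - h) <= nrm (f - g) + nrm (g - h).
Proof. by rewrite -{1}(subrKA g f) nrmD. Qed.

Lemma nrm_sqrD f g :
  nrm (f + g) ^+ 2 = nrm f ^+ 2 + 2 * dotp mu f g + nrm g ^+ 2.
Proof. by rewrite !nrm_sqr dotpDl !dotpDr (dotpC g f); ring. Qed.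

Lemma aeq_nrmB0 f g : aeq mu f g <-> nrm (f - g) = 0.
Proof.
split=> [fg|/fine_Lnormr_eq0 h].
  apply/eqP; rewrite -sqrf_eq0 nrm_sqr; apply/eqP.
  rewrite -(dotp0l (f - g)); apply: aeq_dotpl => //.
  by apply: filterS fg => x /= h _; rewrite -[LHS]/(f x - g x) h// subrr.
apply: filterS h => x h _; apply/eqP; rewrite -subr_eq0; apply/eqP.
exact: h.
Qed.

Lemma aeq_nrm f g : aeq mu f g -> nrm f = nrm g.
Proof.
move=> /aeq_nrmB0 h; apply/eqP; rewrite -subr_eq0 -normr_le0.
by rewrite (le_trans (ler_dist_nrm _ _))// h.
Qed.

Lemma aeq_dotp f g h : aeq mu f g -> dotp mu f h = dotp mu g h.
Proof. exact: aeq_dotpl. Qed.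

Lemma aeqD f f' g g' : aeq mu f f' -> aeq mu g g' ->
  aeq mu (f + g : L2 mu) (f' + g' : L2 mu).
Proof.
apply: filterS2 => x /= h1 h2 _.
by rewrite -[LHS]/(f x + g x) -[RHS]/(f' x + g' x) h1// h2.
Qed.

Lemma aeqZ a f f' : aeq mu f f' -> aeq mu (a *: f : L2 mu) (a *: f' : L2 mu).
Proof.
by apply: filterS => x /= h _; rewrite -[LHS]/(a * f x) h.
Qed.

Lemma dotp_ext f g : (forall h, dotp mu f h = dotp mu g h) -> aeq mu f g.
Proof.
move=> fg; apply/aeq_nrmB0/eqP; rewrite -sqrf_eq0 nrm_sqr dotpBl fg subrr//.
Qed.

(** The class of [f] when [f] is square integrable, and [0] otherwise. *)
Definition toL2 (f : T -> R) : L2 mu :=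
  match pselect (f \in Lfun mu 2%:E) with
  | left fP => Lfun_Sub (lee1n 2) fP
  | right _ => 0
  end.

Lemma toL2E (f : T -> R) : f \in Lfun mu 2%:E -> toL2 f = f :> (T -> R).
Proof. by rewrite /toL2; case: pselect. Qed.

Lemma Lfun2P (f : T -> R) : measurable_fun setT f ->
  (\int[mu]_x (f x ^+ 2)%:E < +oo)%E -> f \in Lfun mu 2%:E.
Proof.
move=> mf foo; rewrite inE; apply/andP; split; first by rewrite inE.
rewrite inE /= /finite_norm unlock /=; apply: poweR_lty.
apply: le_lt_trans foo; rewrite le_eqVlt; apply/orP; left; apply/eqP.
apply: eq_integral => x _ /=; congr (_%:E).
by rewrite powR_mulrn// real_normK ?num_real// expr2.
Qed.

Lemma EFin_nrm_sqr f : ((nrm f ^+ 2)%:E = \int[mu]_x (f x ^+ 2)%:E)%E.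
Proof.
rewrite nrm_sqr /dotp /Rintegral fineK; last first.
  exact: integrable_fin_num (L2_mul_integrable f f).
by apply: eq_integral => x _; rewrite expr2.
Qed.

End L2_space.

(** * Integration against a restricted measure *)

Section restricted_measure.
Context {dT : measure_display} {T : measurableType dT} {R : realType}.
Variables (mu : {measure set T -> \bar R}) (D : set T) (mD : measurable D).

Lemma ge0_integral_mrestr (f : T -> \bar R) :
  measurable_fun setT f -> (forall x, 0 <= f x)%E ->
  (\int[mrestr mu mD]_x f x = \int[mu]_(x in D) f x)%E.
Proof.
move=> mf f0; rewrite -(setUv D) ge0_integral_setU//=; first last.
- by rewrite disj_set2E setICr.
- exact: measurable_funTS.
- exact: measurableC.
rewrite [X in (_ + X)%E](_ : _ = 0%E) ?adde0.
  by apply: eq_measure_integral => A mA AD /=; rewrite /mrestr setIidl.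
rewrite (ge0_negligible_integral (measurableC mD)) ?setDv ?integral_set0//.
- exact: measurableC.
- exact: measurable_funTS.
- by rewrite /= /mrestr setICl measure0.
Qed.

Lemma integral_mrestr (f : T -> \bar R) : measurable_fun setT f ->
  (\int[mrestr mu mD]_x f x = \int[mu]_(x in D) f x)%E.
Proof.
move=> mf; rewrite [LHS]integralE [RHS]integralE !ge0_integral_mrestr//.
- exact: measurable_funeneg.
- exact: measurable_funepos.
Qed.

Lemma Rintegral_mrestr (f : T -> R) : measurable_fun setT f ->
  \int[mrestr mu mD]_x f x = \int[mu]_(x in D) f x.
Proof.
by move=> mf; rewrite /Rintegral integral_mrestr//; exact/measurable_EFinP.
Qed.

Lemma integrable_mrestr (f : T -> \bar R) : measurable_fun setT f ->
  (mrestr mu mD).-integrable setT f <-> mu.-integrable D f.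
Proof.
move=> mf; split=> /integrableP[_ foo]; apply/integrableP.
  split; first exact: measurable_funTS.
  by rewrite -ge0_integral_mrestr//; exact: measurableT_comp.
by split=> //; rewrite ge0_integral_mrestr//; exact: measurableT_comp.
Qed.

Lemma ae_mrestr (Q : T -> Prop) :
  {ae mrestr mu mD, forall x, Q x} <-> {ae mu, forall x, D x -> Q x}.
Proof.
split=> -[N [mN N0 QN]].
  exists (N `&` D); split; first exact: measurableI.
  - exact: N0.
  - by move=> x /= /not_implyP[Dx nQ]; split => //; exact: QN.
exists (N `|` ~` D); split; first by apply: measurableU => //; exact: measurableC.
- rewrite /= /mrestr setIUl setICl setU0.
  by apply: (subset_measure0 _ _ _ N0) => //; exact: measurableI.
- move=> x /= nQ; have [Dx|] := pselect (D x); last by right.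
  by left; apply: QN => /= /(_ Dx).
Qed.

End restricted_measure.

(** * Integrals over open time intervals and Cousin's lemma *)

Section time_integrals.
Context {R : realType}.
Notation leb := (@lebesgue_measure R).
Implicit Types (a b c : R) (f : R -> R).

Lemma oo_sub a b c d : a <= c -> d <= b -> `]c, d[ `<=` (`]a, b[ : set R).
Proof.
move=> ac db x /=; rewrite !in_itv/= => /andP[cx xd].
by rewrite (le_lt_trans ac cx) (lt_le_trans xd db).
Qed.

Lemma oo0 a b : b <= a -> `]a, b[%classic = set0 :> set R.
Proof. by move=> ba; rewrite set_itv_ge// -leNgt bnd_simp. Qed.

Lemma integrable_oo_sub a b c d (f : R -> \bar R) : a <= c -> d <= b ->
  leb.-integrable `]a, b[ f -> leb.-integrable `]c, d[ f.
Proof. by move=> ac db; apply: integrableS => //; exact: oo_sub. Qed.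

Lemma integral_oo_cc a b (f : R -> \bar R) : measurable_fun `]a, b[ f ->
  (\int[leb]_(t in `[a, b]) f t = \int[leb]_(t in `]a, b[) f t)%E.
Proof. by move=> mf; rewrite integral_itv_bndoo. Qed.

Lemma Rintegral_oo_cat a b c f : a <= b -> b <= c ->
  leb.-integrable `]a, c[ (EFin \o f) ->
  \int[leb]_(t in `]a, c[) f t =
  \int[leb]_(t in `]a, b[) f t + \int[leb]_(t in `]b, c[) f t.
Proof.
rewrite le_eqVlt => /predU1P[->|ab].
  by rewrite (@oo0 b b)// Rintegral_set0 add0r.
rewrite le_eqVlt => /predU1P[->|bc].
  by rewrite (@oo0 c c)// Rintegral_set0 addr0.
move=> fi; rewrite (@itv_bndbnd_setU _ _ _ (BRight b)) ?bnd_simp ?ltW//.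
rewrite Rintegral_setU//=.
- congr (_ + _); rewrite Rintegral_itv_bndo_bndc//.
  by apply: integrable_oo_sub fi => //; exact: ltW.
- by rewrite -itv_bndbnd_setU ?bnd_simp ?ltW//.
- apply/disj_setPS => x [/=]; rewrite !in_itv/= => /andP[_ xb] /andP[bx _].
  by move: (le_lt_trans xb bx); rewrite ltxx.
Qed.

Lemma Rintegral_oo_cst a b (r : R) : a <= b ->
  \int[leb]_(t in `]a, b[) r = r * (b - a).
Proof.
move=> ab; rewrite Rintegral_cst//= lebesgue_measure_itv/= lte_fin.
by move: ab; rewrite le_eqVlt => /predU1P[->|->]//; rewrite ltxx subrr.
Qed.

Lemma integrable_oo_cst a b (r : R) : leb.-integrable `]a, b[ (EFin \o cst r).
Proof.
apply: measurable_bounded_integrable => //=.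
- by rewrite lebesgue_measure_itv/=; case: ifP => //; rewrite -EFinB ltry.
- by exists `|r|; split => // M rM t _ /=; exact: ltW.
Qed.

Lemma le_ae_Rintegral d (T : measurableType d) (mu : {measure set T -> \bar R})
  (D : set T) (f g : T -> R) : measurable D ->
  mu.-integrable D (EFin \o f) -> mu.-integrable D (EFin \o g) ->
  {ae mu, forall x, D x -> f x <= g x} ->
  \int[mu]_(x in D) f x <= \int[mu]_(x in D) g x.
Proof.
move=> mD fi gi fg; rewrite -subr_ge0 -RintegralB//.
(* [g - f] is replaced by its positive part, with which it agrees almost everywhere and whose
   integral is nonnegative pointwise. *)
rewrite (_ : Rintegral _ _ _ = \int[mu]_(x in D) Num.max (g x - f x) 0).
  by apply: Rintegral_ge0 => x _; rewrite le_max lexx orbT.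
have mgf : measurable_fun D (fun x => g x - f x).
  by apply: measurable_funB; apply/measurable_EFinP; [case/integrableP : gi|
     case/integrableP : fi].
congr fine; apply: ae_eq_integral => //.
- exact/measurable_EFinP.
- by apply/measurable_EFinP; exact: measurable_maxr.
- by apply: filterS fg => x /= h Dx; rewrite max_l// subr_ge0 h.
Qed.

Lemma eq_ae_Rintegral d (T : measurableType d) (mu : {measure set T -> \bar R})
  (D : set T) (f g : T -> R) : measurable D ->
  measurable_fun D f -> measurable_fun D g ->
  {ae mu, forall x, D x -> f x = g x} ->
  \int[mu]_(x in D) f x = \int[mu]_(x in D) g x.
Proof.
move=> mD mf mg fg; congr fine; apply: ae_eq_integral => //.
- exact/measurable_EFinP.
- exact/measurable_EFinP.
- by apply: filterS fg => x /= h Dx; rewrite h.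
Qed.

(** Cousin's lemma: the local estimate is only required on intervals tagged by
    an interior point [t], whose size may depend on [t]. *)
Lemma cousin a b (Z L : R -> R) : a <= b ->
  (forall e t : R, 0 < e -> a <= t <= b -> exists2 del : R, 0 < del &
    forall s s', a <= s <= t -> t <= s' <= b -> t - del < s -> s' < t + del ->
      Z s' - Z s <= e * (L s' - L s)) ->
  Z b <= Z a.
Proof.
move=> ab loc; suff h e : 0 < e -> Z b - Z a <= e * (L b - L a).
  rewrite -subr_le0; apply/ler_addgt0Pr => e e0; rewrite add0r.
  have p : 0 < 1 + `|L b - L a| by rewrite ltr_wpDr.
  rewrite (le_trans (h (e / (1 + `|L b - L a|)) _)) ?divr_gt0//.
  rewrite mulrAC ler_pdivrMr// ler_pM2l//.
  by rewrite (le_trans (ler_norm _))// lerDr.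
(* [A] collects the end points reached with the allowed error. Its supremum serves as the tag: a
   point of [A] just left of it and a point just right of it are joined by [loc], so the supremum
   can only be [b]. *)
move=> e0; pose A := [set x | a <= x <= b /\ Z x - Z a <= e * (L x - L a)].
have Aa : A a by split; rewrite ?lexx ?ab ?subrr ?mulr0.
have Ab : ubound A b by move=> x [/andP[]].
have hA : has_sup A by split; [exists a|exists b].
have ac : a <= sup A by exact: sup_upper_bound.
have cb : sup A <= b by apply: ge_sup => //; exists a.
have [||del del0 H] := loc e (sup A) => //; first by rewrite ac.
have [x [/andP[ax xb] Zx] xc] := sup_adherent del0 hA.
have xs : x <= sup A.
  by apply: sup_upper_bound => //; split => //; rewrite ax.
have step s' : sup A <= s' -> s' <= b -> s' < sup A + del -> A s'.
  move=> cs sb sd; split; first by rewrite (le_trans ac)//.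
  have := H x s'; rewrite ax xs cs sb xc sd => /(_ isT isT isT isT).
  by move: Zx; rewrite !mulrBr; lra.
have [->|cltb] := eqVneq b (sup A).
  by case: (step (sup A)) => //; rewrite ltrDl.
have {}cltb : sup A < b by rewrite lt_neqAle eq_sym cltb.
pose s' := Num.min b (sup A + del / 2).
have h1 : sup A < s' by rewrite lt_min cltb ltrDl divr_gt0.
have : A s'.
  apply: step; first exact: ltW.
    by rewrite ge_min lexx.
  by rewrite gt_min ltrD2l ltr_pdivrMr// ltr_pMr// ltr1n orbT.
by move=> /(sup_upper_bound hA); rewrite leNgt h1.
Qed.

End time_integrals.

(** * Changes of variables on the line *)

Section change_of_variables.
Context {R : realType}.
Notation leb := (@lebesgue_measure R).
Implicit Types (a b c : R).

Definition tshift c (t : measurableTypeR R) : measurableTypeR R := t + c.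
Definition reflect_at c (t : measurableTypeR R) : measurableTypeR R := c - t.

Lemma measurable_tshift c : measurable_fun setT (tshift c).
Proof. exact: measurable_funD. Qed.

Lemma measurable_reflect_at c : measurable_fun setT (reflect_at c).
Proof. exact: measurable_funB. Qed.

HB.instance Definition _ c :=
  isMeasurableFun.Build _ _ _ _ (tshift c) (measurable_tshift c).
HB.instance Definition _ c :=
  isMeasurableFun.Build _ _ _ _ (reflect_at c) (measurable_reflect_at c).

Lemma lebesgue_measure_shift c (A : set R) : measurable A ->
  pushforward leb (tshift c) A = leb A.
Proof.
move=> mA; apply/esym/lebesgue_measure_unique => //= _ [[a b]] _ <-.
rewrite /pushforward (_ : _ @^-1` _ = `]a - c, b - c]%classic); last first.
  by apply/seteqP; split=> x /=; rewrite /tshift !in_itv/= ltrBlDr lerBrDr.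
rewrite !lebesgue_measure_itv/= !lte_fin ltrD2r; case: ifPn => // _.
by congr (_%:E); rewrite opprB addrA subrK.
Qed.

Lemma lebesgue_measure_reflect c (A : set R) : measurable A ->
  pushforward leb (reflect_at c) A = leb A.
Proof.
move=> mA; apply/esym/lebesgue_measure_unique => //= _ [[a b]] _ <-.
rewrite /pushforward (_ : _ @^-1` _ = `[c - b, c - a[%classic); last first.
  apply/seteqP; split=> x /=; rewrite /reflect_at !in_itv/= => /andP[h1 h2];
    by apply/andP; split; lra.
rewrite !lebesgue_measure_itv/= !lte_fin ltrD2l ltrN2; case: ifPn => // _.
by congr (_%:E); rewrite opprB; lra.
Qed.

Lemma integral_shift a b c (f : R -> \bar R) :
  measurable_fun `]a + c, b + c[ f ->
  (\int[leb]_(t in `]a, b[) f (t + c)%R = \int[leb]_(t in `](a + c)%R, (b + c)%R[) f t)%E.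
Proof.
have E : tshift c @^-1` `]a + c, b + c[ = `]a, b[%classic.
  by apply/seteqP; split => x /=; rewrite /tshift !in_itv/= !ltrD2r.
have ge0 (h : R -> \bar R) : (forall x, 0 <= h x)%E ->
    measurable_fun `]a + c, b + c[ h ->
  (\int[leb]_(t in `]a, b[) h (t + c)%R = \int[leb]_(t in `](a + c)%R, (b + c)%R[) h t)%E.
  move=> h0 mh; rewrite -E.
  rewrite -(@ge0_integral_pushforward _ _ _ _ _ (tshift c) _ leb `]a + c, b + c[ h)//.
  by apply: eq_measure_integral => A mA _; exact: lebesgue_measure_shift.
move=> mf; rewrite [LHS]integralE [RHS]integralE -(ge0 f^\+%E) -?(ge0 f^\-%E)//.
- by congr (_ - _)%E; apply: eq_integral => t _; rewrite !unlock.
- exact: measurable_funeneg.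
- exact: measurable_funepos.
Qed.

Lemma integral_reflect a b c (f : R -> \bar R) :
  measurable_fun `]c - b, c - a[ f ->
  (\int[leb]_(t in `]a, b[) f (c - t)%R = \int[leb]_(t in `](c - b)%R, (c - a)%R[) f t)%E.
Proof.
have E : reflect_at c @^-1` `]c - b, c - a[ = `]a, b[%classic.
  by apply/seteqP; split => x /=; rewrite /reflect_at !in_itv/= !ltrD2l !ltrN2 andbC.
have ge0 (h : R -> \bar R) : (forall x, 0 <= h x)%E ->
    measurable_fun `]c - b, c - a[ h ->
  (\int[leb]_(t in `]a, b[) h (c - t)%R = \int[leb]_(t in `](c - b)%R, (c - a)%R[) h t)%E.
  move=> h0 mh; rewrite -E.
  rewrite -(@ge0_integral_pushforward _ _ _ _ _ (reflect_at c) _ leb `]c - b, c - a[ h)//.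
  by apply: eq_measure_integral => A mA _; exact: lebesgue_measure_reflect.
move=> mf; rewrite [LHS]integralE [RHS]integralE -(ge0 f^\+%E) -?(ge0 f^\-%E)//.
- by congr (_ - _)%E; apply: eq_integral => t _; rewrite !unlock.
- exact: measurable_funeneg.
- exact: measurable_funepos.
Qed.

Lemma measurable_fun_shift d (U : measurableType d) a b c (f : R -> U) :
  measurable_fun `]a + c, b + c[ f ->
  measurable_fun `]a, b[ (fun t => f (t + c)).
Proof.
move=> mf; apply: (@measurable_comp _ _ _ _ _ _ `]a + c, b + c[ f _ (tshift c)) => //.
- by move=> _ [x /=] + <-; rewrite /tshift !in_itv/= !ltrD2r.
- by apply: measurable_funTS; exact: measurable_tshift.
Qed.

Lemma measurable_fun_reflect d (U : measurableType d) a b c (f : R -> U) :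
  measurable_fun `]c - b, c - a[ f ->
  measurable_fun `]a, b[ (fun t => f (c - t)).
Proof.
move=> mf; apply: (@measurable_comp _ _ _ _ _ _ `]c - b, c - a[ f _ (reflect_at c)) => //.
- by move=> _ [x /=] + <-; rewrite /reflect_at !in_itv/= !ltrD2l !ltrN2 andbC.
- by apply: measurable_funTS; exact: measurable_reflect_at.
Qed.

Lemma integrable_shift a b c (f : R -> \bar R) :
  leb.-integrable `]a + c, b + c[ f ->
  leb.-integrable `]a, b[ (fun t => f (t + c)).
Proof.
move=> /integrableP[mf foo]; apply/integrableP; split.
  exact: measurable_fun_shift.
by rewrite (integral_shift (f := fun t => `|f t|%E))//; exact: measurableT_comp.
Qed.

(** Tonelli for the convolution of [k], cut off to [(0, H)], with [kap]: for each such [r] the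
    points [t - r] stay in [(a - H, b)]. It serves twice, with [k = 1] for sliding means and with
    the smoothing kernel in Young's inequality. *)
Lemma ge0_integral_conv_le a b (H : R) (k kap : R -> \bar R) :
  measurable_fun setT k -> measurable_fun setT kap ->
  (forall t, 0 <= k t)%E -> (forall t, 0 <= kap t)%E ->
  (\int[leb]_(t in `]a, b[) \int[leb]_(r in `]0%R, H[) (k r * kap (t - r)%R) <=
   \int[leb]_(r in `]0%R, H[) k r * \int[leb]_(t in `](a - H)%R, b[) kap t)%E.
Proof.
move=> mk mkap k0 kap0.
pose F (p : measurableTypeR R * measurableTypeR R) : \bar R :=
  ((k \_ `]0%R, H[) p.2 * kap (p.1 - p.2)%R)%E.
pose G (p : measurableTypeR R * measurableTypeR R) : \bar R :=
  ((\1_(`]a, b[ : set R) p.1)%:E * F p)%E.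
have mk' : measurable_fun setT (k \_ `]0%R, H[).
  apply/(measurable_restrictT _ _).1 => //; exact: (measurable_funTS mk).
have k'0 t : (0 <= (k \_ `]0%R, H[) t)%E by rewrite patchE; case: ifP.
have mF : measurable_fun setT F.
  apply: emeasurable_funM; first exact: measurableT_comp.
  by apply: (measurableT_comp mkap); exact: measurable_funB.
have mG : measurable_fun setT G.
  apply: emeasurable_funM => //; apply/measurable_EFinP.
  by apply: measurableT_comp => //; exact: measurable_indic.
have G0 x : (0 <= G x)%E by rewrite !mule_ge0// lee_fin.
have EG t r : G (t, r) = ((\1_(`]a, b[ : set R) t)%:E * F (t, r))%E by [].
apply: (@le_trans _ _ (\int[leb]_t \int[leb]_r G (t, r))%E).
  rewrite le_eqVlt; apply/orP; left; apply/eqP.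
  rewrite [LHS]integral_mkcond; apply: eq_integral => t _; rewrite patchE.
  case: ifPn => tab.
    rewrite [LHS]integral_mkcond; apply: eq_integral => r _.
    rewrite EG indicE tab mul1e /F/= !patchE; by case: ifPn; rewrite ?mul0e.
  by apply/esym; apply: integral0_eq => r _; rewrite EG indicE (negbTE tab) mul0e.
rewrite (fubini_tonelli G)//= [X in (_ <= X * _)%E]integral_mkcond.
rewrite -ge0_integralZr//; last exact: integral_ge0.
apply: ge0_le_integral => //.
- by move=> r _; exact: integral_ge0.
- exact: (measurable_fun_fubini_tonelli_G G).
- by apply: emeasurable_funM.
- move=> r _; rewrite [leLHS](_ : _ =
  ((k \_ `]0%R, H[) r * \int[leb]_(t in `]a, b[) kap (t - r)%R)%E); last first.
  rewrite -ge0_integralZl//.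
  - rewrite [RHS]integral_mkcond; apply: eq_integral => t _.
    by rewrite EG patchE indicE; case: ifPn; rewrite ?mul1e ?mul0e.
  - by apply: measurable_funTS; apply: (measurableT_comp mkap); exact: measurable_tshift.
rewrite patchE; case: ifPn => [/set_mem|_]; last by rewrite !mul0e.
rewrite /= in_itv/= => /andP[r0 rH].
apply: lee_wpmul2l => //; rewrite (integral_shift (c := - r))//; last first.
  exact: measurable_funTS.
apply: ge0_subset_integral => //.
- exact: measurable_funTS.
- by apply: oo_sub; lra.
Qed.

End change_of_variables.

(** * Bochner integration *)

Section integrable_domination.
Context d (T : measurableType d) (R : realType) (mu : {measure set T -> \bar R}).
Variables (D : set T).
Implicit Types f g : T -> R.

Lemma integrable_Rle f g : measurable D -> measurable_fun D f ->
  (forall x, D x -> `|f x| <= g x) -> mu.-integrable D (EFin \o g) ->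
  mu.-integrable D (EFin \o f).
Proof.
move=> mD mf fg; apply: le_integrable => //; first exact/measurable_EFinP.
by move=> x Dx /=; rewrite lee_fin (le_trans (fg x Dx))// ler_norm.
Qed.

Lemma integrable_aeRle f g : measurable D -> measurable_fun D f ->
  {ae mu, forall x, D x -> `|f x| <= g x} -> mu.-integrable D (EFin \o g) ->
  mu.-integrable D (EFin \o f).
Proof.
move=> mD mf fg /integrableP[mg goo]; apply/integrableP; split.
  exact/measurable_EFinP.
apply: le_lt_trans goo; apply: ae_ge0_le_integral => //.
- by do 2 apply: measurableT_comp => //.
- exact: measurableT_comp.
- by apply: filterS fg => x h Dx /=; rewrite lee_fin (le_trans (h Dx))// ler_norm.
Qed.

End integrable_domination.

Section real_integrable.
Context d (T : measurableType d) (R : realType) (mu : {measure set T -> \bar R}).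
Variables (D : set T) (mD : measurable D).
Implicit Types f g : T -> R.

Lemma integrable_RZl f r : mu.-integrable D (EFin \o f) ->
  mu.-integrable D (EFin \o (fun x => r * f x)).
Proof. by move=> /(integrableZl mD r); apply: eq_integrable. Qed.

Lemma integrable_RD f g : mu.-integrable D (EFin \o f) ->
  mu.-integrable D (EFin \o g) -> mu.-integrable D (EFin \o (fun x => f x + g x)).
Proof. by move=> fi gi; have := integrableD mD fi gi; apply: eq_integrable. Qed.

Lemma integrable_RN f : mu.-integrable D (EFin \o f) ->
  mu.-integrable D (EFin \o (fun x => - f x)).
Proof. by move=> fi; have := integrableN fi; apply: eq_integrable. Qed.

Lemma integrable_RB f g : mu.-integrable D (EFin \o f) ->
  mu.-integrable D (EFin \o g) -> mu.-integrable D (EFin \o (fun x => f x - g x)).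
Proof. by move=> fi gi; apply: integrable_RD => //; exact: integrable_RN. Qed.

Lemma integrable_measurable_fun f : mu.-integrable D (EFin \o f) -> measurable_fun D f.
Proof. by move=> /integrableP[/measurable_EFinP]. Qed.

Lemma EFin_Rintegral f : mu.-integrable D (EFin \o f) ->
  (\int[mu]_(x in D) f x)%:E = (\int[mu]_(x in D) (f x)%:E)%E.
Proof. by move=> fi; rewrite /Rintegral fineK// integrable_fin_num. Qed.

Lemma ge0_integrable f : measurable_fun D f -> (forall x, D x -> 0 <= f x) ->
  (\int[mu]_(x in D) (f x)%:E < +oo)%E -> mu.-integrable D (EFin \o f).
Proof.
move=> mf f0 foo; apply/integrableP; split; first exact/measurable_EFinP.
apply: le_lt_trans foo; rewrite le_eqVlt; apply/orP; left; apply/eqP.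
by apply: eq_integral => x /set_mem Dx /=; rewrite ger0_norm// f0.
Qed.

End real_integrable.

(** * Strongly measurable functions and their simple approximants *)

Section strong_measurability.
Context {dT : measure_display} {T : measurableType dT} {R : realType}.
Context {mu : {measure set T -> \bar R}}.
Notation leb := (@lebesgue_measure R).
Notation RR := (measurableTypeR R).
Implicit Types (D : set RR) (f g : R -> L2 mu).

Lemma cvg_lip (a e : nat -> R) (l C : R) :
  (forall n, `|a n - l| <= C * e n) -> e @ \oo --> (0 : R) -> a @ \oo --> l.
Proof.
move=> ae e0; apply/cvgrPdist_le => /= eps eps0.
have C1 : 0 < `|C| + 1 by rewrite ltr_wpDl.
have /cvgrPdist_le/(_ (eps / (`|C| + 1)) (divr_gt0 eps0 C1)) := e0.
apply: filterS => n /=; rewrite sub0r normrN => h.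
rewrite distrC (le_trans (ae n))// (le_trans (ler_norm _))// normrM.
rewrite (le_trans (_ : _ <= (`|C| + 1) * `|e n|))//; first by rewrite ler_wpM2r// lerDl.
by rewrite -ler_pdivlMl// mulrC.
Qed.

Definition finite_valued g := finite_set (range g) /\
  forall e, measurable (g @^-1` [set e] : set RR).

Lemma measurable_finite_valued d (U : measurableType d) g
    (phi : R -> L2 mu -> U) D : finite_valued g -> measurable D ->
  (forall e, measurable_fun D (phi ^~ e)) ->
  measurable_fun D (fun t => phi t (g t)).
Proof.
move=> [fr mg] mD mphi _ B mB.
rewrite (_ : D `&` _ = \bigcup_(e in range g)
    ((g @^-1` [set e]) `&` (D `&` (phi ^~ e) @^-1` B))).
  apply: fin_bigcup_measurable => // e _; apply: measurableI => //.
  exact: mphi.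
apply/seteqP; split=> t /=.
  by move=> [Dt Bt]; exists (g t) => //; exists t.
by move=> [e _ [<- [Dt Bt]]].
Qed.

(** Pass to the limit along the simple approximants. [phi] may depend on [t], which is what the
    distance to a moving function and a semigroup run with a time-dependent argument require. *)
Lemma measurable_fun_sm D f (phi : R -> L2 mu -> R) :
  measurable D -> strongly_measurable D f ->
  (forall e, measurable_fun D (phi ^~ e)) ->
  (forall t (h : nat -> L2 mu), D t -> nrm (h n - f t) @[n --> \oo] --> (0 : R) ->
    phi t (h n) @[n --> \oo] --> phi t (f t)) ->
  measurable_fun D (fun t => phi t (f t)).
Proof.
move=> mD [g [fg gf]] mphi cphi.
apply: (@measurable_fun_cvg _ _ _ _ (fun n t => phi t (g n t))).
- by move=> n; apply: measurable_finite_valued => //; split; case: (fg n).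
- by move=> t Dt; apply: cphi => //; exact: gf.
Qed.

Lemma cvg_nrm (h : nat -> L2 mu) (x e : L2 mu) : nrm (h n - x) @[n --> \oo] --> (0 : R) ->
  nrm (h n - e) @[n --> \oo] --> nrm (x - e).
Proof.
apply: cvg_lip (1) _ => n; rewrite mul1r (le_trans (ler_dist_nrm _ _))//.
by rewrite opprB addrA subrK.
Qed.

Lemma cvg_dotp (h : nat -> L2 mu) (x e : L2 mu) : nrm (h n - x) @[n --> \oo] --> (0 : R) ->
  dotp mu (h n) e @[n --> \oo] --> dotp mu x e.
Proof.
apply: cvg_lip (nrm e) _ => n.
by rewrite -dotpBl mulrC cauchy_schwarz.
Qed.

Lemma measurable_nrmB D f (e : L2 mu) : measurable D -> strongly_measurable D f ->
  measurable_fun D (fun t => nrm (f t - e)).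
Proof.
move=> mD sf; apply: (measurable_fun_sm (phi := fun _ x => nrm (x - e))) => //.
by move=> t h _; exact: cvg_nrm.
Qed.

Lemma measurable_nrm D f : measurable D -> strongly_measurable D f ->
  measurable_fun D (fun t => nrm (f t)).
Proof.
move=> mD /(measurable_nrmB 0 mD); apply: eq_measurable_fun => t _.
by rewrite subr0.
Qed.

Lemma measurable_dotp D f (e : L2 mu) : measurable D -> strongly_measurable D f ->
  measurable_fun D (fun t => dotp mu (f t) e).
Proof.
move=> mD sf; apply: (measurable_fun_sm (phi := fun _ x => dotp mu x e)) => //.
by move=> t h _; exact: cvg_dotp.
Qed.

Lemma sm_sub D E f : E `<=` D -> strongly_measurable D f ->
  strongly_measurable E f.
Proof. by move=> ED [g [fg gf]]; exists g; split => // t /ED; exact: gf. Qed.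

(** An approximant is reset to [0] at the times where its error exceeds [nrm (f t)]. The error is
    then dominated by [nrm (f t)], as dominated convergence demands, and the approximants stay
    finite valued. *)
Lemma sm_dominated D f : measurable D -> strongly_measurable D f ->
  exists2 g : nat -> R -> L2 mu, (forall n, finite_valued (g n)) &
    forall t, D t -> (forall n, nrm (g n t - f t) <= nrm (f t)) /\
      nrm (g n t - f t) @[n --> \oo] --> (0 : R).
Proof.
move=> mD sf; have [g0 [fg0 gf0]] := sf.
pose A n : set RR := [set t | D t /\ nrm (g0 n t - f t) <= nrm (f t)].
have mA n : measurable (A n).
  have m1 : measurable_fun D (fun t => nrm (g0 n t - f t) - nrm (f t)).
    apply: measurable_funB; last exact: measurable_nrm.
    apply: (measurable_fun_sm (phi := fun t x => nrm (g0 n t - x))) => //.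
      move=> e; apply: (measurable_finite_valued
        (phi := fun _ x => nrm (x - e))) => //; exact: fg0.
    move=> t h _ /(cvg_nrm (e := g0 n t)); rewrite nrmBC.
    by under eq_fun do rewrite nrmBC.
  rewrite (_ : A n = D `&` (fun t => nrm (g0 n t - f t) - nrm (f t)) @^-1` `]-oo, 0]).
    exact: m1.
  apply/seteqP; split=> t /=; rewrite in_itv/= subr_le0 //.
pose g n t := if t \in A n then g0 n t else 0.
exists g => [n|t Dt].
  split.
    apply: (sub_finite_set (B := range (g0 n) `|` [set 0])); last first.
      by rewrite finite_setU; split => //; case: (fg0 n).
    by move=> _ [t _ <-]; rewrite /g; case: ifP => _; [left; exists t|right].
  move=> e; rewrite (_ : _ @^-1` _ = (A n `&` (g0 n @^-1` [set e])) `|`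
      (if e == 0 then ~` A n else set0)).
    apply: measurableU; first by apply: measurableI => //; case: (fg0 n).
    by case: ifP => // _; exact: measurableC.
  apply/seteqP; split=> t /=; rewrite /g; have [At|At] := pselect (A n t).
  - by rewrite mem_set// => <-; left.
  - by rewrite memNset// => <-; rewrite eqxx; right.
  - rewrite mem_set// => -[[_ ->]//|]; by case: ifP => //= _ /(_ At).
  - by rewrite memNset// => -[[/At]//|]; case: ifPn => // /eqP ->.
have gE n : nrm (g n t - f t) <= nrm (f t) /\ nrm (g n t - f t) <= nrm (g0 n t - f t).
  rewrite /g; have [At|At] := pselect (A n t).
    by rewrite mem_set//; case: At.
  rewrite memNset// sub0r nrmN; split => //.
  by move: At => /not_andP[//|/negP]; rewrite -ltNge => /ltW.
split => [n|]; first by case: (gE n).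
apply: (squeeze_cvgr _ (cvg_cst 0) (gf0 t Dt)).
by apply: nearW => n; rewrite nrm_ge0; case: (gE n).
Qed.

Lemma integrable_finite_valued D g (phi : L2 mu -> R) : finite_valued g ->
  measurable D -> (leb D < +oo)%E ->
  leb.-integrable D (EFin \o (fun t => phi (g t))).
Proof.
move=> fg mD Dfin; apply: measurable_bounded_integrable => //.
  exact: (measurable_finite_valued (phi := fun _ => phi)).
have [fr _] := fg.
exists (\sum_(e <- fset_set (range g)) `|phi e|); split; first exact: num_real.
move=> M /ltW hM t _ /=; apply: le_trans hM.
have gt : g t \in fset_set (range g) by rewrite in_fset_set//; apply/mem_set; exists t.
rewrite (big_fsetD1 _ gt)/=.
by rewrite lerDl sumr_ge0.
Qed.

(** The weights in the finite sum do not depend on [phi], so a linear [phi] commutes with the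
    integral. *)
Lemma Rintegral_finite_valued D g (phi : L2 mu -> R) : finite_valued g ->
  measurable D -> (leb D < +oo)%E ->
  \int[leb]_(t in D) phi (g t) = \sum_(e <- fset_set (range g))
    phi e * fine (leb (D `&` g @^-1` [set e])).
Proof.
move=> fg mD Dfin; have [fr mg] := fg.
transitivity (\int[leb]_(t in D)
    \sum_(e <- fset_set (range g)) phi e * \1_(g @^-1` [set e]) t).
  apply: eq_Rintegral => t _.
  have gt : g t \in fset_set (range g) by rewrite in_fset_set//; apply/mem_set; exists t.
  rewrite (big_fsetD1 _ gt)/=.
  rewrite indicE mem_set//= mulr1 big1_fset ?addr0// => e.
  rewrite !inE => /andP[/eqP eg _] _; rewrite indicE memNset ?mulr0//=.
  by move=> h; apply: eg; rewrite h.
have int1 e : leb.-integrable D (EFin \o (\1_(g @^-1` [set e]) : RR -> R)).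
  apply: measurable_bounded_integrable => //.
  exists 1; split => // M M1 t _ /=; by rewrite (le_trans _ (ltW M1))// ger0_norm.
have inte e : leb.-integrable D
    (EFin \o (fun t => phi e * \1_(g @^-1` [set e]) t)).
  exact: (integrable_RZl mD (phi e) (int1 e)).
have [ints <-] : leb.-integrable D (EFin \o (fun t =>
    \sum_(e <- fset_set (range g)) phi e * \1_(g @^-1` [set e]) t)) /\
  \sum_(e <- fset_set (range g)) \int[leb]_(t in D)
     (phi e * \1_(g @^-1` [set e]) t) =
  \int[leb]_(t in D)
    \sum_(e <- fset_set (range g)) phi e * \1_(g @^-1` [set e]) t.
  elim: (enum_fset _) => [|e s [IH1 IH2]].
    split.
      by under [X in EFin \o X]eq_fun do rewrite big_nil; exact: integrable0.
    rewrite big_nil; under eq_Rintegral do rewrite big_nil.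
    by rewrite Rintegral_cst// mul0r.
  split.
    under [X in EFin \o X]eq_fun do rewrite big_cons.
    exact: (integrable_RD mD (inte e) IH1).
  rewrite big_cons IH2 -RintegralD//.
  by apply: eq_Rintegral => t _; rewrite big_cons.
apply: eq_bigr => e _; rewrite RintegralZl//; congr (_ * _).
by rewrite /Rintegral integral_indic//= setIC.
Qed.

End strong_measurability.

(** * Square integrable scalar functions *)

Section L2_inequalities.
Context d (T : measurableType d) (R : realType) (mu : {measure set T -> \bar R}).
Variables (D : set T) (mD : measurable D).
Implicit Types f g : T -> R.

Lemma integrable_sqrM f g : measurable_fun D f -> measurable_fun D g ->
  mu.-integrable D (EFin \o (fun x => f x ^+ 2)) ->
  mu.-integrable D (EFin \o (fun x => g x ^+ 2)) ->
  mu.-integrable D (EFin \o (fun x => f x * g x)).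
Proof.
move=> mf mg f2 g2; apply: (integrable_Rle (g := fun x => f x ^+ 2 + g x ^+ 2)) => //.
- exact: measurable_funM.
- move=> x _; rewrite ler_norml; apply/andP; split.
    have := sqr_ge0 (f x + g x); have := sqr_ge0 (f x); have := sqr_ge0 (g x).
    by rewrite sqrrD !expr2 -mulr_natl; lra.
  have := sqr_ge0 (f x - g x); have := sqr_ge0 (f x); have := sqr_ge0 (g x).
  by rewrite sqrrB !expr2 -mulr_natl; lra.
- exact: integrable_RD.
Qed.

Lemma integrable_sqrD f g : measurable_fun D f -> measurable_fun D g ->
  mu.-integrable D (EFin \o (fun x => f x ^+ 2)) ->
  mu.-integrable D (EFin \o (fun x => g x ^+ 2)) ->
  mu.-integrable D (EFin \o (fun x => (f x + g x) ^+ 2)).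
Proof.
move=> mf mg f2 g2.
have := integrable_RD mD (integrable_RD mD f2 g2)
  (integrable_RZl mD 2 (integrable_sqrM mf mg f2 g2)).
by apply: eq_integrable => // x _; congr (_%:E); ring.
Qed.

Lemma Rintegral_cauchy_schwarz f g : measurable_fun D f -> measurable_fun D g ->
  mu.-integrable D (EFin \o (fun x => f x ^+ 2)) ->
  mu.-integrable D (EFin \o (fun x => g x ^+ 2)) ->
  (\int[mu]_(x in D) (f x * g x)) ^+ 2 <=
  (\int[mu]_(x in D) (f x ^+ 2)) * (\int[mu]_(x in D) (g x ^+ 2)).
Proof.
move=> mf mg f2 g2; have fg := integrable_sqrM mf mg f2 g2.
have h (a b : R) : 0 <= a ^+ 2 * (\int[mu]_(x in D) (f x ^+ 2))
   + 2 * a * b * (\int[mu]_(x in D) (f x * g x))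
   + b ^+ 2 * (\int[mu]_(x in D) (g x ^+ 2)).
  rewrite -!RintegralZl// -RintegralD//; [|exact: integrable_RZl..].
  rewrite -RintegralD//; [|by apply: integrable_RD => //; exact: integrable_RZl|
    exact: integrable_RZl].
  apply: Rintegral_ge0 => x _; have := sqr_ge0 (a * f x + b * g x).
  by rewrite sqrrD -mulr_natl; lra.
set c := \int[mu]_(x in D) (f x * g x) in h *.
set A := \int[mu]_(x in D) (f x ^+ 2) in h *.
set B := \int[mu]_(x in D) (g x ^+ 2) in h *.
have A0 : 0 <= A by apply: Rintegral_ge0 => x _; exact: sqr_ge0.
have B0 : 0 <= B by apply: Rintegral_ge0 => x _; exact: sqr_ge0.
have h1 := h 1 (- c); have h2 := h (- c) A.
clearbody A B c.
have [A_eq0|A_neq0] := eqVneq A 0.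
  have h3 := h 1 0.
  rewrite A_eq0 in h2 h1 *; rewrite mul0r.
  have [B_eq0|B_neq0] := eqVneq B 0; first by rewrite B_eq0 in h1; nra.
  have {B_neq0}B1 : 0 < B by rewrite lt_neqAle eq_sym B_neq0.
  by have h4 := h B (- c); rewrite A_eq0 in h4; nra.
have {A_neq0} a1 : 0 < A by rewrite lt_neqAle eq_sym A_neq0.
have : 0 <= A * (A * B - c ^+ 2) by nra.
by rewrite pmulr_rge0// subr_ge0.
Qed.

Lemma Rintegral_minkowski f g : measurable_fun D f -> measurable_fun D g ->
  mu.-integrable D (EFin \o (fun x => f x ^+ 2)) ->
  mu.-integrable D (EFin \o (fun x => g x ^+ 2)) ->
  Num.sqrt (\int[mu]_(x in D) ((f x + g x) ^+ 2)) <=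
  Num.sqrt (\int[mu]_(x in D) (f x ^+ 2)) + Num.sqrt (\int[mu]_(x in D) (g x ^+ 2)).
Proof.
move=> mf mg f2 g2; have fg := integrable_sqrM mf mg f2 g2.
have cs := Rintegral_cauchy_schwarz mf mg f2 g2.
have A0 : 0 <= \int[mu]_(x in D) (f x ^+ 2).
  by apply: Rintegral_ge0 => x _; exact: sqr_ge0.
have B0 : 0 <= \int[mu]_(x in D) (g x ^+ 2).
  by apply: Rintegral_ge0 => x _; exact: sqr_ge0.
rewrite -ler_sqr ?nnegrE ?addr_ge0 ?sqrtr_ge0// sqr_sqrtr; last first.
  by apply: Rintegral_ge0 => x _; exact: sqr_ge0.
rewrite sqrrD !sqr_sqrtr// -sqrtrM//.
rewrite (_ : \int[mu]_(x in D) ((f x + g x) ^+ 2) =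
  \int[mu]_(x in D) (f x ^+ 2) + \int[mu]_(x in D) (f x * g x) *+ 2
  + \int[mu]_(x in D) (g x ^+ 2)); last first.
  have fg2 := integrable_RZl mD 2 fg; have ffg := integrable_RD mD f2 fg2.
  rewrite -mulr_natl -RintegralZl// -!RintegralD//.
  by apply: eq_Rintegral => x _; rewrite sqrrD -mulr_natl.
rewrite lerD2r lerD2l lerMn2r/= (le_trans (ler_norm _))//.
by rewrite -sqrtr_sqr ler_wsqrtr.
Qed.

Lemma Rdct0 (h : nat -> T -> R) (G : T -> R) :
  (forall n, measurable_fun D (h n)) -> mu.-integrable D (EFin \o G) ->
  (forall n x, D x -> 0 <= h n x <= G x) ->
  {ae mu, forall x, D x -> h n x @[n --> \oo] --> (0 : R)} ->
  \int[mu]_(x in D) h n x @[n --> \oo] --> (0 : R).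
Proof.
move=> mh Gi hG h0.
have hi n : mu.-integrable D (EFin \o h n).
  apply: (integrable_Rle (g := G)) => // x Dx.
  by case/andP: (hG n x Dx) => h1 h2; rewrite ger0_norm.
have mEh n : measurable_fun D (EFin \o h n) by exact/measurable_EFinP.
have Eh0 : {ae mu, forall x, D x -> (EFin \o h n) x @[n --> \oo] --> cst 0%E x}.
  by apply: filterS h0 => x h0x Dx; apply: cvg_EFin; [exact: nearW|exact: h0x].
have hG' : {ae mu, forall x n, D x -> (`|(EFin \o h n) x| <= (EFin \o G) x)%E}.
  apply: nearW => x n Dx /=.
  by case/andP: (hG n x Dx) => h1 h2; rewrite lee_fin ger0_norm.
have [_ _] := dominated_convergence mD mEh (measurable_cst _) Eh0 Gi hG'.
by rewrite integral0 => H; exact: (fine_cvg H).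
Qed.

End L2_inequalities.

(** * Weighted norms and vector integrals *)

Section Bochner_facts.
Context {dT : measure_display} {T : measurableType dT} {R : realType}.
Context {mu : {measure set T -> \bar R}}.
Notation leb := (@lebesgue_measure R).
Implicit Types (f F : R -> L2 mu).

Lemma measurable_wexp (th : R) (D : set R) : measurable D ->
  measurable_fun D (fun t : R => expR (th * t)).
Proof.
move=> mD; apply: (measurableT_comp (@measurable_expR R)).
exact: measurable_funM.
Qed.

Lemma measurable_wsq th a b f : strongly_measurable `]a, b[ f ->
  measurable_fun `]a, b[ (fun t => expR (2 * th * t) * nrm (f t) ^+ 2).
Proof.
move=> sf; apply: measurable_funM; first exact: measurable_wexp.
by apply: measurable_funX; exact: measurable_nrm.
Qed.

Lemma wnorm_fin_integrable th a b f : strongly_measurable `]a, b[ f ->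
  (wnorm th a b f < +oo)%E ->
  leb.-integrable `]a, b[ (EFin \o (fun t => expR (2 * th * t) * nrm (f t) ^+ 2)).
Proof.
move=> sf; rewrite /wnorm => foo; apply: ge0_integrable => //.
- exact: measurable_wsq.
- by move=> x _; rewrite mulr_ge0// ?expR_ge0 ?sqr_ge0.
- exact: lty_poweRy foo.
Qed.

Lemma wnormE th a b f :
  leb.-integrable `]a, b[ (EFin \o (fun t => expR (2 * th * t) * nrm (f t) ^+ 2)) ->
  (wnorm th a b f = (Num.sqrt (\int[leb]_(t in `]a, b[)
     (expR (2 * th * t) * nrm (f t) ^+ 2)))%:E)%E.
Proof.
move=> fi; rewrite /wnorm -EFin_Rintegral// poweR_EFin; congr (_%:E).
by rewrite powR12_sqrt// Rintegral_ge0// => x _; rewrite mulr_ge0// ?expR_ge0 ?sqr_ge0.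
Qed.

Lemma Bochner_nrm_sqr a b f : Bochner_L2 a b f ->
  leb.-integrable `]a, b[ (EFin \o (fun t => nrm (f t) ^+ 2)).
Proof.
move=> [sf foo]; have := wnorm_fin_integrable sf foo; apply: eq_integrable => //.
by move=> x _ /=; rewrite mulr0 mul0r expR0 mul1r.
Qed.

Lemma Bochner_wnrm_sqr th a b f : Bochner_L2 a b f ->
  leb.-integrable `]a, b[ (EFin \o (fun t => expR (2 * th * t) * nrm (f t) ^+ 2)).
Proof.
move=> fB; have [sf _] := fB.
pose C := expR (`|2 * th| * (`|a| + `|b|)).
apply: (integrable_Rle (g := fun t : measurableTypeR R => C * nrm (f t) ^+ 2)) => //.
- exact: measurable_wsq.
- move=> t /=; rewrite in_itv/= => /andP[ta tb].
  rewrite ger0_norm; last by rewrite mulr_ge0 ?expR_ge0 ?sqr_ge0.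
  rewrite ler_wpM2r ?sqr_ge0//.
  rewrite ler_expR (le_trans (ler_norm _))// normrM ler_wpM2l//.
  have := ler_norm (- a); have := ler_norm b; rewrite normrN.
  have := normr_ge0 a; have := normr_ge0 b.
  by rewrite ler_norml => *; apply/andP; split; lra.
- by apply: integrable_RZl => //; exact: Bochner_nrm_sqr.
Qed.

Lemma Bochner_nrm a b f : Bochner_L2 a b f ->
  leb.-integrable `]a, b[ (EFin \o (fun t => nrm (f t))).
Proof.
move=> fB; have [sf _] := fB.
apply: (integrable_Rle (g := fun t : measurableTypeR R => 1 + nrm (f t) ^+ 2)) => //.
- exact: measurable_nrm.
- move=> t _; rewrite ger0_norm ?nrm_ge0//.
  by have := sqr_ge0 (nrm (f t) - 1); have := sqr_ge0 (nrm (f t)); nra.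
- apply: integrable_RD => //; last exact: Bochner_nrm_sqr.
  exact: integrable_oo_cst.
Qed.

Lemma Bochner_sub a b a' b' f : a <= a' -> b' <= b -> Bochner_L2 a b f ->
  Bochner_L2 a' b' f.
Proof.
move=> aa bb fB; have [sf _] := fB.
have sf' : strongly_measurable `]a', b'[ f by apply: sm_sub sf; exact: oo_sub.
split => //; rewrite wnormE ?ltry//.
by apply: (@integrable_oo_sub _ a b) => //; exact: Bochner_wnrm_sqr.
Qed.

(** [is_vint] only allows tests against elements of [L2], while [L] need not be written as such a
    pairing. Both sides are therefore approximated through the simple functions of [sm_dominated],
    whose integrals are the finite sums [J_ n]. *)
Lemma vint_bounded_functional a b F J (L : L2 mu -> R) (C : R) :
  strongly_measurable `]a, b[ F ->
  leb.-integrable `]a, b[ (EFin \o (fun t => nrm (F t))) -> is_vint a b F J ->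
  (forall c x y, L (c *: x + y) = c * L x + L y) ->
  (forall x, `|L x| <= C * nrm x) ->
  leb.-integrable `]a, b[ (EFin \o (fun t => L (F t))) /\
  \int[leb]_(t in `]a, b[) L (F t) = L J.
Proof.
move=> sF Fi FJ Llin LC.
have mI : measurable (`]a, b[%classic : set (measurableTypeR R)) by [].
have Ifin : (leb `]a, b[%classic < +oo)%E.
  by rewrite lebesgue_measure_itv/=; case: ifP => // _; rewrite -EFinB ltry.
have L0 : L 0 = 0.
  by have := Llin 1 0 0; rewrite scale1r mul1r addr0; lra.
have LB x y : L (x - y) = L x - L y.
  by have := Llin (-1) y x; rewrite scaleN1r mulN1r addrC => ->; rewrite addrC.
have Lsum (s : seq (L2 mu)) (c : L2 mu -> R) :
    L (\sum_(e <- s) c e *: e) = \sum_(e <- s) c e * L e.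
  by elim: s => [|e s IH]; rewrite ?big_nil// !big_cons Llin IH.
have C0 : 0 <= C * nrm J by rewrite (le_trans _ (LC J)).
have [g fg gF] := sm_dominated mI sF.
have mLF : measurable_fun `]a, b[ (fun t => L (F t)).
  apply: (measurable_fun_sm (phi := fun _ x => L x)) => //.
  move=> t h _; apply: cvg_lip (C) _ => n.
  by rewrite -LB.
have LFi : leb.-integrable `]a, b[ (EFin \o (fun t => L (F t))).
  apply: (integrable_Rle (g := fun t : measurableTypeR R => C * nrm (F t))) => //.
  exact: integrable_RZl.
split=> //.
pose c n e := fine (leb (`]a, b[ `&` g n @^-1` [set e])).
pose J_ n := \sum_(e <- fset_set (range (g n))) c n e *: e.
have gJ n (phi : L2 mu -> R) : (forall c x y, phi (c *: x + y) = c * phi x + phi y) ->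
    \int[leb]_(t in `]a, b[) phi (g n t) = phi (J_ n).
  move=> philin; rewrite Rintegral_finite_valued//.
  have p0 : phi 0 = 0.
    by have := philin 1 0 0; rewrite scale1r mul1r addr0; lra.
  rewrite /J_; elim: (enum_fset _) => [|e s IH]; rewrite ?big_nil// !big_cons.
  by rewrite philin IH mulrC.
have gi n (phi : L2 mu -> R) : leb.-integrable `]a, b[ (EFin \o (fun t => phi (g n t))).
  exact: integrable_finite_valued.
pose dl n := \int[leb]_(t in `]a, b[) nrm (g n t - F t).
have mgF n : measurable_fun `]a, b[ (fun t => nrm (g n t - F t)).
  apply: (measurable_fun_sm (phi := fun t x => nrm (g n t - x))) => //.
    move=> e; exact: (measurable_finite_valued (phi := fun _ x => nrm (x - e))).
  move=> t h _ /(cvg_nrm (e := g n t)); rewrite nrmBC.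
  by under eq_fun do rewrite nrmBC.
have gFi n : leb.-integrable `]a, b[ (EFin \o (fun t => nrm (g n t - F t))).
  apply: (integrable_Rle (g := fun t : measurableTypeR R => nrm (F t))) => //.
    exact: mgF.
  by move=> t It; rewrite ger0_norm ?nrm_ge0//; case: (gF t It) => + _; exact.
have dl0 : dl n @[n --> \oo] --> (0 : R).
  apply: (Rdct0 mI (G := fun t => nrm (F t))) => //.
    by move=> n t It; rewrite nrm_ge0/=; case: (gF t It) => + _; exact.
  by apply: nearW => t It; case: (gF t It).
(* Testing the weak integral against [J - J_ n] itself turns it into a bound on the norm. *)
have JJ n : nrm (J - J_ n) <= dl n.
  have [->|J0] := eqVneq (nrm (J - J_ n)) 0.
    by apply: Rintegral_ge0 => t _; exact: nrm_ge0.
  have {}J0 : 0 < nrm (J - J_ n) by rewrite lt_neqAle eq_sym J0 nrm_ge0.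
  rewrite -(ler_pM2r J0) -expr2 nrm_sqr dotpBl.
  have [FJi <-] := FJ (J - J_ n).
  rewrite -(gJ n (fun x => dotp mu x (J - J_ n))); last first.
    by move=> k x y; rewrite dotpDl dotpZl.
  rewrite -RintegralB//; last exact: (gi n (fun x => dotp mu x (J - J_ n))).
  rewrite -RintegralZr//; apply: le_Rintegral => //.
  - apply: integrable_RB => //; exact: (gi n (fun x => dotp mu x (J - J_ n))).
  - have := integrable_RZl mI (nrm (J - J_ n)) (gFi n).
    by apply: eq_integrable => // t _ /=; rewrite mulrC.
  - by move=> t _; rewrite -dotpBl nrmBC dotp_le.
have C1 : 0 <= `|C| by [].
have LC' x : `|L x| <= `|C| * nrm x.
  by rewrite (le_trans (LC x))// ler_wpM2r ?nrm_ge0// ler_norm.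
suff : `|\int[leb]_(t in `]a, b[) L (F t) - L J| <= 0.
  by rewrite normr_le0 subr_eq0 => /eqP.
have e0 : (2 * `|C|) * dl n @[n --> \oo] --> (0 : R).
  by rewrite -(mulr0 (2 * `|C|)); apply: cvgM => //; exact: cvg_cst.
have -> : 0 = limn (fun n => (2 * `|C|) * dl n) by apply/esym/cvg_lim.
apply: limr_ge; first by apply/cvg_ex; exists 0.
apply: nearW => n.
rewrite (_ : _ - _ = \int[leb]_(t in `]a, b[) (L (F t) - L (g n t)) - L (J - J_ n)); last first.
  by rewrite RintegralB// gJ// LB; lra.
have -> : 2 * `|C| * dl n = `|C| * dl n + `|C| * dl n by ring.
rewrite (le_trans (ler_normB _ _))// lerD//.
  rewrite (le_trans (le_normr_Rintegral _ _))//.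
    by apply: integrable_RB => //; exact: gi.
  rewrite -RintegralZl//; apply: le_Rintegral => //.
  - by apply: (@integrable_norm _ _ _ leb _ (fun t => L (F t) - L (g n t)));
      apply: integrable_RB => //; exact: gi.
  - exact: integrable_RZl.
  - by move=> t _; rewrite -LB nrmBC.
by rewrite (le_trans (LC' _))// ler_wpM2l.
Qed.

End Bochner_facts.

(** * Energy inequalities from mean oscillations *)

Global Instance ae_lebesgue_filter (R : realType) :
  Filter (nbhs (almost_everywhere (@lebesgue_measure R))) :=
  ae_filter_ringOfSetsType _.

Section energy.
Context {R : realType}.
Notation leb := (@lebesgue_measure R).
Notation RR := (measurableTypeR R).

Lemma cvg_sqr0 (u : nat -> R) : u @ \oo --> (0 : R) ->
  (fun n => u n ^+ 2) @ \oo --> (0 : R).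
Proof.
move=> h; have H : (u \* u) @ \oo --> (0 * 0 : R) by exact: cvgM.
rewrite mulr0 in H; by rewrite (_ : (fun n => u n ^+ 2) = u \* u).
Qed.

Lemma cvgD0 (u v : nat -> R) : u @ \oo --> (0 : R) -> v @ \oo --> (0 : R) ->
  (fun n => u n + v n) @ \oo --> (0 : R).
Proof.
move=> u0 v0; have H : (u \+ v) @ \oo --> (0 + 0 : R) by exact: cvgD.
by rewrite addr0 in H.
Qed.

Lemma dist01 (x y : R) : 0 <= x <= 1 -> 0 <= y <= 1 -> `|x - y| <= 1.
Proof.
move=> /andP[x0 x1] /andP[y0 y1].
by rewrite ler_norml; apply/andP; split; lra.
Qed.

Lemma within_continuous_eps (F : R -> R) (a b t e : R) :
  {within `[a, b], continuous F} -> a <= t <= b -> 0 < e ->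
  exists2 del : R, 0 < del & forall s, a <= s <= b -> `|s - t| < del ->
    `|F s - F t| <= e.
Proof.
move=> /subspace_continuousP cF tab e0.
have /cvgrPdist_le/(_ e e0) : F x @[x --> within `[a, b] (nbhs t)] --> F t.
  by apply: cF; rewrite /= in_itv.
move=> [del /= del0 H]; exists del => // s sab std.
by rewrite distrC; apply: H; rewrite /= ?in_itv// distrC.
Qed.

Lemma eps_within_continuous (F : R -> R) a b :
  (forall t e, a <= t <= b -> 0 < e -> exists2 del : R, 0 < del &
    forall s, a <= s <= b -> `|s - t| < del -> `|F s - F t| <= e) ->
  {within `[a, b], continuous F}.
Proof.
move=> H; apply/subspace_continuousP => t; rewrite /= in_itv/= => tab.
apply/cvgrPdist_le => e e0; have [del del0 Hd] := H t e tab e0.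
exists del => //= s; rewrite /= in_itv/= => std sab.
by rewrite distrC; apply: Hd; rewrite // distrC.
Qed.

Lemma within_continuous_integrable (F : R -> R) a b :
  {within `[a, b], continuous F} -> leb.-integrable `]a, b[ (EFin \o F).
Proof.
move=> cF; apply: (@integrableS _ _ _ leb `[a, b]) => //.
  by move=> x /=; rewrite !in_itv/= => /andP[/ltW-> /ltW->].
by apply: continuous_compact_integrable => //; exact: segment_compact.
Qed.

Lemma primitive_eps (f : R -> R) (a b t e : R) : a <= t <= b -> 0 < e ->
  leb.-integrable `]a, b[ (EFin \o f) ->
  exists2 del : R, 0 < del & forall s, a <= s <= b -> `|s - t| < del ->
    `|\int[leb]_(r in `]a, s[) f r - \int[leb]_(r in `]a, t[) f r| <= e.
Proof.
move=> tab e0 fi; have ab : a <= b by case/andP: tab => /le_trans; exact.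
have fi' : leb.-integrable `[a, b] (EFin \o f).
  move: fi => /integrableP[mf foo].
  have mf' : measurable_fun `[a, b] (EFin \o f).
    move: ab mf; rewrite le_eqVlt => /predU1P[->|ab] mf.
      rewrite set_itv1; exact: measurable_fun_set1.
    apply/measurable_EFinP; apply: measurable_fun_itv_cc.
    by move/measurable_EFinP : mf; exact.
  apply/integrableP; split => //.
  by rewrite integral_oo_cc//; exact: measurableT_comp.
have [del del0 H] := within_continuous_eps
  (parameterized_integral_continuous ab fi') tab e0.
exists del => // s sab std; have := H s sab std.
have E x : a <= x <= b -> parameterized_integral leb a x f =
    \int[leb]_(r in `]a, x[) f r.
  move=> /andP[ax xb]; rewrite /parameterized_integral /Rintegral integral_oo_cc//.
  by have /integrableP[] := @integrable_oo_sub _ a b a x _ (lexx _) xb fi.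
by rewrite !E.
Qed.

Lemma primitive_sub (f : R -> R) (a b s t : R) : a <= s -> s <= t -> t <= b ->
  leb.-integrable `]a, b[ (EFin \o f) ->
  \int[leb]_(r in `]s, t[) f r =
  \int[leb]_(r in `]a, t[) f r - \int[leb]_(r in `]a, s[) f r.
Proof.
move=> as_ st tb fi; rewrite (@Rintegral_oo_cat _ a s t)//; first by lra.
by apply: integrable_oo_sub fi.
Qed.

Lemma measurable_conv (H : R) (k kap : R -> \bar R) :
  measurable_fun setT k -> measurable_fun setT kap ->
  (forall t, 0 <= k t)%E -> (forall t, 0 <= kap t)%E ->
  measurable_fun setT (fun t : RR =>
    \int[leb]_(r in `]0%R, H[) (k r * kap (t - r)%R))%E.
Proof.
move=> mk mkap k0 kap0.
pose F (p : RR * RR) : \bar R :=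
  ((k \_ `]0%R, H[) p.2 * kap (p.1 - p.2)%R)%E.
have mk' : measurable_fun setT (k \_ `]0%R, H[).
  by apply/(measurable_restrictT _ _).1 => //; exact: (measurable_funTS mk).
have k'0 t : (0 <= (k \_ `]0%R, H[) t)%E by rewrite patchE; case: ifP.
have mF : measurable_fun setT F.
  apply: emeasurable_funM; first exact: measurableT_comp.
  by apply: (measurableT_comp mkap); exact: measurable_funB.
have := measurable_fun_fubini_tonelli_F (m2 := leb) F mF.
move=> /(_ (fun x => mule_ge0 (k'0 x.2) (kap0 (x.1 - x.2)))).
apply: eq_measurable_fun => t _; rewrite /fubini_F [RHS]integral_mkcond.
by apply: eq_integral => r _; rewrite /F/= !patchE; case: ifP; rewrite ?mul0e.
Qed.

(** Convolution with the indicator of [(0, h)]: Tonelli gives both integrability in [t] and the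
    factor [h]. The larger interval [(A, b)] leaves room for the window to the left of [a]. *)
Lemma sliding_integral (A a b h : R) (kap : R -> R) : 0 < h -> A <= a - h ->
  (forall t, 0 <= kap t) -> leb.-integrable `]A, b[ (EFin \o kap) ->
  leb.-integrable `]a, b[ (EFin \o (fun t => \int[leb]_(r in `]t - h, t[) kap r)) /\
  \int[leb]_(t in `]a, b[) \int[leb]_(r in `]t - h, t[) kap r <=
    h * \int[leb]_(r in `]A, b[) kap r.
Proof.
move=> h0 Ah kap0 ki.
have mk := integrable_measurable_fun ki.
pose K : R -> \bar R := (EFin \o kap) \_ `]A, b[.
have mK : measurable_fun setT K.
  apply/(measurable_restrictT _ _).1 => //.
  exact/measurable_EFinP.
have K0 t : (0 <= K t)%E by rewrite /K patchE; case: ifP => //=; rewrite lee_fin.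
have E t : `]a, b[%classic t ->
    (\int[leb]_(r in `](t - h)%R, t[) (kap r)%:E =
     \int[leb]_(r in `]0%R, h[) (1 * K (t - r)%R))%E.
  rewrite /= in_itv/= => /andP[at_ tb].
  under [RHS]eq_integral do rewrite mul1e.
  rewrite integral_reflect; last exact: measurable_funTS.
  rewrite subr0; apply: eq_integral => r /set_mem; rewrite /= in_itv/= => /andP[r1 r2].
  rewrite /K patchE mem_set//= in_itv/=; apply/andP; split; lra.
have m1 : measurable_fun setT (cst 1%E : R -> \bar R) by exact: measurable_cst.
have c10 (t : R) : (0 <= (cst 1%E : R -> \bar R) t)%E by [].
have mc := measurable_conv h m1 mK c10 K0.
have le1 := @ge0_integral_conv_le _ a b h (cst 1%E) K m1 mK c10 K0.
have le2 : (\int[leb]_(t in `]a, b[) \int[leb]_(r in `](t - h)%R, t[) (kap r)%:E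
    <= (h * \int[leb]_(r in `]A, b[) kap r)%:E)%E.
  rewrite (eq_integral (fun t : RR => \int[leb]_(r in `]0%R, h[) (1 * K (t - r)%R))%E); last first.
    by move=> t /set_mem It; exact: E.
  apply: (le_trans le1).
  rewrite integral_cst//= lebesgue_measure_itv/= lte_fin h0 oppr0 adde0 mul1e.
  rewrite EFinM lee_pmul2l// ?lte_fin// EFin_Rintegral//.
  apply: (@le_trans _ _ (\int[leb]_(t in `]A, b[) K t)%E).
    apply: ge0_subset_integral => //; first exact: measurable_funTS.
    by apply: oo_sub.
  rewrite le_eqVlt; apply/orP; left; apply/eqP; apply: eq_integral => t tA.
  by rewrite /K patchE tA.
have E2 t : `]a, b[%classic t ->
    (\int[leb]_(r in `](t - h)%R, t[) (kap r)%:E =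
     (\int[leb]_(r in `]t - h, t[) kap r)%:E)%E.
  rewrite /= in_itv/= => /andP[at_ tb]; rewrite EFin_Rintegral//.
  by apply: (@integrable_oo_sub _ A b) ki; lra.
have mV : measurable_fun `]a, b[ (fun t => \int[leb]_(r in `]t - h, t[) kap r).
  apply/measurable_EFinP.
  apply: (@eq_measurable_fun _ _ _ _ _ (fun t : RR =>
    \int[leb]_(r in `]0%R, h[) (1 * K (t - r)%R))%E).
    by move=> t /set_mem It; rewrite -E// E2.
  exact: measurable_funTS.
have Vi : leb.-integrable `]a, b[ (EFin \o (fun t => \int[leb]_(r in `]t - h, t[) kap r)).
  apply: ge0_integrable => //.
    by move=> t _; exact: Rintegral_ge0.
  apply: le_lt_trans (ltry (h * \int[leb]_(r in `]A, b[) kap r)).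
  apply: le_trans le2.
  rewrite le_eqVlt; apply/orP; left; apply/eqP; apply: eq_integral => t.
  by move=> /set_mem/E2.
split => //; rewrite -lee_fin EFin_Rintegral//; apply: le_trans le2.
rewrite le_eqVlt; apply/orP; left; apply/eqP; apply: eq_integral => t.
by move=> /set_mem/E2.
Qed.

(** Limits in the step length are taken along this sequence, so that dominated convergence
    applies. *)
Definition hstep (n : nat) : R := n.+1%:R^-1.

Lemma hstep_gt0 n : 0 < hstep n. Proof. by rewrite invr_gt0. Qed.

Lemma cvg_hstep : hstep n @[n --> \oo] --> (0 : R).
Proof. exact: cvg_harmonic. Qed.

Lemma near_hstep (e : R) : 0 < e -> \forall n \near \oo, hstep n < e.
Proof.
move=> e0; have /cvgrPdist_lt/(_ e e0) := cvg_hstep.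
by apply: filterS => n; rewrite sub0r normrN gtr0_norm// hstep_gt0.
Qed.

(** The average is the left difference quotient of the primitive of [\1_E], so it converges wherever
    the fundamental theorem of calculus holds, hence almost everywhere. *)
Lemma average_indic (A : R) (E : set RR) : measurable E ->
  {ae leb, forall t, A < t ->
    (hstep n)^-1 * \int[leb]_(r in `]t - hstep n, t[) \1_E r @[n --> \oo] -->
    (\1_E t : R)}.
Proof.
move=> mE; pose f : R -> R := \1_E.
have fi x y : leb.-integrable `[x, y] (EFin \o f).
  apply: (@measurable_bounded_integrable _ _ _ leb f `[x, y]) => //.
  - by rewrite /= lebesgue_measure_itv/=; case: ifP => // _; rewrite -EFinB ltry.
  - by apply: measurable_funTS; exact: measurable_indic.
  - exists 1; split => // M M1 z _ /=; rewrite (le_trans _ (ltW M1))// ger0_norm//.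
    by rewrite /f indicE lern1 leq_b1.
have loc : locally_integrable [set: R] f by apply: locally_integrable_indic => //; exact: openT.
have := @FTC1 _ f (BLeft A) (fi A) loc.
apply: filterS => t H At; have [] := H; first by rewrite lte_fin.
move=> dF Ff; rewrite -[\1_E t]/(f t) -Ff derive1E /derive.
move: dF {Ff}; rewrite /derivable; set F := fun x : R => _ => dF.
have hd : - hstep n @[n --> \oo] --> (0 : R)^'.
  move=> Q HQ; change (\forall y \near (0 : R), y != 0 -> Q y) in HQ.
  have hN : - hstep n @[n --> \oo] --> (0 : R).
    by rewrite -oppr0; apply: cvgN; exact: cvg_hstep.
  have := hN _ HQ.
  apply: (@filterS _ \oo _ (fun n => - hstep n != 0 -> Q (- hstep n))) => n.
  apply.
  by rewrite oppr_eq0 gt_eqF// hstep_gt0.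
have := cvg_comp _ _ hd dF.
apply: cvg_trans; apply: near_eq_cvg.
have tA : 0 < t - A by rewrite subr_gt0.
have := near_hstep tA; apply: filterS => n hn.
rewrite /= invrN scaleNr -scalerN opprB -[LHS]/(_ * _); congr (_ * _).
rewrite /F/= /GRing.scale/= mulr1.
have := hstep_gt0 n; move: (hstep n) hn => h hn h0.
rewrite (_ : - h + t = t - h); last by rewrite addrC.
rewrite Rintegral_itvB//; [|by rewrite bnd_simp; lra..].
by rewrite /Rintegral integral_itv_bndoo//; apply/measurable_EFinP; apply: measurable_funTS; exact: measurable_indic.
Qed.

Lemma average_indic_L1 (A a b : R) (E : set RR) : A < a -> measurable E ->
  \int[leb]_(t in `]a, b[) `|\1_E t - (hstep n)^-1 *
     \int[leb]_(r in `]t - hstep n, t[) \1_E r| @[n --> \oo] --> (0 : R).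
Proof.
move=> Aa mE.
have mE1 : measurable_fun setT (\1_E : RR -> R) by exact: measurable_indic.
have E01 t : 0 <= (\1_E t : R) <= 1 by rewrite indicE; case: (t \in E); rewrite ?lexx ?ler01.
have Ei x y : leb.-integrable `]x, y[ (EFin \o (\1_E : RR -> R)).
  apply: (integrable_Rle (g := cst 1)) => //.
  - by move=> t _ /=; case/andP: (E01 t) => h1 h2; rewrite ger0_norm.
  - exact: integrable_oo_cst.
have V01 n t : 0 <= (hstep n)^-1 * \int[leb]_(r in `]t - hstep n, t[) \1_E r <= 1.
  have h0 := hstep_gt0 n; apply/andP; split.
    by rewrite mulr_ge0 ?invr_ge0 ?(ltW h0)// Rintegral_ge0.
  rewrite ler_pdivrMl// mulr1.
  have {2}-> : hstep n = 1 * (t - (t - hstep n)) by rewrite mul1r; lra.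
  rewrite -Rintegral_oo_cst; last by lra.
  by apply: le_Rintegral => //; exact: integrable_oo_cst.
apply: (Rdct0 _ (G := cst 1)) => //.
- move=> n; apply: measurableT_comp => //; apply: measurable_funB.
    exact: measurable_funTS.
  apply: measurable_funM => //.
  have [] := @sliding_integral (a - hstep n) a b (hstep n) (\1_E) (hstep_gt0 n) (lexx _) _ (Ei _ _).
    by move=> t; case/andP: (E01 t).
  by move=> /integrable_measurable_fun.
- exact: integrable_oo_cst.
- move=> n t _ /=; rewrite normr_ge0/=.
  exact: dist01 (E01 t) (V01 n t).
- have := average_indic A mE; apply: filterS => t H; rewrite /= in_itv/= => /andP[at_ _].
  have {}H := H (lt_trans Aa at_).
  rewrite -(normr0 R); apply: cvg_norm; rewrite -(subrr (\1_E t)).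
  by apply: cvgB => //; exact: cvg_cst.
Qed.

Context {dT : measure_display} {T : measurableType dT}.
Context {mu : {measure set T -> \bar R}}.

Lemma nrm_sqr3 (x y z w : L2 mu) : nrm (x - w) ^+ 2 <=
  3 * (nrm (x - y) ^+ 2 + nrm (y - z) ^+ 2 + nrm (z - w) ^+ 2).
Proof.
have h1 := nrm_dist_trans y x w; have h2 := nrm_dist_trans z y w.
have := nrm_ge0 (x - w).
move: (nrm (x - w)) (nrm (x - y)) (nrm (y - w)) (nrm (y - z)) (nrm (z - w)) h1 h2.
move=> d a e b c h1 h2 d0.
have : d ^+ 2 <= (a + b + c) ^+ 2 by rewrite lerXn2r ?nnegrE//; lra.
by have := sqr_ge0 (a - b); have := sqr_ge0 (b - c); have := sqr_ge0 (a - c); nra.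
Qed.

Lemma integrable_nrm_sqrB (A b : R) (f : R -> L2 mu) (e : L2 mu) :
  strongly_measurable `]A, b[ f ->
  leb.-integrable `]A, b[ (EFin \o (fun t => nrm (f t) ^+ 2)) ->
  leb.-integrable `]A, b[ (EFin \o (fun t => nrm (e - f t) ^+ 2)).
Proof.
move=> sf fi.
apply: (integrable_Rle (g := fun t : RR => 2 * nrm e ^+ 2 + 2 * nrm (f t) ^+ 2)) => //.
- apply: measurable_funX.
  apply: (@eq_measurable_fun _ _ _ _ _ (fun t => nrm (f t - e))).
    by move=> t _; rewrite nrmBC.
  exact: measurable_nrmB.
- move=> t _; rewrite ger0_norm ?sqr_ge0//.
  have h1 := nrmB e (f t); have h2 := nrm_ge0 (e - f t).
  have : nrm (e - f t) ^+ 2 <= (nrm e + nrm (f t)) ^+ 2.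
    by rewrite lerXn2r ?nnegrE// addr_ge0 ?nrm_ge0.
  by have := sqr_ge0 (nrm e - nrm (f t)); nra.
- apply: integrable_RD => //; last exact: integrable_RZl.
  exact: integrable_oo_cst.
Qed.

(** Approximate [f] in [L^2] by a finite-valued [g] and split [f t - f r] at [g t] and [g r]: the
    outer pieces are controlled by the [L^2] error, the inner one by finitely many indicators, whose
    left averages converge in [L^1]. Only a majorant [theta] is asserted, so measurability in [t] of
    the inner integral never has to be shown. *)
Lemma mean_oscillation (A a b : R) (f : R -> L2 mu) (eps : R) : A < a -> 0 < eps ->
  strongly_measurable `]A, b[ f ->
  leb.-integrable `]A, b[ (EFin \o (fun t => nrm (f t) ^+ 2)) ->
  \forall n \near \oo, exists2 theta : R -> R,
    leb.-integrable `]a, b[ (EFin \o theta) /\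
      \int[leb]_(t in `]a, b[) theta t <= eps * hstep n &
    forall t, a < t < b ->
      \int[leb]_(r in `]t - hstep n, t[) (nrm (f t - f r) ^+ 2) <= theta t.
Proof.
move=> Aa eps0 sf fi.
have mI : measurable (`]A, b[%classic : set RR) by [].
have [g fg gf] := sm_dominated mI sf.
have mgf n : measurable_fun `]A, b[ (fun t => nrm (g n t - f t) ^+ 2).
  apply: measurable_funX.
  apply: (measurable_fun_sm (phi := fun t x => nrm (g n t - x))) => //.
    move=> e; exact: (measurable_finite_valued (phi := fun _ x => nrm (x - e))).
  move=> t h _ /(cvg_nrm (e := g n t)); rewrite nrmBC.
  by under eq_fun do rewrite nrmBC.
have gf_le n t : `]A, b[%classic t -> 0 <= nrm (g n t - f t) ^+ 2 <= nrm (f t) ^+ 2.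
  move=> It; rewrite sqr_ge0/= lerXn2r ?nnegrE ?nrm_ge0//.
  by case: (gf t It) => + _; exact.
have gfi n : leb.-integrable `]A, b[ (EFin \o (fun t => nrm (g n t - f t) ^+ 2)).
  apply: (integrable_Rle (g := fun t : RR => nrm (f t) ^+ 2)) => // [|t It].
    exact: mgf.
  by case/andP: (gf_le n t It) => h1 h2; rewrite ger0_norm.
have : \int[leb]_(t in `]A, b[) (nrm (g n t - f t) ^+ 2) @[n --> \oo] --> (0 : R).
  apply: (Rdct0 mI (G := fun t => nrm (f t) ^+ 2)) => //.
  apply: nearW => t It; case: (gf t It) => _ h.
  exact: cvg_sqr0.
(* The two outer pieces each enter with the factor [3 * hstep n], which makes [eps / 2] in total;
   the other half is spent on the indicators. *)
have eps12 : 0 < eps / 12 by rewrite divr_gt0.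
move=> /cvgrPdist_lt/(_ _ eps12) [k _ /(_ k (leqnn k))].
rewrite sub0r normrN ger0_norm; last by apply: Rintegral_ge0 => t _; exact: sqr_ge0.
move: (g k) (fg k) (mgf k) (gfi k) => {mgf gf_le gfi gf}{}g {}fg mgf gfi gk.
have [fr mg] := fg.
pose s := enum_fset (fset_set (range g)).
pose M := \sum_(e <- s) nrm e.
have gs t : g t \in fset_set (range g) by rewrite in_fset_set//; apply/mem_set; exists t.
have gM t : nrm (g t) <= M.
  by rewrite /M /s (big_fsetD1 _ (gs t))/= lerDl sumr_ge0// => e _; exact: nrm_ge0.
pose E e : set RR := g @^-1` [set e].
(* If the two values differ, the indicator of the level set of [g t] alone contributes [1] to the
   sum. *)
have gosc t r : nrm (g t - g r) ^+ 2 <=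
    (2 * M) ^+ 2 * \sum_(e <- s) `|\1_(E e) t - \1_(E e) r|.
  have [->|gtr] := eqVneq (g t) (g r).
    rewrite subrr nrm0 expr0n/= mulr_ge0 ?sqr_ge0//.
    by apply: sumr_ge0 => e _; exact: normr_ge0.
  rewrite -[leLHS]mulr1 ler_pM ?sqr_ge0//.
    rewrite lerXn2r ?nnegrE ?nrm_ge0//.
      by rewrite mulr_ge0// (le_trans (nrm_ge0 (g t)) (gM t)).
    by rewrite (le_trans (nrmB _ _))//; have := gM t; have := gM r; lra.
  rewrite /s (big_fsetD1 _ (gs t))/= -[leLHS]addr0 lerD//.
    rewrite !indicE mem_set// memNset//; first by rewrite subr0 normr1.
    by move=> /= h; rewrite h eqxx in gtr.
  by apply: sumr_ge0 => e _; exact: normr_ge0.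
pose rr e n t := `|\1_(E e) t - (hstep n)^-1 * \int[leb]_(r in `]t - hstep n, t[) \1_(E e) r|.
have E01 e t : 0 <= (\1_(E e) t : R) <= 1.
  by rewrite indicE; case: (t \in E e); rewrite ?lexx ?ler01.
have Ei e x y : leb.-integrable `]x, y[ (EFin \o (\1_(E e) : RR -> R)).
  apply: (integrable_Rle (g := cst 1)) => //.
  - by apply: measurable_funTS; apply: measurable_indic; exact: mg.
  - by move=> t _ /=; case/andP: (E01 e t) => h1 h2; rewrite ger0_norm.
  - exact: integrable_oo_cst.
(* For fixed [t] the difference of the two indicator values has a constant sign in [r], so the
   integral of its modulus is the modulus of its integral. *)
have absE e n t : \int[leb]_(r in `]t - hstep n, t[) `|\1_(E e) t - \1_(E e) r|
    = hstep n * rr e n t.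
  have h0 := hstep_gt0 n.
  have Ei' := Ei e (t - hstep n) t.
  have V0 : 0 <= \int[leb]_(r in `]t - hstep n, t[) \1_(E e) r.
    by apply: Rintegral_ge0 => r _; case/andP: (E01 e r).
  have V1 : \int[leb]_(r in `]t - hstep n, t[) \1_(E e) r <= hstep n.
    rewrite [leRHS](_ : _ = 1 * (t - (t - hstep n))); last by rewrite mul1r; lra.
    rewrite -Rintegral_oo_cst; last by lra.
    by apply: le_Rintegral => //; exact: integrable_oo_cst.
  rewrite /rr -[X in X * _](gtr0_norm h0) -normrM mulrBr mulrA divff ?gt_eqF// mul1r.
  case: (boolP (t \in E e)) => tE.
    rewrite indicE tE mulr1 ger0_norm ?subr_ge0//.
    transitivity (\int[leb]_(r in `]t - hstep n, t[) (1 - \1_(E e) r)).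
      apply: eq_Rintegral => r _; rewrite ger0_norm// subr_ge0.
      by case/andP: (E01 e r).
    rewrite RintegralB//; last exact: integrable_oo_cst.
    rewrite Rintegral_oo_cst; last by move: h0; clear; lra.
    by congr (_ - _); move: h0; clear; lra.
  rewrite indicE (negbTE tE) mulr0 sub0r normrN ger0_norm//.
  by apply: eq_Rintegral => r _; rewrite sub0r normrN ger0_norm.
have rri e n : leb.-integrable `]a, b[ (EFin \o rr e n).
  apply: (@integrable_norm _ _ _ leb _ (fun t => \1_(E e) t - (hstep n)^-1 *
    \int[leb]_(r in `]t - hstep n, t[) \1_(E e) r)).
  apply: integrable_RB; [by []|exact: Ei|].
  apply: integrable_RZl => //.
  have [] := @sliding_integral (a - hstep n) a b (hstep n) (\1_(E e)) (hstep_gt0 n) (lexx _) _ (Ei _ _ _).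
    by move=> t; case/andP: (E01 e t).
  by [].
have rr0 (s' : seq (L2 mu)) : \sum_(e <- s') \int[leb]_(t in `]a, b[) rr e n t @[n --> \oo] --> (0 : R).
  elim: s' => [|e s' IH].
    by under eq_fun do rewrite big_nil; exact: cvg_cst.
  have h1 : (fun n => \int[leb]_(t in `]a, b[) rr e n t) @ \oo --> (0 : R).
    exact: average_indic_L1 Aa (mg e).
  by under eq_fun do rewrite big_cons; exact: (cvgD0 h1 IH).
have sumi (s' : seq (L2 mu)) n : leb.-integrable `]a, b[ (EFin \o (fun t => \sum_(e <- s') rr e n t)) /\
    \int[leb]_(t in `]a, b[) (\sum_(e <- s') rr e n t) =
    \sum_(e <- s') \int[leb]_(t in `]a, b[) rr e n t.
  elim: s' => [|e s' [IH1 IH2]].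
    split; first by under [X in EFin \o X]eq_fun do rewrite big_nil; exact: integrable0.
    by rewrite big_nil; under eq_Rintegral do rewrite big_nil; rewrite Rintegral_cst// mul0r.
  split; first by under [X in EFin \o X]eq_fun do rewrite big_cons; exact: integrable_RD.
  by rewrite big_cons -IH2 -RintegralD//; apply: eq_Rintegral => t _; rewrite big_cons.
pose C := 3 * (2 * M) ^+ 2.
have C0 : 0 <= C by rewrite mulr_ge0// sqr_ge0.
have dl0 : 0 < eps / 2 / (C + 1) by rewrite !divr_gt0// ltr_wpDl.
have aA : 0 < a - A by rewrite subr_gt0.
have := near_hstep aA; move/cvgrPdist_lt : (rr0 s) => /(_ _ dl0).
apply: filterS2 => n; rewrite sub0r normrN => hr hn.
have h0 := hstep_gt0 n.
pose kap t := nrm (g t - f t) ^+ 2.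
pose kap' : R -> R := kap \_ `]A, b[.
have kap'E t : A < t < b -> kap' t = kap t.
  by move=> h; rewrite /kap' patchE mem_set//= in_itv.
have kap'0 t : 0 <= kap' t by rewrite /kap' patchE; case: ifP => // _; exact: sqr_ge0.
have kap'i : leb.-integrable `]A, b[ (EFin \o kap').
  by apply: eq_integrable gfi => // t /set_mem; rewrite /= in_itv/= => h; rewrite kap'E.
have ha : A <= a - hstep n by move: hn; clear; lra.
have [Vi Vle] := sliding_integral h0 ha kap'0 kap'i.
have [Si SE] := sumi s n.
have kapi : leb.-integrable `]a, b[ (EFin \o kap').
  by apply: (@integrable_oo_sub _ A b) kap'i => //; exact: ltW.
have kapI : \int[leb]_(t in `]A, b[) kap' t < eps / 12.
  apply: le_lt_trans gk; rewrite le_eqVlt; apply/orP; left; apply/eqP.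
  by apply: eq_Rintegral => t /set_mem; rewrite /= in_itv/= => h; rewrite kap'E.
have kapI' : \int[leb]_(t in `]a, b[) kap' t < eps / 12.
  apply: le_lt_trans kapI.
  have [ba|ab] := leP b a; first by rewrite oo0// Rintegral_set0 Rintegral_ge0.
  by rewrite (Rintegral_oo_cat (ltW Aa) (ltW ab) kap'i) lerDr Rintegral_ge0.
have mab : measurable (`]a, b[%classic : set RR) by [].
have i1 := integrable_RZl mab (3 * hstep n) kapi.
have i2 := integrable_RZl mab 3 Vi.
have i3 := integrable_RZl mab (C * hstep n) Si.
exists (fun t => 3 * hstep n * kap' t
    + 3 * \int[leb]_(r in `]t - hstep n, t[) kap' r
    + C * hstep n * \sum_(e <- s) rr e n t).
  split; first by apply: integrable_RD => //; apply: integrable_RD.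
  rewrite RintegralD//; last exact: integrable_RD.
  rewrite RintegralD// !RintegralZl// SE.
  set q1 := \int[leb]_(t in `]a, b[) kap' t in kapI' *.
  set q2 := \int[leb]_(t in `]a, b[) _ in Vle *.
  set q3 := \sum_(e <- s) _ in hr *.
  have hr' : C * q3 <= eps / 2.
    have := le_lt_trans (ler_norm _) hr; rewrite ltr_pdivlMr ?ltr_wpDl//.
    have q30 : 0 <= q3.
      by apply: sumr_ge0 => e _; apply: Rintegral_ge0 => t _; exact: normr_ge0.
    by move: (C) C0 (q3) q30; clear; move=> c c0 q q0; nra.
  have : C * hstep n * q3 <= eps / 2 * hstep n by rewrite mulrAC ler_pM2r.
  move: (hstep n) h0 Vle kapI kapI' (C * hstep n * q3) => h h0 Vle kapI kapI' z zh.
  by move: h0 Vle kapI kapI' zh; move: (\int[leb]_(t in _) _) q1 q2 (hstep n) z; clear; move=> q0 q1 q2 h' z; nra.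
move=> t tab; have [at_ tb] := andP tab.
have sub x y : A <= x -> y <= b -> leb.-integrable `]x, y[ (EFin \o kap').
  by move=> Ax yb; apply: (@integrable_oo_sub _ A b) kap'i.
have fti : leb.-integrable `]t - hstep n, t[ (EFin \o (fun r => nrm (f t - f r) ^+ 2)).
  apply: (@integrable_oo_sub _ A b); last exact: integrable_nrm_sqrB.
    by move: hn at_; clear; lra.
  exact: ltW.
have mt : measurable (`]t - hstep n, t[%classic : set RR) by [].
have gi (s' : seq (L2 mu)) : leb.-integrable `]t - hstep n, t[ (EFin \o (fun r =>
    \sum_(e <- s') `|\1_(E e) t - \1_(E e) r|)) /\
    \int[leb]_(r in `]t - hstep n, t[) (\sum_(e <- s') `|\1_(E e) t - \1_(E e) r|) =
    hstep n * \sum_(e <- s') rr e n t.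
  elim: s' => [|e s' [IH1 IH2]].
    split; first by under [X in EFin \o X]eq_fun do rewrite big_nil; exact: integrable0.
    by rewrite big_nil mulr0; under eq_Rintegral do rewrite big_nil; rewrite Rintegral_cst// mul0r.
  have i0 : leb.-integrable `]t - hstep n, t[ (EFin \o (fun r => `|\1_(E e) t - \1_(E e) r|)).
    apply: (@integrable_norm _ _ _ leb _ (fun r => \1_(E e) t - \1_(E e) r)).
    by apply: integrable_RB; [by []|exact: integrable_oo_cst|exact: Ei].
  split; first by under [X in EFin \o X]eq_fun do rewrite big_cons; exact: integrable_RD.
  by rewrite big_cons mulrDr -IH2 -absE -RintegralD//; apply: eq_Rintegral => r _; rewrite big_cons.
have [gi1 gi2] := gi s.
have kti : leb.-integrable `]t - hstep n, t[ (EFin \o kap').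
  by apply: sub; [move: hn at_; clear; lra|exact: ltW].
have j1 : leb.-integrable `]t - hstep n, t[ (EFin \o (fun _ : RR => 3 * kap t)).
  exact: integrable_oo_cst.
have j2 := integrable_RZl mt 3 kti.
have j3 := integrable_RZl mt C gi1.
have -> : 3 * hstep n * kap' t = \int[leb]_(r in `]t - hstep n, t[) (3 * kap t).
  rewrite Rintegral_oo_cst; last by move: h0; clear; lra.
  rewrite kap'E; last by rewrite tb andbT (lt_trans Aa at_).
  by move: (kap t); clear; move=> z; ring.
rewrite -(@RintegralZl _ _ _ leb _ kap' 3 mt kti) -mulrA -gi2 -(@RintegralZl _ _ _ leb _ _ C mt gi1).
rewrite -RintegralD// -RintegralD//; last exact: integrable_RD.
apply: le_Rintegral => //.
  by apply: integrable_RD => //; exact: integrable_RD.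
move=> r; rewrite /= in_itv/= => /andP[r1 r2].
apply: (le_trans (nrm_sqr3 _ (g t) (g r) _)).
rewrite (nrmBC (f t)) kap'E; last by move: hn at_ r1 r2 tb; clear; lra.
have := gosc t r; rewrite /kap /C.
set Q := \sum_(e <- s) _; move: (nrm (g t - g r) ^+ 2) => z zQ.
by move: Q z (nrm _) (nrm _) zQ; clear; move=> Q z x y zQ; nra.
Qed.

End energy.

(** * Energy inequalities and exponential weights *)

Section energy_inequality.
Context {R : realType}.
Notation leb := (@lebesgue_measure R).
Notation RR := (measurableTypeR R).

Lemma eps_continuous_integrable (F : R -> R) (a b : R) :
  (forall t e, a <= t <= b -> 0 < e -> exists2 del : R, 0 < del &
    forall s, a <= s <= b -> `|s - t| < del -> `|F s - F t| <= e) ->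
  leb.-integrable `]a, b[ (EFin \o F).
Proof.
by move=> cF; apply: within_continuous_integrable; exact: eps_within_continuous.
Qed.

Lemma Rintegral_oo_shift (a b h : R) (F : R -> R) :
  leb.-integrable `]a - h, b - h[ (EFin \o F) ->
  \int[leb]_(t in `]a, b[) F (t - h) = \int[leb]_(t in `]a - h, b - h[) F t.
Proof.
move=> Fi; rewrite /Rintegral (@integral_shift _ _ _ (- h) (EFin \o F))//.
by case/integrableP : Fi.
Qed.

Lemma average_near (E : R -> R) (x h eta : R) : 0 < h ->
  leb.-integrable `]x - h, x[ (EFin \o E) ->
  (forall s, x - h < s < x -> `|E s - E x| <= eta) ->
  `|\int[leb]_(t in `]x - h, x[) E t - h * E x| <= h * eta.
Proof.
move=> h0 Ei H.
have -> : h * E x = \int[leb]_(t in `]x - h, x[) E x.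
  by rewrite Rintegral_oo_cst; [ring|lra].
have ci := @integrable_oo_cst R (x - h) x (E x).
have mI : measurable (`]x - h, x[%classic : set RR) by [].
rewrite -RintegralB// (le_trans (le_normr_Rintegral _ _))//.
  exact: integrable_RB.
have -> : h * eta = \int[leb]_(t in `]x - h, x[) eta.
  by rewrite Rintegral_oo_cst; [ring|lra].
apply: le_Rintegral => //.
- by apply: (@integrable_norm _ _ _ leb _ (fun t => E t - E x)); exact: integrable_RB.
- exact: integrable_oo_cst.
Qed.

(** Integrating the hypothesis over [t] in [(a, b)] with [s = t - h] and dividing
    by [h] turns the last term into a mean oscillation, which tends to [0] with
    [h] for every fixed [d]; then [d] tends to [0].  So an energy inequality
    follows from one-sided increments alone, without a chain rule in [V']. *)
Lemma energy_le (tau : R) (q m c2 : R -> R) (N2 : R -> R -> R) :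
  (forall t e, 0 <= t < tau -> 0 < e -> exists2 del : R, 0 < del &
    forall s, 0 <= s -> `|s - t| < del -> `|q s - q t| <= e) ->
  leb.-integrable `]0, tau[ (EFin \o m) ->
  leb.-integrable `]0, tau[ (EFin \o c2) ->
  {ae leb, forall t, 0 < t < tau -> forall s d : R, 0 < s < t -> 0 < d ->
    q t - q s <= \int[leb]_(r in `]s, t[) m r + d * \int[leb]_(r in `]s, t[) c2 r
      + d^-1 * \int[leb]_(r in `]s, t[) N2 t r} ->
  (forall a b eps : R, 0 < a -> a < b -> b < tau -> 0 < eps ->
    \forall n \near \oo, exists2 theta : R -> R,
      leb.-integrable `]a, b[ (EFin \o theta) /\
        \int[leb]_(t in `]a, b[) theta t <= eps * hstep n &
      forall t, a < t < b ->
        \int[leb]_(r in `]t - hstep n, t[) N2 t r <= theta t) ->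
  forall a b, 0 <= a -> a <= b -> b < tau ->
    q b - q a <= \int[leb]_(r in `]a, b[) m r.
Proof.
move=> qc mi ci qle Nosc.
have pos a b : 0 < a -> a < b -> b < tau -> q b - q a <= \int[leb]_(r in `]a, b[) m r.
  move=> a0 ab bt.
  (* The three errors [eta] come from the mean oscillation and from the averages of [E] over the
     boundary layers at [a] and [b]. *)
  have key d eta : 0 < d -> 0 < eta -> q b - q a <= \int[leb]_(r in `]a, b[) m r +
      d * \int[leb]_(r in `]a, b[) c2 r + 3 * eta.
    move=> d0 eta0.
    (* The primitive starts at [a1 < a], so the interval shifted to the left by a small [h] stays
       where [E] is controlled. *)
    pose a1 := a / 2; have a10 : 0 < a1 by rewrite divr_gt0.
    have a1a : a1 < a by rewrite ltr_pdivrMr// ltr_pMr// ltr1n.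
    clearbody a1.
    pose M t := m t + d * c2 t.
    have Mi x y : 0 <= x -> y <= tau -> leb.-integrable `]x, y[ (EFin \o M).
      move=> x0 yt; apply: (@integrable_oo_sub _ 0 tau) => //.
      by apply: integrable_RD => //; exact: integrable_RZl.
    have ME x y : 0 <= x -> y <= tau -> \int[leb]_(r in `]x, y[) M r =
        \int[leb]_(r in `]x, y[) m r + d * \int[leb]_(r in `]x, y[) c2 r.
      move=> x0 yt; have mi' := integrable_oo_sub x0 yt mi.
      have ci' := integrable_oo_sub x0 yt ci.
      by rewrite RintegralD// ?RintegralZl//; exact: integrable_RZl.
    pose E t := q t - \int[leb]_(r in `]a1, t[) M r.
    have Ec t e : a1 <= t <= b -> 0 < e -> exists2 del : R, 0 < del &
        forall s, a1 <= s <= b -> `|s - t| < del -> `|E s - E t| <= e.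
      move=> /andP[t1 t2] e0.
      have e2 : 0 < e / 2 by rewrite divr_gt0.
      have tt : 0 <= t < tau by rewrite (le_trans (ltW a10))// (le_lt_trans t2).
      have [d1 d10 H1] := qc t (e / 2) tt e2.
      have tab : a1 <= t <= b by rewrite t1.
      have [d2 d20 H2] := primitive_eps tab e2 (Mi a1 b (ltW a10) (ltW bt)).
      exists (Num.min d1 d2); first by rewrite lt_min d10.
      move=> s /andP[s1 s2]; rewrite lt_min => /andP[/H1 k1 /H2 k2].
      have {}k1 := k1 (le_trans (ltW a10) s1).
      have := k2 _; rewrite s1 s2 => /(_ isT); rewrite /E => {}k2.
      have -> : q s - \int[leb]_(r in `]a1, s[) M r -
          (q t - \int[leb]_(r in `]a1, t[) M r) = (q s - q t) -
          (\int[leb]_(r in `]a1, s[) M r - \int[leb]_(r in `]a1, t[) M r) by ring.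
      by rewrite (le_trans (ler_normB _ _))// [leRHS]splitr lerD.
    have Ei x y : a1 <= x -> y <= b -> leb.-integrable `]x, y[ (EFin \o E).
      move=> x1 yb; apply: (@integrable_oo_sub _ a1 b) => //.
      exact: eps_continuous_integrable.
    have aab : a1 <= a <= b by rewrite !ltW.
    have bab : a1 <= b <= b by rewrite lexx andbT ltW// (lt_trans a1a).
    have [da da0 Ha] := Ec a eta aab eta0.
    have [db db0 Hb] := Ec b eta bab eta0.
    have d00 : 0 < Num.min (a - a1) (Num.min da db) by rewrite !lt_min subr_gt0 a1a da0.
    have deta : 0 < d * eta by rewrite mulr_gt0.
    near \oo => n.
    have : hstep n < Num.min (a - a1) (Num.min da db) by near: n; exact: near_hstep.
    rewrite !lt_min => /andP[ha /andP[hda hdb]].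
    have [theta [thi thle] Nth] : exists2 theta : R -> R,
      leb.-integrable `]a, b[ (EFin \o theta) /\
        \int[leb]_(t in `]a, b[) theta t <= d * eta * hstep n &
      forall t, a < t < b ->
        \int[leb]_(r in `]t - hstep n, t[) N2 t r <= theta t.
      by near: n; exact: Nosc.
    have : 0 < hstep n :> R by exact: hstep_gt0.
    move: (hstep n) ha hda hdb thle Nth => h ha hda hdb thle Nth h0.
    have mab : measurable (`]a, b[%classic : set RR) by [].
    have hah : a1 <= a - h by move: ha; clear; lra.
    have bh : b - h <= b by move: h0; clear; lra.
    have Eshi : leb.-integrable `]a, b[ (EFin \o (fun t => E (t - h))).
      by apply: (@integrable_shift _ a b (- h) (EFin \o E)); exact: Ei.
    have Eabi : leb.-integrable `]a, b[ (EFin \o E) by apply: Ei => //; exact: ltW.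
    have EI : \int[leb]_(t in `]a, b[) E t - \int[leb]_(t in `]a, b[) E (t - h) <= h * eta.
      rewrite -RintegralB//.
      apply: (@le_trans _ _ (\int[leb]_(t in `]a, b[) (d^-1 * theta t))).
        apply: le_ae_Rintegral => //; [exact: integrable_RB|exact: integrable_RZl|].
        apply: filterS qle => t H; rewrite /= in_itv/= => /andP[at_ tb].
        have t0 : 0 < t < tau by rewrite (lt_trans a0 at_) (lt_trans tb bt).
        have s0 : 0 < t - h < t by move: ha a10 at_ h0; clear => *; apply/andP; split; lra.
        have {}H := H t0 (t - h) d s0 d0.
        have atb : a < t < b by rewrite at_.
        have NN : d^-1 * \int[leb]_(r in `]t - h, t[) N2 t r <= d^-1 * theta t.
          by rewrite ler_pM2l ?invr_gt0// Nth.
        have h1 : a1 <= t - h by move: hah at_; clear; lra.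
        have h2 : t - h <= t by move: h0; clear; lra.
        have tb' : t <= b by exact: ltW.
        have := primitive_sub h1 h2 tb' (Mi a1 b (ltW a10) (ltW bt)).
        have [s0' _] := andP s0; have [_ tT] := andP t0.
        rewrite (ME _ _ (ltW s0') (ltW tT)) /E.
        by move: H NN; clear; lra.
      by rewrite RintegralZl// ler_pdivrMl// (mulrC h) mulrA.
    have ah : a - h <= a by move: h0; clear; lra.
    have abh : a - h <= b - h by rewrite lerD2r ltW.
    have ahb : leb.-integrable `]a - h, b[ (EFin \o E) := Ei _ _ hah (lexx b).
    rewrite Rintegral_oo_shift in EI; last exact: (Ei _ _ hah bh).
    (* Two decompositions of the integral of [E] over [(a - h, b)]: their difference leaves only the
       layers [(b - h, b)] and [(a - h, a)]. *)
    have e1 := Rintegral_oo_cat ah (ltW ab) ahb.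
    have e2 := Rintegral_oo_cat abh bh ahb.
    have Eb : `|\int[leb]_(t in `]b - h, b[) E t - h * E b| <= h * eta.
      apply: average_near => //; first exact: (Ei _ _ (le_trans hah abh) (lexx b)).
      move=> s /andP[s1 s2]; apply: Hb.
        by rewrite (ltW s2) andbT (le_trans (le_trans hah abh))// ltW.
      by move: s1 s2 hdb; clear => *; rewrite ltr_norml; apply/andP; split; lra.
    have Ea : `|\int[leb]_(t in `]a - h, a[) E t - h * E a| <= h * eta.
      apply: average_near => //; first exact: (Ei _ _ hah (ltW ab)).
      move=> s /andP[s1 s2]; apply: Ha.
        by rewrite (le_trans hah (ltW s1)) (le_trans (ltW s2) (ltW ab)).
      by move: s1 s2 hda; clear => *; rewrite ltr_norml; apply/andP; split; lra.
    have EE : E b - E a <= 3 * eta.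
      rewrite -(ler_pM2l h0).
      move: Eb Ea; rewrite !ler_norml => /andP[u1 u2] /andP[u3 u4].
      by move: EI e1 e2 u1 u2 u3 u4; clear; lra.
    have := primitive_sub (ltW a1a) (ltW ab) (lexx b) (Mi a1 b (ltW a10) (ltW bt)).
    rewrite ME ?(ltW a0) ?(ltW bt)//; move: EE; rewrite /E; clear; lra.
  set C := \int[leb]_(r in `]a, b[) c2 r in key.
  apply/ler_addgt0Pr => e e0.
  have C1 : 0 < `|C| + 1 by rewrite ltr_wpDl.
  have := key (e / 2 / (`|C| + 1)) (e / 6) _ _.
  rewrite !divr_gt0// => /(_ isT isT) H; apply: (le_trans H).
  rewrite -addrA lerD2l.
  have : e / 2 / (`|C| + 1) * C <= e / 2.
    rewrite mulrAC ler_pdivrMr// ler_pM2l ?divr_gt0//.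
    by rewrite (le_trans (ler_norm _))// lerDl.
  by move: e0; clear; move=> e0; lra.
move=> a b; rewrite le_eqVlt => /predU1P[<-|a0]; last first.
  rewrite le_eqVlt => /predU1P[->|ab] bt; last exact: pos.
  by rewrite subrr oo0// Rintegral_set0.
rewrite le_eqVlt => /predU1P[<-|b0] bt; first by rewrite subrr oo0// Rintegral_set0.
(* For [a = 0] the estimate on [(x, b)] is extended by continuity of [q] and of the primitive at
   [0]. *)
apply/ler_addgt0Pr => e e0.
have e2 : 0 < e / 2 by rewrite divr_gt0.
have t0 : 0 <= (0 : R) < tau by rewrite lexx (lt_trans b0).
have [d1 d10 H1] := qc 0 (e / 2) t0 e2.
have t0b : 0 <= (0 : R) <= b by rewrite lexx ltW.
have mib : leb.-integrable `]0, b[ (EFin \o m).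
  by apply: (@integrable_oo_sub _ 0 tau) => //; exact: ltW.
have [d2 d20 H2] := primitive_eps t0b e2 mib.
pose x := Num.min (b / 2) (Num.min (d1 / 2) (d2 / 2)).
have x0 : 0 < x by rewrite !lt_min !divr_gt0.
have xb : x < b by rewrite gt_min ltr_pdivrMr// ltr_pMr// ltr1n.
have half (z : R) : 0 < z -> z / 2 < z.
  by move=> z0; rewrite ltr_pdivrMr// ltr_pMr// ltr1n.
have xd1 : `|x - 0| < d1.
  by rewrite subr0 gtr0_norm// !gt_min (half _ d10) !orbT.
have xd2 : `|x - 0| < d2.
  by rewrite subr0 gtr0_norm// !gt_min (half _ d20) !orbT.
have := H1 x (ltW x0) xd1; have := H2 x _ xd2.
rewrite (ltW x0) (ltW xb) => /(_ isT).
rewrite (@oo0 _ 0 0)// Rintegral_set0 subr0.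
have := pos x b x0 xb bt.
have := primitive_sub (ltW x0) (ltW xb) (lexx b) mib.
rewrite !ler_norml => -> k1 /andP[k2 k3] /andP[k4 k5].
by lra.
Unshelve. all: by end_near. Qed.

Lemma Rintegral_expR (g a b : R) : a <= b ->
  \int[leb]_(t in `]a, b[) (g * expR (g * t)) = expR (g * b) - expR (g * a).
Proof.
rewrite le_eqVlt => /predU1P[->|ab]; first by rewrite subrr oo0// Rintegral_set0.
have cexp : continuous (fun t : R => expR (g * t)).
  by move=> t; apply: continuous_comp; [exact: mulrl_continuous|exact: continuous_expR].
have cf : continuous (fun t : R => g * expR (g * t)).
  by move=> t; apply: cvgM; [exact: cvg_cst|exact: cexp].
have dF (x : R) : is_derive x 1 (fun t : R => expR (g * t)) (g * expR (g * x)).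
  apply: is_derive_eq; rewrite /GRing.scale/=.
  by rewrite ?mulr1 ?mulr0 ?addr0 mulrC.
have := @continuous_FTC2 R (fun t => g * expR (g * t)) (fun t => expR (g * t)) a b ab.
rewrite integral_oo_cc; last first.
  apply/measurable_EFinP; apply: measurable_funTS; apply: continuous_measurable_fun.
  exact: cf.
move=> H; rewrite /Rintegral H//.
- by apply: continuous_subspaceT.
- split => [x _| |]; first by case: (dF x).
    by apply: cvg_at_right_filter; exact: cexp.
  by apply: cvg_at_left_filter; exact: cexp.
- by move=> x _; rewrite derive1E; case: (dF x).
Qed.

(** An integrated product rule for [expR (g * t) * q t], where [q] need not be differentiable: on
    short intervals the weight and [q] are nearly constant, and the resulting error, at most
    [e * (|m| + 1)] under the integral, is summed by [cousin] although [m] is merely integrable. *)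
Lemma weighted_energy (g T : R) (q m : R -> R) :
  {within `[0, T], continuous q} -> leb.-integrable `]0, T[ (EFin \o m) ->
  (forall a b, 0 <= a -> a <= b -> b <= T ->
    q b - q a <= \int[leb]_(r in `]a, b[) m r) ->
  forall b, 0 <= b -> b <= T ->
    expR (g * b) * q b - q 0 <=
      \int[leb]_(r in `]0, b[) (expR (g * r) * (m r + g * q r)).
Proof.
move=> cq mi H b b0 bT.
have qi : leb.-integrable `]0, b[ (EFin \o q).
  apply: (@integrable_oo_sub _ 0 T) => //; exact: within_continuous_integrable.
have {}mi : leb.-integrable `]0, b[ (EFin \o m) by apply: (@integrable_oo_sub _ 0 T).
have cexp : continuous (fun t : R => expR (g * t)).
  by move=> t; apply: continuous_comp; [exact: mulrl_continuous|exact: continuous_expR].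
pose K := expR (`|g| * b).
have expK t : 0 <= t <= b -> expR (g * t) <= K.
  move=> /andP[t0 tb]; rewrite ler_expR (le_trans (ler_norm _))// normrM.
  by rewrite (ger0_norm t0) ler_wpM2l.
have K0 : 0 < K by exact: expR_gt0.
have mI x y : measurable (`]x, y[%classic : set RR) by [].
have wi f x y : 0 <= x -> y <= b -> leb.-integrable `]0, b[ (EFin \o f) ->
    leb.-integrable `]x, y[ (EFin \o (fun r => expR (g * r) * f r)).
  move=> x0 yb fi; apply: (@integrable_oo_sub _ 0 b) => //.
  apply: (integrable_Rle (g := fun r : RR => K * `|f r|)) => //.
  - apply: measurable_funM; first exact: measurable_wexp.
    exact: integrable_measurable_fun fi.
  - move=> r; rewrite /= in_itv/= => /andP[r0 rb].
    rewrite normrM ler_wpM2r// ger0_norm ?expR_ge0//.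
    by apply: expK; rewrite !ltW.
  - by apply: integrable_RZl => //; exact: integrable_norm.
pose F r := m r + g * q r.
have Fi : leb.-integrable `]0, b[ (EFin \o F).
  by apply: integrable_RD => //; exact: integrable_RZl.
pose W r := expR (g * r) * F r.
have Wi : leb.-integrable `]0, b[ (EFin \o W) by exact: (wi F).
pose Z t := expR (g * t) * q t - \int[leb]_(r in `]0, t[) W r.
pose L t := \int[leb]_(r in `]0, t[) (`|m r| + 1).
have Li : leb.-integrable `]0, b[ (EFin \o (fun r => `|m r| + 1)).
  by apply: integrable_RD => //; [exact: integrable_norm|exact: integrable_oo_cst].
suff : Z b <= Z 0.
  rewrite /Z mulr0 expR0 mul1r (@oo0 _ 0 0)// Rintegral_set0 subr0 -/F.
  by rewrite /W /F !lerBlDr addrC.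
apply: (@cousin R 0 b Z L b0) => e t e0 tab.
have e' : 0 < e / (1 + `|g| * K) by rewrite divr_gt0// ltr_pwDl// mulr_ge0// ltW.
have e2 : 0 < e / (1 + `|g| * K) / 2 by rewrite divr_gt0.
have tT : 0 <= t <= T by case/andP: tab => -> /le_trans ->.
have [d1 d10 H1] := within_continuous_eps cq tT e2.
have cexp' : {within `[0, b], continuous (fun t : R => expR (g * t))}.
  exact: continuous_subspaceT.
have [d2 d20 H2] := within_continuous_eps cexp' tab e2.
exists (Num.min d1 d2); first by rewrite lt_min d10.
move=> s s' /andP[s0 st] /andP[ts' sb].
rewrite ltrBlDr -ltrBlDl lt_min => /andP[sd1 sd2].
rewrite -ltrBlDl lt_min => /andP[sd1' sd2'].
have ss' : s <= s' by rewrite (le_trans st).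
rewrite /Z /L -(primitive_sub s0 ss' sb Li).
(* Old weight times the increment of [q], plus the increment of the weight times the new value of
   [q]; the latter becomes an integral of the derivative of the weight. *)
have -> : expR (g * s') * q s' - \int[leb]_(r in `]0, s'[) W r -
    (expR (g * s) * q s - \int[leb]_(r in `]0, s[) W r) =
    expR (g * s) * (q s' - q s) + (expR (g * s') - expR (g * s)) * q s' -
    (\int[leb]_(r in `]0, s'[) W r - \int[leb]_(r in `]0, s[) W r) by ring.
rewrite -(primitive_sub s0 ss' sb Wi) -(Rintegral_expR g ss').
have e1i : leb.-integrable `]s, s'[ (EFin \o (fun r : R => g * expR (g * r))).
  apply: within_continuous_integrable; apply: continuous_subspaceT => r.
  by apply: cvgM; [exact: cvg_cst|exact: cexp].
have m2i : leb.-integrable `]s, s'[ (EFin \o m) by apply: (@integrable_oo_sub _ 0 b).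
have W2i : leb.-integrable `]s, s'[ (EFin \o W) by apply: (@integrable_oo_sub _ 0 b).
have L2i : leb.-integrable `]s, s'[ (EFin \o (fun r => `|m r| + 1)) by apply: (@integrable_oo_sub _ 0 b).
apply: (@le_trans _ _ (\int[leb]_(r in `]s, s'[) (expR (g * s) * m r) +
    \int[leb]_(r in `]s, s'[) (q s' * (g * expR (g * r))) - \int[leb]_(r in `]s, s'[) W r)).
  rewrite lerD2r (@RintegralZl _ _ _ leb _ m)// (@RintegralZl _ _ _ leb _ (fun r => g * expR (g * r)))//.
  rewrite (mulrC (q s')) lerD2r ler_pM2l ?expR_gt0//.
  by apply: H => //; rewrite (le_trans sb).
have i1 := integrable_RZl (mI s s') (expR (g * s)) m2i.
have i2 := integrable_RZl (mI s s') (q s') e1i.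
rewrite -RintegralD// -RintegralB//; last exact: integrable_RD.
rewrite -(@RintegralZl _ _ _ leb _ (fun r => `|m r| + 1))//.
apply: le_Rintegral => //.
- by apply: integrable_RB => //; exact: integrable_RD.
- exact: integrable_RZl.
move=> r; rewrite /= in_itv/= => /andP[r1 r2].
have rb : 0 <= r <= b by rewrite (le_trans s0 (ltW r1)) (le_trans (ltW r2)).
have dist (F' : R -> R) (dd ee : R) : (forall s, 0 <= s <= b -> `|s - t| < dd -> `|F' s - F' t| <= ee / 2) ->
    t - s < dd -> s' - t < dd -> forall x y, s <= x <= s' -> s <= y <= s' -> `|F' x - F' y| <= ee.
  move=> HF k1 k2 x y /andP[x1 x2] /andP[y1 y2].
  have -> : F' x - F' y = (F' x - F' t) - (F' y - F' t) by ring.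
  rewrite (le_trans (ler_normB _ _))// [leRHS]splitr lerD// HF//.
  - by move: x1 x2 s0 sb; clear => *; apply/andP; split; lra.
  - by move: x1 x2 k1 k2; clear => *; rewrite ltr_norml; apply/andP; split; lra.
  - by move: y1 y2 s0 sb; clear => *; apply/andP; split; lra.
  - by move: y1 y2 k1 k2; clear => *; rewrite ltr_norml; apply/andP; split; lra.
have q1 : `|q s' - q r| <= e / (1 + `|g| * K).
  apply: (dist q d1) => //; last 2 first.
  - by rewrite ss' lexx.
  - by rewrite !ltW.
  by move=> x /andP[x0 xb]; apply: H1; rewrite x0 (le_trans xb).
have q2 : `|expR (g * s) - expR (g * r)| <= e / (1 + `|g| * K).
  apply: (dist (fun r => expR (g * r)) d2) => //.
  - by rewrite lexx.
  - by rewrite !ltW.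
rewrite /W /F.
have -> : expR (g * s) * m r + q s' * (g * expR (g * r)) - expR (g * r) * (m r + g * q r) =
  (expR (g * s) - expR (g * r)) * m r + g * expR (g * r) * (q s' - q r) by ring.
apply: (le_trans (ler_norm _)); apply: (le_trans (ler_normD _ _)).
rewrite !normrM (ger0_norm (expR_ge0 (g * r))).
have k1 : `|expR (g * s) - expR (g * r)| * `|m r| <= e / (1 + `|g| * K) * `|m r|.
  by rewrite ler_wpM2r.
have k2 : `|g| * expR (g * r) * `|q s' - q r| <= (`|g| * K) * (e / (1 + `|g| * K)).
  rewrite ler_pM ?mulr_ge0 ?expR_ge0// ler_wpM2l//; exact: expK.
have gK : 0 <= `|g| * K by rewrite mulr_ge0// ltW.
have ee : e / (1 + `|g| * K) <= e.
  by rewrite ler_pdivrMr ?ltr_pwDl// ler_peMr ?lerDl// ltW.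
have k3 : e / (1 + `|g| * K) * `|m r| <= e * `|m r| by rewrite ler_wpM2r.
have k4 : (`|g| * K) * (e / (1 + `|g| * K)) <= e.
  rewrite mulrA ler_pdivrMr ?ltr_pwDl// mulrC ler_pM2l// lerDr//.
by rewrite mulrDr mulr1; move: k1 k2 k3 k4; clear; lra.
Qed.

End energy_inequality.

(** * Test functions and [H_0^1] *)

Section test_functions.
Context {R : realType}.
Notation leb := (@lebesgue_measure R).
Notation RR := (measurableTypeR R).
Implicit Types (eta chi f F : R -> R) (a b : R).

Lemma derivable_continuous1 F x : derivable F x 1 -> {for x, continuous F}.
Proof. by move=> /derivable1_diffP /differentiable_continuous. Qed.

Lemma continuous_oo_integrable f a b : continuous f ->
  leb.-integrable `]a, b[ (EFin \o f).
Proof.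
move=> cf; apply: within_continuous_integrable.
by apply: continuous_subspaceT.
Qed.

Lemma Rintegral_derive F f a b : a <= b ->
  (forall x, a <= x <= b -> is_derive x (1 : R) F (f x) /\ {for x, continuous f}) ->
  \int[leb]_(t in `]a, b[) f t = F b - F a.
Proof.
rewrite le_eqVlt => /predU1P[<-|ab] dF.
  by rewrite oo0// Rintegral_set0 subrr.
have cF x : a <= x <= b -> {for x, continuous F}.
  by move=> /dF[? _]; apply: derivable_continuous1; exact: ex_derive.
have cf : {within `[a, b], continuous f}.
  by apply: continuous_in_subspaceT => x /set_mem; rewrite /= in_itv/= => /dF[].
rewrite /Rintegral -integral_oo_cc; last first.
  apply/measurable_EFinP.
  exact: integrable_measurable_fun (within_continuous_integrable cf).
rewrite (@continuous_FTC2 _ f F)//.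
- split.
  + by move=> x; rewrite in_itv/= => /andP[? ?]; have [] := dF x; [lra|move=> ? _; exact: ex_derive].
  + by apply: cvg_at_right_filter; apply: cF; lra.
  + by apply: cvg_at_left_filter; apply: cF; lra.
- move=> x; rewrite in_itv/= => /andP[? ?]; rewrite derive1E.
  by have [] := dF x; [lra|move=> ? _; exact: derive_val].
Qed.

Lemma smooth1_derivable eta x : smooth1 eta -> derivable eta x 1.
Proof. by move=> /(_ 0%N). Qed.

Lemma smooth1_is_derive eta x : smooth1 eta -> is_derive x (1 : R) eta (derive1 eta x).
Proof.
by move=> se; rewrite derive1E; apply: DeriveDef => //; exact: smooth1_derivable se.
Qed.

Lemma smooth1_derive1 eta : smooth1 eta -> smooth1 (derive1 eta).
Proof.
move=> se n; have -> : derive1n n (derive1 eta) = derive1n n.+1 eta.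
  by rewrite /derive1n iterSr.
exact: se.
Qed.

Lemma smooth1_continuous eta : smooth1 eta -> continuous eta.
Proof. by move=> se x; apply: derivable_continuous1; exact: smooth1_derivable. Qed.

Lemma derive1n_lin (c : R) eta chi : smooth1 eta -> smooth1 chi -> forall n,
  derive1n n (fun x => c * eta x + chi x) =
  (fun x => c * derive1n n eta x + derive1n n chi x).
Proof.
move=> se sc; elim=> [//|n IH]; rewrite [LHS]/= -/(derive1n n _) IH.
apply/funext => x; rewrite derive1E.
have h1 : is_derive x (1 : R) (derive1n n eta) (derive1n n.+1 eta x).
  by rewrite [derive1n n.+1 _]/= derive1E; apply: DeriveDef => //; exact: se.
have h2 : is_derive x (1 : R) (derive1n n chi) (derive1n n.+1 chi x).
  by rewrite [derive1n n.+1 _]/= derive1E; apply: DeriveDef => //; exact: sc.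
exact: derive_val.
Qed.

Lemma smooth1_lin (c : R) eta chi : smooth1 eta -> smooth1 chi ->
  smooth1 (fun x => c * eta x + chi x).
Proof.
move=> se sc n x; rewrite derive1n_lin//.
by apply: derivableD; [apply: derivableM => //; exact: se|exact: sc].
Qed.

(** The support is enclosed between the extreme points of the compact set; an interval is easier to
    combine, shift and integrate over than [K]. *)
Lemma test1P a b eta : a < b -> test1 a b eta <-> smooth1 eta /\
  exists a' b', [/\ a < a', a' <= b', b' < b &
    forall x, x < a' \/ b' < x -> eta x = 0].
Proof.
move=> ab; split=> [[se [K [cK Kab K0]]]|[se [a' [b' [aa' ab' bb' eta0]]]]]; split=> //.
  have [K_eq0|/set0P Kn] := eqVneq K set0.
    exists ((a + b) / 2), ((a + b) / 2); split; [lra|lra|lra|by move=> x _; apply: K0; rewrite K_eq0].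
  have cid : {within K, continuous (id : R -> R)}.
    by apply: continuous_subspaceT => x; exact: cvg_id.
  have [M KM Mmax] := compact_EVT_max Kn cK cid.
  have [m Km mmin] := compact_EVT_min Kn cK cid.
  have /Kab := set_mem Km; rewrite /= in_itv/= => /andP[am _].
  have /Kab := set_mem KM; rewrite /= in_itv/= => /andP[_ Mb].
  exists m, M; split=> //; first exact: Mmax.
  move=> x xmM; apply: K0 => Kx.
  have := Mmax _ (mem_set Kx); have := mmin _ (mem_set Kx).
  by case: xmM => /lt_geF/negbT/negP h ? ?; apply: h.
exists `[a', b']%classic; split; first exact: segment_compact.
  by move=> x /=; rewrite !in_itv/= => /andP[? ?]; apply/andP; split; lra.
move=> x /negP; rewrite /= in_itv/= negb_and -!ltNge => /orP xab.
exact: eta0.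
Qed.

Lemma test1_derive1 a b eta : a < b -> test1 a b eta -> test1 a b (derive1 eta).
Proof.
move=> ab /(test1P _ ab)[se [a' [b' [aa' ab' bb' eta0]]]].
apply/(test1P _ ab); split; first exact: smooth1_derive1.
exists a', b'; split=> // x xab; rewrite derive1E.
rewrite (@near_eq_derive _ _ _ eta (cst 0)); first by rewrite derive_cst.
case: xab => xab.
  by near=> y; rewrite eta0//; left; near: y; exact: lt_nbhsl.
by near=> y; rewrite eta0//; right; near: y; exact: lt_nbhsr.
Unshelve. all: by end_near. Qed.

Lemma test1_lin (c : R) a b eta chi : a < b -> test1 a b eta -> test1 a b chi ->
  test1 a b (fun x => c * eta x + chi x).
Proof.
move=> ab /(test1P _ ab)[se [a1 [b1 [aa1 ab1 bb1 eta0]]]].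
move=> /(test1P _ ab)[sc [a2 [b2 [aa2 ab2 bb2 chi0]]]].
apply/(test1P _ ab); split; first exact: smooth1_lin.
exists (Num.min a1 a2), (Num.max b1 b2); split.
- by rewrite lt_min aa1.
- by rewrite ge_min le_max ab1.
- by rewrite gt_max bb1.
move=> x; rewrite lt_min gt_max => xab; rewrite eta0 ?chi0 ?mulr0 ?addr0//.
  by case: xab => /andP[? ?]; [left|right].
by case: xab => /andP[? ?]; [left|right].
Qed.

Lemma test1_bounded a b eta : a < b -> test1 a b eta -> exists C : R, forall x, `|eta x| <= C.
Proof.
move=> ab /(test1P _ ab)[se [a' [b' [aa' ab' bb' eta0]]]].
have cn : {within `[a', b'], continuous (fun x => `|eta x|)}.
  apply: continuous_subspaceT => x; apply: continuous_comp.
    exact: smooth1_continuous.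
  exact: norm_continuous.
have [c _ cmax] := EVT_max ab' cn.
exists `|eta c| => x; have [xa|xa] := ltP x a'; first by rewrite eta0 ?normr0//; left.
have [xb|xb] := ltP b' x; first by rewrite eta0 ?normr0//; right.
by apply: cmax; rewrite in_itv/= xa.
Qed.

Lemma test1_Lfun a b a' b' eta : a < b -> test1 a b eta -> eta \in Lfun (muI a' b') 2%:E.
Proof.
move=> ab te; have se := te.1; have [C etaC] := test1_bounded ab te.
have me : measurable_fun setT (eta : RR -> R).
  by apply: continuous_measurable_fun; exact: smooth1_continuous.
have me2 : measurable_fun setT (fun x : RR => (eta x ^+ 2)%:E).
  by apply/measurable_EFinP; exact: measurable_funX.
have i2 : leb.-integrable `]a', b'[ (EFin \o (fun x : RR => eta x ^+ 2)).
  apply: integrable_Rle (integrable_oo_cst a' b' (C ^+ 2)) => //.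
    by apply: measurable_funTS; exact: measurable_funX.
  by move=> x _; rewrite normrX lerXn2r ?nnegrE//; exact: le_trans (etaC x).
apply: Lfun2P => //; rewrite integral_mrestr//.
by rewrite -EFin_Rintegral// ltry.
Qed.

Lemma Rintegral_cst0_oo a b f : (forall x, a < x < b -> f x = 0) ->
  \int[leb]_(x in `]a, b[) f x = 0.
Proof.
move=> f0; rewrite (@eq_Rintegral _ _ _ _ _ (cst 0)); last first.
  by move=> x /set_mem; rewrite /= in_itv/= => /f0.
by rewrite Rintegral_cst// mul0r.
Qed.

Lemma Rintegral_supp a b a' b' f : a <= a' -> a' <= b' -> b' <= b ->
  leb.-integrable `]a, b[ (EFin \o f) ->
  (forall x, x < a' \/ b' < x -> f x = 0) ->
  \int[leb]_(t in `]a, b[) f t = \int[leb]_(t in `]a', b'[) f t.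
Proof.
move=> aa' ab' bb' fi f0.
rewrite (@Rintegral_oo_cat _ a a' b)//; last exact: le_trans bb'.
rewrite [X in X + _]Rintegral_cst0_oo ?add0r; last first.
  by move=> x /andP[_ ?]; apply: f0; left.
rewrite (@Rintegral_oo_cat _ a' b' b)//; last exact: integrable_oo_sub fi.
rewrite [X in _ + X]Rintegral_cst0_oo ?addr0// => x /andP[? _].
by apply: f0; right.
Qed.

Lemma test1_antiderivative a b chi : a < b -> test1 a b chi ->
  exists2 eta, (forall x, is_derive x (1 : R) eta (chi x)) &
    forall x, a <= x -> eta x = \int[leb]_(t in `]a, x[) chi t.
Proof.
move=> ab /(test1P _ ab)[sc [a' [b' [aa' ab' bb' chi0]]]].
have cc := smooth1_continuous sc.
pose c := a - 1; pose eta x := \int[leb]_(t in `[c, x]) chi t.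
have mchi (x y : R) : measurable_fun (`]x, y[ : set RR) (EFin \o chi).
  by apply/measurable_EFinP; exact: integrable_measurable_fun (continuous_oo_integrable x y cc).
have etaE x : eta x = \int[leb]_(t in `]c, x[) chi t.
  by rewrite /eta /Rintegral integral_oo_cc//; exact: mchi.
have eta_lo x : x <= a' -> eta x = 0.
  move=> xa'; rewrite etaE; apply: Rintegral_cst0_oo => y /andP[_ yx].
  by apply: chi0; left; lra.
exists eta => x; last first.
  move=> ax; rewrite etaE (@Rintegral_oo_cat _ c a)//; last 2 first.
  - by rewrite /c lerBlDr lerDl.
  - exact: continuous_oo_integrable.
  rewrite [X in X + _]Rintegral_cst0_oo ?add0r// => y /andP[_ yx].
  by apply: chi0; left; lra.
have [xa|xa] := ltP x a'.
  have e0 : \near x, cst 0 x = eta x.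
    by near=> y; rewrite eta_lo//; apply/ltW; near: y; exact: lt_nbhsl.
  by rewrite chi0; [exact: near_eq_is_derive e0 _|left].
have [dex <-] : derivable eta x 1 /\ derive1 eta x = chi x.
  apply: (@continuous_FTC1_closed _ chi c x (x + 1)).
  - by rewrite ltrDl.
  - apply: continuous_compact_integrable; first exact: segment_compact.
    exact: continuous_subspaceT.
  - by rewrite /c; move: aa' xa; clear; lra.
  - exact: cc.
by rewrite derive1E; exact: DeriveDef.
Unshelve. all: by end_near. Qed.

(** The vanishing mean makes the primitive zero to the right of the support as well. This is where
    constants enter du Bois-Reymond's argument. *)
Lemma test1_primitive a b chi : a < b -> test1 a b chi ->
  \int[leb]_(t in `]a, b[) chi t = 0 ->
  exists2 eta, test1 a b eta & derive1 eta = chi.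
Proof.
move=> ab tc chi_int.
have [eta deta etaa] := test1_antiderivative ab tc.
move: tc => /(test1P _ ab)[sc [a' [b' [aa' ab' bb' chi0]]]].
have cc := smooth1_continuous sc.
have deta1 : derive1 eta = chi by apply/funext => x; rewrite derive1E; exact: derive_val.
have ceta : continuous eta by move=> x; apply: derivable_continuous1; exact: ex_derive.
have eta_lo x : x < a' -> eta x = 0.
  move=> xa'; have [ax|/ltW xa] := leP a x.
    by rewrite etaa//; apply: Rintegral_cst0_oo => y /andP[_ yx]; apply: chi0; left; lra.
  have etaa0 : eta a = 0 by rewrite etaa// oo0// Rintegral_set0.
  have : \int[leb]_(t in `]x, a[) chi t = eta a - eta x.
    by apply: Rintegral_derive => // y _; split; [exact: deta|exact: cc].
  rewrite Rintegral_cst0_oo ?etaa0; first by move/eqP; rewrite sub0r eq_sym oppr_eq0 => /eqP.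
  by move=> y /andP[_ yx]; apply: chi0; left; lra.
have eta_hi x : b' < x -> eta x = 0.
  move=> xb'; have e1 : \int[leb]_(t in `]a, b'[) chi t = 0.
    rewrite -chi_int (@Rintegral_oo_cat _ a b' b)//; last 3 first.
    - lra.
    - lra.
    - exact: continuous_oo_integrable.
    rewrite [X in _ + X]Rintegral_cst0_oo ?addr0// => y /andP[yx _].
    by apply: chi0; right; lra.
  rewrite etaa; last lra.
  rewrite (@Rintegral_oo_cat _ a b' x)//; last 3 first.
  - lra.
  - lra.
  - exact: continuous_oo_integrable.
  rewrite e1 [X in _ + X]Rintegral_cst0_oo ?addr0// => y /andP[yx _].
  by apply: chi0; right; lra.
exists eta => //; apply/(test1P _ ab); split.
  move=> [|n] x; first exact: ex_derive.
  have -> : derive1n n.+1 eta = derive1n n chi by rewrite /derive1n iterSr deta1.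
  exact: sc.
by exists a', b'; split=> // x [/eta_lo|/eta_hi].
Qed.

Lemma test1_by_parts a b eta F f : a < b -> test1 a b eta ->
  (forall x, is_derive x (1 : R) F (f x)) -> continuous f ->
  \int[leb]_(t in `]a, b[) (F t * derive1 eta t) =
  - \int[leb]_(t in `]a, b[) (f t * eta t).
Proof.
move=> ab te dF cf; have se := te.1.
have cF : continuous F by move=> x; apply: derivable_continuous1; exact: ex_derive.
have ce := smooth1_continuous se.
have cde := smooth1_continuous (smooth1_derive1 se).
have c1 : continuous (fun x => F x * derive1 eta x) by move=> x; apply: cvgM; [exact: cF|exact: cde].
have c2 : continuous (fun x => f x * eta x) by move=> x; apply: cvgM; [exact: cf|exact: ce].
apply/eqP; rewrite -addr_eq0 -RintegralD//; [|exact: continuous_oo_integrable..].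
move: te => /(test1P _ ab)[_ [a' [b' [aa' ab' bb' eta0]]]].
rewrite (@Rintegral_derive (fun x => F x * eta x)) ?ltW//.
  by rewrite !eta0 ?mulr0 ?subrr//; [left|right].
move=> x _; split; last by apply: cvgD; [exact: c1|exact: c2].
have := smooth1_is_derive x se => ?; apply: is_derive_eq.
by rewrite /GRing.scale/= [in RHS](mulrC (f x)).
Qed.

End test_functions.

(** * The space [H_0^1(I)] and Poincare's inequality *)

Section H01.
Context {R : realType}.
Notation leb := (@lebesgue_measure R).
Notation RR := (measurableTypeR R).
Variables (l : R) (l_gt0 : 0 < l).
Notation mI := (muI 0 l).
Notation X := (XI l).
Implicit Types (phi psi : X) (eta chi : R -> R).

Lemma eps0 (x C : R) : (forall e, 0 < e -> `|x| <= C * e) -> x = 0.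
Proof.
move=> h; apply/eqP; rewrite -normr_le0; apply/ler_addgt0Pr => e e0; rewrite add0r.
have C0 : 0 < `|C| + 1 by rewrite ltr_wpDl.
apply: (le_trans (h (e / (`|C| + 1)) _)); first exact: divr_gt0.
rewrite mulrA ler_pdivrMr// mulrC ler_pM2l//.
by rewrite (le_trans (ler_norm C))// lerDl.
Qed.

Lemma dotp_muI (a b : R) (f g : R -> R) :
  measurable_fun setT (f : RR -> R) -> measurable_fun setT (g : RR -> R) ->
  dotp (muI a b) f g = \int[leb]_(x in `]a, b[) (f x * g x).
Proof. by move=> mf mg; rewrite /dotp Rintegral_mrestr//; exact: measurable_funM. Qed.

Definition toXI (f : R -> R) : X := @toL2 _ RR R mI f.

Lemma toL2_test eta : test1 0 l eta -> (toXI eta : X) = eta :> (R -> R).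
Proof. by move=> te; exact: (@toL2E _ RR R mI eta (@test1_Lfun R 0 l 0 l eta l_gt0 te)). Qed.

Lemma nrm_test_lt phi eta (e : R) : test1 0 l eta ->
  ('N[mI]_2%:E[EFin \o (phi \- eta)%R] < e%:E)%E = (nrm (phi - toXI eta : X) < e).
Proof.
move=> te; rewrite -lte_fin EFin_nrm.
suff -> : (phi - toXI eta : X) = phi \- eta :> (R -> R) by [].
by rewrite -[in RHS](toL2_test te).
Qed.

Lemma in_H01P phi dphi : in_H01 phi dphi <-> wderiv phi dphi /\
  forall e : R, 0 < e -> exists2 eta, test1 0 l eta &
    nrm (phi - toXI eta : X) < e /\ nrm (dphi - toXI (derive1 eta) : X) < e.
Proof.
split=> -[wd h]; split=> // e e0; have [eta te [h1 h2]] := h e e0; exists eta => //.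
  by rewrite -!nrm_test_lt//; exact: test1_derive1.
by rewrite !nrm_test_lt//; exact: test1_derive1.
Qed.

Lemma wderivE phi dphi eta : wderiv phi dphi -> test1 0 l eta ->
  dotp mI phi (toXI (derive1 eta) : X) = - dotp mI dphi (toXI eta : X).
Proof. by move=> wd te; rewrite !toL2_test//; [exact: wd|exact: test1_derive1]. Qed.

(** Only [psi] has to vanish at the boundary: it is replaced by test functions, for which the
    identity is the definition of the weak derivative of [chi]. *)
Lemma H01_by_parts psi dpsi (chi dchi : X) : in_H01 psi dpsi -> wderiv chi dchi ->
  dotp mI chi dpsi = - dotp mI dchi psi.
Proof.
move=> /in_H01P[_ h] wd; apply/eqP; rewrite -addr_eq0; apply/eqP.
apply: (@eps0 _ (nrm chi + nrm dchi)) => e e0.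
have [eta te [h1 h2]] := h e e0.
have -> : dotp mI chi dpsi + dotp mI dchi psi =
    dotp mI chi (dpsi - toXI (derive1 eta) : X) + dotp mI dchi (psi - toXI eta : X).
  by rewrite !dotpBr (wderivE wd te); ring.
apply: (le_trans (ler_normD _ _)); rewrite mulrDl lerD//.
  by apply: (le_trans (cauchy_schwarz _ _)); rewrite ler_wpM2l ?nrm_ge0// ltW.
by apply: (le_trans (cauchy_schwarz _ _)); rewrite ler_wpM2l ?nrm_ge0// ltW.
Qed.

Lemma test_measurable eta : test1 0 l eta -> measurable_fun setT (eta : RR -> R).
Proof. by move=> [se _]; apply: continuous_measurable_fun; exact: smooth1_continuous. Qed.

Lemma test_H01 eta : test1 0 l eta -> in_H01 (toXI eta : X) (toXI (derive1 eta) : X).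
Proof.
move=> te; have tde := test1_derive1 l_gt0 te; apply/in_H01P; split.
  move=> chi tc; rewrite !toL2_test//; have tdc := test1_derive1 l_gt0 tc.
  rewrite !dotp_muI; try exact: test_measurable.
  apply: test1_by_parts => //; last exact: smooth1_continuous tde.1.
  by move=> x; exact: smooth1_is_derive te.1.
by move=> e e0; exists eta => //; rewrite !subrr nrm0.
Qed.

Lemma toL2_lin (c : R) eta chi : test1 0 l eta -> test1 0 l chi ->
  aeq mI (toXI (fun x => c * eta x + chi x) : X) (c *: toXI eta + toXI chi : X).
Proof.
move=> te tc; rewrite toL2_test; last exact: test1_lin.
rewrite (_ : (c *: _ + _ : X) = (fun x => c * eta x + chi x) :> (R -> R)); first exact: aeq_refl.
by rewrite -[in RHS](toL2_test te) -[in RHS](toL2_test tc).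
Qed.

Lemma wderivI phi (dphi : X) : (forall eta, test1 0 l eta ->
    dotp mI phi (toXI (derive1 eta)) = - dotp mI dphi (toXI eta)) -> wderiv phi dphi.
Proof. by move=> h eta te; have := h eta te; rewrite !toL2_test//; exact: test1_derive1. Qed.

Lemma wderiv_lin (c : R) phi dphi psi dpsi : wderiv phi dphi -> wderiv psi dpsi ->
  wderiv (c *: phi + psi : X) (c *: dphi + dpsi : X).
Proof.
move=> h1 h2; apply: wderivI => eta te.
by rewrite !dotpDl !dotpZl (wderivE h1 te) (wderivE h2 te); ring.
Qed.

Lemma derive1_lin (c : R) eta chi : smooth1 eta -> smooth1 chi ->
  derive1 (fun x => c * eta x + chi x) = (fun x => c * derive1 eta x + derive1 chi x).
Proof. by move=> se sc; exact: (derive1n_lin c se sc 1). Qed.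

Lemma nrm_linB (c : R) phi psi phi' psi' (e : R) : nrm (phi - phi') < e ->
  nrm (psi - psi') < e ->
  nrm ((c *: phi + psi : X) - (c *: phi' + psi') : X) < (`|c| + 1) * e.
Proof.
move=> h1 h2; have -> : (c *: phi + psi) - (c *: phi' + psi') =
    c *: (phi - phi') + (psi - psi') :> X.
  by rewrite scalerBr opprD addrACA.
apply: (le_lt_trans (nrmD _ _)); rewrite nrmZ mulrDl mul1r ler_ltD//.
by rewrite ler_wpM2l// ltW.
Qed.

Lemma H01_lin (c : R) phi dphi psi dpsi : in_H01 phi dphi -> in_H01 psi dpsi ->
  in_H01 (c *: phi + psi : X) (c *: dphi + dpsi : X).
Proof.
move=> /in_H01P[w1 h1] /in_H01P[w2 h2]; apply/in_H01P; split; first exact: wderiv_lin.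
move=> e e0; have c1 : 0 < `|c| + 1 by rewrite ltr_wpDl.
have ec : 0 < e / (`|c| + 1) by exact: divr_gt0.
have [eta te [p1 p2]] := h1 _ ec; have [chi tc [q1 q2]] := h2 _ ec.
have tde := test1_derive1 l_gt0 te; have tdc := test1_derive1 l_gt0 tc.
exists (fun x => c * eta x + chi x); first exact: test1_lin.
rewrite derive1_lin; [|exact: te.1|exact: tc.1].
have E (f g h : X) : aeq mI g h -> nrm (f - g) = nrm (f - h).
  move=> gh; apply: aeq_nrm; apply: aeqD; first exact: aeq_refl.
  by rewrite -(scaleN1r g) -(scaleN1r h); exact: aeqZ.
rewrite (E _ _ _ (toL2_lin c te tc)) (E _ _ _ (toL2_lin c tde tdc)).
have ee : (`|c| + 1) * (e / (`|c| + 1)) = e by rewrite mulrC divfK// gt_eqF.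
by rewrite -[e]ee; split; exact: nrm_linB.
Qed.

(** Integrate [0 <= (eta' - c eta cot (c x)) ^+ 2] with [c = pi / l]. *)
Lemma poincare_test eta : test1 0 l eta ->
  \int[leb]_(x in `]0, l[) (eta x ^+ 2) <=
    (l / pi) ^+ 2 * \int[leb]_(x in `]0, l[) (derive1 eta x ^+ 2).
Proof.
move=> te; have [se [a' [b' [aa' ab' bb' eta0]]]] := (test1P _ l_gt0).1 te.
pose c : R := pi / l.
have c0 : 0 < c by rewrite divr_gt0// pi_gt0.
have ce := smooth1_continuous se.
have cde := smooth1_continuous (smooth1_derive1 se).
(* [[a1, b1]] contains [[a', b']] in its interior and lies inside [(0, l)]: there [sin (c x)] is
   positive, and [eta] vanishes at both ends. *)
pose a1 := a' / 2; pose b1 := (b' + l) / 2.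
have sin0 x : a1 <= x <= b1 -> 0 < sin (c * x).
  rewrite /a1 /b1 => /andP[ax xb]; apply: sin_gt0_pi; rewrite mulr_gt0//=; last lra.
  by rewrite /c -[ltRHS]mulr1 mulrAC -mulrA ltr_pM2l ?pi_gt0// ltr_pdivrMr//; lra.
(* [eta^2] times the logarithmic derivative of [sin (c x)], the first Dirichlet eigenfunction; the
   derivative of [G] integrates to zero. *)
pose G x := eta x ^+ 2 * (c * cos (c * x) / sin (c * x)).
pose G' x := 2 * eta x * derive1 eta x * (c * cos (c * x) / sin (c * x))
   - (c * eta x) ^+ 2 / sin (c * x) ^+ 2.
have dG x : a1 <= x <= b1 -> is_derive x (1 : R) G (G' x).
  move=> /sin0 sx; have := smooth1_is_derive x se => ?.
  have sn0 : sin (c * x) != 0 by rewrite gt_eqF.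
  have ds : is_derive x (1 : R) (fun x => (sin (c * x))^-1)
      (- (sin (c * x)) ^- 2 *: (c * cos (c * x))).
    apply: is_deriveV => //; apply: is_derive_eq.
    by rewrite /GRing.scale/=; ring.
  apply: is_derive_eq; rewrite /G' /GRing.scale/=.
  have := cos2Dsin2 (c * x); set s := sin _; set k := cos _ => sk.
  apply/eqP; rewrite -subr_eq0.
  rewrite (_ : _ - _ = - (c * eta x) ^+ 2 / s ^+ 2 * (k ^+ 2 + s ^+ 2 - 1)).
    by rewrite sk subrr mulr0.
  by field.
have cs x : {for x, continuous (fun x : R => sin (c * x))}.
  by apply: continuous_comp; [exact: mulrl_continuous|exact: continuous_sin].
have ck x : {for x, continuous (fun x : R => cos (c * x))}.
  by apply: continuous_comp; [exact: mulrl_continuous|exact: continuous_cos].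
have cG' x : a1 <= x <= b1 -> {for x, continuous G'}.
  move=> /sin0 sx; have sn0 : sin (c * x) != 0 by rewrite gt_eqF.
  apply: cvgB.
    apply: cvgM; first by apply: cvgM; [apply: cvgM; [exact: cvg_cst|exact: ce]|exact: cde].
    apply: cvgM; first by apply: cvgM; [exact: cvg_cst|exact: ck].
    by apply: cvgV => //; exact: cs.
  apply: cvgM; first by rewrite /= expr2; apply: cvgM; apply: cvgM; by [exact: cvg_cst|exact: ce].
  by apply: cvgV; [rewrite expf_neq0|rewrite /= expr2; apply: cvgM; exact: cs].
have ab1 : a1 <= b1 by rewrite /a1 /b1; lra.
have IG : \int[leb]_(x in `]a1, b1[) G' x = 0.
  rewrite (@Rintegral_derive _ G)//.
    rewrite /G !eta0 ?expr0n/= ?mul0r ?subrr//; [left|right]; rewrite /a1 /b1; lra.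
  by move=> x xab; split; [exact: dG|exact: cG'].
pose H x := derive1 eta x ^+ 2 - c ^+ 2 * eta x ^+ 2.
have cH : continuous H.
  move=> x; apply: cvgB; first by rewrite /= expr2; apply: cvgM; exact: cde.
  by apply: cvgM; [exact: cvg_cst|rewrite /= expr2; apply: cvgM; exact: ce].
have H0 : 0 <= \int[leb]_(x in `]a1, b1[) H x.
  rewrite -IG; apply: le_Rintegral => //.
  - apply: within_continuous_integrable; apply: continuous_in_subspaceT => x.
    by move=> /set_mem; rewrite /= in_itv/=; exact: cG'.
  - exact: continuous_oo_integrable.
  move=> x; rewrite /= in_itv/= => /andP[ax xb].
  have sx : 0 < sin (c * x) by apply: sin0; rewrite !ltW.
  rewrite -subr_ge0.
  suff -> : H x - G' x = (derive1 eta x - c * eta x * cos (c * x) / sin (c * x)) ^+ 2.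
    exact: sqr_ge0.
  rewrite /H /G'; have := cos2Dsin2 (c * x); set s := sin _; set k := cos _ => sk.
  have sn0 : s != 0 by rewrite gt_eqF.
  apply/eqP; rewrite -subr_eq0.
  rewrite (_ : _ - _ = - (c * eta x) ^+ 2 / s ^+ 2 * (k ^+ 2 + s ^+ 2 - 1)).
    by rewrite sk subrr mulr0.
  by field.
have d0 x : x < a' \/ b' < x -> derive1 eta x = 0.
  move=> xab; rewrite derive1E (@near_eq_derive _ _ _ eta (cst 0)); first by rewrite derive_cst.
  case: xab => xab.
    by near=> y; rewrite eta0//; left; near: y; exact: lt_nbhsl.
  by near=> y; rewrite eta0//; right; near: y; exact: lt_nbhsr.
have : 0 <= \int[leb]_(x in `]0, l[) H x.
  rewrite (@Rintegral_supp _ 0 l a1 b1)//; [by rewrite /a1; lra|by rewrite /b1; lra|exact: continuous_oo_integrable|].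
  move=> x xab; rewrite /H d0 ?eta0 ?expr0n/= ?mulr0 ?subrr//;
    case: xab => h; [left|right|left|right]; move: h; rewrite /a1 /b1; lra.
have csq (h : R -> R) x : continuous h -> {for x, continuous (fun x => h x ^+ 2)}.
  by move=> ch; apply: cvgM; exact: ch.
have i1 : leb.-integrable `]0, l[ (EFin \o (fun x => derive1 eta x ^+ 2)).
  by apply: continuous_oo_integrable => x; exact: csq.
have i2 : leb.-integrable `]0, l[ (EFin \o (fun x => eta x ^+ 2)).
  by apply: continuous_oo_integrable => x; exact: csq.
rewrite RintegralB//; last exact: integrable_RZl.
rewrite (@RintegralZl _ _ _ leb _ (fun x => eta x ^+ 2) (c ^+ 2) _ i2)// subr_ge0 => h.
rewrite -ler_pdivrMl; last by rewrite exprn_gt0// divr_gt0// pi_gt0.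
by rewrite -exprVn invf_div.
Unshelve. all: by end_near. Qed.

Lemma poincare phi dphi : in_H01 phi dphi -> nrm phi <= l / pi * nrm dphi.
Proof.
have lp : 0 <= l / pi by rewrite divr_ge0 ?pi_ge0 ?ltW.
have pt eta : test1 0 l eta -> nrm (toXI eta : X) <= l / pi * nrm (toXI (derive1 eta) : X).
  move=> te; have tde := test1_derive1 l_gt0 te.
  rewrite -(@ler_pXn2r _ 2)// ?nnegrE ?nrm_ge0 ?(mulr_ge0 lp) ?nrm_ge0//.
  rewrite exprMn !nrm_sqr !toL2_test// !dotp_muI; try exact: test_measurable.
  exact: poincare_test.
move=> /in_H01P[_ h]; apply/ler_addgt0Pr => e e0.
pose e' := e / (1 + l / pi).
have lp1 : 0 < 1 + l / pi by rewrite ltr_wpDr.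
have [eta te [h1 h2]] := h e' (divr_gt0 e0 lp1).
have := nrm_le_dist phi (toXI eta : X).
have := nrm_le_dist (toXI (derive1 eta) : X) dphi; rewrite nrmBC.
have := pt _ te.
have ee : e = (1 + l / pi) * e' by rewrite mulrC divfK// gt_eqF.
rewrite ee; move: h1 h2 lp; clear; move: (l / pi) => q; nra.
Qed.

End H01.

(** * Semigroups *)

Section one_sided_calculus.
Context {R : realType}.
Notation leb := (@lebesgue_measure R).
Implicit Types (a b t c : R) (F G : R -> R).

(** Derivative relative to [[a, b]], hence one-sided at the end points, as it must be for orbits of
    a semigroup at time [0]. *)
Definition deriv_in a b F t c : Prop := forall e : R, 0 < e ->
  exists2 del : R, 0 < del & forall s, a <= s <= b -> `|s - t| < del ->
    `|F s - F t - (s - t) * c| <= e * `|s - t|.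

Lemma deriv_inN a b F t c : deriv_in a b F t c -> deriv_in a b (fun s => - F s) t (- c).
Proof.
move=> h e e0; have [del d0 hd] := h e e0; exists del => // s sab st.
rewrite mulrN -!opprD normrN; exact: hd.
Qed.

Lemma deriv_inD a b F G t c c' : deriv_in a b F t c -> deriv_in a b G t c' ->
  deriv_in a b (fun s => F s + G s) t (c + c').
Proof.
move=> h h' e e0; have e2 : 0 < e / 2 by rewrite divr_gt0.
have [d1 d10 hd1] := h _ e2; have [d2 d20 hd2] := h' _ e2.
exists (Num.min d1 d2); first by rewrite lt_min d10.
move=> s sab; rewrite lt_min => /andP[s1 s2].
have := hd1 s sab s1; have := hd2 s sab s2 => H1 H2.
rewrite (_ : _ - _ - _ = (F s - F t - (s - t) * c) + (G s - G t - (s - t) * c')); last by ring.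
by apply: (le_trans (ler_normD _ _)); move: H1 H2; clear; lra.
Qed.

(** Cousin's lemma with [L = id]: near a tag an increment exceeds [c] times the length of the
    interval by at most [e] times that length. *)
Lemma deriv_in_le a b F : a <= b ->
  (forall t, a <= t <= b -> exists2 c, c <= 0 & deriv_in a b F t c) -> F b <= F a.
Proof.
move=> ab h; apply: (@cousin R a b F id ab) => e t e0 /[dup] tab /h[c c0 /(_ e e0)[del d0 hd]].
exists del => // s s' /andP[as_ st] /andP[ts' s'b] h1 h2.
have H1 := hd s _ _; have H2 := hd s' _ _.
move: tab => /andP[at_ tb].
have e1 : `|s - t| = t - s by rewrite distrC ger0_norm ?subr_ge0.
have e2 : `|s' - t| = s' - t by rewrite ger0_norm ?subr_ge0.
have {}H1 : `|F s - F t - (s - t) * c| <= e * (t - s).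
  by move: H1; rewrite e1; apply; [rewrite as_ (le_trans st)|move: h1; clear; lra].
have {}H2 : `|F s' - F t - (s' - t) * c| <= e * (s' - t).
  by move: H2; rewrite e2; apply; [rewrite s'b (le_trans at_)|move: h2; clear; lra].
move: H1 H2; rewrite !ler_norml => /andP[H1 _] /andP[_ H2].
have : (s' - s) * c <= 0 by rewrite mulr_ge0_le0// subr_ge0 (le_trans st).
by rewrite /=; move: H1 H2; clear; nra.
Qed.

Lemma deriv_in_eq a b F : a <= b ->
  (forall t, a <= t <= b -> deriv_in a b F t 0) -> F b = F a.
Proof.
move=> ab h; apply/eqP; rewrite eq_le; apply/andP; split.
  by apply: deriv_in_le => // t /h; exists 0.
rewrite -lerN2; apply: (@deriv_in_le a b (fun s => - F s)) => // t /h/deriv_inN.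
by rewrite oppr0; exists 0.
Qed.

Lemma deriv_inM a b F G t c c' : deriv_in a b F t c -> deriv_in a b G t c' ->
  deriv_in a b (fun s => F s * G s) t (c * G t + F t * c').
Proof.
move=> h h' e e0.
pose B := `|c| + `|c'| + `|F t| + `|G t| + 2.
have B1 : 1 <= B.
  by rewrite /B; have := normr_ge0 c; have := normr_ge0 c'; have := normr_ge0 (F t);
    have := normr_ge0 (G t); lra.
have B0 : 0 < B by apply: lt_le_trans B1.
have e2 : 0 < e / (3 * B) by rewrite divr_gt0// mulr_gt0.
have [d1 d10 hd1] := h _ e2; have [d2 d20 hd2] := h' _ e2.
have [d3 d30 hd3] := h' 1 ltr01.
pose d4 := Num.min 1 (e / (3 * B)) / B.
have d40 : 0 < d4 by rewrite divr_gt0// lt_min ltr01 divr_gt0// ?mulr_gt0.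
exists (Num.min (Num.min d1 d2) (Num.min d3 d4)); first by rewrite !lt_min d10 d20 d30.
move=> s sab; rewrite !lt_min => /andP[/andP[s1 s2] /andP[s3 s4]].
have H1 := hd1 s sab s1; have H2 := hd2 s sab s2; have H3 := hd3 s sab s3.
set k := `|s - t| in s4 H1 H2 H3 *.
have k0 : 0 <= k by exact: normr_ge0.
have GB : `|G s - G t| <= B * k.
  rewrite (_ : G s - G t = (G s - G t - (s - t) * c') + (s - t) * c'); last by ring.
  apply: (le_trans (ler_normD _ _)); rewrite normrM -/k.
  apply: (le_trans (lerD H3 (lexx _))).
  rewrite mul1r [_ * `|c'|]mulrC -[X in X + _]mul1r -mulrDl ler_wpM2r// /B.
  by have := normr_ge0 c; have := normr_ge0 (F t); have := normr_ge0 (G t); lra.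
have kB : B * k <= Num.min 1 (e / (3 * B)).
  by rewrite mulrC -ler_pdivlMr// ltW.
have [kB1 kB2] : B * k <= 1 /\ B * k <= e / (3 * B).
  by move: kB; rewrite le_min => /andP[].
have Gs : `|G s| <= B.
  rewrite (_ : G s = G t + (G s - G t)); last by ring.
  apply: (le_trans (ler_normD _ _)); apply: (le_trans (lerD (lexx _) (le_trans GB kB1))).
  by rewrite /B; have := normr_ge0 c; have := normr_ge0 c'; have := normr_ge0 (F t); lra.
rewrite (_ : _ - _ - _ = (F s - F t - (s - t) * c) * G s + (s - t) * (c * (G s - G t))
  + F t * (G s - G t - (s - t) * c')); last by ring.
have three : e * k = (e / (3 * B) * k) * B + k * (B * (e / (3 * B))) + B * (e / (3 * B) * k).
  by field; rewrite gt_eqF.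
rewrite three; apply: (le_trans (ler_normD _ _)); apply: lerD; last first.
  rewrite normrM ler_pM// /B.
  by have := normr_ge0 c; have := normr_ge0 c'; have := normr_ge0 (G t); lra.
apply: (le_trans (ler_normD _ _)); apply: lerD; first by rewrite normrM ler_pM.
rewrite normrM ler_wpM2l// normrM ler_pM//; last exact: le_trans kB2.
by rewrite /B; have := normr_ge0 (F t); have := normr_ge0 c'; have := normr_ge0 (G t); lra.
Qed.

Lemma deriv_in_is_derive a b F t c : is_derive t (1 : R) F c -> deriv_in a b F t c.
Proof.
move=> dF e e0; have dd : derivable F t 1 by exact: ex_derive.
have : h^-1 *: (F (h *: 1 + t) - F t) @[h --> 0^'] --> c.
  by rewrite -(@derive_val _ _ _ _ _ _ _ dF); exact: dd.
move=> /cvgrPdist_le/(_ e e0); rewrite near_withinE.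
move=> /nbhs_ballP[del /= d0 hd]; exists del => // s _ st.
have [->|stn] := eqVneq s t; first by rewrite !subrr mul0r subrr !normr0 mulr0.
have st0 : s - t != 0 by rewrite subr_eq0.
have := hd (s - t); rewrite /ball/= sub0r normrN => /(_ st st0).
rewrite /GRing.scale/= mulr1 subrK => H.
rewrite (_ : F s - F t - (s - t) * c = - ((c - (s - t)^-1 * (F s - F t)) * (s - t))); last by field.
by rewrite normrN normrM ler_wpM2r.
Qed.

Lemma deriv_in_primitive a b t (f : R -> R) : a <= t <= b ->
  (forall t e, a <= t <= b -> 0 < e -> exists2 del : R, 0 < del &
    forall s, a <= s <= b -> `|s - t| < del -> `|f s - f t| <= e) ->
  deriv_in a b (fun s => \int[leb]_(r in `]a, s[) f r) t (f t).
Proof.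
move=> tab cf e e0; have [del d0 hd] := cf t e tab e0; exists del => //.
have fi := eps_continuous_integrable cf.
move: tab => /andP[at_ tb].
have key x y : a <= x -> x <= y -> y <= b -> (forall r, x <= r <= y -> `|r - t| < del) ->
    `|\int[leb]_(r in `]x, y[) f r - (y - x) * f t| <= e * (y - x).
  move=> ax xy yb h.
  have ixy := integrable_oo_sub ax yb fi.
  have ic := integrable_oo_cst x y (f t).
  rewrite [_ * f t]mulrC -(@Rintegral_oo_cst R x y (f t))// -RintegralB//.
  apply: le_trans (le_normr_Rintegral _ _) _ => //.
    exact: integrable_RB.
  rewrite -Rintegral_oo_cst//; apply: le_Rintegral => //.
  - apply: (@integrable_Rle _ _ _ leb _ _ (fun=> e)) => //.
    + apply: measurableT_comp => //; apply: measurable_funB => //.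
      exact: integrable_measurable_fun ixy.
    + move=> r; rewrite /= in_itv/= => /andP[xr ry]; rewrite normr_id.
      by apply: hd; [rewrite (le_trans ax (ltW xr)) (le_trans (ltW ry) yb)|apply: h; rewrite !ltW].
    + exact: integrable_oo_cst.
  - exact: integrable_oo_cst.
  move=> r; rewrite /= in_itv/= => /andP[xr ry].
  by apply: hd; [rewrite (le_trans ax (ltW xr)) (le_trans (ltW ry) yb)|apply: h; rewrite !ltW].
move=> s /andP[as_ sb]; rewrite ltr_norml => /andP[s1 s2].
have [st|ts] := leP s t.
  rewrite -normrN (_ : - _ = (\int[leb]_(r in `]a, t[) f r - \int[leb]_(r in `]a, s[) f r)
    - (t - s) * f t); last by ring.
  rewrite -(@primitive_sub R f a b)// [in leRHS]distrC [in leRHS]ger0_norm ?subr_ge0//.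
  apply: key => // r /andP[h1 h2]; rewrite ltr_norml; move: s1 h1 h2 d0; clear; lra.
rewrite -(@primitive_sub R f a b)//; last exact: ltW.
rewrite [in leRHS]ger0_norm ?subr_ge0 ?(ltW ts)//.
apply: key => //; first exact: ltW.
by move=> r /andP[h1 h2]; rewrite ltr_norml; move: s2 h1 h2 d0; clear; lra.
Qed.

Lemma deriv_in_FTC a b F (f : R -> R) : a <= b ->
  (forall t e, a <= t <= b -> 0 < e -> exists2 del : R, 0 < del &
    forall s, a <= s <= b -> `|s - t| < del -> `|f s - f t| <= e) ->
  (forall t, a <= t <= b -> deriv_in a b F t (f t)) ->
  F b - F a = \int[leb]_(r in `]a, b[) f r.
Proof.
move=> ab cf dF.
have := @deriv_in_eq a b (fun s => F s + - \int[leb]_(r in `]a, s[) f r) ab.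
rewrite (@oo0 _ a a)// Rintegral_set0 subr0 => <-; first by ring.
move=> t tab; rewrite -(subrr (f t)); apply: deriv_inD; first exact: dF.
by apply: deriv_inN; exact: deriv_in_primitive.
Qed.

End one_sided_calculus.

(** * Orbits of a semigroup on [L^2] *)

Section semigroup.
Context {dT : measure_display} {T : measurableType dT} {R : realType}.
Context {mu : {measure set T -> \bar R}}.
Implicit Types (f g : L2 mu) (F G : R -> L2 mu) (a b t : R).

Lemma aeqN f g : aeq mu f g -> aeq mu (- f : L2 mu) (- g : L2 mu).
Proof. by move=> fg; rewrite -(scaleN1r f) -(scaleN1r g); exact: aeqZ. Qed.

Lemma aeqB f f' g g' : aeq mu f f' -> aeq mu g g' ->
  aeq mu (f - g : L2 mu) (f' - g' : L2 mu).
Proof. by move=> h1 h2; apply: aeqD => //; exact: aeqN. Qed.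

Lemma aeq_dotpr f g (h : L2 mu) : aeq mu f g -> dotp mu h f = dotp mu h g.
Proof. by move=> fg; rewrite dotpC (aeq_dotp _ fg) dotpC. Qed.

Lemma cvg_at_right0 (u : R -> R) (e : R) : u h @[h --> 0^'+] --> (0 : R) -> 0 < e ->
  exists2 del : R, 0 < del & forall h, 0 < h < del -> `|u h| <= e.
Proof.
move=> /cvgrPdist_le h e0; have := h e e0; rewrite near_withinE => /nbhs_ballP[del /= d0 hd].
exists del => // k /andP[k0 kd]; have := hd k; rewrite /ball/= !sub0r !normrN.
by rewrite (gtr0_norm k0); apply.
Qed.

Lemma at_right0_cvg (u : R -> R) : (forall e : R, 0 < e ->
  exists2 del : R, 0 < del & forall h, 0 < h < del -> `|u h| <= e) ->
  u h @[h --> 0^'+] --> (0 : R).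
Proof.
move=> h; apply/cvgrPdist_le => e e0; have [del d0 hd] := h e e0.
rewrite near_withinE; apply/nbhs_ballP; exists del => // k; rewrite /ball/= sub0r normrN => kd k0.
by rewrite sub0r normrN; apply: hd; rewrite k0 -(gtr0_norm k0).
Qed.

Definition vderiv_in a b F t f : Prop := forall e : R, 0 < e ->
  exists2 del : R, 0 < del & forall s, a <= s <= b -> `|s - t| < del ->
    nrm (F s - F t - (s - t) *: f) <= e * `|s - t|.

Definition vcont_in a b F t : Prop := forall e : R, 0 < e ->
  exists2 del : R, 0 < del & forall s, a <= s <= b -> `|s - t| < del ->
    nrm (F s - F t) <= e.

Lemma vderiv_in_dotp a b F G t f g : vderiv_in a b F t f -> vderiv_in a b G t g ->
  deriv_in a b (fun s => dotp mu (F s) (G s)) t (dotp mu f (G t) + dotp mu (F t) g).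
Proof.
move=> hF hG e e0.
pose B := nrm f + nrm g + nrm (F t) + nrm (G t) + 2.
have [f0 g0 F0 G0] : [/\ 0 <= nrm f, 0 <= nrm g, 0 <= nrm (F t) & 0 <= nrm (G t)].
  by split; exact: nrm_ge0.
have B0 : 0 < B by rewrite /B; lra.
have e2 : 0 < e / (3 * B) by rewrite divr_gt0// mulr_gt0.
have [d1 d10 hd1] := hF _ e2; have [d2 d20 hd2] := hG _ e2.
have [d3 d30 hd3] := hG 1 ltr01.
pose d4 := Num.min 1 (e / (3 * B)) / B.
have d40 : 0 < d4 by rewrite divr_gt0// lt_min ltr01.
exists (Num.min (Num.min d1 d2) (Num.min d3 d4)); first by rewrite !lt_min d10 d20 d30.
move=> s sab; rewrite !lt_min => /andP[/andP[s1 s2] /andP[s3 s4]].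
have H1 := hd1 s sab s1; have H2 := hd2 s sab s2; have H3 := hd3 s sab s3.
set k := `|s - t| in s4 H1 H2 H3 *.
have k0 : 0 <= k by exact: normr_ge0.
have GB : nrm (G s - G t) <= B * k.
  rewrite (_ : G s - G t = (G s - G t - (s - t) *: g) + (s - t) *: g); last by rewrite subrK.
  apply: (le_trans (nrmD _ _)); rewrite nrmZ -/k.
  apply: (le_trans (lerD H3 (lexx _))).
  by rewrite mul1r [_ * nrm g]mulrC -[X in X + _]mul1r -mulrDl ler_wpM2r// /B; lra.
have kB : B * k <= Num.min 1 (e / (3 * B)) by rewrite mulrC -ler_pdivlMr// ltW.
have [kB1 kB2] : B * k <= 1 /\ B * k <= e / (3 * B) by move: kB; rewrite le_min => /andP[].
have Gs : nrm (G s) <= B.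
  apply: (le_trans (nrm_le_dist (G s) (G t))).
  by apply: (le_trans (lerD (lexx _) (le_trans GB kB1))); rewrite /B; lra.
rewrite (_ : _ - _ - _ = dotp mu (F s - F t - (s - t) *: f) (G s)
  + (s - t) * dotp mu f (G s - G t) + dotp mu (F t) (G s - G t - (s - t) *: g)); last first.
  by rewrite !dotpBl !dotpBr !dotpZl !dotpZr; ring.
have three : e * k = (e / (3 * B) * k) * B + k * (B * (e / (3 * B))) + B * (e / (3 * B) * k).
  by field; rewrite gt_eqF.
rewrite three; apply: (le_trans (ler_normD _ _)); apply: lerD; last first.
  apply: (le_trans (cauchy_schwarz _ _)); apply: ler_pM; rewrite ?nrm_ge0//.
  by rewrite /B; lra.
apply: (le_trans (ler_normD _ _)); apply: lerD.
  by apply: (le_trans (cauchy_schwarz _ _)); apply: ler_pM; rewrite ?nrm_ge0.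
rewrite normrM ler_wpM2l//.
apply: (le_trans (cauchy_schwarz _ _)); apply: ler_pM; rewrite ?nrm_ge0//.
  by rewrite /B; lra.
exact: le_trans kB2.
Qed.

Lemma vcont_in_dotp a b F G t e : vcont_in a b F t -> vcont_in a b G t -> 0 < e ->
  exists2 del : R, 0 < del & forall s, a <= s <= b -> `|s - t| < del ->
    `|dotp mu (F s) (G s) - dotp mu (F t) (G t)| <= e.
Proof.
move=> hF hG e0.
pose B := nrm (F t) + nrm (G t) + 2.
have [F0 G0] : 0 <= nrm (F t) /\ 0 <= nrm (G t) by split; exact: nrm_ge0.
have B0 : 0 < B by rewrite /B; lra.
pose e' := Num.min 1 (e / (2 * B)).
have e'0 : 0 < e' by rewrite lt_min ltr01 divr_gt0// mulr_gt0.
have [d1 d10 hd1] := hF _ e'0; have [d2 d20 hd2] := hG _ e'0.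
exists (Num.min d1 d2); first by rewrite lt_min d10.
move=> s sab; rewrite lt_min => /andP[s1 s2].
have H1 := hd1 s sab s1; have H2 := hd2 s sab s2.
have [e1 e2] : e' <= 1 /\ e' <= e / (2 * B) by rewrite /e' ge_min lexx ge_min lexx orbT.
have Gs : nrm (G s) <= B.
  apply: (le_trans (nrm_le_dist (G s) (G t))).
  by apply: (le_trans (lerD (lexx _) (le_trans H2 e1))); rewrite /B; lra.
rewrite (_ : _ - _ = dotp mu (F s - F t) (G s) + dotp mu (F t) (G s - G t)); last first.
  by rewrite dotpBl dotpBr; ring.
have -> : e = e / (2 * B) * B + B * (e / (2 * B)) by field; rewrite gt_eqF.
apply: (le_trans (ler_normD _ _)); apply: lerD; apply: (le_trans (cauchy_schwarz _ _));
  apply: ler_pM; rewrite ?nrm_ge0//; [exact: le_trans e2|by rewrite /B; lra|exact: le_trans e2].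
Qed.

Variables (A : L2 mu -> L2 mu -> Prop) (S : R -> L2 mu -> L2 mu).
Hypothesis S_gen : is_semigroup setT A S.

Lemma sg_lin (t c : R) f g : 0 <= t ->
  aeq mu (S t (c *: f + g)) (c *: S t f + S t g : L2 mu).
Proof. by move=> t0; have [/(_ t t0)[_ [h _]] _ _ _] := S_gen; exact: h. Qed.

Lemma sg_bounded t : 0 <= t -> exists2 C : R, 0 < C & forall f, nrm (S t f) <= C * nrm f.
Proof.
move=> t0; have [/(_ t t0)[_ [_ [C h]]] _ _ _] := S_gen.
exists (`|C| + 1) => [|f]; first by rewrite ltr_wpDl.
apply: (le_trans (h f I)); rewrite ler_wpM2r ?nrm_ge0//.
by rewrite (le_trans (ler_norm _))// lerDl.
Qed.

Lemma sg_subr t f g : 0 <= t -> aeq mu (S t (f - g)) (S t f - S t g : L2 mu).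
Proof.
move=> t0; have := @sg_lin t (-1) g f t0.
by rewrite !scaleN1r [- g + f]addrC [- S t g + _]addrC.
Qed.

Lemma nrm_sg_sub t f g : 0 <= t -> nrm (S t f - S t g) = nrm (S t (f - g)).
Proof. by move=> t0; rewrite -(aeq_nrm (sg_subr _ _ t0)). Qed.

Lemma sg_congr t f g : 0 <= t -> aeq mu f g -> aeq mu (S t f) (S t g).
Proof.
move=> t0 /aeq_nrmB0 fg; apply/aeq_nrmB0; rewrite nrm_sg_sub//.
have [C C0 /(_ (f - g))] := sg_bounded t0; rewrite fg mulr0 => h.
by apply/eqP; rewrite eq_le h nrm_ge0.
Qed.

Lemma sg0 f : aeq mu (S 0 f) f.
Proof. by have [_ /(_ f I)[]] := S_gen. Qed.

Lemma sg_add (s t : R) f : 0 <= s -> 0 <= t -> aeq mu (S (s + t) f) (S s (S t f)).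
Proof. by have [_ /(_ f I)[_ h] _ _] := S_gen => s0 t0; exact: h. Qed.

Lemma sg_split (s t : R) f : 0 <= s -> s <= t -> aeq mu (S t f) (S s (S (t - s) f)).
Proof. by move=> s0 st; rewrite -{1}(subrKC s t); apply: sg_add => //; rewrite subr_ge0. Qed.

Lemma sg_Z t c f : 0 <= t -> aeq mu (S t (c *: f)) (c *: S t f : L2 mu).
Proof.
move=> t0; have h0 : aeq mu (S t 0) (0 : L2 mu).
  by apply/aeq_nrmB0; rewrite subr0; have [C _ /(_ 0)] := sg_bounded t0;
    rewrite nrm0 mulr0 => h; apply/eqP; rewrite eq_le h nrm_ge0.
rewrite -[c *: f]addr0; apply: (aeq_trans (sg_lin _ _ _ t0)).
by apply: (aeq_trans (aeqD (aeq_refl _) h0)); rewrite addr0; exact: aeq_refl.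
Qed.

Lemma gen_right f g (e : R) : A f g -> 0 < e -> exists2 del : R, 0 < del &
  forall h, 0 < h < del -> nrm (S h f - f - h *: g) <= e * h.
Proof.
move=> Afg e0; have [_ _ _ /(_ f g I I)[/(_ Afg) /cvg_at_right0/(_ e0)[del d0 hd] _]] := S_gen.
exists del => // h /[dup] hh /andP[h0 _]; have := hd h hh.
rewrite ger0_norm ?nrm_ge0// => H.
rewrite (_ : S h f - f - h *: g = h *: (h^-1 *: (S h f - f) - g)); last first.
  by rewrite scalerBr scalerA divff ?scale1r// gt_eqF.
by rewrite nrmZ gtr0_norm// mulrC ler_wpM2r// ltW.
Qed.

(** [S t] is bounded and commutes with the difference quotients of the orbit, so it carries their
    limit along. *)
Lemma gen_sg f g t : 0 <= t -> A f g -> A (S t f) (S t g).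
Proof.
move=> t0; have [_ _ _ h] := S_gen; move=> /(h f g I I) c; apply/(h _ _ I I).
have [C C0 hC] := sg_bounded t0.
apply: at_right0_cvg => e e0; have [del d0 hd] := cvg_at_right0 c (divr_gt0 e0 C0).
exists del => // k /[dup] hk /andP[k0 _]; have := hd k hk.
rewrite !ger0_norm ?nrm_ge0// => H.
suff -> : nrm (k^-1 *: (S k (S t f) - S t f) - S t g) =
    nrm (S t (k^-1 *: (S k f - f) - g)).
  by apply: (le_trans (hC _)); rewrite mulrC -ler_pdivlMr.
apply: aeq_nrm; apply: aeq_sym.
apply: (aeq_trans (sg_subr _ _ t0)); apply: aeqB; last exact: aeq_refl.
apply: (aeq_trans (sg_Z _ _ t0)); apply: aeqZ.
apply: (aeq_trans (sg_subr _ _ t0)); apply: aeqB; last exact: aeq_refl.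
have k0' := ltW k0.
apply: (aeq_trans (aeq_sym (sg_add f t0 k0'))); rewrite addrC; exact: sg_add.
Qed.

Hypothesis S_bounded : forall a b, 0 < a -> exists2 C : R, 0 < C &
  forall t f, a <= t <= b -> nrm (S t f) <= C * nrm f.

(** Right continuity only uses the bound of the single operator [S t]. On the left the increment is
    factored through the varying [S s], which takes uniform bounds near [t > 0]; [S_bounded] is
    stated away from [0] because that is where the smoothing estimate provides them. *)
Lemma sg_vcont (b t : R) f : 0 <= t -> vcont_in 0 b (S ^~ f) t.
Proof.
move=> t0 e e0; have [_ _ /(_ f I) c0 _] := S_gen.
have [C C0 hC] := sg_bounded t0.
have [d1 d10 hd1] := cvg_at_right0 c0 (divr_gt0 e0 C0).
have right s : t < s -> s - t < d1 -> nrm (S s f - S t f) <= e.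
  move=> ts sd.
  have st0 : 0 <= s - t by rewrite subr_ge0 ltW.
  have -> : nrm (S s f - S t f) = nrm (S t (S (s - t) f - f)).
    rewrite -(nrm_sg_sub _ _ t0); apply: aeq_nrm; apply: aeqB; last exact: aeq_refl.
    by apply: sg_split => //; exact: ltW.
  apply: (le_trans (hC _)); rewrite mulrC -ler_pdivlMr//.
  by rewrite -[leLHS]ger0_norm ?nrm_ge0// hd1// subr_gt0 ts.
have [t_eq0|tn0] := eqVneq t 0.
  exists d1 => // s /andP[s0 _]; rewrite t_eq0 subr0 ger0_norm// => sd.
  have [->|sn0] := eqVneq s 0; first by rewrite subrr nrm0 ltW.
  by have := right s; rewrite t_eq0 subr0; apply => //; rewrite lt_neqAle eq_sym sn0.
have tgt0 : 0 < t by rewrite lt_neqAle eq_sym tn0.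
have t2 : 0 < t / 2 by rewrite divr_gt0.
have [C' C'0 hC'] := @S_bounded (t / 2) t t2.
have [d2 d20 hd2] := cvg_at_right0 c0 (divr_gt0 e0 C'0).
exists (Num.min (Num.min d1 d2) (t / 2)).
  by rewrite !lt_min d10 d20 divr_gt0.
move=> s _; rewrite !lt_min => /andP[/andP[s1 s2] s3].
have [ts|st|->] := ltgtP t s; last by rewrite subrr nrm0 ltW.
  by apply: right => //; apply: le_lt_trans s1; exact: ler_norm.
move: s2 s3; rewrite distrC gtr0_norm ?subr_gt0// => s2 s3.
have s0 : 0 <= s by lra.
have -> : nrm (S s f - S t f) = nrm (S s (S (t - s) f - f)).
  rewrite nrmBC -(nrm_sg_sub _ _ s0); apply: aeq_nrm; apply: aeqB; last exact: aeq_refl.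
  by apply: sg_split => //; exact: ltW.
apply: (le_trans (hC' _ _ _)); first by apply/andP; split; lra.
rewrite mulrC -ler_pdivlMr//.
by rewrite -[leLHS]ger0_norm ?nrm_ge0// hd2// subr_gt0 st.
Qed.

(** The generator gives the right derivative at [0], transported by [S t]. For the left derivative
    the increment is factored through [S s], and [S s g] is then replaced by [S t g] by
    continuity. *)
Lemma sg_vderiv (b t : R) f g : 0 <= t -> A f g -> vderiv_in 0 b (S ^~ f) t (S t g).
Proof.
move=> t0 Afg e e0.
have [C C0 hC] := sg_bounded t0.
have [d1 d10 hd1] := gen_right Afg (divr_gt0 e0 C0).
have right s : t < s -> s - t < d1 -> nrm (S s f - S t f - (s - t) *: S t g) <= e * `|s - t|.
  move=> ts sd.
  have st0 : 0 <= s - t by rewrite subr_ge0 ltW.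
  have -> : nrm (S s f - S t f - (s - t) *: S t g) =
      nrm (S t (S (s - t) f - f - (s - t) *: g)).
    apply: aeq_nrm; apply: aeq_sym.
    apply: (aeq_trans (sg_subr _ _ t0)); apply: aeqB; last exact: sg_Z.
    apply: (aeq_trans (sg_subr _ _ t0)); apply: aeqB; last exact: aeq_refl.
    by apply: aeq_sym; apply: sg_split => //; exact: ltW.
  apply: (le_trans (hC _)); rewrite mulrC -ler_pdivlMr// mulrAC ger0_norm//.
  by rewrite hd1// subr_gt0 ts.
have [t_eq0|tn0] := eqVneq t 0.
  exists d1 => // s /andP[s0 _]; rewrite t_eq0 subr0 ger0_norm// => sd.
  have [->|sn0] := eqVneq s 0.
    by rewrite !(subrr, scale0r) nrm0 mulr0.
  have := right s; rewrite t_eq0 subr0 ger0_norm//; apply => //.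
  by rewrite lt_neqAle eq_sym sn0.
have tgt0 : 0 < t by rewrite lt_neqAle eq_sym tn0.
have t2 : 0 < t / 2 by rewrite divr_gt0.
have [C' C'0 hC'] := @S_bounded (t / 2) t t2.
have e2 : 0 < e / 2 by rewrite divr_gt0.
have [d2 d20 hd2] := gen_right Afg (divr_gt0 e2 C'0).
have [d3 d30 hd3] := @sg_vcont t t g t0 _ e2.
exists (Num.min (Num.min d1 d2) (Num.min d3 (t / 2))).
  by rewrite !lt_min d10 d20 d30 divr_gt0.
move=> s _; rewrite !lt_min => /andP[/andP[s1 s2] /andP[s3 s4]].
have [ts|st|->] := ltgtP t s; last by rewrite !(subrr, scale0r) nrm0 normr0 mulr0.
  by apply: right => //; apply: le_lt_trans s1; exact: ler_norm.
have ats : `|s - t| = t - s by rewrite distrC gtr0_norm ?subr_gt0.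
rewrite ats; move: s2 s4; rewrite ats => s2 s4.
have s0 : 0 <= s by lra.
have H3 : nrm (S s g - S t g) <= e / 2 by apply: hd3 => //; rewrite s0 ltW.
have -> : S s f - S t f - (s - t) *: S t g =
    - (S t f - S s f - (t - s) *: S s g) + (t - s) *: (S t g - S s g).
  rewrite scalerBr -[s - t]opprB scaleNr opprK !opprD !opprK.
  by rewrite -[in RHS]addrA [_ *: S s g + _]addrC subrK [- S t f + _]addrC.
have -> : e * (t - s) = e / 2 * (t - s) + (t - s) * (e / 2) by field.
apply: (le_trans (nrmD _ _)); rewrite nrmN nrmZ gtr0_norm ?subr_gt0//; apply: lerD; last first.
  by apply: ler_wpM2l; [rewrite subr_ge0 ltW|rewrite nrmBC].
have -> : nrm (S t f - S s f - (t - s) *: S s g) =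
    nrm (S s (S (t - s) f - f - (t - s) *: g)).
  apply: aeq_nrm; apply: aeq_sym.
  apply: (aeq_trans (sg_subr _ _ s0)); apply: aeqB; last exact: sg_Z.
  apply: (aeq_trans (sg_subr _ _ s0)); apply: aeqB; last exact: aeq_refl.
  by apply: aeq_sym; apply: sg_split => //; exact: ltW.
apply: (le_trans (hC' _ _ _)); first by apply/andP; split; lra.
rewrite mulrC -ler_pdivlMr// mulrAC.
by rewrite hd2// subr_gt0 st.
Qed.

End semigroup.

(** * The nominal semigroup: density, growth, symmetry *)

Section nominal_semigroup.
Context {R : realType}.
Notation leb := (@lebesgue_measure R).
Notation RR := (measurableTypeR R).
Variables (l e1 : R) (l_gt0 : 0 < l) (e1_gt0 : 0 < e1).
Notation mI := (muI 0 l).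
Notation X := (XI l).
Variables (a1bar : Linf mI) (S : R -> X -> X).
Notation A := (An e1 a1bar).
Hypothesis S_gen : is_semigroup setT A S.
Variables (Cn omn : R).
Hypothesis Cn_est : smoothing_estimate S Cn omn.
Implicit Types (phi psi f g : X).

Lemma mulop_E (g : Linf mI) (f : X) : mulop g f = (fun x => g x * f x) :> (R -> R).
Proof. by []. Qed.

Lemma An_mulop (ddphi phi f : X) : aeq mI f (fun x => e1 * ddphi x + a1bar x * phi x) ->
  aeq mI f (e1 *: ddphi + mulop a1bar phi : X).
Proof. by []. Qed.

Lemma mulop_bounded (g : Linf mI) : exists2 C : R, 0 <= C & forall f : X,
  nrm (mulop g f) <= C * nrm f.
Proof.
have [C hC] := Linf_ae_bounded g; exists `|C| => // f.
rewrite -(@ler_pXn2r _ 2)// ?nnegrE ?mulr_ge0 ?nrm_ge0// exprMn real_normK ?num_real//.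
have mf : measurable_fun setT (f : RR -> R) by [].
have mg : measurable_fun setT (g : RR -> R) by [].
rewrite -lee_fin [X in (_ <= X)%E]EFinM !EFin_nrm_sqr -ge0_integralZl//; first last.
- by rewrite lee_fin sqr_ge0.
- by move=> x _; rewrite lee_fin sqr_ge0.
- by apply/measurable_EFinP; exact: measurable_funX.
apply: ae_ge0_le_integral => //.
- by move=> x _; rewrite lee_fin sqr_ge0.
- by apply/measurable_EFinP; apply: measurable_funX; exact: measurable_funM.
- by move=> x _; rewrite -EFinM lee_fin mulr_ge0 ?sqr_ge0.
- by apply: measurable_funeM; apply/measurable_EFinP; exact: measurable_funX.
apply: filterS hC => x gx _; rewrite -EFinM lee_fin mulop_E exprMn ler_wpM2r ?sqr_ge0//.
by rewrite -(real_normK (num_real (g x))) lerXn2r// nnegrE// (le_trans _ gx).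
Qed.

Lemma mulop_sym (g : Linf mI) phi psi : dotp mI (mulop g phi) psi = dotp mI phi (mulop g psi).
Proof. by apply: eq_Rintegral => x _; rewrite !mulop_E; ring. Qed.

Lemma mulop_lin (g : Linf mI) (c : R) phi psi :
  aeq mI (mulop g (c *: phi + psi : X)) (c *: mulop g phi + mulop g psi : X).
Proof.
apply: dotp_ext => h; rewrite dotpDl dotpZl !(mulop_sym g) dotpDl dotpZl//.
Qed.

Lemma An_sym phi f psi g : A phi f -> A psi g -> dotp mI f psi = dotp mI phi g.
Proof.
move=> [dphi [ddphi [h1 w1 /An_mulop e_f]]] [dpsi [ddpsi [h2 w2 /An_mulop e_g]]].
rewrite (aeq_dotp _ e_f) (aeq_dotpr _ e_g) dotpDl dotpDr dotpZl dotpZr mulop_sym.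
congr (_ + _); congr (_ * _).
have := H01_by_parts l_gt0 h2 w1; have := H01_by_parts l_gt0 h1 w2.
rewrite dotpC => -> /eqP; rewrite eqr_opp => /eqP <-; exact: dotpC.
Qed.

(** Integration by parts leaves [- e1 |phi_x|^2], which is dropped; [m] bounds the multiplication by
    [a1bar]. *)
Lemma An_dissip : exists2 m : R, 0 <= m & forall phi f, A phi f ->
  dotp mI f phi <= m * nrm phi ^+ 2.
Proof.
have [m m0 hm] := mulop_bounded a1bar; exists m => // phi f [dphi [ddphi [h w /An_mulop e_f]]].
rewrite (aeq_dotp _ e_f) dotpDl dotpZl.
have -> : dotp mI ddphi phi = - nrm dphi ^+ 2.
  by rewrite nrm_sqr (H01_by_parts l_gt0 h w) opprK.
rewrite mulrN -[leRHS]add0r lerD//; first by rewrite oppr_le0 mulr_ge0 ?sqr_ge0 ?ltW.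
by apply: (le_trans (dotp_le _ _)); rewrite expr2 mulrA ler_wpM2r ?nrm_ge0.
Qed.

Lemma An_lin (c : R) phi f psi g : A phi f -> A psi g ->
  A (c *: phi + psi : X) (c *: f + g : X).
Proof.
move=> [dphi [ddphi [h1 w1 /An_mulop e_f]]] [dpsi [ddpsi [h2 w2 /An_mulop e_g]]].
exists (c *: dphi + dpsi), (c *: ddphi + ddpsi); split.
- exact: H01_lin.
- exact: wderiv_lin.
have E1 : aeq mI (c *: f + g : X) (c *: (e1 *: ddphi + mulop a1bar phi) +
    (e1 *: ddpsi + mulop a1bar psi) : X) by apply: aeqD => //; exact: aeqZ.
apply: (aeq_trans E1).
have E2 : aeq mI (e1 *: (c *: ddphi + ddpsi) + (c *: mulop a1bar phi + mulop a1bar psi) : X)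
   (e1 *: (c *: ddphi + ddpsi) + mulop a1bar (c *: phi + psi : X) : X).
  by apply: aeqD; [exact: aeq_refl|apply: aeq_sym; exact: mulop_lin].
rewrite (_ : c *: (_ + _) + _ = e1 *: (c *: ddphi + ddpsi) + (c *: mulop a1bar phi + mulop a1bar psi) :> X).
  exact: E2.
by rewrite !scalerDr !scalerA [c * e1]mulrC addrACA.
Qed.

Lemma test_An (eta : R -> R) : test1 0 l eta -> exists f, A (toXI l eta) f.
Proof.
move=> te; have tde := test1_derive1 l_gt0 te.
exists (e1 *: toXI l (derive1 (derive1 eta)) + mulop a1bar (toXI l eta) : X).
exists (toXI l (derive1 eta)), (toXI l (derive1 (derive1 eta))); split.
- exact: test_H01.
- exact: (test_H01 l_gt0 tde).1.
- exact: aeq_refl.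
Qed.

(** [S r phi] lies in [H_0^1], hence is approximated by test functions, and
    tends to [phi] as [r] tends to [0]. *)
Lemma test_dense (phi : X) (e : R) : 0 < e -> exists2 eta, test1 0 l eta &
  nrm (phi - toXI l eta) < e.
Proof.
move=> e0; have e2 : 0 < e / 2 by rewrite divr_gt0.
have [_ _ /(_ phi I) c _] := S_gen.
have [del d0 hd] := cvg_at_right0 c (divr_gt0 e2 (@ltr0Sn R 1)).
have d2 : 0 < del / 2 by rewrite divr_gt0.
have [dphi /in_H01P hS _] := Cn_est phi d2.
have [_ /(_ _ e2)[eta te [h1 _]]] := hS l_gt0; exists eta => //.
apply: (le_lt_trans (nrm_dist_trans (S (del / 2) phi) _ _)).
have := hd (del / 2); rewrite d2 ltr_pdivrMr// => /(_ _)H.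
have {}H : nrm (S (del / 2) phi - phi) <= e / 2 / 2.
  by rewrite -[leLHS]ger0_norm ?nrm_ge0// H// ltr_pMr// ltr1n.
by rewrite nrmBC; lra.
Qed.

Lemma An_dense (phi : X) (e : R) : 0 < e -> exists psi f, A psi f /\ nrm (phi - psi) < e.
Proof.
move=> /(test_dense phi)[eta te h]; have [f Af] := test_An te.
by exists (toXI l eta), f.
Qed.

(** The smoothing estimate bounds the gradient and Poincare's inequality brings the bound back to
    [L^2]; the factor [r^(-1/2)] confines the argument to [a > 0]. *)
Lemma S_bounded_away (a b : R) : 0 < a -> exists2 C : R, 0 < C &
  forall t phi, a <= t <= b -> nrm (S t phi) <= C * nrm phi.
Proof.
move=> a0; exists (l / pi * (`|Cn| * (Num.sqrt a)^-1 * expR (`|omn| * `|b|)) + 1).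
  by rewrite ltr_wpDl// !mulr_ge0 ?expR_ge0 ?invr_ge0 ?sqrtr_ge0 ?pi_ge0// ltW.
move=> t phi /andP[at_ tb]; have t0 : 0 < t by exact: lt_le_trans at_.
have [dphi h hd] := Cn_est phi t0.
apply: (le_trans (poincare l_gt0 h)).
have lp : 0 <= l / pi by rewrite divr_ge0 ?pi_ge0 ?ltW.
apply: (le_trans (ler_wpM2l lp hd)).
rewrite !mulrA ler_wpM2r ?nrm_ge0// -[leLHS]addr0 lerD// -!mulrA.
rewrite !mulrA -!(mulrA (l / pi)) ler_wpM2l//.
apply: (@le_trans _ _ (`|Cn| * (Num.sqrt t)^-1 * expR (omn * t))).
  by rewrite ler_wpM2r ?expR_ge0// ler_wpM2r ?invr_ge0 ?sqrtr_ge0// ler_norm.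
apply: ler_pM; rewrite ?mulr_ge0 ?invr_ge0 ?sqrtr_ge0 ?expR_ge0//.
  by rewrite ler_wpM2l// lef_pV2 ?posrE ?sqrtr_gt0// ler_wsqrtr.
rewrite ler_expR (le_trans (ler_norm _))// normrM ler_wpM2l//.
by rewrite (le_trans _ (ler_norm _))// gtr0_norm.
Qed.

(** The smoothing estimate degenerates at [0], so the bound there comes from dissipativity: for
    [phi] in the domain, [expR (- 2 m s) |S s phi|^2] is nonincreasing. Density extends this, each
    single [S t] being bounded. *)
Lemma S_growth : exists2 m : R, 0 <= m & forall t phi, 0 <= t ->
  nrm (S t phi) <= expR (m * t) * nrm phi.
Proof.
have [m m0 hm] := An_dissip; exists m => //.
have dom t phi f : 0 <= t -> A phi f -> nrm (S t phi) <= expR (m * t) * nrm phi.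
  move=> t0 Af.
  pose Z s := expR (- (2 * m) * s) * dotp mI (S s phi) (S s phi).
  have : Z t <= Z 0.
    apply: deriv_in_le => // s /andP[s0 st].
    have dS := sg_vderiv S_gen S_bounded_away t s0 Af.
    have dE : deriv_in 0 t (fun s => expR (- (2 * m) * s)) s
        (- (2 * m) * expR (- (2 * m) * s)).
      apply: deriv_in_is_derive; apply: is_derive_eq; rewrite /GRing.scale/=.
      by ring.
    exists (- (2 * m) * expR (- (2 * m) * s) * dotp mI (S s phi) (S s phi) +
      expR (- (2 * m) * s) * (dotp mI (S s f) (S s phi) + dotp mI (S s phi) (S s f))); last first.
      exact: deriv_inM dE (vderiv_in_dotp dS dS).
    have := hm _ _ (gen_sg S_gen s0 Af); rewrite [dotp mI (S s phi) (S s f)]dotpC nrm_sqr.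
    have := expR_gt0 (- (2 * m) * s).
    set E := expR _; set x := dotp _ _ _; set y := dotp _ _ _ => E0 h.
    rewrite (_ : _ + _ = E * (2 * (x - m * y))); last by ring.
    by rewrite pmulr_rle0// pmulr_rle0// subr_le0.
  rewrite /Z mulr0 expR0 mul1r mulNr expRN mulrC ler_pdivrMr ?expR_gt0// => h.
  rewrite -(@ler_pXn2r _ 2)// ?nnegrE ?nrm_ge0 ?mulr_ge0 ?expR_ge0 ?nrm_ge0//.
  rewrite exprMn nrm_sqr (le_trans h)// mulrC -expRM_natl.
  rewrite mulrA.
  by rewrite ler_wpM2l ?expR_ge0// -nrm_sqr (aeq_nrm (sg0 S_gen phi)).
move=> t phi t0; have [C C0 hC] := sg_bounded S_gen t0.
apply/ler_addgt0Pr => e e0.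
have CE : 0 < C + expR (m * t) by rewrite addr_gt0 ?expR_gt0.
have [psi [f [Af h]]] := An_dense phi (divr_gt0 e0 CE).
apply: (le_trans (nrm_le_dist _ (S t psi))).
rewrite (nrm_sg_sub S_gen _ _ t0).
have h1 := hC (phi - psi); have h2 := dom t psi f t0 Af.
have h3 := nrm_le_dist psi phi; rewrite nrmBC in h3.
have h4 : nrm (phi - psi) * (C + expR (m * t)) <= e by rewrite -ler_pdivlMr// ltW.
have E0 := expR_gt0 (m * t).
have h5 := ler_wpM2l (ltW E0) h3.
by lra.
Qed.

Lemma S_bounded (b : R) : exists2 C : R, 0 < C & forall t phi, 0 <= t <= b ->
  nrm (S t phi) <= C * nrm phi.
Proof.
have [m m0 hm] := S_growth; exists (expR (m * b)); first exact: expR_gt0.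
move=> t phi /andP[t0 tb]; apply: (le_trans (hm _ _ t0)).
by rewrite ler_wpM2r ?nrm_ge0// ler_expR ler_wpM2l.
Qed.

Lemma S_vcont (b t : R) phi : 0 <= t -> vcont_in 0 b (S ^~ phi) t.
Proof. exact: sg_vcont S_gen S_bounded_away _ _ _. Qed.

(** For [phi] and [psi] in the domain, [s |-> <S s phi, S (t - s) psi>] has zero derivative because
    the generator is symmetric, and its end values are the two sides. Density does the rest. *)
Lemma S_sym t phi psi : 0 <= t -> dotp mI (S t phi) psi = dotp mI phi (S t psi).
Proof.
move=> t0.
have dom phi' f psi' g : A phi' f -> A psi' g ->
    dotp mI (S t phi') psi' = dotp mI phi' (S t psi').
  move=> Af Ag; pose Z s := dotp mI (S s phi') (S (t - s) psi').
  have : Z t = Z 0.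
    apply: deriv_in_eq => // s /andP[s0 st].
    have ts0 : 0 <= t - s by rewrite subr_ge0.
    have dS := sg_vderiv S_gen S_bounded_away t s0 Af.
    have dR : vderiv_in 0 t (fun s => S (t - s) psi') s (- S (t - s) g).
      move=> e e0; have [del d0 hd] := sg_vderiv S_gen S_bounded_away t ts0 Ag e0.
      exists del => // r /andP[r0 rt] rs.
      have := hd (t - r); rewrite subr_ge0 rt gerBl r0 => /(_ isT).
      rewrite (_ : t - r - (t - s) = - (r - s)); last by ring.
      by rewrite normrN scaleNr scalerN => ->.
    rewrite -[X in deriv_in _ _ _ _ X](_ : dotp mI (S s f) (S (t - s) psi') +
       dotp mI (S s phi') (- S (t - s) g) = 0).
      exact: vderiv_in_dotp.
    by rewrite dotpNr (An_sym (gen_sg S_gen s0 Af) (gen_sg S_gen ts0 Ag)) subrr.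
  rewrite /Z subrr subr0 (aeq_dotpr _ (sg0 S_gen psi')) => ->.
  by rewrite (aeq_dotp _ (sg0 S_gen phi')).
have [C C0 hC] := sg_bounded S_gen t0.
apply/eqP; rewrite -subr_eq0; apply/eqP.
apply: (@eps0 _ _ (2 * C * (nrm phi + nrm psi + 1))) => e e0.
pose e' := Num.min 1 e; have e'0 : 0 < e' by rewrite lt_min ltr01.
have [e'1 e'e] : e' <= 1 /\ e' <= e by rewrite /e' !ge_min !lexx orbT.
have [phi' [f [Af h1]]] := An_dense phi e'0; have [psi' [g [Ag h2]]] := An_dense psi e'0.
have [/ltW k1 /ltW k2] := (lt_le_trans h1 e'e, lt_le_trans h2 e'e).
have D1 : dotp mI (S t phi) psi - dotp mI (S t phi') psi' =
    dotp mI (S t (phi - phi')) psi + dotp mI (S t phi') (psi - psi').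
  by rewrite (aeq_dotp _ (sg_subr S_gen _ _ t0)) dotpBl dotpBr; ring.
have D2 : dotp mI phi (S t psi) - dotp mI phi' (S t psi') =
    dotp mI (phi - phi') (S t psi) + dotp mI phi' (S t (psi - psi')).
  by rewrite (aeq_dotpr _ (sg_subr S_gen _ _ t0)) dotpBl dotpBr; ring.
rewrite (_ : _ - _ = (dotp mI (S t phi) psi - dotp mI (S t phi') psi') -
  (dotp mI phi (S t psi) - dotp mI phi' (S t psi'))); last by rewrite (dom _ _ _ _ Af Ag); ring.
rewrite D1 D2; apply: (le_trans (ler_normB _ _)).
have p' : nrm phi' <= nrm phi + 1.
  by apply: (le_trans (nrm_le_dist _ phi)); rewrite lerD2l nrmBC (le_trans (ltW h1)).
have n0 (x : X) := nrm_ge0 x.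
have b1 : `|dotp mI (S t (phi - phi')) psi| <= C * e * nrm psi.
  apply: (le_trans (cauchy_schwarz _ _)); apply: ler_wpM2r => //.
  by apply: (le_trans (hC _)); rewrite ler_wpM2l// ltW.
have b2 : `|dotp mI (S t phi') (psi - psi')| <= C * (nrm phi + 1) * e.
  apply: (le_trans (cauchy_schwarz _ _)); apply: ler_pM => //.
  by apply: (le_trans (hC _)); rewrite ler_wpM2l// ltW.
have b3 : `|dotp mI (phi - phi') (S t psi)| <= e * (C * nrm psi).
  by apply: (le_trans (cauchy_schwarz _ _)); apply: ler_pM.
have b4 : `|dotp mI phi' (S t (psi - psi'))| <= (nrm phi + 1) * (C * e).
  apply: (le_trans (cauchy_schwarz _ _)); apply: ler_pM => //.
  by apply: (le_trans (hC _)); rewrite ler_wpM2l// ltW.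
have a1 := ler_normD (dotp mI (S t (phi - phi')) psi) (dotp mI (S t phi') (psi - psi')).
have a2 := ler_normD (dotp mI (phi - phi') (S t psi)) (dotp mI phi' (S t (psi - psi'))).
by lra.
Qed.

End nominal_semigroup.

(** * Spectral projection, feedback and the closed-loop semigroup *)

Section closed_loop_semigroup.
Context {R : realType}.
Notation leb := (@lebesgue_measure R).
Notation RR := (measurableTypeR R).
Variables (l e1 : R) (l_gt0 : 0 < l) (e1_gt0 : 0 < e1).
Notation mI := (muI 0 l).
Notation X := (XI l).
Variables (a1bar g : Linf mI) (rho : R) (P K : X -> X).
Notation A := (An e1 a1bar).
Notation E := (Xcr e1 a1bar rho).
Hypothesis P_proj : orthogonal_projection E P.
Hypothesis K_lin : bounded_linear E K.
Implicit Types (phi psi f x y : X).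

Lemma Xcr_lin (c : R) phi psi : E phi -> E psi -> E (c *: phi + psi : X).
Proof.
move=> [n [lam [e [he hs]]]] [m [lam' [e' [he' hs']]]].
exists (n + m)%N, (fun i : 'I_(n + m) => match fintype.split i with inl j => lam j | inr k => lam' k end),
  (fun i : 'I_(n + m) => match fintype.split i with inl j => c *: e j | inr k => e' k end).
split=> [i|].
  case: (fintype.split i) => j; last exact: he'.
  have [h1 h2] := he j; split=> //.
  (* The second summand is [- e j + e j], i.e. zero: scaling is extracted from the lemma on linear
     combinations. *)
  have := An_lin (a1bar := a1bar) l_gt0 c h2 (An_lin (a1bar := a1bar) l_gt0 (-1) h2 h2).
  rewrite !scaleN1r !addNr !addr0 => h3.
  by rewrite scalerA mulrC -scalerA.
rewrite big_split_ord/=.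
have -> : \sum_(i < n) match fintype.split (lshift m i) with inl j => c *: e j | inr k => e' k end
    = c *: \sum_(i < n) e i :> X.
  by rewrite scaler_sumr; apply: eq_bigr => i _; rewrite (unsplitK (inl i) : fintype.split (lshift m i) = _).
have -> : \sum_(i < m) match fintype.split (rshift n i) with inl j => c *: e j | inr k => e' k end
    = \sum_(i < m) e' i :> X.
  by apply: eq_bigr => i _; rewrite (unsplitK (inr i) : fintype.split (rshift n i) = _).
exact: (aeqD (aeqZ c hs) hs').
Qed.

(** [P] is a choice of representatives, given by no algebraic property; orthogonality determines it
    almost everywhere, and linearity follows from this. *)
Lemma P_unique phi psi : E psi -> (forall chi, E chi -> dotp mI (phi - psi : X) chi = 0) ->
  aeq mI (P phi) psi.
Proof.
move=> Epsi h; have [EP hP] := P_proj phi.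
apply/aeq_nrmB0; apply/eqP; rewrite -sqrf_eq0 nrm_sqr.
have Ed : E (P phi - psi : X) by rewrite -[- psi]scaleN1r addrC; exact: Xcr_lin.
have -> : dotp mI (P phi - psi : X) (P phi - psi : X) =
   dotp mI (phi - psi : X) (P phi - psi : X) - dotp mI (phi - P phi : X) (P phi - psi : X).
  by rewrite -dotpBl; congr (dotp mI _ _); rewrite [RHS]addrC opprB addrA subrK.
by rewrite h// hP// subrr.
Qed.

Lemma P_lin (c : R) phi psi : aeq mI (P (c *: phi + psi)) (c *: P phi + P psi : X).
Proof.
have [E1 h1] := P_proj phi; have [E2 h2] := P_proj psi.
apply: P_unique => [|chi Echi]; first exact: Xcr_lin.
have -> : c *: phi + psi - (c *: P phi + P psi) = c *: (phi - P phi) + (psi - P psi) :> X.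
  by rewrite scalerBr opprD addrACA.
by rewrite dotpDl dotpZl h1// h2// mulr0 addr0.
Qed.

Lemma P_contraction phi : nrm (P phi) <= nrm phi.
Proof.
have [E1 h1] := P_proj phi.
rewrite -(@ler_pXn2r _ 2)// ?nnegrE ?nrm_ge0//.
rewrite -[in leRHS](subrK (P phi) phi) nrm_sqrD h1// mulr0 addr0 lerDr.
exact: sqr_ge0.
Qed.

Lemma K_congr phi psi : E phi -> E psi -> aeq mI phi psi -> aeq mI (K phi) (K psi).
Proof.
move=> E1 E2 h; have [lin [C bd]] := K_lin.
apply/aeq_nrmB0; have := lin (-1) _ _ E2 E1; rewrite !scaleN1r.
rewrite [- psi + _]addrC [- K psi + _]addrC => /aeq_nrm <-.
have := bd (phi - psi); rewrite (aeq_nrmB0 _ _).1// mulr0 => h0.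
apply/eqP; rewrite eq_le nrm_ge0 andbT; apply: h0.
by rewrite -[- psi]scaleN1r addrC; exact: Xcr_lin.
Qed.

Lemma KP_lin (c : R) phi psi :
  aeq mI (K (P (c *: phi + psi))) (c *: K (P phi) + K (P psi) : X).
Proof.
have [E1 _] := P_proj phi; have [E2 _] := P_proj psi.
have [E3 _] := P_proj (c *: phi + psi).
apply: (aeq_trans (K_congr E3 (Xcr_lin c E1 E2) (P_lin c phi psi))).
by have [lin _] := K_lin; exact: lin.
Qed.

Lemma KP_bounded : exists2 C : R, 0 < C & forall phi, nrm (K (P phi)) <= C * nrm phi.
Proof.
have [_ [C bd]] := K_lin; exists (`|C| + 1) => [|phi]; first by rewrite ltr_wpDl.
have [E1 _] := P_proj phi; apply: (le_trans (bd _ E1)).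
apply: (@le_trans _ _ ((`|C| + 1) * nrm (P phi))).
  by rewrite ler_wpM2r ?nrm_ge0// (le_trans (ler_norm _))// lerDl.
by rewrite ler_wpM2l ?P_contraction// addr_ge0.
Qed.

(** The bounded perturbation [B K_cr P_cr] of the nominal generator. *)
Definition feedback phi : X := mulop g (K (P phi)).

Lemma mulop_congr (h : Linf mI) phi psi : aeq mI phi psi -> aeq mI (mulop h phi) (mulop h psi).
Proof. by apply: filterS => z hz _; rewrite !mulop_E hz. Qed.

Lemma feedback_lin (c : R) phi psi :
  aeq mI (feedback (c *: phi + psi)) (c *: feedback phi + feedback psi : X).
Proof. by apply: (aeq_trans (mulop_congr _ (KP_lin c phi psi))); exact: mulop_lin. Qed.

Lemma feedback_bounded : exists2 C : R, 0 < C & forall phi, nrm (feedback phi) <= C * nrm phi.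
Proof.
have [C C0 bd] := KP_bounded; have [C' C'0 bd'] := mulop_bounded g.
exists ((C' + 1) * C) => [|phi]; first by rewrite mulr_gt0// ltr_wpDl.
apply: (le_trans (bd' _)); rewrite -mulrA; apply: ler_pM => //; first exact: nrm_ge0.
by rewrite lerDl.
Qed.

Lemma feedback_sub phi psi : nrm (feedback phi - feedback psi) = nrm (feedback (phi - psi)).
Proof.
apply: aeq_nrm; apply: aeq_sym; have := feedback_lin (-1) psi phi.
by rewrite !scaleN1r [- psi + _]addrC [- feedback psi + _]addrC.
Qed.

Variables (S SF : R -> X -> X).
Hypothesis S_gen : is_semigroup setT A S.
Variables (Cn omn : R).
Hypothesis Cn_est : smoothing_estimate S Cn omn.
Hypothesis SF_gen : is_semigroup setT (AF e1 a1bar g P K) SF.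
Variable (MF : R).
Hypothesis MF_gt0 : 0 < MF.
Hypothesis SF_bounded : forall t phi, 0 <= t -> nrm (SF t phi) <= MF * nrm phi.

Lemma SF_bounded_away (a b : R) : 0 < a -> exists2 C : R, 0 < C &
  forall t phi, a <= t <= b -> nrm (SF t phi) <= C * nrm phi.
Proof.
move=> a0; exists MF => // t phi /andP[at_ _]; apply: SF_bounded.
by apply: le_trans at_; exact: ltW.
Qed.

Lemma SF_rev_vcont (h t : R) (z : R -> X) : 0 <= t <= h -> vcont_in 0 h z t ->
  vcont_in 0 h (fun s => SF (h - s) (z s)) t.
Proof.
move=> /andP[t0 th] cz e e0.
have e2 : 0 < e / 2 by rewrite divr_gt0.
have ht : 0 <= h - t by rewrite subr_ge0.
have [d1 d10 hd1] := cz _ (divr_gt0 e2 MF_gt0).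
have [d2 d20 hd2] := sg_vcont SF_gen SF_bounded_away h (z t) ht e2.
exists (Num.min d1 d2); first by rewrite lt_min d10.
move=> s /[dup] sh /andP[s0 sh']; rewrite lt_min => /andP[s1 s2].
have hs : 0 <= h - s by rewrite subr_ge0.
apply: (le_trans (nrm_dist_trans (SF (h - s) (z t)) _ _)).
have -> : e = e / 2 + e / 2 by field.
apply: lerD.
  rewrite (nrm_sg_sub SF_gen _ _ hs); apply: (le_trans (SF_bounded _ hs)).
  by rewrite mulrC -ler_pdivlMr// hd1.
apply: hd2; first by rewrite hs gerBl s0.
by rewrite (_ : h - s - (h - t) = - (s - t)) ?normrN//; ring.
Qed.

(** Product rule for [SF (h - s)] applied to a moving point. Only the value [z t] has to lie in the
    domain; the first-order remainder of [z] is controlled by the uniform bound [MF]. *)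
Lemma SF_rev_vderiv (h t : R) (z : R -> X) (z' f : X) : 0 <= t <= h ->
  vderiv_in 0 h z t z' -> AF e1 a1bar g P K (z t) f ->
  vderiv_in 0 h (fun s => SF (h - s) (z s)) t (SF (h - t) (z' - f)).
Proof.
move=> /andP[t0 th] cz Af e e0.
have e3 : 0 < e / 3 by rewrite divr_gt0.
have ht : 0 <= h - t by rewrite subr_ge0.
have [d1 d10 hd1] := cz _ (divr_gt0 e3 MF_gt0).
have [d2 d20 hd2] := sg_vcont SF_gen SF_bounded_away h z' ht e3.
have [d3 d30 hd3] := sg_vderiv SF_gen SF_bounded_away h ht Af e3.
exists (Num.min d1 (Num.min d2 d3)); first by rewrite !lt_min d10 d20 d30.
move=> s /[dup] sh /andP[s0 sh']; rewrite !lt_min => /andP[s1 /andP[s2 s3]].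
have hs : 0 <= h - s by rewrite subr_ge0.
have hsr : 0 <= h - s <= h by rewrite hs gerBl.
have Eh : h - s - (h - t) = - (s - t) by ring.
have H1 := hd1 _ sh s1.
have H2 : nrm (SF (h - s) z' - SF (h - t) z') <= e / 3 by apply: hd2 => //; rewrite Eh normrN.
have H3 : nrm (SF (h - s) (z t) - SF (h - t) (z t) - (h - s - (h - t)) *: SF (h - t) f)
    <= e / 3 * `|s - t|.
  by rewrite -[in leRHS]normrN -Eh; apply: hd3 => //; rewrite Eh normrN.
pose a := SF (h - s) (z s - z t - (s - t) *: z').
pose b := SF (h - s) z' - SF (h - t) z'.
pose c := SF (h - s) (z t) - SF (h - t) (z t) - (h - s - (h - t)) *: SF (h - t) f.
have -> : nrm (SF (h - s) (z s) - SF (h - t) (z t) - (s - t) *: SF (h - t) (z' - f)) =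
    nrm (a + (s - t) *: b + c).
  apply: aeq_nrm; apply: aeq_sym.
  pose u := SF (h - s) (z s) - SF (h - s) (z t) - (s - t) *: SF (h - s) z'.
  have ea : aeq mI a u.
    apply: (aeq_trans (sg_subr SF_gen _ _ hs)); apply: aeqB; last exact: (sg_Z SF_gen _ _ hs).
    exact: (sg_subr SF_gen _ _ hs).
  apply: (aeq_trans (aeqD (aeqD ea (aeq_refl _)) (aeq_refl _))).
  have eb := aeqZ (s - t) (sg_subr SF_gen z' f ht).
  apply: aeq_sym; apply: (aeq_trans (aeqB (aeq_refl _) eb)).
  rewrite /u /b /c Eh !scalerBr scaleNr opprK.
  set p := SF (h - s) (z s); set q := SF (h - s) (z t); set r := _ *: SF (h - s) z'.
  set v := SF (h - t) (z t); set w := _ *: SF (h - t) z'; set y := _ *: SF (h - t) f.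
  suff -> : p - q - r + (r - w) + (q - v + y) = p - v - (w - y) :> X by exact: aeq_refl.
  by rewrite [p - q - r + _]addrA subrK opprB [p - q - w]addrAC addrA addrA subrK
     ?addrA -!addrA; congr (_ + _); rewrite addrCA; congr (_ + _); rewrite addrC.
have -> : e * `|s - t| = e / 3 * `|s - t| + `|s - t| * (e / 3) + e / 3 * `|s - t| by field.
apply: (le_trans (nrmD _ _)); apply: lerD => //.
apply: (le_trans (nrmD _ _)); apply: lerD; last by rewrite nrmZ ler_wpM2l.
apply: (le_trans (SF_bounded _ hs)); rewrite mulrC -ler_pdivlMr// mulrAC//.
Qed.

Lemma feedback_vcont (a b t : R) (z : R -> X) : vcont_in a b z t ->
  vcont_in a b (fun s => feedback (z s)) t.
Proof.
move=> cz e e0; have [C C0 bd] := feedback_bounded.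
have [d1 d10 hd1] := cz _ (divr_gt0 e0 C0); exists d1 => // s sab st.
by rewrite feedback_sub (le_trans (bd _))// mulrC -ler_pdivlMr// hd1.
Qed.

Lemma cst_vcont (a b t : R) (x : X) : vcont_in a b (fun=> x) t.
Proof. by move=> e e0; exists 1 => // s _ _; rewrite subrr nrm0 ltW. Qed.

Lemma cst_vderiv (a b t : R) (x : X) : vderiv_in a b (fun=> x) t (0 : X).
Proof. by move=> e e0; exists 1 => // s _ _; rewrite scaler0 !subrr nrm0 mulr_ge0// ltW. Qed.

Lemma SF_integrand_cont (h : R) x psi (t e : R) : 0 <= t <= h -> 0 < e ->
  exists2 del : R, 0 < del & forall s, 0 <= s <= h -> `|s - t| < del ->
    `|dotp mI (SF (h - s) (feedback (S s x))) psi -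
      dotp mI (SF (h - t) (feedback (S t x))) psi| <= e.
Proof.
move=> /[dup] th /andP[t0 _] e0.
apply: (@vcont_in_dotp _ _ _ mI 0 h (fun s => SF (h - s) (feedback (S s x))) (fun=> psi)) => //.
- apply: SF_rev_vcont => //; apply: feedback_vcont.
  exact: (S_vcont l_gt0 S_gen Cn_est).
- exact: cst_vcont.
Qed.

(** The two generators share their domain, so [s |-> SF (h - s) (S s x)] is differentiable for [x]
    in it, and the unbounded parts of the derivative cancel, leaving the feedback. Density and
    uniform bounds give all [x]. *)
Lemma SF_duhamel (h : R) x psi : 0 <= h ->
  dotp mI (SF h x) psi - dotp mI (S h x) psi =
  \int[leb]_(s in `]0, h[) dotp mI (SF (h - s) (feedback (S s x))) psi.
Proof.
move=> h0; pose J x' s := dotp mI (SF (h - s) (feedback (S s x'))) psi.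
have iJ x' : leb.-integrable `]0, h[ (EFin \o J x').
  by apply: eps_continuous_integrable => t e th e0; exact: SF_integrand_cont.
have dom x' f : A x' f -> dotp mI (SF h x') psi - dotp mI (S h x') psi =
    \int[leb]_(s in `]0, h[) J x' s.
  move=> Af; pose Z s := - dotp mI (SF (h - s) (S s x')) psi.
  have <- : Z h - Z 0 = \int[leb]_(s in `]0, h[) J x' s.
    apply: deriv_in_FTC => //; first by move=> t e th e0; exact: SF_integrand_cont.
    move=> t /[dup] th /andP[t0 _].
    have ht : 0 <= h - t by rewrite subr_ge0; case/andP: th.
    have dS := sg_vderiv S_gen (S_bounded_away l_gt0 Cn_est) h t0 Af.
    have AFx : AF e1 a1bar g P K (S t x') (S t f + feedback (S t x') : X).
      by exists (S t f); [exact: (gen_sg S_gen)|exact: aeq_refl].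
    have dZ := vderiv_in_dotp (SF_rev_vderiv th dS AFx) (cst_vderiv 0 h t psi).
    have := deriv_inN dZ; rewrite dotp0r addr0 -dotpNl.
    suff -> : dotp mI (- SF (h - t) (S t f - (S t f + feedback (S t x')))) psi = J x' t by [].
    apply: aeq_dotp; rewrite opprD addrA subrr add0r.
    have := sg_Z SF_gen (-1) (feedback (S t x')) ht; rewrite !scaleN1r => /aeqN.
    by rewrite opprK.
  rewrite /Z subrr subr0 opprK [RHS]addrC; congr (_ - _).
    by apply: aeq_dotp; apply: aeq_sym; apply: (sg_congr SF_gen) => //; exact: (sg0 S_gen).
  by rewrite -(aeq_dotp _ (sg0 SF_gen (S h x'))).
have [Cs Cs0 hCs] := S_bounded l_gt0 e1_gt0 S_gen Cn_est h.
have [Cf Cf0 hCf] := feedback_bounded.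
have Jb x' s : 0 <= s <= h -> `|J x' s| <= MF * (Cf * (Cs * nrm x')) * nrm psi.
  move=> /[dup] sh /andP[s0 sh']; apply: (le_trans (cauchy_schwarz _ _)).
  rewrite ler_wpM2r ?nrm_ge0//; apply: (le_trans (SF_bounded _ _)); first by rewrite subr_ge0.
  rewrite ler_wpM2l ?(ltW MF_gt0)//; apply: (le_trans (hCf _)); rewrite ler_wpM2l ?(ltW Cf0)//.
  exact: hCs.
have Jsub x1 x2 s : 0 <= s <= h -> J x1 s - J x2 s = J (x1 - x2) s.
  move=> /[dup] sh /andP[s0 sh']; have hs : 0 <= h - s by rewrite subr_ge0.
  rewrite /J -dotpBl; apply: aeq_dotp; apply: aeq_sym.
  apply: aeq_trans (sg_subr SF_gen _ _ hs); apply: (sg_congr SF_gen) => //.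
  have := feedback_lin (-1) (S s x2) (S s x1); rewrite !scaleN1r [- S s x2 + _]addrC
    [- feedback _ + _]addrC => h2.
  apply: aeq_trans h2; rewrite /feedback; apply: mulop_congr.
  have [Ea _] := P_proj (S s (x1 - x2)); have [Eb _] := P_proj (S s x1 - S s x2).
  apply: (K_congr Ea Eb).
  apply: P_unique => // chi Echi.
  have [_ h3] := P_proj (S s x1 - S s x2).
  rewrite dotpBl (aeq_dotp _ (sg_subr S_gen _ _ s0)) -dotpBl; exact: h3.
apply/eqP; rewrite -subr_eq0; apply/eqP.
apply: (@eps0 _ _ ((MF + Cs + MF * (Cf * Cs) * h) * nrm psi)) => e e0.
have [x' [f [Af hx]]] := An_dense l_gt0 S_gen Cn_est x e0.
have D1 : dotp mI (SF h x) psi - dotp mI (SF h x') psi = dotp mI (SF h (x - x')) psi.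
  by rewrite (aeq_dotp _ (sg_subr SF_gen _ _ h0)) dotpBl.
have D2 : dotp mI (S h x) psi - dotp mI (S h x') psi = dotp mI (S h (x - x')) psi.
  by rewrite (aeq_dotp _ (sg_subr S_gen _ _ h0)) dotpBl.
have D3 : \int[leb]_(s in `]0, h[) J x s - \int[leb]_(s in `]0, h[) J x' s =
    \int[leb]_(s in `]0, h[) J (x - x') s.
  rewrite -RintegralB//; apply: eq_Rintegral => s /set_mem; rewrite /= in_itv/= => /andP[s0 sh].
  by apply: Jsub; rewrite !ltW.
rewrite -/(J x) (_ : _ - _ - _ = dotp mI (SF h (x - x')) psi - dotp mI (S h (x - x')) psi
   - \int[leb]_(s in `]0, h[) J (x - x') s); last first.
  by rewrite -D1 -D2 -D3 -(dom _ _ Af); ring.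
have n0 := nrm_ge0 psi; have nx := nrm_ge0 (x - x').
have b1 : `|dotp mI (SF h (x - x')) psi| <= MF * e * nrm psi.
  apply: (le_trans (cauchy_schwarz _ _)); rewrite ler_wpM2r//.
  by apply: (le_trans (SF_bounded _ h0)); rewrite ler_wpM2l ?(ltW MF_gt0)// ltW.
have b2 : `|dotp mI (S h (x - x')) psi| <= Cs * e * nrm psi.
  apply: (le_trans (cauchy_schwarz _ _)); rewrite ler_wpM2r//.
  by apply: (le_trans (hCs _ _ _)); [rewrite h0 lexx|rewrite ler_wpM2l ?(ltW Cs0)// ltW].
have b3 : `|\int[leb]_(s in `]0, h[) J (x - x') s| <= MF * (Cf * (Cs * e)) * nrm psi * h.
  apply: (le_trans (le_normr_Rintegral _ (iJ _))) => //.
  rewrite -[in leRHS](subr0 h) -Rintegral_oo_cst//; apply: le_Rintegral => //.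
  - have := iJ (x - x'); move=> /integrable_abse//.
  - exact: integrable_oo_cst.
  move=> s; rewrite /= in_itv/= => /andP[s0 sh]; apply: (le_trans (Jb _ _ _)); first by rewrite !ltW.
  rewrite ler_wpM2r// !ler_wpM2l ?(ltW MF_gt0) ?(ltW Cf0) ?(ltW Cs0)//.
  exact: ltW.
have a1 := ler_normB (dotp mI (SF h (x - x')) psi - dotp mI (S h (x - x')) psi)
  (\int[leb]_(s in `]0, h[) J (x - x') s).
have a2 := ler_normB (dotp mI (SF h (x - x')) psi) (dotp mI (S h (x - x')) psi).
apply: (le_trans a1); apply: (le_trans (lerD a2 (lexx _))).
apply: (le_trans (lerD (lerD b1 b2) b3)).
by rewrite le_eqVlt; apply/orP; left; apply/eqP; ring.
Qed.

(** The generators differ by a bounded operator, so the semigroups differ by [O(h)] in operator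
    norm: Duhamel's formula is tested against the difference itself. *)
Lemma SF_sub_S (b : R) : exists2 C : R, 0 < C & forall h x, 0 <= h <= b ->
  nrm (SF h x - S h x) <= C * h * nrm x.
Proof.
have [Cs Cs0 hCs] := S_bounded l_gt0 e1_gt0 S_gen Cn_est b.
have [Cf Cf0 hCf] := feedback_bounded.
exists (MF * (Cf * Cs)) => [|h x /andP[h0 hb]]; first by rewrite !mulr_gt0.
set y := SF h x - S h x.
have [y0|yn] := eqVneq (nrm y) 0; first by rewrite y0 !mulr_ge0 ?nrm_ge0// ltW.
have yp : 0 < nrm y by rewrite lt_neqAle eq_sym yn nrm_ge0.
rewrite -(ler_pM2r yp) -expr2 nrm_sqr {1}/y dotpBl SF_duhamel//.
have iJ : leb.-integrable `]0, h[ (EFin \o (fun s => dotp mI (SF (h - s) (feedback (S s x))) y)).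
  by apply: eps_continuous_integrable => t e th e0; exact: SF_integrand_cont.
have -> : MF * (Cf * Cs) * h * nrm x * nrm y = MF * (Cf * (Cs * nrm x)) * nrm y * (h - 0) by ring.
rewrite -Rintegral_oo_cst//; apply: le_Rintegral => //; first exact: integrable_oo_cst.
clearbody y; move=> s; rewrite /= in_itv/= => /andP[s0 sh]; apply: (le_trans (dotp_le _ _)).
rewrite ler_wpM2r ?nrm_ge0//; apply: (le_trans (SF_bounded _ _)); first by rewrite subr_ge0 ltW.
rewrite ler_wpM2l ?(ltW MF_gt0)//; apply: (le_trans (hCf _)); rewrite ler_wpM2l ?(ltW Cf0)//.
by apply: hCs; rewrite (ltW s0) (le_trans (ltW sh)).
Qed.

End closed_loop_semigroup.

(** * Weak time derivatives and Pettis' theorem *)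

Section time_derivative.
Context {R : realType}.
Notation leb := (@lebesgue_measure R).
Notation RR := (measurableTypeR R).

Lemma mIoo (a b : R) : measurable (`]a, b[%classic : set RR).
Proof. by []. Qed.

Lemma ae_exists (a b : R) (Q : R -> Prop) : a < b -> {ae leb, forall t, Q t} ->
  exists2 t, a < t < b & Q t.
Proof.
move=> ab [N [mN N0 QN]]; apply: contrapT => h.
have sub : `]a, b[%classic `<=` N.
  move=> t /=; rewrite in_itv/= => tab; apply: QN => /= Qt.
  by apply: h; exists t.
have : (leb `]a, b[%classic <= leb N)%E by apply: le_measure => //; rewrite inE.
by rewrite N0 lebesgue_measure_itv/= lte_fin ab -EFinD lee_fin subr_le0 leNgt ab.
Qed.

Lemma ae_continuous_eq (f : R -> R) (a b c : R) : a < b ->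
  (forall t e, a <= t <= b -> 0 < e -> exists2 del : R, 0 < del &
    forall s, a <= s <= b -> `|s - t| < del -> `|f s - f t| <= e) ->
  {ae leb, forall t, a < t < b -> f t = c} -> forall t, a <= t <= b -> f t = c.
Proof.
move=> ab cf ae_f t /[dup] tab /andP[at_ tb].
apply/eqP; rewrite -subr_eq0; apply/eqP; apply: (@eps0 _ _ 1) => e e0; rewrite mul1r.
have [del d0 hd] := cf t e tab e0.
pose x := Num.max a (t - del); pose y := Num.min b (t + del).
have xy : x < y.
  by rewrite /x /y gt_max !lt_min ab /=; apply/andP; split; [|apply/andP; split]; lra.
have [s /andP[xs sy] /(_ _)fs] := ae_exists xy ae_f.
have /andP[as_ sb] : a < s < b.
  by move: xs sy; rewrite /x /y gt_max lt_min => /andP[-> _] /andP[-> _].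
rewrite -(fs _) ?as_// distrC; apply: hd; first by rewrite !ltW.
move: xs sy; rewrite /x /y gt_max lt_min => /andP[_ h1] /andP[_ h2].
by rewrite ltr_norml; apply/andP; split; lra.
Qed.

Variables (l : R) (l_gt0 : 0 < l).
Notation mI := (muI 0 l).
Notation X := (XI l).
Hypothesis dense : forall (phi : X) (e : R), 0 < e -> exists2 eta, test1 0 l eta &
  nrm (phi - toXI l eta) < e.

Lemma dense_eq0 (v : X) : (forall eta, test1 0 l eta -> dotp mI v (toXI l eta) = 0) ->
  nrm v = 0.
Proof.
move=> h; have [//|n0] := eqVneq (nrm v) 0.
have np : 0 < nrm v by rewrite lt_neqAle eq_sym n0 nrm_ge0.
have [eta te he] := dense v np; have := h eta te => h0.
have : nrm v ^+ 2 < nrm v ^+ 2; last by rewrite ltxx.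
rewrite [ltLHS]nrm_sqr (_ : dotp mI v v = dotp mI v (v - toXI l eta)); last first.
  by rewrite dotpBr h0 subr0.
by apply: (le_lt_trans (dotp_le _ _)); rewrite expr2 ltr_pM2l.
Qed.

(** Only the values in [(0, l)] are controlled, so the function is cut off before its class is
    taken; without global measurability [toL2] would return [0]. *)
Definition clsI (f : R -> R) : X := toXI l (f \_ `]0, l[).

Lemma clsIP (f : R -> R) : measurable_fun (`]0, l[ : set RR) f ->
  leb.-integrable `]0, l[ (EFin \o (fun x => f x ^+ 2)) ->
  clsI f = f \_ `]0, l[ :> (R -> R).
Proof.
move=> mf fi; apply: (@toL2E _ RR R mI); apply: Lfun2P.
  by apply/(measurable_restrictT _ _).1.
rewrite integral_mrestr.
  rewrite (@eq_integral _ RR _ leb `]0, l[ (fun x => (f x ^+ 2)%:E)).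
    by have <- := EFin_Rintegral (mIoo 0 l) fi; exact: ltry.
  by move=> x xI; rewrite patchE xI.
by apply/measurable_EFinP; apply: measurable_funX; apply/(measurable_restrictT _ _).1.
Qed.

Lemma dotp_clsI (f g : R -> R) : measurable_fun (`]0, l[ : set RR) f ->
  leb.-integrable `]0, l[ (EFin \o (fun x => f x ^+ 2)) ->
  measurable_fun setT (g : RR -> R) ->
  dotp mI (clsI f) g = \int[leb]_(x in `]0, l[) (f x * g x).
Proof.
move=> mf fi mg; rewrite clsIP// dotp_muI//; last by apply/(measurable_restrictT _ _).1.
by apply: eq_Rintegral => x xI; rewrite patchE xI.
Qed.

Lemma cst1_sqr (a b : R) :
  leb.-integrable `]a, b[ (EFin \o (fun x => (cst 1 : R -> R) x ^+ 2)).
Proof. by have := integrable_oo_cst a b (1 ^+ 2 : R). Qed.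

Lemma cont_sqr_integrable (f : R -> R) (a b : R) :
  (forall t e, a <= t <= b -> 0 < e -> exists2 del : R, 0 < del &
    forall s, a <= s <= b -> `|s - t| < del -> `|f s - f t| <= e) ->
  leb.-integrable `]a, b[ (EFin \o (fun x => f x ^+ 2)).
Proof.
move=> cf; have := eps_within_continuous cf => wc.
apply: within_continuous_integrable => x; apply: cvgM; exact: wc.
Qed.

(** No bump function is written down: if all test functions had mean zero, the constant [1] would be
    orthogonal to a dense set. *)
Lemma test1_mean1 : exists2 chi, test1 0 l chi & \int[leb]_(x in `]0, l[) chi x = 1.
Proof.
have mc : measurable_fun (`]0, l[ : set RR) (cst 1 : R -> R) by exact: measurable_cst.
have ic : leb.-integrable `]0, l[ (EFin \o (fun x => (cst 1 : R -> R) x ^+ 2)).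
  by have := integrable_oo_cst 0 l (1 ^+ 2 : R).
have n1 : nrm (clsI (cst 1)) != 0.
  rewrite -sqrf_eq0 nrm_sqr {2}clsIP// dotp_clsI//; last by apply/(measurable_restrictT _ _).1.
  rewrite (@eq_Rintegral _ _ _ _ _ (cst 1)); last by move=> x xI; rewrite patchE xI mulr1.
  by rewrite Rintegral_oo_cst ?(ltW l_gt0)// mul1r subr0 gt_eqF.
have [[eta te h]|h] := pselect (exists2 eta, test1 0 l eta & dotp mI (clsI (cst 1)) (toXI l eta) != 0).
  have E : dotp mI (clsI (cst 1)) (toXI l eta) = \int[leb]_(x in `]0, l[) eta x.
    rewrite toL2_test// dotp_clsI//; last exact: test_measurable te.
    by apply: eq_Rintegral => x _; rewrite mul1r.
  rewrite E in h; set c := Rintegral _ _ _ in h.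
  (* The zero function in the shape produced by [test1_lin], in order to scale [eta] by means of the
     same lemma. *)
  have tz := test1_lin (-1) l_gt0 te te.
  exists (fun x => c^-1 * eta x + (-1 * eta x + eta x)); first exact: test1_lin.
  rewrite (@eq_Rintegral _ _ _ _ _ (fun x : RR => c^-1 * eta x)); last by move=> x _; ring.
  rewrite (@RintegralZl _ _ _ leb _ eta c^-1)//; first by rewrite mulVf.
  exact: continuous_oo_integrable (smooth1_continuous te.1).
case/negP: n1; apply/eqP; apply: dense_eq0 => eta te.
by apply: contrapT => /eqP hn; apply: h; exists eta.
Qed.

(** [H = f - W], with [W] the primitive of [w], has zero weak derivative and is therefore constant.
    Here [(0, l)] plays the role of a time interval, because density of test functions is assumed on
    [(0, l)]. *)
Lemma du_bois_reymond (f w : R -> R) :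
  (forall t e, 0 <= t <= l -> 0 < e -> exists2 del : R, 0 < del &
    forall s, 0 <= s <= l -> `|s - t| < del -> `|f s - f t| <= e) ->
  measurable_fun (`]0, l[ : set RR) w ->
  leb.-integrable `]0, l[ (EFin \o (fun x => w x ^+ 2)) ->
  (forall eta, test1 0 l eta -> \int[leb]_(t in `]0, l[) (derive1 eta t * f t) =
     - \int[leb]_(t in `]0, l[) (eta t * w t)) ->
  forall a b, 0 <= a -> a <= b -> b <= l -> f b - f a = \int[leb]_(t in `]a, b[) w t.
Proof.
move=> cf mw w2 wd.
have wi : leb.-integrable `]0, l[ (EFin \o w).
  have mc1 : measurable_fun (`]0, l[ : set RR) (cst 1 : R -> R) by exact: measurable_cst.
  have := integrable_sqrM (mIoo _ _) mw mc1 w2 (cst1_sqr 0 l).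
  by apply: eq_integrable => // x _; rewrite /= mulr1.
pose W t := \int[leb]_(r in `]0, t[) w r.
have cW t e : 0 <= t <= l -> 0 < e -> exists2 del : R, 0 < del &
    forall s, 0 <= s <= l -> `|s - t| < del -> `|W s - W t| <= e.
  by move=> tl e0; exact: primitive_eps.
pose H t := f t - W t.
have cH t e : 0 <= t <= l -> 0 < e -> exists2 del : R, 0 < del &
    forall s, 0 <= s <= l -> `|s - t| < del -> `|H s - H t| <= e.
  move=> tl e0; have e2 : 0 < e / 2 by rewrite divr_gt0.
  have [d1 d10 h1] := cf t _ tl e2; have [d2 d20 h2] := cW t _ tl e2.
  exists (Num.min d1 d2); first by rewrite lt_min d10.
  move=> s sl; rewrite lt_min => /andP[s1 s2]; rewrite /H.
  rewrite (_ : _ - _ = (f s - f t) - (W s - W t)); last by ring.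
  apply: (le_trans (ler_normB _ _)); have -> : e = e / 2 + e / 2 by field.
  by apply: lerD; [exact: h1|exact: h2].
have iH := eps_continuous_integrable cH; have mH := integrable_measurable_fun iH.
have i2H := cont_sqr_integrable cH.
have iW := eps_continuous_integrable cW; have mW := integrable_measurable_fun iW.
have i_f := eps_continuous_integrable cf; have mf := integrable_measurable_fun i_f.
have itest (g eta : R -> R) : measurable_fun (`]0, l[ : set RR) g ->
   leb.-integrable `]0, l[ (EFin \o (fun x => g x ^+ 2)) -> test1 0 l eta ->
   leb.-integrable `]0, l[ (EFin \o (fun x => g x * eta x)).
  move=> mg g2 te; have ce := smooth1_continuous te.1; apply: integrable_sqrM => //.
    exact: integrable_measurable_fun (continuous_oo_integrable 0 l ce).
  by apply: continuous_oo_integrable => x; apply: cvgM; exact: ce.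
have RmulB (g h eta : R -> R) : measurable_fun (`]0, l[ : set RR) g ->
   measurable_fun (`]0, l[ : set RR) h ->
   leb.-integrable `]0, l[ (EFin \o (fun x => g x ^+ 2)) ->
   leb.-integrable `]0, l[ (EFin \o (fun x => h x ^+ 2)) -> test1 0 l eta ->
   \int[leb]_(t in `]0, l[) ((g t - h t) * eta t) =
   \int[leb]_(t in `]0, l[) (g t * eta t) - \int[leb]_(t in `]0, l[) (h t * eta t).
  move=> mg mh g2 h2 te; rewrite -RintegralB//; [|exact: itest..].
  by apply: eq_Rintegral => x _; rewrite mulrBl.
(* [W] need not be continuously differentiable, so it is not integrated by parts directly: [w] is
   approximated by a test function [v], whose primitive [F] can be, at the cost of an error of order
   [e]. *)
have claim1 zeta : test1 0 l zeta -> \int[leb]_(t in `]0, l[) (H t * derive1 zeta t) = 0.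
  move=> tz; have tdz := test1_derive1 l_gt0 tz.
  have [C hC] := test1_bounded l_gt0 tdz.
  apply: (@eps0 _ _ (nrm (toXI l zeta) + Num.sqrt l * C * l)) => e e0.
  have [v tv hv] := dense (clsI w) e0.
  have [F dF FE] := test1_antiderivative l_gt0 tv.
  have cv := smooth1_continuous tv.1.
  have cF : continuous F by move=> x; apply: derivable_continuous1; exact: ex_derive.
  have ibp := test1_by_parts l_gt0 tz dF cv.
  have iv := continuous_oo_integrable 0 l cv; have mv := integrable_measurable_fun iv.
  have v2 : leb.-integrable `]0, l[ (EFin \o (fun x => v x ^+ 2)).
    by apply: continuous_oo_integrable => x; apply: cvgM; exact: cv.
  have iF := continuous_oo_integrable 0 l cF; have mF := integrable_measurable_fun iF.
  have F2 : leb.-integrable `]0, l[ (EFin \o (fun x => F x ^+ 2)).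
    by apply: continuous_oo_integrable => x; apply: cvgM; exact: cF.
  have W2 := cont_sqr_integrable cW; have f2 := cont_sqr_integrable cf.
  have wv2 : leb.-integrable `]0, l[ (EFin \o (fun x => (w x - v x) ^+ 2)).
    have := integrable_sqrD (mIoo _ _) mw (measurable_funN mv) w2.
    by apply; apply: eq_integrable v2 => // x _; rewrite /= sqrrN.
  have mwv : measurable_fun (`]0, l[ : set RR) (fun x => w x - v x) by exact: measurable_funB.
  have nwv : \int[leb]_(x in `]0, l[) ((w x - v x) ^+ 2) <= e ^+ 2.
    have -> : \int[leb]_(x in `]0, l[) ((w x - v x) ^+ 2) = nrm (clsI w - toXI l v : X) ^+ 2.
      rewrite nrm_sqr dotp_muI//.
      apply: eq_Rintegral => x xI; rewrite expr2.
      suff -> : (clsI w - toXI l v : X) x = w x - v x by [].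
      by rewrite -[LHS]/(clsI w x - toXI l v x) clsIP// toL2_test// patchE xI.
    by rewrite lerXn2r ?nnegrE ?nrm_ge0 ?(ltW e0) ?(ltW hv).
  have WF t : 0 <= t <= l -> `|W t - F t| <= Num.sqrt l * e.
    move=> /andP[t0 tl]; rewrite FE// /W.
    have s1 := integrable_oo_sub (lexx 0) tl wi; have s2 := integrable_oo_sub (lexx 0) tl iv.
    have s3 := integrable_oo_sub (lexx 0) tl wv2.
    rewrite -RintegralB// -(@ler_pXn2r _ 2)// ?nnegrE ?mulr_ge0 ?sqrtr_ge0 ?(ltW e0)//.
    rewrite real_normK ?num_real// exprMn sqr_sqrtr ?(ltW l_gt0)// mulrC.
    have mt : measurable_fun (`]0, t[ : set RR) (fun x => w x - v x).
      by apply: measurable_funB; [exact: integrable_measurable_fun s1|exact: integrable_measurable_fun s2].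
    have mc1 : measurable_fun (`]0, t[ : set RR) (cst 1 : R -> R) by exact: measurable_cst.
    have := Rintegral_cauchy_schwarz (mIoo _ _) mt mc1 s3 (cst1_sqr 0 t).
    rewrite (@eq_Rintegral _ _ _ _ _ (fun x : RR => w x - v x) (fun x : RR => (w x - v x) * cst 1 x)); last first.
      by move=> x _; rewrite mulr1.
    rewrite [X in _ * X](@eq_Rintegral _ _ _ _ _ (cst 1)); last by move=> x _; rewrite /= expr1n.
    rewrite Rintegral_oo_cst// mul1r subr0 => cs; apply: (le_trans cs).
    apply: ler_pM => //; first by apply: Rintegral_ge0 => x _; exact: sqr_ge0.
    apply: le_trans nwv.
    rewrite (@Rintegral_oo_cat _ 0 t l)//= lerDl; apply: Rintegral_ge0 => x _; exact: sqr_ge0.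
  have D : \int[leb]_(t in `]0, l[) (H t * derive1 zeta t) =
      - (\int[leb]_(t in `]0, l[) ((w t - v t) * zeta t))
      - \int[leb]_(t in `]0, l[) ((W t - F t) * derive1 zeta t).
    rewrite /H (RmulB f W _ mf mW f2 W2 tdz) (RmulB w v _ mw mv w2 v2 tz) (RmulB W F _ mW mF W2 F2 tdz) ibp.
    under eq_Rintegral do rewrite mulrC.
    rewrite wd//; under [X in - X - _ = _]eq_Rintegral do rewrite mulrC.
    by ring.
  rewrite D -opprD normrN; apply: (le_trans (ler_normD _ _)); rewrite mulrDl; apply: lerD.
    have -> : \int[leb]_(t in `]0, l[) ((w t - v t) * zeta t) =
       dotp mI (clsI w - toXI l v : X) (toXI l zeta).
      have mz := test_measurable tz; have mvT := test_measurable tv.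
      rewrite dotpBl (toL2_test l_gt0 tz) (toL2_test l_gt0 tv) dotp_clsI// dotp_muI//.
      exact: RmulB.
    apply: (le_trans (cauchy_schwarz _ _)); rewrite mulrC ler_wpM2l ?nrm_ge0//.
    exact: ltW.
  have -> : Num.sqrt l * C * l * e = (Num.sqrt l * e * C) * (l - 0) by ring.
  have iWF : leb.-integrable `]0, l[ (EFin \o (fun t => (W t - F t) * derive1 zeta t)).
    have := integrable_RB (mIoo _ _) (itest _ _ mW W2 tdz) (itest _ _ mF F2 tdz).
    by apply: eq_integrable => // x _; rewrite /= mulrBl.
  apply: (le_trans (le_normr_Rintegral _ iWF)) => //.
  rewrite -Rintegral_oo_cst ?(ltW l_gt0)//; apply: le_Rintegral => //.
  - exact: integrable_abse iWF.
  - exact: integrable_oo_cst.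
  move=> x; rewrite /= in_itv/= => /andP[x0 xl]; rewrite normrM; apply: ler_pM => //.
  by apply: WF; rewrite !ltW.
(* Subtracting from a test function its mean times [chi0] leaves the derivative of a test function,
   so [H] and the constant [c0] have the same pairings. *)
have [chi0 tc0 chi1] := test1_mean1.
pose c0 := \int[leb]_(t in `]0, l[) (H t * chi0 t).
have mcc : measurable_fun (`]0, l[ : set RR) (cst c0 : R -> R) by exact: measurable_cst.
have icc : leb.-integrable `]0, l[ (EFin \o (fun x => (cst c0 : R -> R) x ^+ 2)).
  by have := integrable_oo_cst 0 l (c0 ^+ 2 : R).
have hc : nrm (clsI H - clsI (cst c0) : X) = 0.
  apply: dense_eq0 => chi tc.
  have mchi := test_measurable tc.
  rewrite dotpBl (toL2_test l_gt0 tc) !dotp_clsI//.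
  set m := \int[leb]_(t in `]0, l[) chi t.
  have ichi := continuous_oo_integrable 0 l (smooth1_continuous tc.1).
  have ichi0 := continuous_oo_integrable 0 l (smooth1_continuous tc0.1).
  have tx := test1_lin (- m) l_gt0 tc0 tc.
  have [|zeta tz dz] := test1_primitive l_gt0 tx.
    rewrite RintegralD//; last exact: integrable_RZl.
    by rewrite (@RintegralZl _ _ _ leb _ chi0 (- m))// chi1 mulr1 addNr.
  have := claim1 zeta tz; rewrite dz.
  under eq_Rintegral do rewrite mulrDr mulrCA.
  rewrite RintegralD//; [|by apply: integrable_RZl => //; exact: itest|exact: itest].
  rewrite (@RintegralZl _ _ _ leb _ (fun t => H t * chi0 t) (- m))//; last exact: itest.
  move=> /eqP; rewrite -/c0 (@RintegralZl _ _ _ leb _ chi c0)// -/m.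
  by rewrite mulNr addrC subr_eq0 => /eqP ->; rewrite mulrC subrr.
have Hc : {ae leb, forall t, 0 < t < l -> H t = c0}.
  have /aeq_nrmB0 := hc; rewrite /aeq clsIP// clsIP// => /ae_mrestr.
  apply: filterS => t ht t0l; have := ht t0l.
  have tI : t \in `]0, l[%classic by apply/mem_set; rewrite /= in_itv.
  by rewrite !patchE tI; apply.
have HE := ae_continuous_eq l_gt0 cH Hc.
move=> a b a0 ab bl.
have := HE a; have := HE b; rewrite a0 bl (le_trans a0 ab) (le_trans ab bl) => /(_ isT) hb /(_ isT) ha.
rewrite (@primitive_sub R w 0 l a b)//.
have e1 : H b - H a = 0 by rewrite ha hb subrr.
by move: e1; rewrite /H /W => e1; apply/eqP; rewrite -subr_eq0 -[X in _ == X]e1; apply/eqP; ring.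
Qed.

End time_derivative.

(** * Weak derivatives on arbitrary time intervals *)

Section time_windows.
Context {R : realType}.
Notation leb := (@lebesgue_measure R).
Notation RR := (measurableTypeR R).

Lemma derive1n_shift (s : R) (eta : R -> R) : smooth1 eta -> forall n,
  derive1n n (fun x => eta (x + s)) = (fun x => derive1n n eta (x + s)).
Proof.
move=> se; elim=> [//|n IH]; rewrite [LHS]/= -/(derive1n n _) IH.
apply/funext => x; rewrite derive1E.
have h1 : is_derive (x + s) (1 : R) (derive1n n eta) (derive1n n.+1 eta (x + s)).
  by rewrite [derive1n n.+1 _]/= derive1E; apply: DeriveDef => //; exact: se.
have h2 : is_derive x (1 : R) (fun x : R => x + s) 1.
  by apply: is_derive_eq; rewrite addr0.
have := @is_derive1_comp R (derive1n n eta) (fun x => x + s) x _ _ h1 h2.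
by rewrite mulr1 => h; exact: (@derive_val _ _ _ _ _ _ _ h).
Qed.

Lemma smooth1_shift (s : R) (eta : R -> R) : smooth1 eta -> smooth1 (fun x => eta (x + s)).
Proof.
move=> se n x; rewrite derive1n_shift//.
have h1 : is_derive (x + s) (1 : R) (derive1n n eta) ('D_1 (derive1n n eta) (x + s)).
  by apply: DeriveDef => //; exact: se.
have h2 : is_derive x (1 : R) (fun x : R => x + s) 1.
  by apply: is_derive_eq; rewrite addr0.
have h := @is_derive1_comp R (derive1n n eta) (fun x => x + s) x _ _ h1 h2.
exact: (@ex_derive _ _ _ _ _ _ _ h).
Qed.

Lemma test1_shift (a b s a' b' : R) (eta : R -> R) : a < b -> a' <= a - s -> b - s <= b' ->
  test1 a b eta -> test1 a' b' (fun x => eta (x + s)).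
Proof.
move=> ab ha hb /(test1P _ ab)[se [a1 [b1 [aa1 ab1 bb1 eta0]]]].
have ab' : a' < b' by lra.
apply/(test1P _ ab'); split; first exact: smooth1_shift.
exists (a1 - s), (b1 - s); split; [lra|lra|lra|].
by move=> x xab; apply: eta0; case: xab => ?; [left|right]; lra.
Qed.

Variables (l : R) (l_gt0 : 0 < l).
Notation mI := (muI 0 l).
Notation X := (XI l).
Hypothesis dense : forall (phi : X) (e : R), 0 < e -> exists2 eta, test1 0 l eta &
  nrm (phi - toXI l eta) < e.

(** The result on [(0, l)] is translated to windows [(s, s + l)], and these are chained over
    [[a, b]]. The length of the window is imposed by the density hypothesis and has no dynamical
    meaning. *)
Lemma weak_FTC (f w : R -> R) :
  (forall t e, 0 <= t -> 0 < e -> exists2 del : R, 0 < del &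
    forall s, 0 <= s -> `|s - t| < del -> `|f s - f t| <= e) ->
  (forall tau, 0 < tau -> measurable_fun (`]0, tau[ : set RR) w /\
    leb.-integrable `]0, tau[ (EFin \o (fun x => w x ^+ 2))) ->
  (forall tau eta, 0 < tau -> test1 0 tau eta ->
    \int[leb]_(t in `]0, tau[) (derive1 eta t * f t) =
     - \int[leb]_(t in `]0, tau[) (eta t * w t)) ->
  forall a b, 0 <= a -> a <= b -> f b - f a = \int[leb]_(t in `]a, b[) w t.
Proof.
move=> cf hw wd.
have wi tau : 0 < tau -> leb.-integrable `]0, tau[ (EFin \o w).
  move=> tau0; have [mw w2] := hw tau tau0.
  have mc1 : measurable_fun (`]0, tau[ : set RR) (cst 1 : R -> R) by exact: measurable_cst.
  have := integrable_sqrM (mIoo _ _) mw mc1 w2 (cst1_sqr 0 tau).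
  by apply: eq_integrable => // x _; rewrite /= mulr1.
have window s : 0 <= s -> forall a b, s <= a -> a <= b -> b <= s + l ->
    f b - f a = \int[leb]_(t in `]a, b[) w t.
  move=> s0 a b sa ab bl; have sl0 : 0 < s + l by rewrite ltr_wpDl.
  have [mw w2] := hw _ sl0; have iw := wi _ sl0.
  have os : `]0 + s, l + s[%classic `<=` (`]0, s + l[%classic : set RR).
    by apply: oo_sub; [rewrite add0r|rewrite addrC].
  have E (F : R -> R) : leb.-integrable `]0, s + l[ (EFin \o F) ->
      forall a b, 0 <= a -> a <= b -> b <= l ->
      \int[leb]_(t in `]a, b[) F (t + s) = \int[leb]_(t in `]a + s, b + s[) F t.
    move=> iF a1 b1 a10 ab1 bl1.
    have H := @Rintegral_oo_shift R a1 b1 (- s) F; rewrite !opprK in H.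
    by apply: H; apply: integrable_oo_sub iF; [rewrite addr_ge0|rewrite addrC lerD2l].
  have := @du_bois_reymond R l l_gt0 dense (fun t => f (t + s)) (fun t => w (t + s)).
  move=> /(_ _ _ _ _ (a - s) (b - s)).
  rewrite !subrK E ?subr_ge0 ?lerD2r ?lerBlDl// !subrK; apply => //.
  - move=> t e /andP[t0 _] e0; have ts0 : 0 <= t + s by exact: addr_ge0.
    have [del d0 hd] := cf _ e ts0 e0; exists del => // r /andP[r0 _] rt.
    by apply: hd; [exact: addr_ge0|rewrite (_ : r + s - (t + s) = r - t)//; ring].
  - by apply: measurable_fun_shift; exact: measurable_funS mw.
  - apply: (@integrable_shift R 0 l s (EFin \o (fun x => w x ^+ 2))).
    exact: integrableS w2.
  (* A test function on the window, being zero outside, is also one on [(0, s + l)], where the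
     hypothesis applies. *)
  move=> eta te.
  have te' : test1 0 (s + l) (fun x => eta (x - s)).
    by apply: test1_shift te => //; lra.
  have := wd _ _ sl0 te'.
  have -> : derive1 (fun x => eta (x - s)) = (fun x => derive1 eta (x - s)).
    exact: (derive1n_shift (- s) te.1 1).
  have [se [a1 [b1 [aa1 ab1 bb1 eta0]]]] := (test1P _ l_gt0).1 te.
  have [sde [a2 [b2 [aa2 ab2 bb2 deta0]]]] := (test1P _ l_gt0).1 (test1_derive1 l_gt0 te).
  have i_f : leb.-integrable `]0, s + l[ (EFin \o f).
    apply: eps_continuous_integrable => t e /andP[t0 _] e0.
    by have [del d0 hd] := cf t e t0 e0; exists del => // r /andP[r0 _]; exact: hd.
  have key (h g : R -> R) (C a3 b3 : R) : continuous h -> (forall x, `|h x| <= C) ->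
      leb.-integrable `]0, s + l[ (EFin \o g) ->
      0 < a3 -> a3 <= b3 -> b3 < l -> (forall x, x < a3 \/ b3 < x -> h x = 0) ->
      \int[leb]_(t in `]0, s + l[) (h (t - s) * g t) =
      \int[leb]_(t in `]0, l[) (h t * g (t + s)).
    move=> ch hC ig a30 ab3 b3l h0.
    have ihg : leb.-integrable `]0, s + l[ (EFin \o (fun t => h (t - s) * g t)).
      have mg := integrable_measurable_fun ig.
      apply: (@integrable_Rle _ _ _ leb _ _ (fun t => C * `|g t|)) => //.
      - apply: measurable_funM => //.
        apply: measurable_funTS; apply: continuous_measurable_fun => x.
        apply: continuous_comp; last exact: ch.
        by apply: cvgB; [exact: cvg_id|exact: cvg_cst].
      - by move=> x _; rewrite normrM ler_wpM2r.
      - by apply: (@integrable_RZl _ _ _ leb) => //; exact: integrable_abse ig.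
    rewrite (@Rintegral_oo_cat R 0 s (s + l))//; last by rewrite lerDl ltW.
    rewrite [X in X + _]Rintegral_cst0_oo ?add0r; last first.
      by move=> x /andP[_ xs]; rewrite h0 ?mul0r//; left; lra.
    have := E _ ihg 0 l (lexx 0) (ltW l_gt0) (lexx l).
    rewrite add0r [l + s]addrC => <-.
    by apply: eq_Rintegral => x _; rewrite addrK.
  have [C1 hC1] := test1_bounded l_gt0 te.
  have [C2 hC2] := test1_bounded l_gt0 (test1_derive1 l_gt0 te).
  rewrite (key _ _ C2 a2 b2)//; last exact: smooth1_continuous.
  by rewrite (key _ _ C1 a1 b1)//; exact: smooth1_continuous.
move=> a b a0 ab.
have ind n : forall b, a <= b -> b <= a + n%:R * l -> f b - f a = \int[leb]_(t in `]a, b[) w t.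
  elim: n => [|n IH] c ac cn.
    have -> : c = a by apply/eqP; rewrite eq_le ac andbT (le_trans cn)// mul0r addr0.
    by rewrite subrr oo0// Rintegral_set0.
  have [h|h] := leP c (a + n%:R * l); first exact: IH.
  have nl0 : 0 <= n%:R * l by rewrite mulr_ge0// ltW.
  have c0 : 0 < c by apply: le_lt_trans h; rewrite addr_ge0.
  rewrite (@Rintegral_oo_cat R a (a + n%:R * l) c)//; [|by rewrite lerDl|exact: ltW|].
    rewrite -IH ?lerDl// -(window (a + n%:R * l))//; [by ring|exact: addr_ge0|exact: ltW|].
    by move: cn; rewrite -natr1; lra.
  exact: integrable_oo_sub (wi c c0).
have [n] : exists n : nat, (b - a) / l <= n%:R.
  exists (Num.truncn ((b - a) / l)).+1; apply/ltW; exact: truncnS_gt.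
by rewrite ler_pdivrMr// lerBlDl => /ind; apply.
Qed.

End time_windows.

(** * Pettis' measurability theorem *)

Section pettis.
Context {R : realType}.
Notation leb := (@lebesgue_measure R).
Notation RR := (measurableTypeR R).
Variables (l : R) (l_gt0 : 0 < l).
Notation mI := (muI 0 l).
Notation X := (XI l).
Hypothesis dense : forall (phi : X) (e : R), 0 < e -> exists2 eta, test1 0 l eta &
  nrm (phi - toXI l eta) < e.

(** A step function with cells of length [h] and the values listed in [s]. Rational data make the
    family countable, and [dense_seq] enumerates it. *)
Fixpoint rstep (h : R) (s : seq rat) (x : R) : R :=
  if s is q :: s' then (if x < h then ratr q else rstep h s' (x - h)) else 0.

Lemma rstep_measurable (h : R) s : measurable_fun setT (rstep h s : RR -> R).
Proof.
elim: s => [|q s IH] /=; first exact: measurable_cst.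
apply: measurable_fun_ifT => //; first exact: measurable_fun_ltr.
by apply: (@measurableT_comp _ _ _ _ _ _ (rstep h s) _ (fun x : RR => x - h)) => //; exact: measurable_funB.
Qed.

Lemma rstep_bounded (h : R) s : exists C : R, forall x, `|rstep h s x| <= C.
Proof.
elim: s => [|q s [C IH]] /=; first by exists 0 => x; rewrite normr0.
exists (Num.max `|ratr q| C) => x; case: ifPn => _; first by rewrite le_max lexx.
by rewrite le_max IH orbT.
Qed.

Lemma bounded_Lfun (f : R -> R) (C : R) : measurable_fun setT (f : RR -> R) ->
  (forall x, `|f x| <= C) -> f \in Lfun mI 2%:E.
Proof.
move=> mf hC.
have i2 : leb.-integrable `]0, l[ (EFin \o (fun x : RR => f x ^+ 2)).
  apply: integrable_Rle (integrable_oo_cst 0 l (C ^+ 2)) => //.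
    by apply: measurable_funTS; exact: measurable_funX.
  by move=> x _; rewrite normrX lerXn2r ?nnegrE//; exact: le_trans (hC x).
apply: (@Lfun2P _ RR R mI) => //; rewrite integral_mrestr//.
  by have <- := EFin_Rintegral (mIoo 0 l) i2; exact: ltry.
by apply/measurable_EFinP; exact: measurable_funX.
Qed.

Definition dense_seq (k : nat) : X :=
  if choice.unpickle k is Some (q, s) then toXI l (rstep (ratr (q : rat)) s) else 0.

Lemma rstep_approx (eta : R -> R) (h M e : R) : 0 < h -> 0 < e ->
  (forall x y, `|eta x - eta y| <= M * `|x - y|) -> M * h <= e ->
  forall n a, exists s, forall x, 0 <= x < n%:R * h -> `|eta (a + x) - rstep h s x| <= 2 * e.
Proof.
move=> h0 e0 lip Mh; elim=> [|n IH] a.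
  by exists [::] => x; rewrite mul0r => /andP[? ?]; lra.
have lt1 : eta a < eta a + e by rewrite ltrDl.
have [q] := rat_in_itvoo lt1.
rewrite in_itv/= => /andP[q1 q2].
have [s hs] := IH (a + h); exists (q :: s) => x /andP[x0 xn] /=.
case: ltP => xh.
  have M0 : 0 <= M.
    by have := lip 1 0; rewrite subr0 normr1 mulr1; exact: le_trans.
  have h1 : `|eta (a + x) - eta a| <= e.
    by apply: (le_trans (lip _ _)); apply: le_trans Mh; rewrite addrC addKr ger0_norm// ler_wpM2l// ltW.
  rewrite (_ : _ - _ = (eta (a + x) - eta a) + (eta a - ratr q)); last by ring.
  apply: (le_trans (ler_normD _ _)).
  have : `|eta a - ratr q| <= e by rewrite distrC gtr0_norm ?subr_gt0//; lra.
  by lra.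
have := hs (x - h); rewrite subr_ge0 xh (_ : a + h + (x - h) = a + x); last by ring.
by apply; move: xn; rewrite -natr1; lra.
Qed.

Lemma test1_lipschitz (eta : R -> R) : test1 0 l eta -> exists2 M : R, 0 < M &
  forall x y, `|eta x - eta y| <= M * `|x - y|.
Proof.
move=> te; have tde := test1_derive1 l_gt0 te; have [C hC] := test1_bounded l_gt0 tde.
have C1 : 0 < `|C| + 1 by rewrite ltr_wpDl.
exists (`|C| + 1) => // x y.
wlog xy : x y / x <= y => [H|].
  by have [/H//|/ltW/H] := leP x y; rewrite distrC [in leRHS]distrC.
rewrite distrC [in leRHS]distrC [X in _ <= _ * X]ger0_norm ?subr_ge0//.
have cd := smooth1_continuous tde.1.
rewrite -(@Rintegral_derive R eta (derive1 eta) x y)//; last first.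
  by move=> z _; split; [exact: smooth1_is_derive te.1|exact: cd].
have i1 := continuous_oo_integrable x y cd.
apply: (le_trans (le_normr_Rintegral _ i1)) => //.
rewrite -Rintegral_oo_cst//; apply: le_Rintegral => //.
- exact: integrable_abse i1.
- exact: integrable_oo_cst.
by move=> z _; apply: (le_trans (hC z)); rewrite (le_trans (ler_norm _))// lerDl.
Qed.

Lemma dense_seqP (phi : X) (e : R) : 0 < e -> exists k, nrm (phi - dense_seq k) < e.
Proof.
move=> e0; have e2 : 0 < e / 2 by rewrite divr_gt0.
have [eta te he] := dense phi e2.
have [M M0 lip] := test1_lipschitz te.
pose e' := e / (8 * (Num.sqrt l + 1)).
have sl : 0 < Num.sqrt l + 1 by rewrite ltr_wpDl ?sqrtr_ge0.
have e'0 : 0 < e' by rewrite divr_gt0// mulr_gt0.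
have e'E : 2 * e' * (Num.sqrt l + 1) = e / 4 by rewrite /e'; field; rewrite gt_eqF.
clearbody e'.
have [q] := rat_in_itvoo (divr_gt0 e'0 M0).
rewrite in_itv/= => /andP[q0 qe]; set h : R := ratr q in q0 qe.
have Mh : M * h <= e' by rewrite mulrC -ler_pdivlMr// ltW.
pose n := (Num.truncn (l / h)).+1.
have nl : l < n%:R * h by rewrite -ltr_pdivrMr//; exact: truncnS_gt.
have [s hs] := rstep_approx q0 e'0 lip Mh n 0.
exists (choice.pickle (q, s)); rewrite /dense_seq choice.pickleK -/h.
apply: (le_lt_trans (nrm_dist_trans (toXI l eta) _ _)).
have -> : e = e / 2 + e / 2 by field.
apply: ltrD => //.
have [C hC] := rstep_bounded h s; have mr := rstep_measurable h s.
have Er : (toXI l (rstep h s) : X) = rstep h s :> (R -> R).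
  by apply: (@toL2E _ RR R mI); exact: bounded_Lfun hC.
apply: (@le_lt_trans _ _ (2 * e' * Num.sqrt l)); last first.
  by move: e'E; rewrite mulrDr mulr1; lra.
rewrite -(@ler_pXn2r _ 2)// ?nnegrE ?nrm_ge0 ?mulr_ge0 ?sqrtr_ge0 ?(ltW e'0)//.
rewrite exprMn sqr_sqrtr ?(ltW l_gt0)// nrm_sqr dotp_muI//.
rewrite -[l in leRHS]subr0 -Rintegral_oo_cst ?(ltW l_gt0)//.
have E x : (toXI l eta - toXI l (rstep h s) : X) x = eta x - rstep h s x.
  by rewrite -[LHS]/(toXI l eta x - toXI l (rstep h s) x) Er toL2_test.
have bnd x : 0 < x < l -> (eta x - rstep h s x) * (eta x - rstep h s x) <= (2 * e') ^+ 2.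
  move=> /andP[x0 xl]; have := hs x; rewrite add0r (ltW x0) (lt_trans xl nl) => /(_ isT) b.
  by rewrite -expr2 -real_normK ?num_real// lerXn2r// nnegrE// mulr_ge0// ltW.
rewrite (@eq_Rintegral _ _ _ _ _ (fun x : RR => (eta x - rstep h s x) * (eta x - rstep h s x))); last first.
  by move=> x _; rewrite -!E.
have me := test_measurable te.
apply: le_Rintegral => //.
- apply: (@integrable_Rle _ _ _ leb _ _ (fun=> (2 * e') ^+ 2)) => //; last exact: integrable_oo_cst.
    by apply: measurable_funTS; apply: measurable_funM; apply: measurable_funB.
  move=> x; rewrite /= in_itv/= => x0l; rewrite ger0_norm; first exact: bnd.
  by rewrite -expr2 sqr_ge0.
by exact: integrable_oo_cst.
Qed.

(** [f t] is approximated by the element closest to it among the first [n]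
    elements of the dense sequence, i.e. the one maximizing
    [2 <f t, e> - |e| ^+ 2]. *)
Lemma pettis (D : set RR) (f : R -> X) : measurable D ->
  (forall psi : X, measurable_fun D (fun t => dotp mI (f t) psi)) ->
  strongly_measurable D f.
Proof.
move=> mD mf.
pose m k : R -> R := (fun t => 2 * dotp mI (f t) (dense_seq k) - nrm (dense_seq k) ^+ 2) \_ D.
have mm k : measurable_fun setT (m k : RR -> R).
  have h : measurable_fun D
      (fun t : RR => 2 * dotp mI (f t) (dense_seq k) - nrm (dense_seq k) ^+ 2).
    by apply: measurable_funB => //; apply: measurable_funM => //; exact: mf.
  exact: (measurable_restrictT _ mD).1 h.
(* [F] carries the index of the best approximation so far together with its score, so that
   measurability of both follows by one induction. *)
pose F := fix F n t := if n is n'.+1 then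
   (if m (F n' t).1 t < m n t then (n, m n t) else F n' t) else (0%N, m 0%N t).
have Fm n t : (F n t).2 = m (F n t).1 t by elim: n => //= n IH; case: ifPn.
pose i n t := (F n t).1; pose v n t := (F n t).2.
have mv n : measurable_fun setT (v n : RR -> R) /\ measurable_fun setT (i n : RR -> nat).
  elim: n => [|n [IHv IHi]]; first by split; [exact: mm|exact: measurable_cst].
  have -> : v n.+1 = (fun t => if v n t < m n.+1 t then m n.+1 t else v n t).
    by apply/funext => t; rewrite /v /= -Fm; case: ifPn.
  have -> : i n.+1 = (fun t => if v n t < m n.+1 t then n.+1 else i n t).
    by apply/funext => t; rewrite /i /v /= -Fm; case: ifPn.
  have mb : measurable_fun setT (fun t : RR => v n t < m n.+1 t) by exact: measurable_fun_ltr.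
  by split; apply: measurable_fun_ifT.
have ile n t : (i n t <= n)%N.
  by rewrite /i; elim: n => //= n IH; case: ifPn => // _; exact: leqW.
have imax n k t : (k <= n)%N -> m k t <= m (i n t) t.
  rewrite /i; elim: n => [|n IH] /=; first by rewrite leqn0 => /eqP ->.
  rewrite leq_eqVlt => /predU1P[->|]; first by case: ltP.
  rewrite ltnS => /IH h; case: ifPn => // /ltW; exact: le_trans.
exists (fun n t => dense_seq (i n t)); split.
  move=> n; split.
    apply: (@sub_finite_set _ _ (dense_seq @` `I_n.+1)).
      by move=> _ [t _ <-]; exists (i n t) => //=; rewrite ltnS.
    by apply: finite_image; exact: finite_II.
  move=> e; have -> : (fun t => dense_seq (i n t)) @^-1` [set e] =
     i n @^-1` (dense_seq @^-1` [set e]) by [].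
  by rewrite -[X in measurable X]setTI; apply: (mv n).2.
move=> t Dt; apply/cvgrPdist_lt => e e0.
have [k hk] := dense_seqP (f t) e0.
near=> n; rewrite sub0r normrN ger0_norm ?nrm_ge0//.
apply: le_lt_trans hk; rewrite nrmBC.
rewrite -(@ler_pXn2r _ 2)// ?nnegrE ?nrm_ge0//.
have E j : nrm (f t - dense_seq j) ^+ 2 = nrm (f t) ^+ 2 - m j t.
  rewrite /m patchE mem_set// -[f t - _]/(f t + - dense_seq j) nrm_sqrD dotpNr nrmN; ring.
rewrite !E lerD2l lerN2; apply: imax; near: n; exact: nbhs_infty_ge.
Unshelve. all: by end_near. Qed.

End pettis.

(** * The coupled system *)

Section essential_bounds.
Context {dT : measure_display} {T : measurableType dT} {R : realType}.
Variable mu : {measure set T -> \bar R}.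

(** [Lnrm] is the finite part of the essential supremum and would read [0] if that were infinite;
    the constant [C] excludes this case. *)
Lemma Lnrmoo_ae (f : T -> R) (C : R) : {ae mu, forall x, `|f x| <= C} ->
  {ae mu, forall x, `|f x| <= Lnrm mu +oo%E f}.
Proof.
move=> fC; rewrite /Lnrm unlock /=; case: ifPn => [mu0|]; last first.
  rewrite -leNgt => mu0; apply: measure0_ae.
  by apply/eqP; rewrite eq_le mu0 measure_ge0.
have le : (ess_sup mu (abse \o (EFin \o f)) <= C%:E)%E by apply/ess_supP.
have := ess_sup_ge mu (abse \o (EFin \o f)).
apply: filterS => x /=.
by case: (ess_sup _ _) le => [r| |]//= _; rewrite leeNy_eq.
Qed.

Lemma nrmoo_ge0 (g : Linf mu) : 0 <= nrmoo g.
Proof. by rewrite /nrmoo /Lnrm fine_ge0// Lnorm_ge0. Qed.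

Lemma nrmoo_ae (g : Linf mu) : {ae mu, forall x, `|g x| <= nrmoo g}.
Proof. by have [C /Lnrmoo_ae] := Linf_ae_bounded g. Qed.

Lemma Lfun2_dom (f : T -> R) (h : L2 mu) (C : R) : 0 <= C ->
  measurable_fun setT f -> {ae mu, forall x, `|f x| <= C * `|h x|} ->
  f \in Lfun mu 2%:E /\ nrm (toL2 f : L2 mu) <= C * nrm h.
Proof.
move=> C0 mf fh.
have mh : measurable_fun setT (h : T -> R) by [].
have le : (\int[mu]_x (f x ^+ 2)%:E <= (C ^+ 2 * nrm h ^+ 2)%:E)%E.
  rewrite EFinM EFin_nrm_sqr -ge0_integralZl//; first last.
  - by rewrite lee_fin sqr_ge0.
  - by move=> x _; rewrite lee_fin sqr_ge0.
  - by apply/measurable_EFinP; exact: measurable_funX.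
  apply: ae_ge0_le_integral => //.
  - by move=> x _; rewrite lee_fin sqr_ge0.
  - by apply/measurable_EFinP; exact: measurable_funX.
  - by move=> x _; rewrite -EFinM lee_fin mulr_ge0 ?sqr_ge0.
  - by apply: measurable_funeM; apply/measurable_EFinP; exact: measurable_funX.
  apply: filterS fh => x fx _; rewrite -EFinM lee_fin.
  by rewrite -real_normK ?num_real// -(real_normK (num_real (h x))) -exprMn lerXn2r// nnegrE ?mulr_ge0.
have fL : f \in Lfun mu 2%:E.
  by apply: Lfun2P => //; apply: (le_lt_trans le); exact: ltry.
split=> //; rewrite -(@ler_pXn2r _ 2)// ?nnegrE ?mulr_ge0 ?nrm_ge0//.
by rewrite exprMn -lee_fin EFin_nrm_sqr toL2E.
Qed.

End essential_bounds.

(** * Slices of product measures *)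

Section slices.
Context d1 d2 (T1 : measurableType d1) (T2 : measurableType d2) (R : realType).
Variables (m1 : {sigma_finite_measure set T1 -> \bar R})
  (m2 : {sigma_finite_measure set T2 -> \bar R}).

(** Tonelli for the indicator of a null set that covers the failures of [Q]: almost every slice
    integral vanishes, and then almost every value on such a slice. *)
Lemma ae_slice (Q : T1 * T2 -> Prop) : {ae (m1 \x m2)%E, forall p, Q p} ->
  {ae m2, forall y, {ae m1, forall x, Q (x, y)}}.
Proof.
move=> [N [mN N0 QN]].
pose f : T1 * T2 -> \bar R := EFin \o \1_N.
have mf : measurable_fun setT f by apply/measurable_EFinP.
have f0 p : (0 <= f p)%E by rewrite lee_fin.
have I0 : (\int[m2]_y fubini_G m1 f y = 0)%E.
  by rewrite -fubini_tonelli2// integral_indic// setIT.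
have mG : measurable_fun setT (fubini_G m1 f) by exact: measurable_fun_fubini_tonelli_G.
have G0 y : (0 <= fubini_G m1 f y)%E by apply: integral_ge0.
have : ae_eq m2 setT (fubini_G m1 f) (cst 0%E).
  apply/ae_eq_integral_abs => //.
  by rewrite -[RHS]I0; apply: eq_integral => y _; rewrite gee0_abs.
apply: filterS => y /(_ I) Gy.
have mfy : measurable_fun setT (fun x => f (x, y)) by apply: measurableT_comp mf _.
have : ae_eq m1 setT (fun x => f (x, y)) (cst 0%E).
  apply/ae_eq_integral_abs => //.
  by rewrite -[RHS]Gy; apply: eq_integral => x _; rewrite gee0_abs.
apply: filterS => x /(_ I) fx; apply: contrapT => nQ.
have Nxy : N (x, y) by apply: QN.
move: fx => /(congr1 fine); rewrite /f /= indicE mem_set//= => /eqP.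
by rewrite oner_eq0.
Qed.

Lemma ae_slice1 (Q : T1 * T2 -> Prop) : {ae (m1 \x m2)%E, forall p, Q p} ->
  {ae m1, forall x, {ae m2, forall y, Q (x, y)}}.
Proof.
move=> [N [mN N0 QN]].
pose f : T1 * T2 -> \bar R := EFin \o \1_N.
have mf : measurable_fun setT f by apply/measurable_EFinP.
have f0 p : (0 <= f p)%E by rewrite lee_fin.
have I0 : (\int[m1]_x fubini_F m2 f x = 0)%E.
  by rewrite -fubini_tonelli1// integral_indic// setIT.
have mG : measurable_fun setT (fubini_F m2 f) by exact: measurable_fun_fubini_tonelli_F.
have G0 y : (0 <= fubini_F m2 f y)%E by apply: integral_ge0.
have : ae_eq m1 setT (fubini_F m2 f) (cst 0%E).
  apply/ae_eq_integral_abs => //.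
  by rewrite -[RHS]I0; apply: eq_integral => y _; rewrite gee0_abs.
apply: filterS => x /(_ I) Gx.
have mfx : measurable_fun setT (fun y => f (x, y)) by apply: measurableT_comp mf _.
have : ae_eq m2 setT (fun y => f (x, y)) (cst 0%E).
  apply/ae_eq_integral_abs => //.
  by rewrite -[RHS]Gx; apply: eq_integral => y _; rewrite gee0_abs.
apply: filterS => y /(_ I) fx; apply: contrapT => nQ.
have Nxy : N (x, y) by apply: QN.
move: fx => /(congr1 fine); rewrite /f /= indicE mem_set//= => /eqP.
by rewrite oner_eq0.
Qed.

Lemma tonelli_rect (A : set T1) (B : set T2) (f : T1 * T2 -> \bar R) :
  measurable A -> measurable B ->
  measurable_fun setT f -> (forall p, 0 <= f p)%E ->
  (\int[(m1 \x m2)%E]_(p in A `*` B) f p = \int[m1]_(x in A) \int[m2]_(y in B) f (x, y))%E.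
Proof.
move=> mA mB mf f0; have mAB : measurable (A `*` B) by exact: measurableX.
rewrite integral_mkcond fubini_tonelli1//; last 2 first.
- have h : measurable_fun (A `*` B) f by exact: measurable_funS mf.
  exact: (measurable_restrictT _ mAB).1 h.
- by move=> p; rewrite patchE; case: ifPn.
rewrite [RHS]integral_mkcond; apply: eq_integral => x _.
rewrite /fubini_F patchE; case: ifPn => xA.
  rewrite [RHS]integral_mkcond; apply: eq_integral => y _.
  rewrite !patchE; case: ifPn => [/set_mem[_ yB]|/negP h].
    by rewrite mem_set.
  by rewrite memNset// => yB; apply: h; apply/mem_set; split=> //; exact: set_mem xA.
apply: integral0_eq => y _; rewrite patchE memNset// => -[Ax _].
by move/negP: xA; apply; exact: mem_set.
Qed.

Lemma measurable_Rintegral_slice (B : set T2) (f : T1 * T2 -> R) : measurable B ->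
  measurable_fun setT f -> measurable_fun setT (fun x => \int[m2]_(y in B) f (x, y)).
Proof.
move=> mB mf.
have mfB : measurable_fun setT ((EFin \o f) \_ (setT `*` B)).
  apply/(measurable_restrictT _ _).1; first exact: measurableX.
  by apply/measurable_EFinP; exact: measurable_funTS.
have mp := measurable_funepos mfB; have mn := measurable_funeneg mfB.
have m1' : measurable_fun setT (fubini_F m2 (((EFin \o f) \_ (setT `*` B))^\+)%E).
  by apply: measurable_fun_fubini_tonelli_F => // p; exact: funepos_ge0.
have m2' : measurable_fun setT (fubini_F m2 (((EFin \o f) \_ (setT `*` B))^\-)%E).
  by apply: measurable_fun_fubini_tonelli_F => // p; exact: funeneg_ge0.
have -> : (fun x => \int[m2]_(y in B) f (x, y)) =
    fine \o (fun x => fubini_F m2 (((EFin \o f) \_ (setT `*` B))^\+)%E x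
                    - fubini_F m2 (((EFin \o f) \_ (setT `*` B))^\-)%E x)%E.
  apply/funext => x; rewrite /Rintegral /=; congr fine.
  rewrite integral_mkcond integralE /fubini_F; congr (_ - _)%E; apply: eq_integral => y _;
    rewrite !unlock /= !patchE; suff -> : ((x, y) \in setT `*` B) = (y \in B) by [].
    by apply/idP/idP => /set_mem h; apply/mem_set => //; case: h.
  by apply/idP/idP => /set_mem h; apply/mem_set => //; case: h.
by apply: measurableT_comp => //; exact: emeasurable_funB.
Qed.

End slices.

Lemma product_sigma_finite d1 d2 (T1 : measurableType d1) (T2 : measurableType d2)
  (R : realType) (m1 : {sigma_finite_measure set T1 -> \bar R})
  (m2 : {sigma_finite_measure set T2 -> \bar R}) : sigma_finite setT (m1 \x m2)%E.
Proof.
have /sigma_finiteP[F [TF ndF Ffin]] := sigma_finiteT m1.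
have /sigma_finiteP[G [TG ndG Gfin]] := sigma_finiteT m2.
exists (fun n => F n `*` G n).
  apply/seteqP; split=> // -[x y] _.
  have [i _ Fi] : (\bigcup_k F k) x by rewrite -TF.
  have [j _ Gj] : (\bigcup_k G k) y by rewrite -TG.
  exists (maxn i j) => //; split.
    exact: (subsetPset _ _ (ndF _ _ (leq_maxl i j))).
  exact: (subsetPset _ _ (ndG _ _ (leq_maxr i j))).
move=> n; have [mF Fn] := Ffin n; have [mG Gn] := Gfin n.
split; first exact: measurableX.
by rewrite product_measure1E// lte_mul_pinfty// ge0_fin_numE.
Qed.

(** The product of the first two measures is packed as a sigma-finite measure, so that it can be
    sliced against the third. *)
Lemma ae_slice3 d1 d2 d3 (T1 : measurableType d1) (T2 : measurableType d2)
  (T3 : measurableType d3) (R : realType)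
  (m1 : {sigma_finite_measure set T1 -> \bar R})
  (m2 : {sigma_finite_measure set T2 -> \bar R})
  (m3 : {sigma_finite_measure set T3 -> \bar R}) (Q : T1 * T2 * T3 -> Prop) :
  {ae ((m1 \x m2) \x m3)%E, forall p, Q p} ->
  {ae m3, forall z, {ae (m1 \x m2)%E, forall p, Q (p, z)}}.
Proof.
pose m12 : {sigma_finite_measure set (T1 * T2)%type -> \bar R} :=
  HB.pack_for {sigma_finite_measure set (T1 * T2)%type -> \bar R} (m1 \x m2)%E
    (Measure_isSigmaFinite.Build _ _ _ (m1 \x m2)%E (product_sigma_finite m1 m2)).
by move=> h; apply: (@ae_slice _ _ _ _ R m12 m3 Q).
Qed.

(** * The coefficients at almost every time *)

Section coefficients.
Context {R : realType}.
Notation leb := (@lebesgue_measure R).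
Notation RR := (measurableTypeR R).
Variables (l d : R) (l_gt0 : 0 < l) (d_gt0 : 0 < d).
Notation mI := (muI 0 l).
Notation mO := (muOmega l d).
Notation X := (XI l).
Notation W := (XO l d).
Variables (al1 : Linf (muIt l)) (a1bar : Linf mI).
Variables (lam1 : Linf (muOmegat l d)) (lam2 : Linf (muIt l)).

(** Times whose spatial slices inherit the essential bounds over space and time; by slicing, almost
    every positive time is regular. *)
Definition regular_time (t : R) : Prop :=
  [/\ {ae mI, forall x, `|al1 (x, t) - a1bar x| <= m_alpha al1 a1bar},
      {ae mO, forall p, `|lam1 (p, t)| <= nrmoo lam1} &
      {ae mI, forall x, `|lam2 (x, t)| <= nrmoo lam2}].

Lemma ae_muIt_slice (Q : R * R -> Prop) : {ae muIt l, forall p, Q p} ->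
  {ae leb, forall t, 0 < t -> {ae mI, forall x, Q (x, t)}}.
Proof.
move=> /ae_mrestr/ae_slice; apply: filterS => t h t0.
apply/ae_mrestr; apply: filterS h => x + xI; apply; split=> //=.
by rewrite in_itv/= ltW.
Qed.

Lemma ae_muOmegat_slice (Q : R * R * R -> Prop) : {ae muOmegat l d, forall p, Q p} ->
  {ae leb, forall t, 0 < t -> {ae mO, forall p, Q (p, t)}}.
Proof.
move=> /ae_mrestr/ae_slice3; apply: filterS => t h t0.
apply/ae_mrestr; apply: filterS h => x + xI; apply; split=> //=.
by rewrite in_itv/= ltW.
Qed.

Lemma ae_muIt_fst (Q : R -> Prop) : {ae mI, forall x, Q x} ->
  {ae muIt l, forall p, Q p.1}.
Proof.
move=> /ae_mrestr[N [mN N0 QN]]; apply/ae_mrestr.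
exists (N `*` setT); split.
- exact: measurableX.
- by apply: etrans (product_measure1E _ _ mN measurableT) _; rewrite N0 mul0e.
by move=> [x t] /= h; split=> //; apply: QN => /= hx; apply: h => -[xI _]; exact: hx.
Qed.

Lemma ae_regular_time : {ae leb, forall t, 0 < t -> regular_time t}.
Proof.
have h1 : {ae muIt l, forall p, `|al1 p - a1bar p.1| <= m_alpha al1 a1bar}.
  have [C1 hC1] := Linf_ae_bounded al1; have [C2 hC2] := Linf_ae_bounded a1bar.
  apply: (@Lnrmoo_ae _ _ _ _ _ (C1 + C2)).
  have := ae_muIt_fst hC2; move: hC1; apply: filterS2 => p a b.
  by apply: (le_trans (ler_normB _ _)); exact: lerD.
have := ae_muIt_slice h1.
have := ae_muIt_slice (nrmoo_ae lam2).
have := ae_muOmegat_slice (nrmoo_ae lam1).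
by apply: filterS3 => t a b c t0; split; [exact: c|exact: a|exact: b].
Qed.

Lemma m_alpha_ge0 : 0 <= m_alpha al1 a1bar.
Proof. by rewrite /m_alpha /Lnrm fine_ge0// Lnorm_ge0. Qed.

Lemma M12_ge0 : 0 <= M12 lam1.
Proof. by rewrite /M12 mulr_ge0 ?sqrtr_ge0 ?nrmoo_ge0. Qed.

Lemma measurable_slice_t d' (T' : measurableType d') (f : T' * RR -> R) (t : R) :
  measurable_fun setT f -> measurable_fun setT (fun x => f (x, t)).
Proof. by move=> mf; apply: measurableT_comp mf _. Qed.

Lemma muO_mrestr (f : RR * RR -> \bar R) : measurable_fun setT f -> (forall p, 0 <= f p)%E ->
  (\int[mO]_p f p = \int[leb]_(x in `]0%R, l[) \int[leb]_(y in `]0%R, d[) f (x, y))%E.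
Proof.
move=> mf f0; rewrite ge0_integral_mrestr//.
exact: tonelli_rect.
Qed.

(** Cauchy-Schwarz in [y] against the constant [1] on [(0, d)] produces the factor [d], whence
    [sqrt d] in [M12]. It applies for almost every [x], where the slice of [vx] is square integrable
    and that of [lam1] is bounded. *)
Lemma C12_L2 (t : R) (vx : W) : {ae mO, forall p, `|lam1 (p, t)| <= nrmoo lam1} ->
  C12 lam1 t vx \in Lfun mI 2%:E /\
  nrm (@toL2 _ RR R mI (C12 lam1 t vx)) <= M12 lam1 * nrm vx.
Proof.
move=> hl.
have ml : measurable_fun setT (lam1 : RR * RR * RR -> R) by [].
have mv : measurable_fun setT (vx : RR * RR -> R) by [].
have mlt := measurable_slice_t t ml.
have mF : measurable_fun setT (fun p : RR * RR => lam1 (p, t) * vx p) by exact: measurable_funM.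
have mC : measurable_fun setT (C12 lam1 t vx : RR -> R).
  exact: (measurable_Rintegral_slice _ (mIoo 0 d) mF).
have mv2 : measurable_fun setT (fun p : RR * RR => (vx p ^+ 2)%:E).
  by apply/measurable_EFinP; exact: measurable_funX.
have Iv : (\int[leb]_(x in `]0%R, l[) \int[leb]_(y in `]0%R, d[) (vx (x, y) ^+ 2)%:E
    = (nrm vx ^+ 2)%:E)%E.
  by rewrite EFin_nrm_sqr muO_mrestr// => p; rewrite lee_fin sqr_ge0.
pose G x : \bar R := (\int[leb]_(y in `]0%R, d[) (vx (x, y) ^+ 2)%:E)%E.
have G0 x : (0 <= G x)%E by apply: integral_ge0 => y _; rewrite lee_fin sqr_ge0.
have mG : measurable_fun setT (G : RR -> \bar R).
  have mfB : measurable_fun setT ((fun p : RR * RR => (vx p ^+ 2)%:E) \_ (setT `*` `]0, d[)).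
    apply/(measurable_restrictT _ _).1; first exact: measurableX.
    exact: measurable_funS mv2.
  have -> : G = fubini_F leb ((fun p : RR * RR => (vx p ^+ 2)%:E) \_ (setT `*` `]0, d[)).
    apply/funext => x; rewrite /G integral_mkcond /fubini_F; apply: eq_integral => y _.
    rewrite !patchE; suff -> : ((x, y) \in [set: RR] `*` `]0, d[%classic) = (y \in `]0, d[%classic) by [].
    by apply/idP/idP => /set_mem h; apply/mem_set => //; case: h.
  by apply: measurable_fun_fubini_tonelli_F => // p; rewrite patchE; case: ifPn => // _; rewrite lee_fin sqr_ge0.
have M0 : 0 <= nrmoo lam1 by exact: nrmoo_ge0.
have hl' : {ae leb, forall x, 0 < x < l ->
    {ae leb, forall y, 0 < y < d -> `|lam1 (x, y, t)| <= nrmoo lam1}}.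
  move: hl => /ae_mrestr/ae_slice1; apply: filterS => x hx xI.
  by apply: filterS hx => y + yI; apply; split; rewrite /= in_itv.
have Gfin : {ae leb, forall x, 0 < x < l -> (G x < +oo)%E}.
  have : leb.-integrable `]0, l[ G.
    apply/integrableP; split; first exact: measurable_funTS.
    under eq_integral do rewrite gee0_abs//.
    by rewrite Iv ltry.
  move=> /(integrable_ae (mIoo 0 l)); apply: filterS => x h xI.
  by rewrite -ge0_fin_numE//; apply: h; rewrite /= in_itv.
have Cb : {ae leb, forall x, 0 < x < l -> ((C12 lam1 t vx x ^+ 2)%:E <=
    (nrmoo lam1 ^+ 2 * d)%:E * G x)%E}.
  move: hl' Gfin; apply: filterS2 => x hx + xI; have {}hx := hx xI => /(_ xI) Gx.
  have cd0 : 0 <= nrmoo lam1 ^+ 2 * d by rewrite mulr_ge0 ?sqr_ge0// ltW.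
  have mvx : measurable_fun setT (fun y : RR => vx (x, y)) by apply: measurableT_comp mv _.
  have mlx : measurable_fun setT (fun y : RR => lam1 (x, y, t)).
    by apply: (@measurableT_comp _ _ _ _ _ _ (fun p : RR * RR => lam1 (p, t))).
  have iv2 : leb.-integrable `]0, d[ (EFin \o (fun y : RR => vx (x, y) ^+ 2)).
    apply: ge0_integrable => //; first by apply: measurable_funTS; exact: measurable_funX.
    by move=> y _; exact: sqr_ge0.
  have mf : measurable_fun (`]0, d[ : set RR) (fun y : RR => lam1 (x, y, t) * vx (x, y)).
    by apply: measurable_funTS; exact: measurable_funM.
  have bf : {ae leb, forall y, y \in (`]0, d[%classic : set RR) ->
      (lam1 (x, y, t) * vx (x, y)) ^+ 2 <= nrmoo lam1 ^+ 2 * vx (x, y) ^+ 2}.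
    apply: filterS hx => y hy /set_mem; rewrite /= in_itv/= => /hy h.
    by rewrite exprMn ler_wpM2r ?sqr_ge0// -real_normK ?num_real// lerXn2r ?nnegrE.
  have if2 : leb.-integrable `]0, d[ (EFin \o (fun y : RR => (lam1 (x, y, t) * vx (x, y)) ^+ 2)).
    apply: (@integrable_aeRle _ _ _ leb _ _ (fun y : RR => nrmoo lam1 ^+ 2 * vx (x, y) ^+ 2)) => //.
    - exact: measurable_funX.
    - apply: filterS bf => y h yI; rewrite ger0_norm ?sqr_ge0//; apply: h; exact/mem_set.
    - exact: integrable_RZl.
  have mc1 : measurable_fun (`]0, d[ : set RR) (cst 1 : R -> R) by exact: measurable_cst.
  have := Rintegral_cauchy_schwarz (mIoo 0 d) mf mc1 if2 (cst1_sqr 0 d).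
  rewrite [X in _ * X](@eq_Rintegral _ _ _ _ _ (fun _ : RR => 1)); last by move=> y _; rewrite /= expr1n.
  rewrite Rintegral_oo_cst ?(ltW d_gt0)// mul1r subr0.
  rewrite (@eq_Rintegral _ _ _ _ _ (fun y : RR => lam1 (x, y, t) * vx (x, y))
     (fun y : RR => lam1 (x, y, t) * vx (x, y) * cst 1 y)); last by move=> y _; rewrite mulr1.
  rewrite -/(C12 lam1 t vx x) => cs.
  have -> : G x = (\int[leb]_(y in `]0, d[) (vx (x, y) ^+ 2))%:E.
    by rewrite (EFin_Rintegral (mIoo 0 d) iv2).
  rewrite -EFinM lee_fin (le_trans cs)// mulrAC ler_wpM2r ?(ltW d_gt0)//.
  rewrite -(@RintegralZl _ _ _ leb _ (fun y : RR => vx (x, y) ^+ 2) (nrmoo lam1 ^+ 2))//.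
  apply: le_ae_Rintegral => //; first exact: integrable_RZl.
  by apply: filterS bf => y h yI; apply: h; exact/mem_set.
have le : (\int[mI]_x (C12 lam1 t vx x ^+ 2)%:E <= ((M12 lam1 * nrm vx) ^+ 2)%:E)%E.
  rewrite ge0_integral_mrestr//; last 2 first.
  - by apply/measurable_EFinP; exact: measurable_funX.
  - by move=> x; rewrite lee_fin sqr_ge0.
  have -> : (((M12 lam1 * nrm vx) ^+ 2)%:E = (nrmoo lam1 ^+ 2 * d)%:E * (nrm vx ^+ 2)%:E)%E.
    by rewrite -EFinM /M12 !exprMn sqr_sqrtr ?(ltW d_gt0)// [d * _]mulrC.
  have cd0 : (0 <= (nrmoo lam1 ^+ 2 * d)%:E)%E by rewrite lee_fin mulr_ge0 ?sqr_ge0// ltW.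
  have mGI : measurable_fun (`]0, l[ : set RR) G by exact: measurable_funTS.
  rewrite -Iv -/G -ge0_integralZl//; last by move=> x _; exact: G0.
  apply: ae_ge0_le_integral => //.
  - by move=> x _; rewrite lee_fin sqr_ge0.
  - by apply/measurable_EFinP; apply: measurable_funTS; exact: measurable_funX.
  - by move=> x _; rewrite mule_ge0//; exact: (G0 x).
  - by apply: measurable_funeM; exact: mGI.
have fL : C12 lam1 t vx \in Lfun mI 2%:E.
  by apply: (@Lfun2P _ RR R mI) => //; apply: (le_lt_trans le); exact: ltry.
split=> //; rewrite -(@ler_pXn2r _ 2)// ?nnegrE ?mulr_ge0 ?nrm_ge0 ?M12_ge0//.
by rewrite -lee_fin EFin_nrm_sqr (@toL2E _ RR R mI).
Qed.

(** The forcing left over when the nominal operator is split off from the [u]-equation. As [toL2] is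
    total, it is an element of [X] at every time, and the intended one at regular times. *)
Definition coupling (t : R) (ut : X) (vxt : W) : X :=
  @toL2 _ RR R mI (fun x => (al1 (x, t) - a1bar x) * ut x) -
  @toL2 _ RR R mI (C12 lam1 t vxt).

Lemma couplingP (t : R) (ut : X) (vxt : W) : regular_time t ->
  nrm (coupling t ut vxt) <= m_alpha al1 a1bar * nrm ut + M12 lam1 * nrm vxt /\
  forall phi : X, dotp mI (fun x => al1 (x, t) * ut x) phi - dotp mI (C12 lam1 t vxt) phi =
    dotp mI (coupling t ut vxt) phi + dotp mI (mulop a1bar ut) phi.
Proof.
move=> [h1 h2 _].
have ma : measurable_fun setT (al1 : RR * RR -> R) by [].
have mat := measurable_slice_t t ma.
have mab : measurable_fun setT (a1bar : RR -> R) by [].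
have mu' : measurable_fun setT (ut : RR -> R) by [].
have mf : measurable_fun setT (fun x : RR => (al1 (x, t) - a1bar x) * ut x).
  by apply: measurable_funM => //; exact: measurable_funB.
have [|fL fn] := @Lfun2_dom _ _ _ mI (fun x : RR => (al1 (x, t) - a1bar x) * ut x) ut
  (m_alpha al1 a1bar) m_alpha_ge0 mf.
  by apply: filterS h1 => x hx; rewrite normrM ler_wpM2r.
have [CL Cn] := C12_L2 vxt h2.
split; first by apply: (le_trans (nrmB _ _)); exact: lerD.
move=> phi; rewrite /coupling dotpBl.
rewrite [X in _ = _ - dotp mI X _ + _](@toL2E _ RR R mI)//.
rewrite addrAC; congr (_ - _); rewrite -dotpDl.
apply: eq_Rintegral => x _; congr (_ * _).
rewrite -[RHS]/(toL2 _ x + mulop a1bar ut x) toL2E// mulop_E; ring.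
Qed.

(** [C21 lam2 t ut] is constant in [y], so the integration over [(0, d)] contributes the factor
    [d]. *)
Lemma C21_bound (t : R) (ut : X) (psi : W) : regular_time t ->
  `|dotp mO (C21 lam2 t ut) psi| <= Num.sqrt d * nrmoo lam2 * nrm ut * nrm psi.
Proof.
move=> [_ _ h].
have ml : measurable_fun setT (lam2 : RR * RR -> R) by [].
have mlt := measurable_slice_t t ml.
have mu' : measurable_fun setT (ut : RR -> R) by [].
have mF : measurable_fun setT (C21 lam2 t ut : RR * RR -> R).
  apply: measurable_funM.
    exact: (@measurableT_comp _ _ _ _ _ _ (fun x : RR => lam2 (x, t)) _ fst).
  exact: (@measurableT_comp _ _ _ _ _ _ (ut : RR -> R) _ fst).
have M0 : 0 <= nrmoo lam2 by exact: nrmoo_ge0.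
have C0 : 0 <= Num.sqrt d * nrmoo lam2 * nrm ut by rewrite !mulr_ge0 ?sqrtr_ge0 ?nrm_ge0.
have le : (\int[mO]_p (C21 lam2 t ut p ^+ 2)%:E <=
    ((Num.sqrt d * nrmoo lam2 * nrm ut) ^+ 2)%:E)%E.
  rewrite muO_mrestr; last 2 first.
  - by apply/measurable_EFinP; exact: measurable_funX.
  - by move=> p; rewrite lee_fin sqr_ge0.
  have -> : ((Num.sqrt d * nrmoo lam2 * nrm ut) ^+ 2)%:E =
     ((nrmoo lam2 ^+ 2 * d)%:E * \int[leb]_(x in `]0%R, l[) (ut x ^+ 2)%:E)%E.
    rewrite -ge0_integral_mrestr//; last 2 first.
    - by apply/measurable_EFinP; exact: measurable_funX.
    - by move=> x; rewrite lee_fin sqr_ge0.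
    by rewrite -EFin_nrm_sqr -EFinM !exprMn sqr_sqrtr ?(ltW d_gt0)// [d * _]mulrC.
  have cd0 : 0 <= nrmoo lam2 ^+ 2 * d by rewrite mulr_ge0 ?sqr_ge0// ltW.
  have mu2 : measurable_fun (`]0, l[ : set RR) (fun x => (ut x ^+ 2)%:E).
    by apply/measurable_EFinP; apply: measurable_funTS; exact: measurable_funX.
  rewrite -ge0_integralZl//; last by move=> x _; rewrite lee_fin sqr_ge0.
  apply: ae_ge0_le_integral => //.
  - by move=> x _; apply: integral_ge0 => y _; rewrite lee_fin sqr_ge0.
  - apply: (@eq_measurable_fun _ _ RR _ _ (fun x => ((C21 lam2 t ut (x, 0)) ^+ 2 * d)%:E)).
      move=> x _; rewrite /C21/= integral_cst//= lebesgue_measure_itv/= lte_fin d_gt0.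
      by rewrite -EFinD subr0 EFinM.
    apply/measurable_EFinP; apply: measurable_funTS; apply: measurable_funM => //.
    by apply: measurable_funX; exact: measurable_funM.
  - by move=> x _; rewrite -EFinM lee_fin mulr_ge0 ?sqr_ge0.
  - exact: measurable_funeM.
  move/ae_mrestr: h; apply: filterS => x hx xI.
  rewrite /C21/= integral_cst//= lebesgue_measure_itv/= lte_fin d_gt0 -EFinD subr0.
  rewrite -!EFinM lee_fin exprMn mulrAC ler_wpM2r ?sqr_ge0// ler_wpM2r ?(ltW d_gt0)//.
  by rewrite -real_normK ?num_real// lerXn2r ?nnegrE//; exact: hx.
have fL : C21 lam2 t ut \in Lfun mO 2%:E.
  by apply: (@Lfun2P _ _ R mO) => //; apply: (le_lt_trans le); exact: ltry.
have -> : dotp mO (C21 lam2 t ut) psi = dotp mO (@toL2 _ _ R mO (C21 lam2 t ut)) psi.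
  by rewrite toL2E.
apply: (le_trans (cauchy_schwarz _ _)); rewrite ler_wpM2r ?nrm_ge0//.
rewrite -(@ler_pXn2r _ 2)// ?nnegrE ?nrm_ge0//.
by rewrite -lee_fin EFin_nrm_sqr toL2E.
Qed.

End coefficients.

(** * Continuous functions and [H^1] on the rectangle *)

Section plane_functions.
Context {R : realType}.
Notation leb := (@lebesgue_measure R).
Notation RR := (measurableTypeR R).
Variables (l d : R).
Notation mO := (muOmega l d).
Notation W := (XO l d).

(** Measurability refers to the product structure, generated by rectangles: a superlevel set is
    open, hence a countable union of rectangles with rational corners. *)
Lemma continuous2_measurable (f : R * R -> R) : continuous f ->
  measurable_fun setT (f : RR * RR -> R).
Proof.
move=> cf; apply: (measurability _ (RGenOInfty.measurableE R)) => //.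
move=> _ [_ [a ->] <-]; rewrite setTI.
pose I := ((rat * rat) * (rat * rat))%type.
pose rect (i : I) : set (RR * RR) :=
  `](ratr i.1.1 : R), ratr i.1.2[%classic `*` `](ratr i.2.1 : R), ratr i.2.2[%classic.
pose B : set I := [set i | rect i `<=` f @^-1` `]a, +oo[].
have -> : f @^-1` `]a, +oo[ = \bigcup_(i in B) rect i.
  apply/seteqP; split=> [[x y] /= |p [i Bi]]; last exact: Bi.
  rewrite in_itv/= andbT => fa.
  have /cvgrPdist_lt/(_ (f (x, y) - a)) := cf (x, y).
  rewrite subr_gt0 => /(_ fa)/nbhs_ballP[e /= e0 he].
  have [q1] := @rat_in_itvoo R (x - e) x (ltac:(lra)).
  have [q2] := @rat_in_itvoo R x (x + e) (ltac:(lra)).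
  have [q3] := @rat_in_itvoo R (y - e) y (ltac:(lra)).
  have [q4] := @rat_in_itvoo R y (y + e) (ltac:(lra)).
  rewrite !in_itv/= => /andP[a4 b4] /andP[a3 b3] /andP[a2 b2] /andP[a1 b1].
  exists ((q1, q2), (q3, q4)); last by rewrite /rect/=; split=> /=; rewrite in_itv/= ?b1 ?a2 ?b3 ?a4.
  move=> [x' y'] [] /=; rewrite !in_itv/= => /andP[c1 c2] /andP[c3 c4]; rewrite andbT.
  have /= := he (x', y').
  have hb : ball (x, y) e (x', y').
    by split; rewrite /ball/= ltr_norml; apply/andP; split; lra.
  by move=> /(_ hb); rewrite ltr_norml => /andP[h1 h2]; lra.
rewrite bigcup_mkcond; apply: countable_bigcupT_measurable; first exact: countableP.
by move=> i; case: ifPn => // _; exact: measurableX.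
Qed.

Lemma continuous2_Lfun (f : R * R -> R) : continuous f -> f \in Lfun mO 2%:E.
Proof.
move=> cf; have mf := continuous2_measurable cf.
pose Q : set (R * R) := `[0, l]%classic `*` `[0, d]%classic.
have [C hC] : exists C : R, forall p, Q p -> `|f p| <= C.
  have cQ : compact Q by apply: compact_setX; exact: segment_compact.
  have [Q0|/set0P Qn] := eqVneq Q set0; first by exists 0 => p; rewrite Q0.
  have cn : {within Q, continuous (fun p => `|f p|)}.
    by apply: continuous_subspaceT => p; apply: continuous_comp; [exact: cf|exact: norm_continuous].
  have [c _ hc] := compact_EVT_max Qn cQ cn.
  by exists `|f c| => p Qp; apply: hc; exact: mem_set.
apply: Lfun2P => //.
have fin : (mO setT < +oo)%E.
  have -> : mO setT = (leb \x leb)%E (setT `&` (`]0, l[%classic `*` `]0, d[%classic)) by [].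
  have -> : (setT `&` (`]0, l[%classic `*` `]0, d[%classic)) = (`]0, l[%classic `*` `]0, d[%classic : set (RR * RR)).
    exact: setTI.
  rewrite (product_measure1E _ _ (mIoo 0 l) (mIoo 0 d)).
  have E (a : R) : leb (`]0, a[%classic : set RR) = (if 0 < a then a else 0)%:E.
    by rewrite lebesgue_measure_itv/= lte_fin; case: ifPn => // _; rewrite oppr0 adde0.
  rewrite (_ : (_ * _)%E = ((if 0 < l then l else 0)%:E * (if 0 < d then d else 0)%:E)%E).
    by rewrite -EFinM ltry.
  by congr (_ * _)%E; exact: E.
apply: (@le_lt_trans _ _ (\int[mO]_p (C ^+ 2)%:E)%E).
  apply: ae_ge0_le_integral => //.
  - by move=> x _; rewrite lee_fin sqr_ge0.
  - by apply/measurable_EFinP; exact: measurable_funX.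
  - by move=> x _; rewrite lee_fin sqr_ge0.
  apply/ae_mrestr; apply: nearW => -[x y] [/= xl yd] _; rewrite lee_fin.
  have h : `|f (x, y)| <= C.
    by apply: hC; split=> /=; move: xl yd; rewrite !in_itv/= => /andP[? ?] /andP[? ?]; apply/andP; split; lra.
  by rewrite -real_normK ?num_real// lerXn2r ?nnegrE// (le_trans _ h).
rewrite integral_cst// lte_mul_pinfty// ?lee_fin ?sqr_ge0//.
Qed.

Lemma dotp_continuous2_lin (f : R * R -> R) (c : R) (g h : W) : continuous f ->
  dotp mO (c *: g + h : W) f = c * dotp mO g f + dotp mO h f.
Proof.
move=> cf; have E (k : W) : dotp mO k f = dotp mO k (@toL2 _ _ R mO f).
  by rewrite toL2E//; exact: continuous2_Lfun.
by rewrite !E dotpDl dotpZl.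
Qed.

Lemma H1_lin (c : R) (psi px py psi' px' py' : W) : in_H1 psi px py -> in_H1 psi' px' py' ->
  in_H1 (c *: psi + psi' : W) (c *: px + px' : W) (c *: py + py' : W).
Proof.
move=> h h' eta te; have [a1 a2] := h eta te; have [b1 b2] := h' eta te.
have [se _] := te.
have c0 : continuous eta by have [] := se [::].
have cx : continuous (pdx eta) by case: (se [:: true]) => h1 _ _; exact: h1.
have cy : continuous (pdy eta) by case: (se [:: false]) => h1 _ _; exact: h1.
split.
  by rewrite (dotp_continuous2_lin _ _ _ cx) (dotp_continuous2_lin _ _ _ c0) a1 b1; ring.
by rewrite (dotp_continuous2_lin _ _ _ cy) (dotp_continuous2_lin _ _ _ c0) a2 b2; ring.
Qed.

Lemma dotp_0_raw (f : R * R -> R) : dotp mO (0 : W) f = 0.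
Proof.
rewrite /dotp (@eq_Rintegral _ _ _ _ _ (cst 0)); last by move=> x _; rewrite mul0r.
by rewrite Rintegral_cst// mul0r.
Qed.

Lemma H1_0 : in_H1 (0 : W) 0 0.
Proof. by move=> eta _; rewrite !dotp_0_raw oppr0. Qed.

Lemma H01_0 : 0 < l -> in_H01 (0 : XI l) 0.
Proof.
move=> l0; apply/in_H01P => //; split.
  by apply: wderivI => // eta te; rewrite !dotp0l oppr0.
have t0 : test1 0 l (fun=> 0).
  split; first by move=> n x; rewrite (_ : derive1n n _ = fun=> 0);
    [exact: derivable_cst|elim: n => //= n ->; apply/funext => y; rewrite derive1_cst].
  by exists set0; split=> //; exact: compact0.
have E (f : R -> R) : f = (fun=> 0) -> nrm (0 - toXI l f : XI l) = 0.
  move=> ->; apply/aeq_nrmB0; rewrite toL2_test//; exact: aeq_refl.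
move=> e e0; exists (fun=> 0) => //; rewrite !E//.
by apply/funext => y; rewrite derive1_cst.
Qed.

End plane_functions.

(** * Increments and energies of a weak solution *)

Section weak_solution.
Context {R : realType}.
Notation leb := (@lebesgue_measure R).
Notation RR := (measurableTypeR R).
Variables (l d : R) (l_gt0 : 0 < l).
Notation mI := (muI 0 l).
Notation mO := (muOmega l d).
Notation X := (XI l).
Notation W := (XO l d).
Hypothesis dense : forall (phi : X) (e : R), 0 < e -> exists2 eta, test1 0 l eta &
  nrm (phi - toXI l eta) < e.
Variables (u ux : R -> X) (v vx vy : R -> W) (w : R -> X -> W -> R).
Hypothesis u_cont : forall t e : R, 0 <= t -> 0 < e -> exists2 del : R, 0 < del &
  forall s, 0 <= s -> `|s - t| < del -> nrm (u s - u t) <= e.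
Hypothesis v_cont : forall t e : R, 0 <= t -> 0 < e -> exists2 del : R, 0 < del &
  forall s, 0 <= s -> `|s - t| < del -> nrm (v s - v t) <= e.
Hypothesis w_dual : forall tau, 0 < tau -> L2_dual tau w.
Hypothesis w_deriv : forall tau, 0 < tau -> time_derivative tau u v w.
Hypothesis uv_V : {ae leb, forall t, 0 < t -> in_V (u t) (ux t) (v t) (vx t) (vy t)}.
Hypothesis ux_B : forall tau, 0 < tau -> Bochner_L2 0 tau ux.
Hypothesis v_B : forall tau, 0 < tau -> Bochner_L2 0 tau v.
Hypothesis vx_B : forall tau, 0 < tau -> Bochner_L2 0 tau vx.
Hypothesis vy_B : forall tau, 0 < tau -> Bochner_L2 0 tau vy.

(** Writes [g] as [(g - f) + f] in the shape [a *: phi1 + phi2] in which linearity of [w] is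
    stated. *)
Lemma L2_recomb dT' (T' : measurableType dT') (mu : {measure set T' -> \bar R}) (f g : L2 mu) :
  1 *: (-1 *: f + g) + f = g.
Proof. by rewrite scale1r scaleN1r addrAC addNr add0r. Qed.

Lemma nrm_recomb dT' (T' : measurableType dT') (mu : {measure set T' -> \bar R}) (c : R)
  (f g : L2 mu) : nrm (-1 *: (c *: f) + c *: g) ^+ 2 = c ^+ 2 * nrm (g - f) ^+ 2.
Proof.
rewrite (_ : -1 *: (c *: f) + c *: g = c *: (g - f)).
  by rewrite nrmZ exprMn real_normK ?num_real.
by rewrite scaleN1r addrC scalerBr.
Qed.

Lemma ae_and (P Q : R -> Prop) : {ae leb, forall t, P t} -> {ae leb, forall t, Q t} ->
  {ae leb, forall t, P t /\ Q t}.
Proof. by apply: filterS2. Qed.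

Lemma near_and (P Q : nat -> Prop) : (\forall n \near \oo, P n) -> (\forall n \near \oo, Q n) ->
  \forall n \near \oo, P n /\ Q n.
Proof. by apply: filterS2. Qed.

Lemma L2_sqr_integrable (a b : R) (c : L2 (muI a b)) :
  leb.-integrable `]a, b[ (EFin \o (fun t => c t ^+ 2)).
Proof.
have mc : measurable_fun setT (c : RR -> R) by [].
have := L2_mul_integrable c c.
move=> /(integrable_mrestr leb (mIoo a b) _).1 h.
have -> : (fun t => c t ^+ 2) = c \* c by apply/funext => t; rewrite expr2.
by apply: h; apply/measurable_EFinP; exact: measurable_funM.
Qed.

(** For a fixed test pair the scalar pairing is continuous, and the dual norm bound [c t] makes its
    weak derivative square integrable in time, so [weak_FTC] applies. *)
Lemma weak_increment phi dphi psi px py : in_V phi dphi psi px py ->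
  forall a b : R, 0 <= a -> a <= b ->
  leb.-integrable `]a, b[ (EFin \o (fun t => w t phi psi)) /\
  dotp mI (u b) phi + dotp mO (v b) psi - (dotp mI (u a) phi + dotp mO (v a) psi) =
  \int[leb]_(t in `]a, b[) w t phi psi.
Proof.
move=> hV.
have hw (tau : R) : 0 < tau -> measurable_fun (`]0, tau[ : set RR) (fun t => w t phi psi) /\
    leb.-integrable `]0, tau[ (EFin \o (fun t => w t phi psi ^+ 2)).
  move=> tau0; have [_ /(_ _ _ _ _ _ hV) mw [c hc]] := w_dual tau0; split=> //.
  apply: (@integrable_aeRle _ _ _ leb _ _ (fun t => Vnorm dphi psi px py ^+ 2 * c t ^+ 2)) => //.
  - exact: measurable_funX.
  - apply: filterS hc => t ht; rewrite /= in_itv/= => t0.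
    rewrite ger0_norm ?sqr_ge0// -real_normK ?num_real// mulrC -exprMn.
    by rewrite lerXn2r ?nnegrE ?(le_trans (normr_ge0 _) (ht t0 _ _ _ _ _ hV))// (ht t0 _ _ _ _ _ hV).
  - by apply: integrable_RZl => //; exact: L2_sqr_integrable.
move=> a b a0 ab; split.
  have b1 : 0 < b + 1 by lra.
  have [mw w2] := hw _ b1.
  have mc1 : measurable_fun (`]0, b + 1[ : set RR) (cst 1 : R -> R) by exact: measurable_cst.
  have iw : leb.-integrable `]0, b + 1[ (EFin \o (fun t => w t phi psi)).
    have := integrable_sqrM (mIoo _ _) mw mc1 w2 (cst1_sqr 0 (b + 1)).
    by apply: eq_integrable => // x _; rewrite /= mulr1.
  by apply: integrable_oo_sub iw => //; lra.
apply: (weak_FTC l_gt0 dense (f := fun t => dotp mI (u t) phi + dotp mO (v t) psi)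
  (w := fun t => w t phi psi)) => //.
  move=> t e t0 e0.
  pose C := nrm phi + nrm psi + 1.
  have C0 : 0 < C by rewrite /C; have := nrm_ge0 phi; have := nrm_ge0 psi; lra.
  have [d1 d10 h1] := u_cont t0 (divr_gt0 e0 C0).
  have [d2 d20 h2] := v_cont t0 (divr_gt0 e0 C0).
  exists (Num.min d1 d2); first by rewrite lt_min d10.
  move=> s s0; rewrite lt_min => /andP[s1 s2].
  rewrite (_ : _ - _ = dotp mI (u s - u t) phi + dotp mO (v s - v t) psi); last first.
    by rewrite !dotpBl; ring.
  apply: (le_trans (ler_normD _ _)).
  apply: (@le_trans _ _ (e / C * nrm phi + e / C * nrm psi)).
    apply: lerD; apply: (le_trans (cauchy_schwarz _ _)); apply: ler_wpM2r; rewrite ?nrm_ge0//.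
      exact: h1.
    exact: h2.
  rewrite -mulrDr -mulrA ger_pMr//.
  by rewrite mulrC ler_pdivrMr// mul1r /C; lra.
by move=> tau eta tau0 te; exact: (w_deriv tau0 te hV).
Qed.

Lemma V_scale (c1 c2 : R) t : in_V (u t) (ux t) (v t) (vx t) (vy t) ->
  in_V (c1 *: u t : X) (c1 *: ux t : X) (c2 *: v t : W) (c2 *: vx t : W) (c2 *: vy t : W).
Proof.
move=> [h1 h2]; split.
  by have := H01_lin l_gt0 c1 h1 (H01_0 l_gt0); rewrite !addr0.
by have := H1_lin c2 h2 (@H1_0 R l d); rewrite !addr0.
Qed.

Lemma V_lin (c : R) (phi dphi phi' dphi' : X) (psi px py psi' px' py' : W) :
  in_V phi dphi psi px py -> in_V phi' dphi' psi' px' py' ->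
  in_V (c *: phi + phi' : X) (c *: dphi + dphi' : X) (c *: psi + psi' : W)
    (c *: px + px' : W) (c *: py + py' : W).
Proof. by move=> [h1 h2] [h1' h2']; split; [exact: H01_lin|exact: H1_lin]. Qed.

(** Convexity of the square: the increment is at most twice its linearization at the later point.
    That point can then be frozen as the test function of [weak_increment]. *)
Lemma sqr_diff_le dT' (T' : measurableType dT') (mu : {measure set T' -> \bar R}) (f g : L2 mu) :
  nrm f ^+ 2 - nrm g ^+ 2 <= 2 * dotp mu (f - g) f.
Proof.
rewrite -subr_ge0 !nrm_sqr dotpBl (_ : _ - _ = dotp mu (f - g) (f - g)); first exact: dotp_ge0.
by rewrite dotpBl !dotpBr [dotp mu f g]dotpC; ring.
Qed.

(** [w r] is tested against the state at the later time [t]; replacing that by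
    the state at [r] costs [c r] times the [V]-distance of the two. *)
Lemma energy_bound (c1 c2 : R) (M : R -> R) : 0 <= c1 -> 0 <= c2 ->
  (forall tau, 0 < tau -> leb.-integrable `]0, tau[ (EFin \o M)) ->
  {ae leb, forall t, 0 < t -> 2 * w t (c1 *: u t) (c2 *: v t) <= M t} ->
  forall a b, 0 <= a -> a <= b ->
    c1 * nrm (u b) ^+ 2 + c2 * nrm (v b) ^+ 2 - (c1 * nrm (u a) ^+ 2 + c2 * nrm (v a) ^+ 2) <=
    \int[leb]_(t in `]a, b[) M t.
Proof.
move=> c10 c20 iM wM a b a0 ab.
have tau0 : 0 < b + 1 by lra.
set tau := b + 1 in tau0 *.
have [wlin _ [c hc]] := w_dual tau0.
(* Squared [V]-distance of the weighted states at [t] and [r]; its averages are small by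
   [mean_oscillation], applied to each component. *)
pose N2 t r := c1 ^+ 2 * nrm (ux t - ux r) ^+ 2 + c2 ^+ 2 *
  (nrm (v t - v r) ^+ 2 + nrm (vx t - vx r) ^+ 2 + nrm (vy t - vy r) ^+ 2).
have iN dT' (T' : measurableType dT') (mu : {measure set T' -> \bar R}) (f : R -> L2 mu) (t s s' : R) :
    Bochner_L2 0 tau f -> 0 <= s -> s' <= tau ->
    leb.-integrable `]s, s'[ (EFin \o (fun r => nrm (f t - f r) ^+ 2)).
  move=> Bf s0 s'tau; have Bs := Bochner_sub s0 s'tau Bf.
  by apply: integrable_nrm_sqrB; [case: Bs|exact: Bochner_nrm_sqr].
have iN2 t s s' : 0 <= s -> s' <= tau -> leb.-integrable `]s, s'[ (EFin \o N2 t).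
  move=> s0 s1; apply: integrable_RD => //; apply: integrable_RZl => //.
    by apply: iN => //; exact: ux_B.
  apply: integrable_RD => //; [apply: integrable_RD => //|]; apply: iN => //;
    [exact: v_B|exact: vx_B|exact: vy_B].
apply: (@energy_le R tau (fun t => c1 * nrm (u t) ^+ 2 + c2 * nrm (v t) ^+ 2) M
  (fun t => c t ^+ 2) N2) => //; last by rewrite /tau ltrDl.
- move=> t e /andP[t0 _] e0.
  pose C := c1 * (2 * nrm (u t) + 1) + c2 * (2 * nrm (v t) + 1) + 1.
  have nu := nrm_ge0 (u t); have nv := nrm_ge0 (v t).
  have p1 : 0 <= c1 * (2 * nrm (u t) + 1) by rewrite mulr_ge0//; lra.
  have p2 : 0 <= c2 * (2 * nrm (v t) + 1) by rewrite mulr_ge0//; lra.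
  have C0 : 0 < C by rewrite /C; lra.
  pose e' := Num.min 1 (e / C).
  have e'0 : 0 < e' by rewrite lt_min ltr01 divr_gt0.
  have [e'1 e'C] : e' <= 1 /\ e' <= e / C by rewrite /e' !ge_min !lexx orbT.
  have [d1 d10 h1] := u_cont t0 e'0.
  have [d2 d20 h2] := v_cont t0 e'0.
  exists (Num.min d1 d2); first by rewrite lt_min d10.
  move=> s s0; rewrite lt_min => /andP[s1 s2].
  have key dT' (T' : measurableType dT') (mu : {measure set T' -> \bar R}) (f g : L2 mu) :
      nrm (f - g) <= e' -> `|nrm f ^+ 2 - nrm g ^+ 2| <= (2 * nrm g + 1) * e'.
    move=> fg; have fg0 : 0 <= nrm f + nrm g by rewrite addr_ge0 ?nrm_ge0.
    rewrite subr_sqr normrM (ger0_norm fg0).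
    rewrite mulrC; apply: ler_pM => //; rewrite ?addr_ge0 ?nrm_ge0//.
      by have := nrm_le_dist f g; lra.
    exact: le_trans (ler_dist_nrm _ _) fg.
  have k1 := key _ _ _ _ _ (h1 s s0 s1); have k2 := key _ _ _ _ _ (h2 s s0 s2).
  rewrite (_ : _ - _ = c1 * (nrm (u s) ^+ 2 - nrm (u t) ^+ 2) +
    c2 * (nrm (v s) ^+ 2 - nrm (v t) ^+ 2)); last by ring.
  apply: (le_trans (ler_normD _ _)); rewrite !normrM (ger0_norm c10) (ger0_norm c20).
  apply: (@le_trans _ _ (C * e')).
    apply: (le_trans (lerD (ler_wpM2l c10 k1) (ler_wpM2l c20 k2))).
    rewrite (_ : C * e' = c1 * ((2 * nrm (u t) + 1) * e') + c2 * ((2 * nrm (v t) + 1) * e') + e');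
      last by rewrite /C; ring.
    by rewrite lerDl ltW.
  by rewrite mulrC -ler_pdivlMr.
- exact: iM.
- exact: L2_sqr_integrable.
- have := uv_V; apply: filterS => t Vt /andP[t0 tt] s dd /andP[s0 st] dd0.
  have {}Vt := Vt t0; have Vc := V_scale c1 c2 Vt.
  have [iw wE] := weak_increment Vc (ltW s0) (ltW st).
  have stau : 0 <= s /\ t <= tau by split; exact: ltW.
  have [ss0 ttau] := stau.
  apply: (@le_trans _ _ (2 * \int[leb]_(r in `]s, t[) w r (c1 *: u t) (c2 *: v t))).
    rewrite -wE !dotpZr.
    have k1 := ler_wpM2l c10 (sqr_diff_le (u t) (u s)).
    have k2 := ler_wpM2l c20 (sqr_diff_le (v t) (v s)).
    by move: k1 k2; rewrite !dotpBl; lra.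
  have iMs := integrable_oo_sub ss0 ttau (iM _ tau0).
  have ics := integrable_oo_sub ss0 ttau (L2_sqr_integrable c).
  have iNs := iN2 t s t ss0 ttau.
  rewrite -(@RintegralZl _ _ _ leb _ _ 2)//.
  rewrite -(@RintegralZl _ _ _ leb _ (fun t => c t ^+ 2) dd)//.
  rewrite -(@RintegralZl _ _ _ leb _ (N2 t) dd^-1)//.
  have i1 := integrable_RZl (mIoo s t) dd ics; have i2 := integrable_RZl (mIoo s t) dd^-1 iNs.
  rewrite -RintegralD// -RintegralD//; last exact: integrable_RD.
  apply: le_ae_Rintegral => //.
  - exact: integrable_RZl.
  - by apply: integrable_RD => //; exact: integrable_RD.
  have := ae_and (ae_and wM hc) (ae_and wlin uv_V); apply: filterS => r [[hM hcr] [hlin hV]].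
  rewrite /= in_itv/= => /andP[sr rt].
  have r0 : 0 < r by exact: lt_trans sr.
  have rtau : 0 < r < tau by rewrite r0 (lt_trans rt).
  have {}hV := hV r0; have Vr := V_scale c1 c2 hV; have {}hM := hM r0.
  have Vd := V_lin (-1) Vr Vc.
  have := hlin rtau 1 _ _ _ _ _ _ _ _ _ _ Vd Vr.
  rewrite !L2_recomb mul1r => ->.
  have hb := hcr rtau _ _ _ _ _ Vd.
  have E : Vnorm (-1 *: (c1 *: ux r) + c1 *: ux t : X) (-1 *: (c2 *: v r) + c2 *: v t : W)
     (-1 *: (c2 *: vx r) + c2 *: vx t : W) (-1 *: (c2 *: vy r) + c2 *: vy t : W) = Num.sqrt (N2 t r).
    rewrite /Vnorm /N2; congr Num.sqrt; rewrite !nrm_recomb; ring.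
  rewrite E in hb.
  have N0 : 0 <= N2 t r.
    rewrite /N2; apply: addr_ge0; apply: mulr_ge0; rewrite ?sqr_ge0//.
    by do 2 (apply: addr_ge0; last exact: sqr_ge0); exact: sqr_ge0.
  set x := w r _ _ in hb *; set y := w r _ _ in hM *.
  have x1 : x <= c r * Num.sqrt (N2 t r) by exact: le_trans (ler_norm _) hb.
  (* Young's inequality with the free parameter [dd], which [energy_le] sends to zero. *)
  have x2 : 2 * (c r * Num.sqrt (N2 t r)) <= dd * c r ^+ 2 + dd^-1 * N2 t r.
    rewrite -[in leRHS](sqr_sqrtr N0) -subr_ge0.
    rewrite (_ : _ - _ = dd^-1 * (dd * c r - Num.sqrt (N2 t r)) ^+ 2); last by field; rewrite gt_eqF.
    by rewrite mulr_ge0 ?invr_ge0 ?sqr_ge0 ?ltW.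
  rewrite mulrDr [leLHS]addrC -[leRHS]addrA; apply: lerD => //; apply: le_trans x2; exact: ler_wpM2l.
move=> a1 b1 eps a10 ab1 b1t eps0.
pose C := c1 ^+ 2 + 3 * c2 ^+ 2 + 1.
have C0 : 0 < C by rewrite /C; have := sqr_ge0 c1; have := sqr_ge0 c2; lra.
have ec : 0 < eps / C by exact: divr_gt0.
have mo dT' (T' : measurableType dT') (mu : {measure set T' -> \bar R}) (f : R -> L2 mu) :
    (forall tau, 0 < tau -> Bochner_L2 0 tau f) ->
  \forall n \near \oo, exists2 theta : R -> R,
    leb.-integrable `]a1, b1[ (EFin \o theta) /\
      \int[leb]_(t in `]a1, b1[) theta t <= eps / C * hstep n &
    forall t, a1 < t < b1 ->
      \int[leb]_(r in `]t - hstep n, t[) (nrm (f t - f r) ^+ 2) <= theta t.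
  move=> Bf; have Bb := Bf b1 (lt_trans a10 ab1).
  by apply: (@mean_oscillation R _ _ _ 0 a1 b1 f (eps / C)) => //; [case: Bb|exact: Bochner_nrm_sqr].
have := near_and (near_hstep a10) (near_and (near_and (mo _ _ _ _ ux_B) (mo _ _ _ _ v_B))
  (near_and (mo _ _ _ _ vx_B) (mo _ _ _ _ vy_B))).
apply: filterS => n [hn [[[t1 [i1 I1] H1] [t2 [i2 I2] H2]] [[t3 [i3 I3] H3] [t4 [i4 I4] H4]]]].
exists (fun t => c1 ^+ 2 * t1 t + c2 ^+ 2 * (t2 t + t3 t + t4 t)).
  have j1 := integrable_RZl (mIoo a1 b1) (c1 ^+ 2) i1.
  have j23 := integrable_RD (mIoo a1 b1) i2 i3.
  have j234 := integrable_RD (mIoo a1 b1) j23 i4.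
  have j2 := integrable_RZl (mIoo a1 b1) (c2 ^+ 2) j234.
  split; first exact: integrable_RD.
  rewrite RintegralD// (@RintegralZl _ _ _ leb _ t1)// (@RintegralZl _ _ _ leb _ (fun t => t2 t + t3 t + t4 t))//.
  rewrite RintegralD// RintegralD//.
  have h0 := hstep_gt0 n : 0 < hstep n :> R.
  have q1 := ler_wpM2l (sqr_ge0 c1) I1.
  have q2 := ler_wpM2l (sqr_ge0 c2) (lerD (lerD I2 I3) I4).
  apply: (le_trans (lerD q1 q2)).
  rewrite (_ : _ + _ = (c1 ^+ 2 + 3 * c2 ^+ 2) * (eps / C * hstep n)); last by ring.
  rewrite mulrA ler_pM2r// mulrA ler_pdivrMr// mulrC ler_pM2l// /C; lra.
move=> t /[dup] tt /andP[t1' t2'].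
have th0 : 0 <= t - hstep n by rewrite subr_ge0 (le_trans (ltW hn))// ltW.
have ttau : t <= tau by exact: le_trans (ltW t2') (ltW b1t).
have I dT' (T' : measurableType dT') (mu : {measure set T' -> \bar R}) (f : R -> L2 mu) :
    (forall tau, 0 < tau -> Bochner_L2 0 tau f) ->
    leb.-integrable `]t - hstep n, t[ (EFin \o (fun r => nrm (f t - f r) ^+ 2)).
  by move=> Bf; apply: iN => //; exact: Bf.
have J1 := I _ _ _ _ ux_B; have J2 := I _ _ _ _ v_B; have J3 := I _ _ _ _ vx_B; have J4 := I _ _ _ _ vy_B.
have J23 := integrable_RD (mIoo (t - hstep n) t) J2 J3.
have J234 := integrable_RD (mIoo (t - hstep n) t) J23 J4.
rewrite /N2 RintegralD//; [|exact: integrable_RZl|exact: integrable_RZl].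
rewrite (@RintegralZl _ _ _ leb _ (fun r => nrm (ux t - ux r) ^+ 2))//.
rewrite (@RintegralZl _ _ _ leb _ (fun r => nrm (v t - v r) ^+ 2 + nrm (vx t - vx r) ^+ 2 + nrm (vy t - vy r) ^+ 2))//.
rewrite RintegralD// RintegralD//.
apply: lerD; rewrite ler_wpM2l ?sqr_ge0//; first exact: H1.
by apply: lerD; [apply: lerD; [exact: H2|exact: H3]|exact: H4].
Qed.

End weak_solution.

(** * Energy estimates for the plant *)

Section plant.
Context {R : realType}.
Notation leb := (@lebesgue_measure R).
Notation RR := (measurableTypeR R).
Variables (l d D e1 e2 e2b : R) (l_gt0 : 0 < l) (d_gt0 : 0 < d) (D_gt0 : 0 < D)
  (e1_gt0 : 0 < e1).
Notation mI := (muI 0 l).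
Notation mO := (muOmega l d).
Notation X := (XI l).
Notation W := (XO l d).
Hypothesis dense : forall (phi : X) (e : R), 0 < e -> exists2 eta, test1 0 l eta &
  nrm (phi - toXI l eta) < e.
Variables (al1 : Linf (muIt l)) (al2 : Linf (muOmegat l d)).
Variables (lam1 : Linf (muOmegat l d)) (lam2 : Linf (muIt l)).
Variables (g a1bar : Linf mI).
Variables (U u ux : R -> X) (v vx vy : R -> W) (w : R -> X -> W -> R).
Hypothesis U_B : forall tau, 0 < tau -> Bochner_L2 (- D) tau U.
Hypothesis u_cont : forall t e : R, 0 <= t -> 0 < e -> exists2 del : R, 0 < del &
  forall s, 0 <= s -> `|s - t| < del -> nrm (u s - u t) <= e.
Hypothesis v_cont : forall t e : R, 0 <= t -> 0 < e -> exists2 del : R, 0 < del &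
  forall s, 0 <= s -> `|s - t| < del -> nrm (v s - v t) <= e.
Hypothesis w_dual : forall tau, 0 < tau -> L2_dual tau w.
Hypothesis w_deriv : forall tau, 0 < tau -> time_derivative tau u v w.
Hypothesis uv_V : {ae leb, forall t, 0 < t -> in_V (u t) (ux t) (v t) (vx t) (vy t)}.
Hypothesis u_B : forall tau, 0 < tau -> Bochner_L2 0 tau u.
Hypothesis ux_B : forall tau, 0 < tau -> Bochner_L2 0 tau ux.
Hypothesis v_B : forall tau, 0 < tau -> Bochner_L2 0 tau v.
Hypothesis vx_B : forall tau, 0 < tau -> Bochner_L2 0 tau vx.
Hypothesis vy_B : forall tau, 0 < tau -> Bochner_L2 0 tau vy.
Hypothesis equation : {ae leb, forall t, 0 < t ->
  forall phi dphi psi px py, in_V phi dphi psi px py ->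
    w t phi psi
    + e1 * dotp mI (ux t) dphi
    + e2 * dotp mO (vx t) px + e2b * dotp mO (vy t) py
    - dotp mI (fun x => al1 (x, t) * u t x) phi
    - dotp mO (fun p => al2 (p, t) * v t p) psi
    + dotp mI (C12 lam1 t (vx t)) phi + dotp mO (C21 lam2 t (ux t)) psi
    = dotp mI (mulop g (U (t - D))) phi}.

Lemma dotp_raw0 dT' (T' : measurableType dT') (mu : {measure set T' -> \bar R}) (f : T' -> R) :
  dotp mu f (0 : L2 mu) = 0.
Proof.
rewrite /dotp (@eq_Rintegral _ _ _ _ _ (cst 0)); last by move=> x _; rewrite mulr0.
by rewrite Rintegral_cst// mul0r.
Qed.

Notation dd := (fun t => coupling al1 a1bar lam1 t (u t) (vx t)).

Lemma u_equation : {ae leb, forall t, 0 < t ->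
  nrm (dd t) <= m_alpha al1 a1bar * nrm (u t) + M12 lam1 * nrm (vx t) /\
  forall phi dphi : X, in_H01 phi dphi ->
  w t phi 0 = - (e1 * dotp mI (ux t) dphi) + dotp mI (dd t) phi +
    dotp mI (mulop a1bar (u t)) phi + dotp mI (mulop g (U (t - D))) phi}.
Proof.
have := ae_and equation (ae_regular_time al1 a1bar lam1 lam2).
apply: filterS => t [eqt reg] t0; have {}eqt := eqt t0; have {}reg := reg t0.
have [nd ed] := couplingP d_gt0 (u t) (vx t) reg; split=> // phi dphi hphi.
have := eqt phi dphi 0 0 0 (conj hphi (@H1_0 R l d)).
rewrite !dotp_raw0 !mulr0 !addr0 subr0 => h.
have := ed phi; move: h => <-; move: (dotp mI (fun x => _) _) => p; lra.
Qed.

Variables (mu_v : R) (mu_v_gt0 : 0 < mu_v).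
Hypothesis coercive : {ae leb, forall t : R, 0 <= t ->
     forall phi px py : W, in_H1 phi px py ->
     mu_v * (nrm phi ^+ 2 + nrm px ^+ 2 + nrm py ^+ 2) <=
       e2 * nrm px ^+ 2 + e2b * nrm py ^+ 2
       - \int[mO]_p (al2 (p, t) * `|phi p| ^+ 2)}.
Variables (Ca Cg : R) (Ca_ge0 : 0 <= Ca) (Cg_ge0 : 0 <= Cg).
Hypothesis Ca_bound : forall f : X, nrm (mulop a1bar f) <= Ca * nrm f.
Hypothesis Cg_bound : forall f : X, nrm (mulop g f) <= Cg * nrm f.
Notation bv := (b_v d lam2 mu_v).
Notation ma := (m_alpha al1 a1bar).
Notation m12 := (M12 lam1).

Lemma bv_ge0 : 0 <= bv.
Proof.
by apply: divr_ge0; [apply: mulr_ge0; [exact: ltW|exact: sqr_ge0]|apply: mulr_ge0 => //; exact: ltW].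
Qed.

(** Coercivity yields [2 mu_v] times the full squared norm. One [mu_v |v|^2] absorbs the coupling by
    Young's inequality, which leaves [d L_2^2 / mu_v = 2 b_v] in front of [|u_x|^2]; spare gradient
    terms are dropped. *)
Lemma v_part : {ae leb, forall t, 0 < t ->
  - 2 * (e2 * nrm (vx t) ^+ 2 + e2b * nrm (vy t) ^+ 2
    - dotp mO (fun p => al2 (p, t) * v t p) (v t) + dotp mO (C21 lam2 t (ux t)) (v t)) <=
  - mu_v * (nrm (v t) ^+ 2 + nrm (vx t) ^+ 2) + 2 * bv * nrm (ux t) ^+ 2}.
Proof.
have := ae_and (ae_and coercive uv_V) (ae_regular_time al1 a1bar lam1 lam2).
apply: filterS => t [[co V] reg] t0; have [_ hv] := V t0.
have := co (ltW t0) _ _ _ hv.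
have -> : \int[mO]_p (al2 (p, t) * `|v t p| ^+ 2) = dotp mO (fun p => al2 (p, t) * v t p) (v t).
  by apply: eq_Rintegral => p _; rewrite real_normK ?num_real// expr2 mulrA.
have := C21_bound d_gt0 (ux t) (v t) (reg t0).
move=> /ler_normlP[h _].
set a := dotp _ _ _ in h *; set b := dotp _ _ _.
set L := nrmoo lam2 in h *; set n := nrm (ux t) in h *; set m := nrm (v t) in h *.
have d0 : 0 <= Num.sqrt d by exact: sqrtr_ge0.
have L0 : 0 <= L by exact: nrmoo_ge0.
have key : 2 * (Num.sqrt d * L * n * m) <= mu_v * m ^+ 2 + 2 * bv * n ^+ 2.
  rewrite -subr_ge0.
  have -> : 2 * bv = (Num.sqrt d * L) ^+ 2 / mu_v.
    by rewrite /b_v exprMn sqr_sqrtr ?(ltW d_gt0)// -/L; field; rewrite gt_eqF.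
  rewrite (_ : _ - _ = (mu_v * m - Num.sqrt d * L * n) ^+ 2 / mu_v); last by field; rewrite gt_eqF.
  by rewrite divr_ge0 ?sqr_ge0// ltW.
have vx0 : 0 <= mu_v * nrm (vx t) ^+ 2 by rewrite mulr_ge0 ?sqr_ge0// ltW.
have vy0 : 0 <= mu_v * nrm (vy t) ^+ 2 by rewrite mulr_ge0 ?sqr_ge0// ltW.
by move=> co'; lra.
Qed.

Lemma power_le (c1 : R) : 0 <= c1 -> {ae leb, forall t, 0 < t ->
  2 * w t (c1 *: u t) (1 *: v t) <=
  c1 * (- 2 * e1 * nrm (ux t) ^+ 2 + 2 * ((ma + Ca) * nrm (u t) ^+ 2 + m12 * nrm (vx t) * nrm (u t) +
     Cg * nrm (U (t - D)) * nrm (u t))) +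
  (- mu_v * (nrm (v t) ^+ 2 + nrm (vx t) ^+ 2) + 2 * bv * nrm (ux t) ^+ 2)}.
Proof.
move=> c10.
have := ae_and (ae_and equation v_part) (ae_and uv_V (ae_regular_time al1 a1bar lam1 lam2)).
apply: filterS => t [[eqt vp] [V reg]] t0; have {}V := V t0.
have [nd ed] := couplingP d_gt0 (u t) (vx t) (reg t0).
have := eqt t0 _ _ _ _ _ (V_scale l_gt0 c1 1 V); have {}vp := vp t0.
have {}ed := ed (c1 *: u t).
rewrite !scale1r !dotpZr -!nrm_sqr in ed *.
have k1 := le_trans (cauchy_schwarz (dd t) (u t)) (ler_wpM2r (nrm_ge0 (u t)) nd).
have k2 := le_trans (cauchy_schwarz (mulop a1bar (u t)) (u t)) (ler_wpM2r (nrm_ge0 (u t)) (Ca_bound (u t))).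
have k3 := le_trans (cauchy_schwarz (mulop g (U (t - D))) (u t)) (ler_wpM2r (nrm_ge0 (u t)) (Cg_bound (U (t - D)))).
move: (ler_norm (dotp mI (dd t) (u t))) (ler_norm (dotp mI (mulop a1bar (u t)) (u t))) (ler_norm (dotp mI (mulop g (U (t - D))) (u t))).
move: k1 k2 k3 ed vp.
set A1 := dotp mI (dd t) (u t); set A2 := dotp mI (mulop a1bar _) _; set A3 := dotp mI (mulop g _) _.
set A4 := dotp mI _ _; set A5 := dotp mI _ _; set A6 := dotp mO _ _; set A7 := dotp mO _ _.
set w0 := w t _ _; clearbody A1 A2 A3 A4 A5 A6 A7 w0.
move=> k1 k2 k3 ed vp n1 n2 n3 h.
have q1 : A1 <= (ma * nrm (u t) + m12 * nrm (vx t)) * nrm (u t) by exact: le_trans k1.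
have q2 : A2 <= Ca * nrm (u t) * nrm (u t) by exact: le_trans k2.
have q3 : A3 <= Cg * nrm (U (t - D)) * nrm (u t) by exact: le_trans k3.
have p1 := ler_wpM2l c10 (lerD (lerD q1 q2) q3).
lra.
Qed.

Lemma v_energy (a b : R) : 0 <= a -> a <= b -> nrm (v b) ^+ 2 - nrm (v a) ^+ 2 <=
  \int[leb]_(t in `]a, b[) (- mu_v * (nrm (v t) ^+ 2 + nrm (vx t) ^+ 2) + 2 * bv * nrm (ux t) ^+ 2).
Proof.
move=> a0 ab.
have := energy_bound l_gt0 dense u_cont v_cont w_dual w_deriv uv_V ux_B v_B vx_B vy_B (lexx 0) ler01
  (M := fun t => - mu_v * (nrm (v t) ^+ 2 + nrm (vx t) ^+ 2) + 2 * bv * nrm (ux t) ^+ 2).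
move=> /(_ _ _ a b a0 ab); rewrite !mul0r !mul1r !add0r; apply.
  move=> tau t0; apply: integrable_RD => //; apply: integrable_RZl => //.
    by apply: integrable_RD => //; apply: Bochner_nrm_sqr; [exact: v_B|exact: vx_B].
  by apply: Bochner_nrm_sqr; exact: ux_B.
have := power_le (lexx 0); apply: filterS => t h t0.
by have := h t0; rewrite mul0r add0r.
Qed.

(** Chosen so that [kappa * (2 * e1) = 2 * bv + 1]: the diffusion of [u] pays for the coupling into
    [v] and one [|u_x|^2] is left. *)
Definition kappa : R := (2 * bv + 1) / (2 * e1).
(** Growth rate of [kappa |u|^2] after Young's inequality: [Cg] comes from the input, the last term
    from the coupling into [u], absorbed in [mu_v |v_x|^2]. *)
Definition growth : R := 2 * ma + 2 * Ca + Cg + kappa * m12 ^+ 2 / mu_v.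

Lemma kappa_gt0 : 0 < kappa.
Proof.
apply: divr_gt0; last exact: mulr_gt0.
by have := bv_ge0; move: bv => x; lra.
Qed.

Lemma U_delay_sqr (tau : R) : 0 < tau -> leb.-integrable `]0, tau[
  (EFin \o (fun t => nrm (U (t - D)) ^+ 2)).
Proof.
move=> t0; apply: (@integrable_shift R 0 tau (- D) (EFin \o (fun t => nrm (U t) ^+ 2))).
apply: (@integrable_oo_sub R (- D) tau); rewrite ?add0r//; first by rewrite gerDl oppr_le0 ltW.
by apply: Bochner_nrm_sqr; exact: U_B.
Qed.

Lemma joint_energy (a b : R) : 0 <= a -> a <= b ->
  kappa * nrm (u b) ^+ 2 + nrm (v b) ^+ 2 - (kappa * nrm (u a) ^+ 2 + nrm (v a) ^+ 2) <=
  \int[leb]_(t in `]a, b[) (- nrm (ux t) ^+ 2 + growth * kappa * nrm (u t) ^+ 2 +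
    kappa * Cg * nrm (U (t - D)) ^+ 2).
Proof.
move=> a0 ab; have k0 := kappa_gt0.
have := energy_bound l_gt0 dense u_cont v_cont w_dual w_deriv uv_V ux_B v_B vx_B vy_B (ltW k0) ler01
  (M := fun t => - nrm (ux t) ^+ 2 + growth * kappa * nrm (u t) ^+ 2 +
    kappa * Cg * nrm (U (t - D)) ^+ 2).
move=> /(_ _ _ a b a0 ab); rewrite !mul1r; apply.
  move=> tau t0; apply: integrable_RD => //; [apply: integrable_RD => //|].
  - by apply: integrable_RN => //; apply: Bochner_nrm_sqr; exact: ux_B.
  - by apply: integrable_RZl => //; apply: Bochner_nrm_sqr; exact: u_B.
  - by apply: integrable_RZl => //; exact: U_delay_sqr.
have := power_le (ltW k0); apply: filterS => t h t0.
apply: (le_trans (h t0)).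
have E : kappa * (2 * e1) = 2 * bv + 1.
  by rewrite /kappa mulfVK// gt_eqF// mulr_gt0.
have c1 : 2 * (kappa * m12 * nrm (vx t) * nrm (u t)) <=
   mu_v * nrm (vx t) ^+ 2 + kappa ^+ 2 * m12 ^+ 2 / mu_v * nrm (u t) ^+ 2.
  rewrite -subr_ge0 (_ : _ - _ = (mu_v * nrm (vx t) - kappa * m12 * nrm (u t)) ^+ 2 / mu_v).
    by rewrite divr_ge0 ?sqr_ge0// ltW.
  by field; rewrite gt_eqF.
have c2 : kappa * Cg * (2 * (nrm (U (t - D)) * nrm (u t))) <=
    kappa * Cg * (nrm (U (t - D)) ^+ 2 + nrm (u t) ^+ 2).
  apply: ler_wpM2l; first by rewrite mulr_ge0// ltW.
  by rewrite -subr_ge0 (_ : _ - _ = (nrm (U (t - D)) - nrm (u t)) ^+ 2) ?sqr_ge0//; ring.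
have v0 : 0 <= mu_v * nrm (v t) ^+ 2 by rewrite mulr_ge0 ?sqr_ge0// ltW.
have E' : kappa * (2 * e1) * nrm (ux t) ^+ 2 = (2 * bv + 1) * nrm (ux t) ^+ 2 by rewrite E.
rewrite (_ : growth * kappa = (2 * ma + 2 * Ca + Cg) * kappa + kappa ^+ 2 * m12 ^+ 2 / mu_v); last first.
  by rewrite /growth; ring.
move: c1 c2 v0 E' => /=.
move: (kappa ^+ 2 * _ / _) => q; lra.
Qed.

End plant.

(** * The forcing as a Bochner function *)

Section forcing.
Context {R : realType}.
Notation leb := (@lebesgue_measure R).
Notation RR := (measurableTypeR R).
Variables (l D e1 : R) (l_gt0 : 0 < l) (D_gt0 : 0 < D).
Notation mI := (muI 0 l).
Notation X := (XI l).
Hypothesis dense : forall (phi : X) (e : R), 0 < e -> exists2 eta, test1 0 l eta &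
  nrm (phi - toXI l eta) < e.

Lemma Bochner_sqr dT (T : measurableType dT) (mu : {measure set T -> \bar R}) (a b : R)
  (f : R -> L2 mu) : strongly_measurable `]a, b[ f ->
  leb.-integrable `]a, b[ (EFin \o (fun t => nrm (f t) ^+ 2)) -> Bochner_L2 a b f.
Proof.
move=> sf fi; split => //; rewrite wnormE ?ltry//.
by apply: eq_integrable fi => // x _ /=; rewrite mulr0 mul0r expR0 mul1r.
Qed.

Lemma measurable_dotp_dense (A : set RR) (f : R -> X) :
  (forall eta, test1 0 l eta -> measurable_fun A (fun t => dotp mI (f t) (toXI l eta))) ->
  forall psi : X, measurable_fun A (fun t => dotp mI (f t) psi).
Proof.
move=> h psi.
have /choice[eta eta_] : forall n : nat, exists eta, test1 0 l eta /\
    nrm (psi - toXI l eta) < n.+1%:R^-1.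
  move=> n; have n0 : (0 : R) < n.+1%:R^-1 by rewrite invr_gt0 ltr0n.
  by have [eta te he] := dense psi n0; exists eta.
apply: (measurable_fun_cvg (h := fun n t => dotp mI (f t) (toXI l (eta n)))).
  by move=> n; apply: h; case: (eta_ n).
move=> t _.
rewrite (_ : (fun _ => _) = (fun n => dotp mI (toXI l (eta n)) (f t))); last first.
  by apply/funext => n; rewrite dotpC.
rewrite dotpC; apply: cvg_dotp.
apply: (@squeeze_cvgr _ _ _ _ (fun=> 0) (fun n => n.+1%:R^-1)).
- by apply: nearW => n; rewrite nrm_ge0/= nrmBC ltW//; case: (eta_ n).
- exact: cvg_cst.
- exact: cvg_harmonic.
Qed.

Variables (g a1bar : Linf mI) (U u ux dd : R -> X) (w : R -> X -> R) (m : R -> R).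
Hypothesis U_B : forall tau, 0 < tau -> Bochner_L2 (- D) tau U.
Hypothesis u_B : forall tau, 0 < tau -> Bochner_L2 0 tau u.
Hypothesis ux_B : forall tau, 0 < tau -> Bochner_L2 0 tau ux.
Hypothesis w_meas : forall phi dphi, in_H01 phi dphi -> forall tau, 0 < tau ->
  measurable_fun (`]0, tau[ : set RR) (fun t => w t phi).
Hypothesis m_sqr : forall tau, 0 < tau -> leb.-integrable `]0, tau[ (EFin \o (fun t => m t ^+ 2)).
Hypothesis u_eq : {ae leb, forall t, 0 < t ->
  nrm (dd t) <= m t /\
  forall phi dphi : X, in_H01 phi dphi ->
  w t phi = - (e1 * dotp mI (ux t) dphi) + dotp mI (dd t) phi +
    dotp mI (mulop a1bar (u t)) phi + dotp mI (mulop g (U (t - D))) phi}.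

Lemma measurable_dotp_delay (tau : R) (psi : X) : 0 < tau ->
  measurable_fun (`]0, tau[ : set RR) (fun t => dotp mI (mulop g (U (t - D))) psi).
Proof.
move=> t0.
have : measurable_fun (`]0 - D, tau - D[ : set RR) (fun t => dotp mI (U t) (mulop g psi)).
  apply: measurable_dotp => //; apply: sm_sub (U_B t0).1; apply: oo_sub; first by rewrite sub0r.
  by rewrite gerBl ltW.
move=> /(@measurable_fun_shift R _ _ 0 tau (- D)); apply: eq_measurable_fun => t _.
by rewrite mulop_sym.
Qed.

(** [F] is [dd] corrected on a null set; its weak measurability is read off the
    equation itself. *)
Lemma forcing_exists : exists F : R -> X,
  (forall tau, 0 < tau -> Bochner_L2 0 tau F) /\
  {ae leb, forall t, 0 < t -> nrm (F t) <= m t /\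
    forall phi dphi : X, in_H01 phi dphi ->
    w t phi = - (e1 * dotp mI (ux t) dphi) + dotp mI (F t) phi +
      dotp mI (mulop a1bar (u t)) phi + dotp mI (mulop g (U (t - D))) phi}.
Proof.
have [N [mN N0 hN]] := u_eq.
pose F t : X := if t \in N then 0 else dd t.
have FE t : t \notin N -> F t = dd t by move=> /negPf tN; rewrite /F tN.
have good : {ae leb, forall t, t \notin N}.
  by exists N; split=> // t /=; rewrite notin_setE => /contrapT.
have eqF : {ae leb, forall t, 0 < t -> nrm (F t) <= m t /\
    forall phi dphi : X, in_H01 phi dphi ->
    w t phi = - (e1 * dotp mI (ux t) dphi) + dotp mI (F t) phi +
      dotp mI (mulop a1bar (u t)) phi + dotp mI (mulop g (U (t - D))) phi}.
  by have := ae_and u_eq good; apply: filterS => t [h tN]; rewrite FE.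
exists F; split=> // tau t0.
have sF : strongly_measurable `]0, tau[ F.
  apply: (pettis l_gt0 dense) => //; apply: measurable_dotp_dense => eta te.
  have hH := test_H01 l_gt0 te.
  have -> : (fun t => dotp mI (F t) (toXI l eta)) = (fun t => if t \in N then 0 else
      dotp mI (dd t) (toXI l eta)).
    by apply/funext => t; rewrite /F; case: ifP => // _; rewrite dotp0l.
  (* The equation solved for the pairing of the forcing with a test function; all the terms of [h]
     are measurable in time. *)
  pose h t := w t (toXI l eta) + e1 * dotp mI (ux t) (toXI l (derive1 eta)) -
    dotp mI (mulop a1bar (u t)) (toXI l eta) - dotp mI (mulop g (U (t - D))) (toXI l eta).
  have mh : measurable_fun (`]0, tau[ : set RR) h.
    apply: measurable_funB; last exact: measurable_dotp_delay.
    apply: measurable_funB.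
      apply: measurable_funD; first exact: w_meas hH _ t0.
      apply: measurable_funM => //.
      by apply: measurable_dotp => //; case: (ux_B t0).
    rewrite (_ : (fun _ => _) = (fun t => dotp mI (u t) (mulop a1bar (toXI l eta)))); last first.
      by apply/funext => t; rewrite mulop_sym.
    by apply: measurable_dotp => //; case: (u_B t0).
  apply: (@eq_measurable_fun _ _ _ _ _ (fun t => if t \in N then 0 else h t)).
    move=> t; rewrite inE/= in_itv/= => /andP[tt _]; case: ifPn => // tN.
    have Pt : 0 < t ->
        nrm (dd t) <= m t /\ forall phi dphi : X, in_H01 phi dphi ->
        w t phi = - (e1 * dotp mI (ux t) dphi) + dotp mI (dd t) phi +
        dotp mI (mulop a1bar (u t)) phi + dotp mI (mulop g (U (t - D))) phi.
      by apply: contrapT => bad; move: tN; rewrite notin_setE; apply; apply: hN.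
    by have [_ /(_ _ _ hH)] := Pt tt; rewrite /h => ->; ring.
  rewrite (_ : (fun _ => _) = (fun t => \1_(~` N) t * h t)); last first.
    apply/funext => t; rewrite indicE in_setC; case: (t \in N) => /=; rewrite ?mul0r ?mul1r//.
  apply: measurable_funM => //.
  by apply: measurable_funTS; apply: measurable_indic; exact: measurableC.
apply: Bochner_sqr => //.
apply: (integrable_aeRle _ _ _ (m_sqr t0)) => //.
  by apply: measurable_funX; exact: measurable_nrm.
apply: filterS eqF => t h; rewrite /= in_itv/= => /andP[tt _]; have [h1 _] := h tt.
by rewrite ger0_norm ?sqr_ge0// lerXn2r ?nnegrE ?(le_trans _ h1) ?nrm_ge0.
Qed.

End forcing.

(** * Duhamel's formula and the predictor *)

Section linear_bounds.
Context {R : realType}.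
Implicit Types (a b e s t x : R).

Lemma add_le2 a b e : a <= e -> b <= e -> a + b <= 2 * e. Proof. by lra. Qed.

Lemma near_tag s s' t del x : t - del < s -> s' < t + del -> s <= x <= s' -> `|x - t| < del.
Proof. by move=> h1 h2 /andP[h3 h4]; rewrite ltr_norml; apply/andP; split; lra. Qed.

Lemma nrm_le1 dT (T : measurableType dT) (mu : {measure set T -> \bar R}) (f g : L2 mu) e :
  e <= 1 -> nrm (f - g) <= e -> nrm f <= nrm g + 1.
Proof. by move=> e1 fg; apply: (le_trans (nrm_le_dist f g)); rewrite lerD2l (le_trans fg). Qed.

End linear_bounds.

Section abstract_duhamel.
Context {R : realType}.
Notation leb := (@lebesgue_measure R).
Notation RR := (measurableTypeR R).

Lemma cousin_eq (a b : R) (Z L : R -> R) : a <= b ->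
  (forall e t : R, 0 < e -> a <= t <= b -> exists2 del : R, 0 < del &
    forall s s', a <= s <= t -> t <= s' <= b -> t - del < s -> s' < t + del ->
      `|Z s' - Z s| <= e * (L s' - L s)) ->
  Z b = Z a.
Proof.
move=> ab h; apply/eqP; rewrite eq_le; apply/andP; split.
  apply: (@cousin R a b Z L ab) => e t e0 tab; have [del d0 hd] := h e t e0 tab.
  by exists del => // s s' h1 h2 h3 h4; apply: le_trans (hd s s' h1 h2 h3 h4); exact: ler_norm.
rewrite -lerN2; apply: (@cousin R a b (fun s => - Z s) L ab) => e t e0 tab.
have [del d0 hd] := h e t e0 tab; exists del => // s s' h1 h2 h3 h4.
apply: le_trans (hd s s' h1 h2 h3 h4); apply: le_trans (ler_norm _) _.
by rewrite -opprD normrN.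
Qed.

Lemma norm_Rintegral_le (a b : R) (f m : R -> R) :
  leb.-integrable `]a, b[ (EFin \o f) -> leb.-integrable `]a, b[ (EFin \o m) ->
  (forall x, a < x < b -> `|f x| <= m x) ->
  `|\int[leb]_(x in `]a, b[) f x| <= \int[leb]_(x in `]a, b[) m x.
Proof.
move=> fi mi fm; apply: (le_trans (le_normr_Rintegral (mIoo a b) fi)).
apply: le_ae_Rintegral => //; first by have := integrable_norm fi; apply: eq_integrable.
by apply: aeW => x; rewrite /= in_itv/=; exact: fm.
Qed.

(** Subtracting the expansions of two neighbours at a common tag yields a first-order expansion
    between the neighbours. *)
Lemma straddle_recomb (V : lmodType R) (P Q T F : V) (a b : R) :
  P - T - a *: - F - (Q - T - b *: - F) = P - Q + (a - b) *: F.
Proof.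
rewrite !scalerN !opprK scalerBl opprD addrACA opprB; congr (_ + _).
by rewrite addrA subrK.
Qed.

(** Meant for a semigroup run backwards and paired with a vector. Continuity in [t] is known at
    fixed [x] only; the Lipschitz bound in [x] carries measurability over to [f t] through its
    simple approximants. *)
Lemma rev_integrable dT (T : measurableType dT) (mu : {measure set T -> \bar R})
  (a b C : R) (L : R -> L2 mu -> R) (f : R -> L2 mu) :
  strongly_measurable `]a, b[ f -> leb.-integrable `]a, b[ (EFin \o (fun t => nrm (f t))) ->
  (forall (x : L2 mu) (t e : R), a <= t <= b -> 0 < e -> exists2 del : R, 0 < del &
    forall s : R, a <= s <= b -> `|s - t| < del -> `|L s x - L t x| <= e) ->
  (forall (t : R) (x y : L2 mu), a <= t <= b -> `|L t x - L t y| <= C * nrm (x - y)) ->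
  (forall (t : R) (x : L2 mu), a <= t <= b -> `|L t x| <= C * nrm x) ->
  leb.-integrable `]a, b[ (EFin \o (fun t => L t (f t))).
Proof.
move=> sf fi cL lL bL.
have sub (t : R) : a < t < b -> a <= t <= b by move=> /andP[/ltW-> /ltW->].
apply: (@integrable_Rle _ _ _ leb _ _ (fun t => C * nrm (f t))) => //.
- apply: measurable_fun_sm => //.
    by move=> x; apply: integrable_measurable_fun; apply: eps_continuous_integrable => t e; exact: cL.
  move=> t h; rewrite /= in_itv/= => /sub tab.
  by apply: (cvg_lip (C := C)) => n; exact: lL.
- by move=> t; rewrite /= in_itv/= => /sub tab; exact: bL.
- exact: integrable_RZl.
Qed.

End abstract_duhamel.

(** * Duhamel's formula for the nominal semigroup *)

Section duhamel.
Context {R : realType}.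
Notation leb := (@lebesgue_measure R).
Notation RR := (measurableTypeR R).
Variables (l e1 : R) (l_gt0 : 0 < l) (e1_gt0 : 0 < e1).
Notation mI := (muI 0 l).
Notation X := (XI l).
Variables (a1bar : Linf mI) (S : R -> X -> X).
Notation A := (An e1 a1bar).
Hypothesis S_gen : is_semigroup setT A S.
Variables (Cn omn : R).
Hypothesis Cn_est : smoothing_estimate S Cn omn.

Lemma S_rev_vcont (a b t : R) (x : X) : t <= b -> vcont_in a b (fun s => S (b - s) x) t.
Proof.
move=> tb e e0.
have bt : 0 <= b - t by rewrite subr_ge0.
have [del d0 hd] := S_vcont l_gt0 S_gen Cn_est (b - a) x bt e0.
exists del => // s /andP[as_ sb] st; apply: hd.
  by rewrite subr_ge0 sb lerB.
by rewrite (_ : b - s - (b - t) = - (s - t)) ?normrN//; ring.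
Qed.

Lemma S_rev_vderiv (a b t : R) (x f : X) : 0 <= a -> t <= b -> A x f ->
  vderiv_in a b (fun s => S (b - s) x) t (- S (b - t) f).
Proof.
move=> a0 tb Axf e e0.
have bt : 0 <= b - t by rewrite subr_ge0.
have [del d0 hd] := sg_vderiv S_gen (S_bounded_away l_gt0 Cn_est) b bt Axf e0.
exists del => // s /andP[as_ sb] st.
have E : b - s - (b - t) = - (s - t) by ring.
have := hd (b - s) _ _; rewrite E normrN scalerN scaleNr; apply => //.
by rewrite subr_ge0 sb gerBl (le_trans a0).
Qed.

Lemma S_forcing_integrable (a b : R) (H : R -> X) (psi : X) : Bochner_L2 a b H ->
  leb.-integrable `]a, b[ (EFin \o (fun s => dotp mI (H s) (S (b - s) psi))).
Proof.
move=> HB; have [sH _] := HB.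
have [C C0 hC] := S_bounded l_gt0 e1_gt0 S_gen Cn_est (b - a).
have bd (t : R) (x : X) : a <= t <= b -> `|dotp mI x (S (b - t) psi)| <= C * nrm psi * nrm x.
  move=> /andP[at_ tb]; apply: (le_trans (cauchy_schwarz _ _)); rewrite mulrC ler_wpM2r ?nrm_ge0//.
  by apply: hC; rewrite subr_ge0 tb lerB.
apply: (rev_integrable (L := fun s x => dotp mI x (S (b - s) psi)) (C := C * nrm psi)) => //.
- exact: Bochner_nrm.
- move=> x t e /andP[at_ tb] e0.
  by apply: (@vcont_in_dotp _ _ _ mI a b (fun=> x) (fun s => S (b - s) psi)) => //;
    [exact: cst_vcont|exact: S_rev_vcont].
- by move=> t x y tab; rewrite -dotpBl; exact: bd.
Qed.

Variables (u H : R -> X).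
Hypothesis u_cont : forall t e : R, 0 <= t -> 0 < e -> exists2 del : R, 0 < del &
  forall s, 0 <= s -> `|s - t| < del -> nrm (u s - u t) <= e.
Hypothesis H_B : forall tau, 0 < tau -> Bochner_L2 0 tau H.
Hypothesis weak : forall phi f, A phi f -> forall a b : R, 0 <= a -> a <= b ->
  dotp mI (u b) phi - dotp mI (u a) phi =
  \int[leb]_(s in `]a, b[) (dotp mI (u s) f + dotp mI (H s) phi).

Lemma u_vcont (a b t : R) : 0 <= a -> 0 <= t -> vcont_in a b u t.
Proof.
move=> a0 t0 e e0; have [del d0 hd] := u_cont t0 e0; exists del => // s /andP[as_ _].
by apply: hd; exact: le_trans as_.
Qed.

Lemma u_dotp_integrable (a b : R) (psi : X) : 0 <= a ->
  leb.-integrable `]a, b[ (EFin \o (fun s => dotp mI (u s) psi)).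
Proof.
move=> a0; apply: eps_continuous_integrable => t e /andP[at_ _] e0.
apply: (@vcont_in_dotp _ _ _ mI a b u (fun=> psi)) => //; last exact: cst_vcont.
by apply: u_vcont => //; exact: le_trans at_.
Qed.

Lemma H_BI (a b : R) : 0 <= a -> Bochner_L2 a b H.
Proof.
move=> a0; have t0 : 0 < `|b| + 1 by rewrite ltr_wpDl.
by apply: Bochner_sub (H_B t0) => //; have := ler_norm b; lra.
Qed.

Lemma H_dotp_integrable (a b : R) (psi : X) : 0 <= a ->
  leb.-integrable `]a, b[ (EFin \o (fun s => dotp mI (H s) psi)).
Proof.
move=> a0; have HB := H_BI b a0.
apply: (@integrable_Rle _ _ _ leb _ _ (fun s => nrm psi * nrm (H s))) => //.
- by apply: measurable_dotp => //; case: HB.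
- by move=> x _; rewrite mulrC; exact: cauchy_schwarz.
- by apply: integrable_RZl => //; exact: Bochner_nrm.
Qed.

(** Both sides are compared along [s |-> S (b - s) psi]; near a tag the
    increments agree to first order, by the weak equation and the derivative
    of the semigroup. *)
Lemma duhamel_domain (a b : R) (psi f : X) : A psi f -> 0 <= a -> a <= b ->
  dotp mI (u b) psi = dotp mI (u a) (S (b - a) psi) +
  \int[leb]_(s in `]a, b[) dotp mI (H s) (S (b - s) psi).
Proof.
move=> Af a0 ab.
pose I s := \int[leb]_(r in `]a, s[) dotp mI (H r) (S (b - r) psi).
pose Z s := dotp mI (u s) (S (b - s) psi) - I s.
pose L s := s + \int[leb]_(r in `]a, s[) nrm (H r).
have iI := S_forcing_integrable psi (H_BI b a0).
have iN := Bochner_nrm (H_BI b a0).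
suff E : Z b = Z a.
  move: E; rewrite /Z /I subrr set_itvoo0 Rintegral_set0 subr0 => <-; rewrite addrNK.
  by apply: aeq_dotpr; apply: aeq_sym; have [_ /(_ psi Logic.I)[]] := S_gen.
apply: (@cousin_eq R a b Z L ab) => e t e0 /andP[at_ tb].
have t0 : 0 <= t by exact: le_trans at_.
set Nu := nrm (u t); set Nf := nrm (S (b - t) f).
have [Nu0 Nf0] : 0 <= Nu /\ 0 <= Nf by split; exact: nrm_ge0.
pose C := 2 * Nf + 2 * Nu + 3.
have C0 : 0 < C by rewrite /C; lra.
pose eta := Num.min 1 (e / C).
have eta0 : 0 < eta by rewrite lt_min ltr01 divr_gt0.
have [eta1 etaC] : eta <= 1 /\ C * eta <= e.
  by rewrite mulrC -ler_pdivlMr// /eta !ge_min !lexx orbT.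
have [d1 d10 h1] := u_vcont b a0 t0 eta0.
have [d2 d20 h2] := S_rev_vcont a f tb eta0.
have [d3 d30 h3] := S_rev_vcont a psi tb eta0.
have [d4 d40 h4] := S_rev_vderiv a0 tb Af eta0.
exists (Num.min (Num.min d1 d2) (Num.min d3 d4)); first by rewrite !lt_min d10 d20 d30.
move=> s s' /andP[as_ st] /andP[ts' s'b] hs hs'.
have [mem sc] : (forall x, s <= x <= s' -> a <= x <= b) /\ s <= s'.
  have ss'_ := le_trans st ts'; split=> // x /andP[sx xs'].
  by rewrite (le_trans as_ sx) (le_trans xs' s'b).
have close x : s <= x <= s' -> `|x - t| < Num.min (Num.min d1 d2) (Num.min d3 d4).
  exact: near_tag hs hs'.
have {}h1 x : s <= x <= s' -> nrm (u x - u t) <= eta.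
  move=> /[dup] /mem m /close; rewrite !lt_min => /andP[/andP[c _] _]; exact: h1.
have {}h2 x : s <= x <= s' -> nrm (S (b - x) f - S (b - t) f) <= eta.
  move=> /[dup] /mem m /close; rewrite !lt_min => /andP[/andP[_ c] _]; exact: h2.
have {}h3 x : s <= x <= s' -> nrm (S (b - x) psi - S (b - t) psi) <= eta.
  move=> /[dup] /mem m /close; rewrite !lt_min => /andP[_ /andP[c _]]; exact: h3.
have {}h4 x : s <= x <= s' ->
    nrm (S (b - x) psi - S (b - t) psi - (x - t) *: - S (b - t) f) <= eta * `|x - t|.
  move=> /[dup] /mem m /close; rewrite !lt_min => /andP[_ /andP[_ c]]; exact: h4.
have [ss ss'] : s <= s <= s' /\ s <= s' <= s' by rewrite !lexx sc.
have s0 : 0 <= s by exact: le_trans as_.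
have bs' : 0 <= b - s' by rewrite subr_ge0.
have W := weak (gen_sg S_gen bs' Af) s0 sc.
set sf' := S (b - s') f in W; set sp' := S (b - s') psi in W.
rewrite RintegralD// in W; last 2 first.
- exact: u_dotp_integrable.
- exact: H_dotp_integrable.
have iIs : leb.-integrable `]s, s'[ (EFin \o (fun r => dotp mI (H r) (S (b - r) psi))).
  exact: integrable_oo_sub iI.
have iNs : leb.-integrable `]s, s'[ (EFin \o (fun r => nrm (H r))).
  exact: integrable_oo_sub iN.
have EI : I s' - I s = \int[leb]_(r in `]s, s'[) dotp mI (H r) (S (b - r) psi).
  by rewrite /I (Rintegral_oo_cat as_ sc (integrable_oo_sub (lexx a) s'b iI)) addrC addKr.
have EL : L s' - L s = s' - s + \int[leb]_(r in `]s, s'[) nrm (H r).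
  by rewrite /L (Rintegral_oo_cat as_ sc (integrable_oo_sub (lexx a) s'b iN)); ring.
(* First-order rate at the tag: the weak equation contributes [c * (s' - s)] and the backward orbit
   of [psi] the opposite amount, so both cancel in [Z s' - Z s]. *)
pose c := dotp mI (u t) (S (b - t) f).
have B1 : `|\int[leb]_(r in `]s, s'[) dotp mI (u r) sf' - c * (s' - s)| <=
    eta * (Nf + 1 + Nu) * (s' - s).
  rewrite -(Rintegral_oo_cst c sc) -RintegralB//; last 2 first.
  - exact: u_dotp_integrable.
  - exact: integrable_oo_cst.
  rewrite -(Rintegral_oo_cst _ sc); apply: norm_Rintegral_le.
  - by apply: integrable_RB => //; [exact: u_dotp_integrable|exact: integrable_oo_cst].
  - exact: integrable_oo_cst.
  move=> x /andP[sx xs']; have sxs : s <= x <= s' by rewrite !ltW.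
  rewrite (_ : _ - _ = dotp mI (u x - u t) sf' + dotp mI (u t) (sf' - S (b - t) f)); last first.
    by rewrite dotpBl dotpBr /c; ring.
  apply: (le_trans (ler_normD _ _)).
  rewrite (_ : eta * _ = eta * (Nf + 1) + Nu * eta); last by ring.
  apply: lerD; apply: (le_trans (cauchy_schwarz _ _)); apply: ler_pM; rewrite ?nrm_ge0//.
  - exact: h1.
  - exact: nrm_le1 eta1 (h2 _ ss').
  - exact: h2.
have B2 : `|dotp mI (u s) (sp' - S (b - s) psi) + c * (s' - s)| <=
    eta * (Nu + 1 + Nf) * (s' - s).
  set De := sp' - S (b - s) psi.
  have hD : nrm (De + (s' - s) *: S (b - t) f) <= eta * (s' - s).
    have -> : De + (s' - s) *: S (b - t) f = (sp' - S (b - t) psi - (s' - t) *: - S (b - t) f) -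
       (S (b - s) psi - S (b - t) psi - (s - t) *: - S (b - t) f).
      by rewrite straddle_recomb; congr (_ + _ *: _); ring.
    apply: (le_trans (nrmB (sp' - S (b - t) psi - (s' - t) *: - S (b - t) f : X) _)).
    apply: (le_trans (lerD (h4 _ ss') (h4 _ ss))).
    have [n1 n2] : 0 <= s' - t /\ 0 <= t - s by rewrite !subr_ge0.
    rewrite (ger0_norm n1) (distrC s t) (ger0_norm n2).
    by rewrite le_eqVlt; apply/orP; left; apply/eqP; ring.
  rewrite (_ : _ + _ = dotp mI (u s) (De + (s' - s) *: S (b - t) f) +
     (s' - s) * dotp mI (u t - u s) (S (b - t) f)); last first.
    by rewrite dotpDr dotpZr dotpBl /c; ring.
  apply: (le_trans (ler_normD _ _)).
  rewrite (_ : eta * _ * _ = (Nu + 1) * (eta * (s' - s)) + (s' - s) * (eta * Nf)); last by ring.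
  apply: lerD.
    apply: (le_trans (cauchy_schwarz _ _)); apply: ler_pM; rewrite ?nrm_ge0//.
    exact: nrm_le1 eta1 (h1 _ ss).
  have n3 : 0 <= s' - s by rewrite subr_ge0.
  rewrite normrM (ger0_norm n3); apply: ler_wpM2l => //.
  apply: (le_trans (cauchy_schwarz _ _)); apply: ler_wpM2r; first exact: nrm_ge0.
  by rewrite nrmBC; exact: h1.
have B3 : `|\int[leb]_(r in `]s, s'[) dotp mI (H r) sp' -
     \int[leb]_(r in `]s, s'[) dotp mI (H r) (S (b - r) psi)| <=
     2 * eta * \int[leb]_(r in `]s, s'[) nrm (H r).
  have iH := H_dotp_integrable s' sp' s0.
  rewrite -RintegralB// -(@RintegralZl _ _ _ leb _ (fun r => nrm (H r)))//.
  apply: norm_Rintegral_le; [exact: integrable_RB|exact: integrable_RZl|].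
  move=> x /andP[sx xs']; have sxs : s <= x <= s' by rewrite !ltW.
  rewrite -dotpBr; apply: (le_trans (cauchy_schwarz _ _)); rewrite mulrC; apply: ler_wpM2r; first exact: nrm_ge0.
  apply: (le_trans (nrm_dist_trans (S (b - t) psi) _ _)).
  rewrite [nrm (S (b - t) _ - _)]nrmBC; apply: add_le2; [exact: h3 ss'|exact: h3 sxs].
have ZE : Z s' - Z s = (\int[leb]_(r in `]s, s'[) dotp mI (u r) sf' - c * (s' - s)) +
    (dotp mI (u s) (sp' - S (b - s) psi) + c * (s' - s)) +
    (\int[leb]_(r in `]s, s'[) dotp mI (H r) sp' - (I s' - I s)).
  rewrite /Z -/sp' dotpBr; clearbody I c; move: W.
  move: (dotp mI (u s') sp') (dotp mI (u s) sp') (dotp mI (u s) _) => x1 x2 x3.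
  move: (\int[leb]_(r in `]s, s'[) dotp mI (u r) sf') (\int[leb]_(r in `]s, s'[) dotp mI (H r) sp').
  by move=> y1 y2 W; lra.
rewrite ZE EI EL.
apply: (le_trans (ler_normD _ _)); apply: (le_trans (lerD (ler_normD _ _) (lexx _))).
apply: (le_trans (lerD (lerD B1 B2) B3)).
set NN := \int[leb]_(r in `]s, s'[) nrm (H r).
have NN0 : 0 <= NN by apply: Rintegral_ge0 => x _; exact: nrm_ge0.
apply: (@le_trans _ _ (C * eta * (s' - s + NN))).
  have p1 : 0 <= eta * (s' - s) by rewrite mulr_ge0 ?subr_ge0// ltW.
  have p2 : 0 <= eta * NN by rewrite mulr_ge0// ltW.
  have p3 : 0 <= (2 * Nf + 2 * Nu + 1) * (eta * NN) by rewrite mulr_ge0// !addr_ge0// mulr_ge0.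
  rewrite -subr_ge0 (_ : _ - _ = eta * (s' - s) + (2 * Nf + 2 * Nu + 1) * (eta * NN)); first exact: addr_ge0.
  by rewrite /C; ring.
by apply: ler_wpM2r => //; rewrite addr_ge0// subr_ge0.
Qed.

(** Every term is continuous in [psi], the integral with the constant [C * N], so density of the
    domain suffices. *)
Lemma duhamel (a b : R) (psi : X) : 0 <= a -> a <= b ->
  dotp mI (u b) psi = dotp mI (u a) (S (b - a) psi) +
  \int[leb]_(s in `]a, b[) dotp mI (H s) (S (b - s) psi).
Proof.
move=> a0 ab.
have [C C0 hC] := S_bounded l_gt0 e1_gt0 S_gen Cn_est (b - a).
have bab : 0 <= b - a by rewrite subr_ge0.
pose N := \int[leb]_(s in `]a, b[) nrm (H s).
apply/eqP; rewrite -subr_eq0; apply/eqP.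
apply: (@eps0 _ _ (nrm (u b) + C * nrm (u a) + C * N)) => e e0.
have [psi' [f [Af hp]]] := An_dense l_gt0 S_gen Cn_est psi e0.
have D' := duhamel_domain Af a0 ab.
have i1 := S_forcing_integrable psi (H_BI b a0).
have i2 := S_forcing_integrable psi' (H_BI b a0).
have iN := Bochner_nrm (H_BI b a0).
rewrite (_ : _ - _ = dotp mI (u b) (psi - psi') - dotp mI (u a) (S (b - a) psi - S (b - a) psi')
  - (\int[leb]_(s in `]a, b[) dotp mI (H s) (S (b - s) psi) -
     \int[leb]_(s in `]a, b[) dotp mI (H s) (S (b - s) psi'))); last first.
  have alg (p q r i j x : R) : x = q + j -> p - (r + i) = p - x - (r - q) - (i - j) by move=> ->; ring.
  by rewrite !dotpBr; exact: alg D'.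
have k1 : `|dotp mI (u b) (psi - psi')| <= nrm (u b) * e.
  by apply: (le_trans (cauchy_schwarz _ _)); apply: ler_wpM2l; [exact: nrm_ge0|exact: ltW].
have kS r : a <= r <= b -> nrm (S (b - r) psi - S (b - r) psi') <= C * e.
  move=> /andP[ar rb]; have br : 0 <= b - r by rewrite subr_ge0.
  rewrite (nrm_sg_sub S_gen _ _ br).
  have br' : 0 <= b - r <= b - a by rewrite br lerB.
  by apply: (le_trans (hC _ _ br')); apply: ler_wpM2l; exact: ltW.
have k2 : `|dotp mI (u a) (S (b - a) psi - S (b - a) psi')| <= nrm (u a) * (C * e).
  apply: (le_trans (cauchy_schwarz _ _)); apply: ler_wpM2l; first exact: nrm_ge0.
  by apply: kS; rewrite lexx.
have k3 : `|\int[leb]_(s in `]a, b[) dotp mI (H s) (S (b - s) psi) -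
     \int[leb]_(s in `]a, b[) dotp mI (H s) (S (b - s) psi')| <= C * e * N.
  rewrite -RintegralB// -(@RintegralZl _ _ _ leb _ (fun r => nrm (H r)))//.
  apply: norm_Rintegral_le; [exact: integrable_RB|exact: integrable_RZl|].
  move=> x /andP[ax xb]; rewrite -dotpBr; apply: (le_trans (cauchy_schwarz _ _)).
  rewrite mulrC; apply: ler_wpM2r; first exact: nrm_ge0.
  by apply: kS; rewrite !ltW.
apply: (le_trans (ler_normB _ _)); apply: (le_trans (lerD (ler_normB _ _) k3)).
apply: (le_trans (lerD (lerD k1 k2) (lexx _))).
by rewrite le_eqVlt; apply/orP; left; apply/eqP; ring.
Qed.

End duhamel.

(** * Increments of the predictor *)

Section predictor.
Context {R : realType}.
Notation leb := (@lebesgue_measure R).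
Notation RR := (measurableTypeR R).
Variables (l D e1 : R) (l_gt0 : 0 < l) (D_gt0 : 0 < D) (e1_gt0 : 0 < e1).
Notation mI := (muI 0 l).
Notation X := (XI l).
Variables (a1bar g : Linf mI) (S : R -> X -> X).
Notation A := (An e1 a1bar).
Hypothesis S_gen : is_semigroup setT A S.
Variables (Cn omn : R).
Hypothesis Cn_est : smoothing_estimate S Cn omn.

(** Pettis' theorem reduces membership to scalar measurability and an integrable bound on the
    squared norm. *)
Lemma Bochner_weak (a b : R) (f : R -> X) (m : R -> R) :
  (forall psi : X, measurable_fun (`]a, b[ : set RR) (fun t => dotp mI (f t) psi)) ->
  leb.-integrable `]a, b[ (EFin \o m) -> (forall t, a < t < b -> nrm (f t) ^+ 2 <= m t) ->
  Bochner_L2 a b f.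
Proof.
move=> mf im fm.
have sf : strongly_measurable `]a, b[ f.
  by apply: (pettis l_gt0 (test_dense l_gt0 S_gen Cn_est)).
apply: Bochner_sqr => //.
apply: (@integrable_Rle _ _ _ leb `]a, b[ (fun t : RR => nrm (f t) ^+ 2) m) => //.
  by apply: measurable_funX; exact: measurable_nrm.
move=> t; rewrite /= in_itv/= => tab; rewrite ger0_norm ?sqr_ge0//; exact: fm.
Qed.

Lemma Bochner_op (a b C : R) (f : R -> X) (T T' : X -> X) :
  (forall x psi : X, dotp mI (T x) psi = dotp mI x (T' psi)) ->
  (forall x : X, nrm (T x) <= C * nrm x) -> Bochner_L2 a b f -> Bochner_L2 a b (fun t => T (f t)).
Proof.
move=> TT bT fB; apply: (@Bochner_weak _ _ _ (fun t => C ^+ 2 * nrm (f t) ^+ 2)).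
- move=> psi; apply: (@eq_measurable_fun _ _ _ _ _ (fun t => dotp mI (f t) (T' psi))).
    by move=> t _; rewrite TT.
  by apply: measurable_dotp => //; case: fB.
- by apply: integrable_RZl => //; exact: Bochner_nrm_sqr.
move=> t _; rewrite -exprMn lerXn2r ?nnegrE ?nrm_ge0//.
by apply: le_trans (bT _); exact: nrm_ge0.
Qed.

Lemma Bochner_add (a b : R) (f h : R -> X) : Bochner_L2 a b f -> Bochner_L2 a b h ->
  Bochner_L2 a b (fun t => f t + h t : X).
Proof.
move=> fB hB; apply: (@Bochner_weak _ _ _ (fun t => 2 * nrm (f t) ^+ 2 + 2 * nrm (h t) ^+ 2)).
- move=> psi; apply: (@eq_measurable_fun _ _ _ _ _
    (fun t => dotp mI (f t) psi + dotp mI (h t) psi)); first by move=> t _; rewrite dotpDl.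
  by apply: measurable_funD; apply: measurable_dotp => //; [case: fB|case: hB].
- by apply: integrable_RD => //; apply: integrable_RZl => //; exact: Bochner_nrm_sqr.
move=> t _; apply: (@le_trans _ _ ((nrm (f t) + nrm (h t)) ^+ 2)).
  by rewrite lerXn2r ?nnegrE ?addr_ge0 ?nrm_ge0// nrmD.
rewrite -subr_ge0 (_ : _ - _ = (nrm (f t) - nrm (h t)) ^+ 2) ?sqr_ge0//; ring.
Qed.

Lemma Bochner_delay (a b c : R) (f : R -> X) : Bochner_L2 (a - c) (b - c) f ->
  Bochner_L2 a b (fun t => f (t - c)).
Proof.
move=> fB; apply: (@Bochner_weak _ _ _ (fun t => nrm (f (t - c)) ^+ 2)) => //.
- move=> psi.
  have : measurable_fun (`]a - c, b - c[ : set RR) (fun t => dotp mI (f t) psi).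
    by apply: measurable_dotp => //; case: fB.
  by move=> /(@measurable_fun_shift R _ _ a b (- c)).
- apply: (@integrable_shift R a b (- c) (EFin \o (fun t => nrm (f t) ^+ 2))).
  exact: Bochner_nrm_sqr.
Qed.

Variables (U u F Y : R -> X).
Hypothesis U_B : forall tau, 0 < tau -> Bochner_L2 (- D) tau U.
Hypothesis F_B : forall tau, 0 < tau -> Bochner_L2 0 tau F.
Hypothesis u_cont : forall t e : R, 0 <= t -> 0 < e -> exists2 del : R, 0 < del &
  forall s, 0 <= s -> `|s - t| < del -> nrm (u s - u t) <= e.
Notation G := (fun r => mulop g (U r)).
Notation H := (fun r => F r + mulop g (U (r - D)) : X).
Hypothesis weak : forall phi f, A phi f -> forall a b : R, 0 <= a -> a <= b ->
  dotp mI (u b) phi - dotp mI (u a) phi =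
  \int[leb]_(s in `]a, b[) (dotp mI (u s) f + dotp mI (H s) phi).
Hypothesis Y_pred : is_predictor D g S U u Y.

Lemma G_B (tau : R) : 0 < tau -> Bochner_L2 (- D) tau G.
Proof.
move=> t0; have [C _ hC] := mulop_bounded g.
by apply: (@Bochner_op _ _ C U (mulop g) (mulop g)) => //; [exact: mulop_sym|exact: U_B].
Qed.

Lemma G_BI (a b : R) : - D <= a -> Bochner_L2 a b G.
Proof.
move=> a0; have t0 : 0 < `|b| + 1 by rewrite ltr_wpDl.
by apply: Bochner_sub (G_B t0) => //; have := ler_norm b; lra.
Qed.

Lemma delayed_B (a b : R) : 0 <= a -> Bochner_L2 a b (fun t => G (t - D)).
Proof. by move=> a0; apply: Bochner_delay; apply: G_BI; lra. Qed.

Lemma total_forcing_B (tau : R) : 0 < tau -> Bochner_L2 0 tau H.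
Proof. by move=> t0; apply: Bochner_add; [exact: F_B|exact: delayed_B]. Qed.

Lemma S_comp_dotp (s t : R) (x psi : X) : 0 <= s -> 0 <= t ->
  dotp mI x (S s (S t psi)) = dotp mI x (S (s + t) psi).
Proof.
move=> s0 t0; apply: aeq_dotpr; apply: aeq_sym.
by have [_ /(_ psi Logic.I)[_ h] _ _] := S_gen; exact: h.
Qed.

(** Moving the window of the predictor from [s] to [s'] exchanges the delayed
    input for the present one; only [F] is transported by [S D]. *)
Lemma predictor_increment (s s' : R) (psi : X) : 0 <= s -> s <= s' ->
  dotp mI (Y s') psi = dotp mI (Y s) (S (s' - s) psi) +
  \int[leb]_(r in `]s, s'[) dotp mI (S D (F r) + G r : X) (S (s' - r) psi).
Proof.
move=> s0 ss'; have s'0 : 0 <= s' by exact: le_trans ss'.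
have D0 := ltW D_gt0.
have sym (t : R) (phi chi : X) : 0 <= t -> dotp mI (S t phi) chi = dotp mI phi (S t chi).
  by exact: (S_sym l_gt0 S_gen Cn_est).
pose k (r : R) := dotp mI (G r) (S (s' - r) psi).
have ik (a : R) : - D <= a -> leb.-integrable `]a, s'[ (EFin \o k).
  by move=> aD; apply: (S_forcing_integrable l_gt0 e1_gt0 S_gen Cn_est); exact: G_BI.
(* The predictor at time [t] expressed with the integrand [k] of the final time [s']; for [t = s]
   the condition on [phi] is the semigroup law. *)
have YE (t : R) (phi : X) : 0 <= t -> t <= s' -> (forall r : R, t - D < r < t -> dotp mI (G r) (S (t - r) phi) = k r) ->
    dotp mI (Y t) phi = dotp mI (u t) (S D phi) + \int[leb]_(r in `]t - D, t[) k r.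
  move=> t0 ts' hk; have [J hJ YJ] := Y_pred t0.
  rewrite (aeq_dotp _ YJ) dotpDl (sym _ _ _ D0); congr (_ + _).
  have [_ <-] := hJ phi.
  have -> : \int[leb]_(r in `]t - D, t[) k r = \int[leb]_(r in `]0, D[) k (r - (D - t)).
    have [E1 E2] : 0 - (D - t) = t - D /\ D - (D - t) = t by split; ring.
    rewrite Rintegral_oo_shift E1 E2//.
    by apply: (@integrable_oo_sub R (t - D) s') => //; apply: ik; lra.
  apply: eq_Rintegral => r; rewrite inE/= in_itv/= => /andP[r0 rD].
  rewrite sym ?subr_ge0 ?(ltW rD)// -hk; last by apply/andP; split; lra.
  by rewrite /zhist (_ : t - D + r = r - (D - t)); [congr (dotp _ _ (S _ _)); ring|ring].
have s'E := YE s' psi s'0 (lexx _) (fun r _ => erefl).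
have sE := YE s (S (s' - s) psi) s0 ss' _.
rewrite s'E {}sE; last first.
  move=> r /andP[_ rs]; rewrite /k S_comp_dotp ?subr_ge0 ?(ltW rs)//.
  by congr (dotp _ _ (S _ _)); ring.
have iF : leb.-integrable `]s, s'[ (EFin \o (fun r => dotp mI (F r) (S (s' - r) (S D psi)))).
  apply: (S_forcing_integrable l_gt0 e1_gt0 S_gen Cn_est).
  have t0 : 0 < s' + 1 by lra.
  by apply: Bochner_sub (F_B t0) => //; lra.
have iGd : leb.-integrable `]s, s'[ (EFin \o (fun r => dotp mI (G (r - D)) (S (s' - r) (S D psi)))).
  by apply: (S_forcing_integrable l_gt0 e1_gt0 S_gen Cn_est); exact: delayed_B.
rewrite (duhamel l_gt0 e1_gt0 S_gen Cn_est u_cont total_forcing_B weak (S D psi) s0 ss').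
have -> : \int[leb]_(r in `]s, s'[) dotp mI (H r) (S (s' - r) (S D psi)) =
    \int[leb]_(r in `]s, s'[) dotp mI (F r) (S (s' - r) (S D psi)) +
    \int[leb]_(r in `]s - D, s' - D[) k r.
  under eq_Rintegral do rewrite dotpDl.
  rewrite (RintegralD (mIoo s s') iF iGd); congr (_ + _).
  rewrite -Rintegral_oo_shift; last first.
    by apply: (@integrable_oo_sub R (s - D) s') => //; [lra|apply: ik; lra].
  have h (r : R) : s < r < s' -> dotp mI (G (r - D)) (S (s' - r) (S D psi)) = k (r - D).
    move=> /andP[sr rs']; rewrite /k S_comp_dotp ?subr_ge0 ?(ltW rs')//.
    by congr (dotp _ _ (S _ _)); ring.
  by apply: eq_Rintegral => r; rewrite inE/= in_itv/= => /h.
have -> : \int[leb]_(r in `]s, s'[) dotp mI (S D (F r) + G r) (S (s' - r) psi) =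
    \int[leb]_(r in `]s, s'[) dotp mI (F r) (S (s' - r) (S D psi)) + \int[leb]_(r in `]s, s'[) k r.
  rewrite -RintegralD//; last by apply: ik; lra.
  have h (r : R) : s < r < s' -> dotp mI (S D (F r) + G r) (S (s' - r) psi) =
      dotp mI (F r) (S (s' - r) (S D psi)) + k r.
    move=> /andP[sr rs']; rewrite dotpDl (sym _ _ _ D0) !S_comp_dotp ?subr_ge0 ?(ltW rs')//.
    by congr (dotp _ _ (S _ _) + _); ring.
  by apply: eq_Rintegral => r; rewrite inE/= in_itv/= => /h.
have -> : dotp mI (u s) (S (s' - s) (S D psi)) = dotp mI (u s) (S D (S (s' - s) psi)).
  by rewrite !S_comp_dotp ?subr_ge0// addrC.
have iks : leb.-integrable `]s - D, s'[ (EFin \o k) by apply: ik; lra.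
(* The integral of [k] over [(s - D, s')] is cut once at [s' - D] and once at [s]. *)
have [c1 c2] : s - D <= s' - D /\ s' - D <= s' by split; lra.
have [c3 c4] : s - D <= s /\ s <= s' by split; lra.
have E1 := Rintegral_oo_cat c1 c2 iks; have E2 := Rintegral_oo_cat c3 c4 iks.
have sum4 (p q x y z c : R) : x + y = z + c -> p + (q + x) + y = p + z + (q + c) by lra.
by apply: sum4; rewrite -E1.
Qed.

End predictor.

(** * The predictor as a mild solution of the closed loop *)

Section closed_loop_mild.
Context {R : realType}.
Notation leb := (@lebesgue_measure R).
Notation RR := (measurableTypeR R).

Lemma nrm_dual dT (T : measurableType dT) (mu : {measure set T -> \bar R}) (c : R) (y : L2 mu) :
  0 <= c -> (forall phi : L2 mu, `|dotp mu y phi| <= c * nrm phi) -> nrm y <= c.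
Proof.
move=> c0 h; have := nrm_ge0 y; rewrite le_eqVlt => /predU1P[<-//|y0].
by have := h y; rewrite -nrm_sqr ger0_norm ?sqr_ge0// expr2 ler_pM2r.
Qed.

Lemma norm_Rintegral_ae_le (a b : R) (f m : R -> R) :
  leb.-integrable `]a, b[ (EFin \o f) -> leb.-integrable `]a, b[ (EFin \o m) ->
  {ae leb, forall x, a < x < b -> `|f x| <= m x} ->
  `|\int[leb]_(x in `]a, b[) f x| <= \int[leb]_(x in `]a, b[) m x.
Proof.
move=> fi mi fm; apply: (le_trans (le_normr_Rintegral (mIoo a b) fi)).
apply: le_ae_Rintegral => //; first by have := integrable_norm fi; apply: eq_integrable.
Qed.

Variables (l e1 : R) (l_gt0 : 0 < l) (e1_gt0 : 0 < e1).
Notation mI := (muI 0 l).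
Notation X := (XI l).
Variables (a1bar g : Linf mI) (rho : R) (P K : X -> X).
Notation A := (An e1 a1bar).
Notation E := (Xcr e1 a1bar rho).
Hypothesis P_proj : orthogonal_projection E P.
Hypothesis K_lin : bounded_linear E K.
Variables (S SF : R -> X -> X).
Hypothesis S_gen : is_semigroup setT A S.
Variables (Cn omn : R).
Hypothesis Cn_est : smoothing_estimate S Cn omn.
Hypothesis SF_gen : is_semigroup setT (AF e1 a1bar g P K) SF.
Variable MF : R.
Hypothesis MF_gt0 : 0 < MF.
Hypothesis SF_bounded : forall t phi, 0 <= t -> nrm (SF t phi) <= MF * nrm phi.
Notation fb := (feedback g P K).

Variables (Y Q G : R -> X).
Hypothesis Q_B : forall tau, 0 < tau -> Bochner_L2 0 tau Q.
Hypothesis G_B : forall tau, 0 < tau -> Bochner_L2 0 tau G.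
Hypothesis Y_inc : forall (s s' : R) (psi : X), 0 <= s -> s <= s' ->
  dotp mI (Y s') psi = dotp mI (Y s) (S (s' - s) psi) +
  \int[leb]_(r in `]s, s'[) dotp mI (Q r + G r : X) (S (s' - r) psi).
Hypothesis GY : {ae leb, forall r, 0 <= r -> aeq mI (G r) (fb (Y r))}.
Notation N := (fun r => Q r + G r : X).

Lemma N_BI (a b : R) : 0 <= a -> Bochner_L2 a b N.
Proof.
move=> a0; have t0 : 0 < `|b| + 1 by rewrite ltr_wpDl.
have : Bochner_L2 0 (`|b| + 1) N.
  by apply: (Bochner_add l_gt0 S_gen Cn_est); [exact: Q_B|exact: G_B].
by apply: Bochner_sub => //; have := ler_norm b; lra.
Qed.

Lemma Q_BI (a b : R) : 0 <= a -> Bochner_L2 a b Q.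
Proof.
move=> a0; have t0 : 0 < `|b| + 1 by rewrite ltr_wpDl.
by apply: Bochner_sub (Q_B t0) => //; have := ler_norm b; lra.
Qed.

Lemma S_dotp_sym (t : R) (phi psi : X) : 0 <= t -> dotp mI (S t phi) psi = dotp mI phi (S t psi).
Proof. exact: (S_sym l_gt0 S_gen Cn_est). Qed.

Lemma Y_step (b : R) : exists2 C : R, 0 < C & forall s s', 0 <= s -> s <= s' -> s' <= b ->
  nrm (Y s' - S (s' - s) (Y s)) <= C * \int[leb]_(r in `]s, s'[) nrm (N r).
Proof.
have [C C0 hC] := S_bounded l_gt0 e1_gt0 S_gen Cn_est b; exists C => // s s' s0 ss' s'b.
have h0 : 0 <= s' - s by rewrite subr_ge0.
have NB := N_BI s' s0.
apply: nrm_dual.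
  by apply: mulr_ge0; [exact: ltW|apply: Rintegral_ge0 => x _; exact: nrm_ge0].
move=> phi; rewrite dotpBl (S_dotp_sym _ _ h0) (Y_inc phi s0 ss') addrAC subrr add0r.
rewrite mulrAC -(@RintegralZl _ _ _ leb _ (fun r => nrm (N r)))//; last exact: Bochner_nrm.
apply: norm_Rintegral_le.
- exact: (S_forcing_integrable l_gt0 e1_gt0 S_gen Cn_est).
- by apply: integrable_RZl => //; exact: Bochner_nrm.
move=> x /andP[sx xs']; apply: (le_trans (cauchy_schwarz _ _)); rewrite mulrC.
apply: ler_wpM2r; first exact: nrm_ge0.
by apply: hC; apply/andP; split; lra.
Qed.

(** Both [Y s] and [Y t] are compared with the orbit of [Y s0] from a common earlier time [s0], so
    that both sides of [t] are treated alike and continuity of a single orbit is enough. *)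
Lemma Y_cont (t e : R) : 0 <= t -> 0 < e -> exists2 del : R, 0 < del &
  forall s, 0 <= s -> `|s - t| < del -> nrm (Y s - Y t) <= e.
Proof.
move=> t0 e0; have [C C0 hC] := Y_step (t + 1).
have e8 : 0 < e / (8 * C) by apply: divr_gt0 => //; apply: mulr_gt0.
have tt : 0 <= t <= t + 1 by rewrite t0/=; lra.
have iN := Bochner_nrm (N_BI (t + 1) (lexx 0)).
have [d1 d10 h1] := primitive_eps tt e8 iN.
pose s0 := Num.max 0 (t - d1 / 2).
have d12 : 0 < d1 / 2 by rewrite divr_gt0.
have s00 : 0 <= s0 by rewrite le_max lexx.
have s0t : s0 <= t by rewrite ge_max t0/=; lra.
have s0d : t - d1 / 2 <= s0 by rewrite le_max lexx orbT.
have ts0 : 0 <= t - s0 by rewrite subr_ge0.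
have e2 : 0 < e / 2 by rewrite divr_gt0.
have [d2 d20 h2] := S_vcont l_gt0 S_gen Cn_est (t + 1) (Y s0) ts0 e2.
exists (Num.min 1 (Num.min (d1 / 2) d2)); first by rewrite !lt_min ltr01 d12.
move=> s sge0; rewrite !lt_min => /andP[st1 /andP[st2 st3]].
have [s1 s2] : s <= t + 1 /\ t - d1 / 2 < s.
  by move: st1 st2; rewrite !ltr_norml => /andP[_ h] /andP[h' _]; split; lra.
have s0s : s0 <= s by rewrite ge_max sge0/= ltW.
have step x : s0 <= x -> x <= t + 1 -> `|x - t| < d1 -> nrm (Y x - S (x - s0) (Y s0)) <= e / 4.
  move=> s0x xt xd; apply: (le_trans (hC _ _ s00 s0x xt)).
  have x0 : 0 <= x by exact: le_trans s0x.
  have E1 := Rintegral_oo_cat s00 s0x (integrable_oo_sub (lexx 0) xt iN).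
  have k1 := h1 x _ xd; have k2 := h1 s0 _ _.
  have {}k1 : `|\int[leb]_(r in `]0, x[) nrm (N r) - \int[leb]_(r in `]0, t[) nrm (N r)| <= e / (8 * C).
    by apply: k1; rewrite x0.
  have {}k2 : `|\int[leb]_(r in `]0, s0[) nrm (N r) - \int[leb]_(r in `]0, t[) nrm (N r)| <= e / (8 * C).
    apply: k2; first by rewrite s00/=; lra.
    rewrite distrC ger0_norm//; apply: le_lt_trans (_ : d1 / 2 < d1); last by rewrite ltr_pdivrMr// ltr_pMr// ltr1n.
    by rewrite lerBlDr -lerBlDl.
  have -> : e / 4 = C * (e / (8 * C) + e / (8 * C)) by field; rewrite gt_eqF.
  apply: ler_wpM2l; first exact: ltW.
  move: k1 k2 => /ler_normlP[_ k1] /ler_normlP[k2 _]; move: E1 k1 k2; lra.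
have -> : e = e / 4 + (e / 2 + e / 4) by field.
apply: (le_trans (nrm_dist_trans (S (s - s0) (Y s0)) _ _)); apply: lerD.
  by apply: step => //; lra.
apply: (le_trans (nrm_dist_trans (S (t - s0) (Y s0)) _ _)); apply: lerD.
  apply: h2; first by apply/andP; split; lra.
  by rewrite (_ : s - s0 - (t - s0) = s - t)//; ring.
by rewrite nrmBC; apply: step; rewrite ?subrr ?normr0//; lra.
Qed.

(** Puts the increment of [Y] in the form of a vector integral, to which functionals built from [SF]
    can be applied. *)
Lemma S_conv_vint (s s' : R) : 0 <= s -> s <= s' ->
  [/\ strongly_measurable `]s, s'[ (fun r => S (s' - r) (N r)),
      leb.-integrable `]s, s'[ (EFin \o (fun r => nrm (S (s' - r) (N r)))) &
      is_vint s s' (fun r => S (s' - r) (N r)) (Y s' - S (s' - s) (Y s))].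
Proof.
move=> s0 ss'; have NB := N_BI s' s0.
have Ed r (phi : X) : s < r < s' -> dotp mI (S (s' - r) (N r)) phi = dotp mI (N r) (S (s' - r) phi).
  by move=> /andP[_ rs']; rewrite S_dotp_sym// subr_ge0 ltW.
have iN (phi : X) := S_forcing_integrable l_gt0 e1_gt0 S_gen Cn_est phi NB.
have iS (phi : X) : leb.-integrable `]s, s'[ (EFin \o (fun r => dotp mI (S (s' - r) (N r)) phi)).
  apply: eq_integrable (iN phi) => // r; rewrite inE/= in_itv/= => rs /=.
  by rewrite -Ed.
have sm : strongly_measurable `]s, s'[ (fun r => S (s' - r) (N r)).
  apply: (pettis l_gt0 (test_dense l_gt0 S_gen Cn_est)) => // phi.
  exact: integrable_measurable_fun (iS phi).
have [C C0 hC] := S_bounded l_gt0 e1_gt0 S_gen Cn_est (s' - s).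
split=> //.
- apply: (@integrable_Rle _ _ _ leb `]s, s'[ (fun r : RR => nrm (S (s' - r) (N r)))
    (fun r => C * nrm (N r))) => //.
  + exact: measurable_nrm.
  + move=> r; rewrite /= in_itv/= ger0_norm ?nrm_ge0// => /andP[sr rs'].
    by apply: hC; apply/andP; split; lra.
  + by apply: integrable_RZl => //; exact: Bochner_nrm.
move=> phi; split; first exact: iS.
have h0 : 0 <= s' - s by rewrite subr_ge0.
rewrite dotpBl (S_dotp_sym _ _ h0) (Y_inc phi s0 ss') addrAC subrr add0r.
by apply: eq_Rintegral => r; rewrite inE/= in_itv/=; exact: Ed.
Qed.

Section functional.
Variables (T : R) (psi : X) (T0 : 0 <= T).
Notation L := (fun r x => dotp mI (SF (T - r) x) psi).
Notation M := (MF * nrm psi).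

Lemma L_bound (r : R) (x : X) : r <= T -> `|L r x| <= M * nrm x.
Proof.
move=> rT; apply: (le_trans (cauchy_schwarz _ _)); rewrite mulrAC; apply: ler_wpM2r; first exact: nrm_ge0.
by apply: SF_bounded; rewrite subr_ge0.
Qed.

Lemma L_lin (r c : R) (x y : X) : r <= T -> L r (c *: x + y) = c * L r x + L r y.
Proof.
move=> rT; have rT0 : 0 <= T - r by rewrite subr_ge0.
by rewrite (aeq_dotp _ (sg_lin SF_gen c x y rT0)) dotpDl dotpZl.
Qed.

Lemma L_sub (r : R) (x y : X) : r <= T -> L r (x - y) = L r x - L r y.
Proof.
move=> rT; have rT0 : 0 <= T - r by rewrite subr_ge0.
by rewrite (aeq_dotp _ (sg_subr SF_gen x y rT0)) dotpBl.
Qed.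

Lemma L_split (r r' : R) (x : X) : r <= r' -> r' <= T -> L r x = L r' (SF (r' - r) x).
Proof.
move=> rr' r'T; have r0 : 0 <= T - r' by rewrite subr_ge0.
have r1 : T - r' <= T - r by lra.
rewrite (aeq_dotp _ (sg_split SF_gen x r0 r1)).
by congr (dotp _ (SF _ (SF _ _)) _); ring.
Qed.

Lemma L_Q_integrable (a b : R) : 0 <= a -> b <= T ->
  leb.-integrable `]a, b[ (EFin \o (fun r => L r (Q r))).
Proof.
move=> a0 bT; have QB := Q_BI b a0.
apply: (rev_integrable (L := fun r x => L r x) (C := M)) => //.
- by case: QB.
- exact: Bochner_nrm.
- move=> x t e /andP[at_ tb] e0.
  have tT : 0 <= t <= T by apply/andP; split; lra.
  have [del d0 hd] := @vcont_in_dotp _ _ _ mI 0 T (fun s => SF (T - s) x) (fun=> psi) t e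
    (SF_rev_vcont SF_gen MF_gt0 SF_bounded tT (cst_vcont _ _ _ _)) (cst_vcont _ _ _ _) e0.
  exists del => // s /andP[as_ sb] st; apply: hd => //.
  by apply/andP; split; lra.
- by move=> t x y /andP[_ tb]; rewrite -L_sub ?L_bound//; exact: le_trans bT.
- by move=> t x /andP[_ tb]; apply: L_bound; exact: le_trans bT.
Qed.

(** First order expansion of Duhamel's formula for [SF] against [S]. *)
Lemma SF_sub_S_close (eta : R) (z x y : X) (h Cf Cs : R) : 0 <= h -> 0 <= eta -> 0 <= Cf -> 0 <= Cs ->
  (forall phi, nrm (fb phi) <= Cf * nrm phi) ->
  (forall s phi, 0 <= s <= h -> nrm (S s phi) <= Cs * nrm phi) ->
  z = fb y -> nrm (x - y) <= eta ->
  (forall s, 0 <= s <= h -> nrm (S s y - y) <= eta) ->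
  (forall s, 0 <= s <= h -> nrm (SF s z - z) <= eta) ->
  nrm (SF h x - S h x - h *: z) <= (MF * (Cf * (Cs + 1)) + 1) * eta * h.
Proof.
move=> h0 eta0 Cf0 Cs0 hf hS zE xy Sy Sz.
have c0 : 0 <= (MF * (Cf * (Cs + 1)) + 1) * eta.
  by rewrite !(mulr_ge0, addr_ge0)// ltW.
apply: nrm_dual; first exact: mulr_ge0.
move=> phi; rewrite !dotpBl dotpZl.
rewrite (SF_duhamel l_gt0 e1_gt0 P_proj K_lin S_gen Cn_est SF_gen MF_gt0 SF_bounded x phi h0).
have iJ : leb.-integrable `]0, h[ (EFin \o (fun s => dotp mI (SF (h - s) (fb (S s x))) phi)).
  apply: eps_continuous_integrable => t e th e0.
  exact: (SF_integrand_cont l_gt0 P_proj K_lin S_gen Cn_est SF_gen MF_gt0 SF_bounded).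
have -> : h * dotp mI z phi = \int[leb]_(s in `]0, h[) dotp mI z phi.
  by rewrite Rintegral_oo_cst// subr0 mulrC.
have iz := integrable_oo_cst 0 h (dotp mI z phi).
rewrite -RintegralB//.
have -> : (MF * (Cf * (Cs + 1)) + 1) * eta * h * nrm phi =
    \int[leb]_(s in `]0, h[) ((MF * (Cf * (Cs + 1)) + 1) * eta * nrm phi).
  by rewrite Rintegral_oo_cst// subr0; ring.
apply: norm_Rintegral_le; [exact: integrable_RB|exact: integrable_oo_cst|].
move=> s /andP[s0 sh]; rewrite -dotpBl; apply: (le_trans (cauchy_schwarz _ _)).
apply: ler_wpM2r; first exact: nrm_ge0.
have s_h : 0 <= s <= h by rewrite !ltW.
have hs : 0 <= h - s by rewrite subr_ge0 ltW.
have hs' : 0 <= h - s <= h by apply/andP; split; lra.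
apply: (le_trans (nrm_dist_trans (SF (h - s) z) _ _)).
rewrite (nrm_sg_sub SF_gen _ _ hs) mulrDl mul1r; apply: lerD; last exact: Sz.
apply: (le_trans (SF_bounded _ hs)); rewrite -!mulrA; apply: ler_wpM2l; first exact: ltW.
rewrite zE (feedback_sub l_gt0 g P_proj K_lin); apply: (le_trans (hf _)); apply: ler_wpM2l => //.
apply: (le_trans (nrm_dist_trans (S s y) _ _)).
have s0' := ltW s0.
rewrite (nrm_sg_sub S_gen _ _ s0') mulrDl mul1r; apply: lerD; last exact: Sy.
by apply: (le_trans (hS _ _ s_h)); apply: ler_wpM2l.
Qed.

(** [A_F] is not symmetric, so no adjoint is available: instead the increments
    of [s |-> <SF (T - s) (Y s), psi>] are estimated at every tag by means of
    the continuity of [Y] and the expansion of [SF h - S h]. *)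
Lemma mild_functional : L T (Y T) = L 0 (Y 0) + \int[leb]_(r in `]0, T[) L r (Q r).
Proof.
have [Cs Cs0 hCs] := S_bounded l_gt0 e1_gt0 S_gen Cn_est (T + 1).
have [Cd Cd0 hCd] := SF_sub_S l_gt0 e1_gt0 P_proj K_lin S_gen Cn_est SF_gen MF_gt0 SF_bounded (T + 1).
have [Cf Cf0 hCf] := feedback_bounded g P_proj K_lin : exists2 C : R, 0 < C &
  forall phi, nrm (fb phi) <= C * nrm phi.
have iL := L_Q_integrable (lexx 0) (lexx T).
have iQ := Bochner_nrm (Q_BI T (lexx 0)).
have M0 : 0 <= M by rewrite mulr_ge0 ?nrm_ge0// ltW.
pose I s := \int[leb]_(r in `]0, s[) L r (Q r).
pose Z s := L s (Y s) - I s.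
pose La s := s + \int[leb]_(r in `]0, s[) nrm (Q r).
suff E0 : Z T = Z 0.
  move: E0; rewrite /Z {2}/I set_itvoo0 Rintegral_set0 (subr0 (L 0 _)) => <-.
  by rewrite /I addrNK.
apply: (@cousin_eq R 0 T Z La T0) => e t e0 /andP[t0 tT].
set z := fb (Y t).
pose k1 := Cs * Cf + 1; pose k2 := MF * (Cf * (Cs + 1)) + 1.
have [k10 k20] : 0 <= k1 /\ 0 <= k2.
  split; first by rewrite /k1 addr_ge0// mulr_ge0// ltW.
  rewrite /k2 addr_ge0// mulr_ge0 ?ltW// mulr_gt0//; lra.
pose C := M * (k1 + k2) + M * Cd + 1.
have C0 : 0 < C.
  have p1 : 0 <= M * (k1 + k2) by rewrite mulr_ge0// addr_ge0.
  have p2 : 0 <= M * Cd by rewrite mulr_ge0// ltW.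
  rewrite /C; lra.
pose eta := Num.min 1 (e / C).
have eta0 : 0 < eta by rewrite lt_min ltr01 divr_gt0.
have [eta1 etaC] : eta <= 1 /\ C * eta <= e.
  by rewrite mulrC -ler_pdivlMr// /eta !ge_min !lexx orbT.
have [d1 d10 h1] := Y_cont t0 eta0.
have [d2 d20 h2] := S_vcont l_gt0 S_gen Cn_est 1 z (lexx 0) eta0.
have [d3 d30 h3] := sg_vcont SF_gen (SF_bounded_away MF_gt0 SF_bounded) 1 z (lexx 0) eta0.
have [d4 d40 h4] := S_vcont l_gt0 S_gen Cn_est 1 (Y t) (lexx 0) eta0.
clearbody eta.
pose del := Num.min (Num.min d1 d2) (Num.min d3 (Num.min d4 eta)).
have del0 : 0 < del by rewrite !lt_min d10 d20 d30 d40 eta0.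
have [[de1 de2] [de3 [de4 de5]]] : (del <= d1 /\ del <= d2) /\ (del <= d3 /\ (del <= d4 /\ del <= eta)).
  by do ?split; rewrite /del !ge_min !lexx ?orbT.
clearbody del.
exists (del / 2); first by rewrite divr_gt0.
move=> s s' /andP[s0 st] /andP[ts' s'T] hs hs'.
have ss' : s <= s' by exact: le_trans ts'.
set h := s' - s.
have h0 : 0 <= h by rewrite subr_ge0.
have hdel : h < del by rewrite /h; lra.
have hT : h <= T + 1.
  by apply: (le_trans (lerB s'T s0)); rewrite subr0 lerDl.
have sT : s <= T by exact: le_trans ss' s'T.
have del2 : del / 2 <= del by rewrite [leRHS]splitr lerDl ltW// divr_gt0.
have hs2 : t - del < s by apply: le_lt_trans hs; rewrite lerD2l lerN2.
have hs2' : s' < t + del by apply: (lt_le_trans hs'); rewrite lerD2l.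
have {}h1 r : s <= r <= s' -> nrm (Y r - Y t) <= eta.
  move=> /andP[sr rs']; apply: h1; first exact: le_trans sr.
  apply: lt_le_trans de1; apply: near_tag hs2 hs2' _; exact/andP.
have id0 (W : X) (V : R -> X -> X) : aeq mI (V 0 W) W -> forall c : R, nrm (V c W - V 0 W) <= eta -> nrm (V c W - W) <= eta.
  by move=> hV c; rewrite (aeq_nrm (aeqB (aeq_refl _) hV)).
have S0 (W : X) : aeq mI (S 0 W) W by have [_ /(_ W Logic.I)[]] := S_gen.
have SF0 (W : X) : aeq mI (SF 0 W) W by have [_ /(_ W Logic.I)[]] := SF_gen.
have near0 (c : R) : 0 <= c <= h -> 0 <= c <= 1 /\ `|c - 0| < del.
  move=> /andP[c0 ch]; rewrite subr0 ger0_norm// c0/=.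
  by split; [rewrite (le_trans ch)// (le_trans (ltW hdel))// (le_trans de5)|exact: le_lt_trans hdel].
have {}h2 c : 0 <= c <= h -> nrm (S c z - z) <= eta.
  by move=> /near0[n1 n2]; apply: (id0 z S) => //; apply: h2 => //; exact: lt_le_trans de2.
have {}h3 c : 0 <= c <= h -> nrm (SF c z - z) <= eta.
  by move=> /near0[n1 n2]; apply: (id0 z SF) => //; apply: h3 => //; exact: lt_le_trans de3.
have {}h4 c : 0 <= c <= h -> nrm (S c (Y t) - Y t) <= eta.
  by move=> /near0[n1 n2]; apply: (id0 (Y t) S) => //; apply: h4 => //; exact: lt_le_trans de4.
have {}hCs c phi : 0 <= c <= h -> nrm (S c phi) <= Cs * nrm phi.
  by move=> /andP[c0 ch]; apply: hCs; rewrite c0/=; exact: le_trans hT.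
have [smv inv vint] := S_conv_vint s0 ss'; rewrite -/h in vint.
have [iV EV] := vint_bounded_functional smv inv vint
  (fun c x y => L_lin c x y s'T) (fun x => L_bound x s'T).
have close := SF_sub_S_close h0 (ltW eta0) (ltW Cf0) (ltW Cs0) hCf hCs (erefl z)
  (h1 s (introT andP (conj (lexx s) ss'))) h4 h3.
rewrite -/k2 in close.
have iLs := L_Q_integrable s0 s'T.
have iQs : leb.-integrable `]s, s'[ (EFin \o (fun r => nrm (Q r))).
  exact: integrable_oo_sub iQ.
have EI : I s' - I s = \int[leb]_(r in `]s, s'[) L r (Q r).
  by rewrite /I (Rintegral_oo_cat s0 ss' (integrable_oo_sub (lexx 0) s'T iL)) addrC addKr.
have EL : La s' - La s = h + \int[leb]_(r in `]s, s'[) nrm (Q r).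
  by rewrite /La (Rintegral_oo_cat s0 ss' (integrable_oo_sub (lexx 0) s'T iQ)) /h; ring.
(* Pointwise defect: the feedback part of [S (s' - r) (N r)] is close to [z], and its [Q] part
   differs from [SF (s' - r) (Q r)] by [O(h) |Q r|]. The [h *: z] so produced cancels the
   first-order term of [SF h - S h]. *)
pose Er r := L s' (S (s' - r) (N r)) - L r (Q r) - L s' z.
have iz := integrable_oo_cst s s' (L s' z).
have iVL := integrable_RB (mIoo s s') iV iLs.
have iE := integrable_RB (mIoo s s') iVL iz.
have EE : \int[leb]_(r in `]s, s'[) Er r =
    L s' (Y s' - S h (Y s)) - (I s' - I s) - h * L s' z.
  rewrite /Er RintegralB// RintegralB// EV EI Rintegral_oo_cst// -/h; congr (_ - _); exact: mulrC.
have ZE : Z s' - Z s = \int[leb]_(r in `]s, s'[) Er r - L s' (SF h (Y s) - S h (Y s) - h *: z).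
  rewrite EE !L_sub//.
  have -> : L s' (h *: z) = h * L s' z.
    have rT0 : 0 <= T - s' by rewrite subr_ge0.
    by rewrite (aeq_dotp _ (sg_Z SF_gen h z rT0)) dotpZl.
  rewrite /Z (L_split (Y s) ss' s'T) -/h.
  move: (L s' _) (L s' _) (L s' _) (L s' _) (I s') (I s) => x1 x2 x3 x4 x5 x6; ring.
have B2 : `|L s' (SF h (Y s) - S h (Y s) - h *: z)| <= M * (k2 * eta * h).
  by apply: (le_trans (L_bound _ s'T)); apply: ler_wpM2l.
have B1 : `|\int[leb]_(r in `]s, s'[) Er r| <=
    M * (k1 * eta) * h + M * (Cd * eta) * \int[leb]_(r in `]s, s'[) nrm (Q r).
  rewrite -(Rintegral_oo_cst _ ss') -(@RintegralZl _ _ _ leb _ (fun r => nrm (Q r)))//.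
  have ic := integrable_oo_cst s s' (M * (k1 * eta)).
  have iQc := integrable_RZl (mIoo s s') (M * (Cd * eta)) iQs.
  rewrite -RintegralD//; apply: norm_Rintegral_ae_le => //; first exact: integrable_RD.
  apply: filterS GY => r GYr /andP[sr rs'].
  have r0 : 0 <= r by rewrite (le_trans s0)// ltW.
  have {}GYr := GYr r0.
  have c0 : 0 <= s' - r by rewrite subr_ge0 ltW.
  have ch : 0 <= s' - r <= h by rewrite c0 lerB// ltW.
  have cT : 0 <= s' - r <= T + 1 by case/andP: ch => _ ch; rewrite c0 (le_trans ch hT).
  have rs : s <= r <= s' by rewrite !ltW.
  have aN : aeq mI (S (s' - r) (N r)) (S (s' - r) (Q r) + S (s' - r) (fb (Y r)) : X).
    apply: (@aeq_trans _ _ _ _ _ (S (s' - r) (1 *: Q r + fb (Y r)))).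
      by apply: (sg_congr S_gen) => //; rewrite scale1r; exact: aeqD (aeq_refl _) GYr.
    by have := sg_lin S_gen 1 (Q r) (fb (Y r)) c0; rewrite (scale1r (S (s' - r) (Q r) : X)).
  have s'T0 : 0 <= T - s' by rewrite subr_ge0.
  have -> : Er r = L s' (S (s' - r) (fb (Y r)) - z) - L s' (SF (s' - r) (Q r) - S (s' - r) (Q r)).
    have alg (x y z1 p q : R) : x = p + q -> x - y - z1 = q - z1 - (y - p) by move=> ->; ring.
    have E1 := aeq_dotp psi (sg_congr SF_gen s'T0 aN).
    have E2 := L_lin 1 (S (s' - r) (Q r)) (S (s' - r) (fb (Y r))) s'T.
    rewrite (scale1r (S (s' - r) (Q r) : X)) mul1r in E2.
    rewrite (L_sub _ _ s'T) (L_sub (SF (s' - r) (Q r)) _ s'T) /Er (L_split (Q r) (ltW rs') s'T).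
    exact: alg (etrans E1 E2).
  apply: (le_trans (ler_normB _ _)); apply: lerD; apply: (le_trans (L_bound _ s'T)).
    apply: ler_wpM2l => //.
    apply: (le_trans (nrm_dist_trans (S (s' - r) z) _ _)).
    rewrite (nrm_sg_sub S_gen _ _ c0) /k1 mulrDl mul1r; apply: lerD; last exact: h2.
    apply: (le_trans (hCs _ _ ch)); rewrite -mulrA; apply: ler_wpM2l; first exact: ltW.
    rewrite (feedback_sub l_gt0 g P_proj K_lin); apply: (le_trans (hCf _)); apply: ler_wpM2l; first exact: ltW.
    exact: h1.
  rewrite -[in leRHS]mulrA; apply: ler_wpM2l => //; apply: (le_trans (hCd _ _ cT)).
  apply: ler_wpM2r; first exact: nrm_ge0.
  apply: ler_wpM2l; first exact: ltW.
  by move: ch => /andP[_ ch]; rewrite (le_trans ch)// ltW// (lt_le_trans hdel).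
rewrite ZE EL; apply: (le_trans (ler_normB _ _)); apply: (le_trans (lerD B1 B2)).
set NN := \int[leb]_(r in `]s, s'[) nrm (Q r).
have NN0 : 0 <= NN by apply: Rintegral_ge0 => x _; exact: nrm_ge0.
apply: (@le_trans _ _ (C * eta * (h + NN))); last first.
  by apply: ler_wpM2r => //; exact: addr_ge0.
have q1 : 0 <= eta * NN by rewrite mulr_ge0// ltW.
have q2 : 0 <= eta * h by rewrite mulr_ge0// ltW.
rewrite -subr_ge0 (_ : _ - _ = (M * Cd + 1) * (eta * h) + (M * (k1 + k2) + 1) * (eta * NN)); last first.
  by rewrite /C; ring.
apply: addr_ge0; apply: mulr_ge0 => //; apply: addr_ge0 => //; apply: mulr_ge0 => //.
  exact: ltW.
exact: addr_ge0.
Qed.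

End functional.

Lemma closed_loop_is_mild (t : R) : 0 <= t -> exists2 J : X,
  is_vint 0 t (fun s => SF (t - s) (Q s)) J & aeq mI (Y t) (SF t (Y 0) + J : X).
Proof.
move=> t0; exists (Y t - SF t (Y 0)); last by rewrite addrC subrK; exact: aeq_refl.
move=> psi; split; first exact: (L_Q_integrable psi (lexx 0) (lexx t)).
have := mild_functional psi t0; rewrite subrr subr0 => E0.
have SF0 : aeq mI (SF 0 (Y t)) (Y t) by have [_ /(_ (Y t) Logic.I)[]] := SF_gen.
by rewrite dotpBl -(aeq_dotp _ SF0) E0 addrC addKr.
Qed.

End closed_loop_mild.

(** * Convolution with the smoothing kernel *)

Section kernel.
Context {R : realType}.
Notation leb := (@lebesgue_measure R).
Notation RR := (measurableTypeR R).

Lemma measurable_invsqrt (D : R) :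
  measurable_fun (`]0, D[ : set RR) (fun r : R => (Num.sqrt r)^-1).
Proof.
apply: open_continuous_measurable_fun; first exact: interval_open.
move=> r /set_mem; rewrite /= in_itv/= => /andP[r0 _].
apply: cvgV; first by rewrite gt_eqF// sqrtr_gt0.
exact: sqrt_continuous.
Qed.

(** Exhaustion by [(1 / (n + 1), D)], where the primitive [2 sqrt x] bounds the integrals; monotone
    convergence reaches the singular end point. *)
Lemma invsqrt_integrable (D : R) : leb.-integrable `]0, D[ (EFin \o (fun r => (Num.sqrt r)^-1)).
Proof.
have m0 : measurable_fun (`]0, D[ : set RR) (fun r : R => (Num.sqrt r)^-1).
  exact: measurable_invsqrt.
apply: ge0_integrable => //.
pose F n : set RR := `]n.+1%:R^-1, D[%classic.
have E : \bigcup_n F n = `]0, D[%classic.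
  apply/seteqP; split=> [x [n _]|x]; rewrite /F /= !in_itv/= => /andP[x1 x2].
    by rewrite x2 andbT (lt_trans _ x1)// invr_gt0.
  have [n _ hn] := near_infty_natSinv_lt (PosNum x1).
  exists n => //=; rewrite in_itv/= x2 andbT; exact: (hn n (leqnn n)).
have FS n : F n `<=` `]0, D[%classic by rewrite -E; exact: bigcup_sup.
have cvg : (\int[leb]_(x in F n) ((Num.sqrt x)^-1)%:E @[n --> \oo] -->
    \int[leb]_(x in \bigcup_n F n) ((Num.sqrt x)^-1)%:E)%E.
  apply: ge0_nondecreasing_set_cvg_integral.
  - move=> n m nm; apply/subsetPset => x; rewrite /F /= !in_itv/= => /andP[x1 ->].
    by rewrite andbT (le_lt_trans _ x1)// lef_pV2 ?posrE// ler_nat ltnS.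
  - by move=> n; rewrite /F.
  - by move=> n; apply/measurable_EFinP; exact: measurable_funS m0.
  - by move=> n x _; rewrite lee_fin invr_ge0 sqrtr_ge0.
rewrite -E; apply: (@le_lt_trans _ _ (2 * Num.sqrt D)%:E); last exact: ltry.
rewrite -(cvg_lim _ cvg)//; apply: lime_le; first by apply/cvg_ex; eexists; exact: cvg.
apply: nearW => n.
have n0 : 0 < n.+1%:R^-1 :> R by rewrite invr_gt0.
have [Dn|nD] := leP D n.+1%:R^-1.
  by rewrite /F oo0// integral_set0 lee_fin mulr_ge0 ?sqrtr_ge0.
have cf x : n.+1%:R^-1 <= x <= D -> is_derive x (1 : R) (fun x => 2 * Num.sqrt x) ((Num.sqrt x)^-1) /\
    {for x, continuous (fun x : R => (Num.sqrt x)^-1)}.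
  move=> /andP[nx _]; have x0 : 0 < x by exact: lt_le_trans nx.
  split; last by apply: cvgV; [rewrite gt_eqF// sqrtr_gt0|exact: sqrt_continuous].
  have d := is_derive1_sqrt x0.
  have := @is_deriveZ _ _ _ Num.sqrt 2 x 1 _ d.
  by move=> h; apply: is_derive_eq h _; rewrite /GRing.scale/= invfM mulrA divff// mul1r.
have I := Rintegral_derive (ltW nD) cf.
have iF : leb.-integrable (F n) (EFin \o (fun r => (Num.sqrt r)^-1)).
  apply: (@integrable_Rle _ _ _ leb (F n) (fun r : R => (Num.sqrt r)^-1)
    (cst (Num.sqrt n.+1%:R^-1)^-1)) => //; first by rewrite /F.
  - exact: measurable_funS m0.
  - move=> x; rewrite /F /= in_itv/= => /andP[nx _].
    rewrite ger0_norm ?invr_ge0 ?sqrtr_ge0// lef_pV2 ?posrE ?sqrtr_gt0//; last exact: lt_trans nx.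
    by rewrite ler_wsqrtr// ltW.
  - exact: integrable_oo_cst.
apply: (@le_trans _ _ (\int[leb]_(x in F n) (Num.sqrt x)^-1)%:E); first by rewrite (EFin_Rintegral (mIoo _ _) iF).
by rewrite lee_fin /F I gerBl mulr_ge0// sqrtr_ge0.
Qed.

Lemma kernel_integrable (D c om : R) :
  leb.-integrable `]0, D[ (EFin \o (fun r => c * ((Num.sqrt r)^-1 * expR (om * r)))).
Proof.
apply: integrable_RZl => //.
apply: (@integrable_Rle _ _ _ leb `]0, D[ (fun r : RR => (Num.sqrt r)^-1 * expR (om * r))
  (fun r => expR (`|om| * D) * (Num.sqrt r)^-1)) => //.
- apply: measurable_funM; first exact: measurable_invsqrt.
  by apply: measurable_funTS; apply: measurableT_comp => //; exact: measurable_funM.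
- move=> r; rewrite /= in_itv/= => /andP[r0 rD].
  rewrite ger0_norm ?mulr_ge0 ?expR_ge0 ?invr_ge0 ?sqrtr_ge0// mulrC.
  apply: ler_wpM2r; first by rewrite invr_ge0 sqrtr_ge0.
  rewrite ler_expR; apply: (le_trans (ler_norm _)); rewrite normrM (gtr0_norm r0).
  by apply: ler_wpM2l => //; exact: ltW.
- by apply: integrable_RZl => //; exact: invsqrt_integrable.
Qed.

(** Cauchy-Schwarz for the measure [k dr], with the factors [sqrt k] and [sqrt k * h]. *)
Lemma weighted_cauchy_schwarz (D : R) (k h : R -> R) :
  leb.-integrable `]0, D[ (EFin \o k) -> measurable_fun (`]0, D[ : set RR) h ->
  (forall r, 0 <= k r) ->
  leb.-integrable `]0, D[ (EFin \o (fun r => k r * h r ^+ 2)) ->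
  leb.-integrable `]0, D[ (EFin \o (fun r => k r * h r)) /\
  (\int[leb]_(r in `]0, D[) (k r * h r)) ^+ 2 <=
  (\int[leb]_(r in `]0, D[) k r) * \int[leb]_(r in `]0, D[) (k r * h r ^+ 2).
Proof.
move=> ik mh k0 ikh.
have mk := integrable_measurable_fun ik.
have ms : measurable_fun (`]0, D[ : set RR) (fun r => Num.sqrt (k r)).
  by apply: measurableT_comp mk; apply: continuous_measurable_fun; exact: sqrt_continuous.
have msh : measurable_fun (`]0, D[ : set RR) (fun r => Num.sqrt (k r) * h r) by exact: measurable_funM.
have E1 : (fun r => Num.sqrt (k r) ^+ 2) = k by apply/funext => r; rewrite sqr_sqrtr.
have E2 : (fun r => (Num.sqrt (k r) * h r) ^+ 2) = (fun r => k r * h r ^+ 2).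
  by apply/funext => r; rewrite exprMn sqr_sqrtr.
have E3 : (fun r => Num.sqrt (k r) * (Num.sqrt (k r) * h r)) = (fun r => k r * h r).
  by apply/funext => r; rewrite mulrA -expr2 sqr_sqrtr.
split.
  by have := integrable_sqrM (mIoo 0 D) ms msh; rewrite E1 E2 E3; apply.
by have := Rintegral_cauchy_schwarz (mIoo 0 D) ms msh; rewrite E1 E2 E3; apply.
Qed.

(** Young's inequality for [L^1] and [L^2] before its concluding Cauchy-Schwarz step. Restricting to
    [t > D] keeps [t - r] inside [(0, T)]. [Phi] is the finite part of a Tonelli integral, hence
    correct for almost every [t]. *)
Lemma young (D T : R) (k h : R -> R) : 0 < D ->
  leb.-integrable `]0, D[ (EFin \o k) -> (forall r, 0 <= k r) ->
  leb.-integrable `]0, T[ (EFin \o (fun t => h t ^+ 2)) ->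
  exists Phi : R -> R,
  [/\ leb.-integrable `]D, T[ (EFin \o Phi),
      \int[leb]_(t in `]D, T[) Phi t <=
        (\int[leb]_(r in `]0, D[) k r) * \int[leb]_(t in `]0, T[) (h t ^+ 2) &
      {ae leb, forall t, D < t < T ->
        leb.-integrable `]0, D[ (EFin \o (fun r => k r * h (t - r) ^+ 2)) /\
        Phi t = \int[leb]_(r in `]0, D[) (k r * h (t - r) ^+ 2)}].
Proof.
move=> D0 ik k0 ih.
pose kE : RR -> \bar R := (EFin \o k) \_ `]0, D[.
pose hE : RR -> \bar R := (EFin \o (fun t => h t ^+ 2)) \_ `]0, T[.
have mkE : measurable_fun setT kE.
  by apply: (measurable_restrictT _ (mIoo 0 D)).1; exact: (measurable_int _ ik).
have mhE : measurable_fun setT hE.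
  by apply: (measurable_restrictT _ (mIoo 0 T)).1; exact: (measurable_int _ ih).
have kE0 t : (0 <= kE t)%E by apply: erestrict_ge0 => x _; rewrite lee_fin.
have hE0 t : (0 <= hE t)%E by apply: erestrict_ge0 => x _; rewrite lee_fin sqr_ge0.
pose C t := (\int[leb]_(r in `]0%R, D[) (kE r * hE (t - r)%R))%E.
have mC : measurable_fun setT (C : RR -> \bar R) by exact: measurable_conv.
have C0 t : (0 <= C t)%E by apply: integral_ge0 => r _; rewrite mule_ge0.
have Eh : (\int[leb]_(t in `]0%R, T[) hE t = (\int[leb]_(t in `]0, T[) (h t ^+ 2))%:E)%E.
  by rewrite EFin_Rintegral//; apply: eq_integral => t tT; rewrite /hE patchE tT.
have Ek : (\int[leb]_(t in `]0%R, D[) kE t = (\int[leb]_(t in `]0, D[) k t)%:E)%E.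
  by rewrite EFin_Rintegral//; apply: eq_integral => t tT; rewrite /kE patchE tT.
have Cle : (\int[leb]_(t in `]D, T[) C t <=
    ((\int[leb]_(r in `]0%R, D[) k r) * \int[leb]_(t in `]0%R, T[) (h t ^+ 2))%:E)%E.
  apply: (le_trans (ge0_integral_conv_le D T D mkE mhE kE0 hE0)).
  by rewrite subrr Eh Ek -EFinM.
have iC : leb.-integrable `]D, T[ C.
  apply/integrableP; split; first exact: measurable_funTS.
  by under eq_integral do rewrite gee0_abs//; exact: le_lt_trans Cle (ltry _).
have Cfin := integrable_ae (mIoo D T) iC.
have mfC : measurable_fun (`]D, T[ : set RR) (fun t : RR => fine (C t)).
  by apply: measurableT_comp => //; exact: measurable_funTS.
have Cle' : (\int[leb]_(t in `]D, T[) (fine (C t))%:E <=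
    ((\int[leb]_(r in `]0%R, D[) k r) * \int[leb]_(t in `]0%R, T[) (h t ^+ 2))%:E)%E.
  apply: le_trans Cle; apply: ge0_le_integral => //.
  - by move=> x _; rewrite lee_fin fine_ge0.
  - exact/measurable_EFinP.
  - exact: measurable_funTS.
  - by move=> x _; case: (C x) (C0 x) => [r| |]//= _; rewrite leey.
have iPhi : leb.-integrable `]D, T[ (EFin \o (fun t => fine (C t))).
  apply: ge0_integrable => //; first by move=> x _; exact: fine_ge0.
  exact: le_lt_trans Cle' (ltry _).
exists (fun t => fine (C t)); split=> //.
  by rewrite -lee_fin EFin_Rintegral.
apply: filterS Cfin => t ht /[dup] tDT /andP[Dt tT].
have {}ht : C t \is a fin_num by apply: ht; rewrite /= in_itv.
have CE : C t = (\int[leb]_(r in `]0%R, D[) (k r * h (t - r) ^+ 2)%:E)%E.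
  apply: eq_integral => r rD; rewrite /kE /hE !patchE rD.
  move: rD; rewrite inE/= in_itv/= => /andP[r0 rD].
  have -> : t - r \in (`]0, T[%classic : set R) by rewrite inE/= in_itv/=; apply/andP; split; lra.
  by rewrite -EFinM.
have mkh : measurable_fun (`]0, D[ : set RR) (fun r : R => k r * h (t - r) ^+ 2).
  apply: measurable_funM; first exact: integrable_measurable_fun ik.
  have mh2 : measurable_fun (`]t - D, t - 0[ : set RR) (fun s : R => h s ^+ 2).
    apply: measurable_funS (integrable_measurable_fun ih) => //.
    by apply: oo_sub; [lra|rewrite subr0 ltW].
  exact: (measurable_fun_reflect mh2).
split; last by rewrite CE.
apply: ge0_integrable => //; first by move=> r _; rewrite mulr_ge0 ?sqr_ge0.
by rewrite -CE ltey_eq ht.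
Qed.

End kernel.

Section reflection.
Context {R : realType}.
Notation leb := (@lebesgue_measure R).

Lemma integrable_oo_reflect (a b c : R) (F : R -> R) :
  leb.-integrable `]c - b, c - a[ (EFin \o F) ->
  leb.-integrable `]a, b[ (EFin \o (fun t => F (c - t))).
Proof.
move=> /integrableP[mF Foo]; apply/integrableP; split.
  exact: (@measurable_fun_reflect R _ _ a b c (EFin \o F)).
by rewrite (integral_reflect (f := fun t => `|(F t)%:E|%E))//; exact: measurableT_comp.
Qed.

Lemma Rintegral_oo_reflect (a b c : R) (F : R -> R) :
  leb.-integrable `]c - b, c - a[ (EFin \o F) ->
  \int[leb]_(t in `]a, b[) F (c - t) = \int[leb]_(t in `]c - b, c - a[) F t.
Proof.
move=> Fi; rewrite /Rintegral (@integral_reflect _ _ _ c (EFin \o F))//.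
by case/integrableP : Fi.
Qed.

End reflection.

(** * The gap between the state and the delayed predictor *)

Section predictor_gap.
Context {R : realType}.
Notation leb := (@lebesgue_measure R).
Notation RR := (measurableTypeR R).
Variables (l D e1 : R) (l_gt0 : 0 < l) (D_gt0 : 0 < D) (e1_gt0 : 0 < e1).
Notation mI := (muI 0 l).
Notation X := (XI l).
Variables (a1bar g : Linf mI) (S : R -> X -> X).
Notation A := (An e1 a1bar).
Hypothesis S_gen : is_semigroup setT A S.
Variables (Cn omn : R).
Hypothesis Cn_est : smoothing_estimate S Cn omn.

Variables (U u F Y : R -> X).
Hypothesis U_B : forall tau, 0 < tau -> Bochner_L2 (- D) tau U.
Hypothesis F_B : forall tau, 0 < tau -> Bochner_L2 0 tau F.
Hypothesis u_cont : forall t e : R, 0 <= t -> 0 < e -> exists2 del : R, 0 < del &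
  forall s, 0 <= s -> `|s - t| < del -> nrm (u s - u t) <= e.
Notation G := (fun r => mulop g (U r)).
Notation H := (fun r => F r + mulop g (U (r - D)) : X).
Hypothesis weak : forall phi f, A phi f -> forall a b : R, 0 <= a -> a <= b ->
  dotp mI (u b) phi - dotp mI (u a) phi =
  \int[leb]_(s in `]a, b[) (dotp mI (u s) f + dotp mI (H s) phi).
Hypothesis Y_pred : is_predictor D g S U u Y.

Lemma nrm_dual_test (c : R) (y : X) : 0 <= c ->
  (forall eta, test1 0 l eta -> `|dotp mI y (toXI l eta)| <= c * nrm (toXI l eta)) -> nrm y <= c.
Proof.
move=> c0 h; apply: nrm_dual => // phi; apply/ler_addgt0Pr => e e0.
pose C := c + nrm y + 1.
have C0 : 0 < C by rewrite /C; have := nrm_ge0 y; lra.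
have [eta te he] := test_dense l_gt0 S_gen Cn_est phi (divr_gt0 e0 C0).
rewrite (_ : dotp mI y phi = dotp mI y (toXI l eta) + dotp mI y (phi - toXI l eta)); last first.
  by rewrite dotpBr; ring.
apply: (le_trans (ler_normD _ _)).
have k1 := h _ te.
have k2 := le_trans (cauchy_schwarz y (phi - toXI l eta)) (ler_wpM2l (nrm_ge0 y) (ltW he)).
have k3 : nrm (toXI l eta) <= nrm phi + e / C.
  by apply: (le_trans (nrm_le_dist (toXI l eta) phi)); rewrite lerD2l nrmBC ltW.
have k4 := ler_wpM2l c0 k3.
apply: (le_trans (lerD (le_trans k1 k4) k2)).
rewrite mulrDr -addrA lerD2l -mulrDl mulrA ler_pdivrMr// mulrC ler_wpM2l ?(ltW e0)// /C; lra.
Qed.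

(** Duhamel's formula from [t - D] to [t] and the definition of [Y (t - D)] contain the same input
    integral, which cancels. *)
Lemma predictor_gap (t : R) (psi : X) : D <= t ->
  dotp mI (u t - Y (t - D)) psi = \int[leb]_(s in `]t - D, t[) dotp mI (F s) (S (t - s) psi).
Proof.
move=> Dt; have D0 := ltW D_gt0.
have s0 : 0 <= t - D by rewrite subr_ge0.
have st : t - D <= t by lra.
have sym (r : R) (phi chi : X) : 0 <= r -> dotp mI (S r phi) chi = dotp mI phi (S r chi).
  by exact: (S_sym l_gt0 S_gen Cn_est).
have t1 : 0 < t + 1 by lra.
have iF : leb.-integrable `]t - D, t[ (EFin \o (fun r => dotp mI (F r) (S (t - r) psi))).
  apply: (S_forcing_integrable l_gt0 e1_gt0 S_gen Cn_est).
  by apply: Bochner_sub (F_B t1) => //; lra.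
pose k (r : R) := dotp mI (G r) (S (t - D - r) psi).
have ik : leb.-integrable `]t - D - D, t - D[ (EFin \o k).
  apply: (S_forcing_integrable l_gt0 e1_gt0 S_gen Cn_est).
  by apply: (G_BI l_gt0 g S_gen Cn_est U_B); lra.
have [J hJ YJ] := Y_pred s0.
rewrite dotpBl (aeq_dotp _ YJ) dotpDl (sym _ _ _ D0).
rewrite (duhamel l_gt0 e1_gt0 S_gen Cn_est u_cont
  (total_forcing_B l_gt0 g S_gen Cn_est U_B F_B) weak psi s0 st) subKr.
have [_ <-] := hJ psi.
have -> : \int[leb]_(s in `]0, D[) dotp mI (S (D - s) (mulop g (zhist D U (t - D) s))) psi =
    \int[leb]_(r in `]t - D - D, t - D[) k r.
  have [E1 E2] : 0 - (D + D - t) = t - D - D /\ D - (D + D - t) = t - D by split; ring.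
  have := @Rintegral_oo_shift R 0 D (D + D - t) k; rewrite E1 E2 => /(_ ik) <-.
  apply: eq_Rintegral => r; rewrite inE/= in_itv/= => /andP[r0 rD].
  rewrite sym ?subr_ge0 ?(ltW rD)// /k /zhist.
  have -> : r - (D + D - t) = t - D - D + r by ring.
  by congr (dotp _ _ (S _ _)); ring.
have iGd : leb.-integrable `]t - D, t[ (EFin \o (fun r => k (r - D))).
  by apply: (@integrable_shift R _ _ (- D) (EFin \o k)).
have -> : \int[leb]_(s in `]t - D, t[) dotp mI (H s) (S (t - s) psi) =
    \int[leb]_(s in `]t - D, t[) dotp mI (F s) (S (t - s) psi) + \int[leb]_(r in `]t - D - D, t - D[) k r.
  rewrite -(Rintegral_oo_shift ik) -RintegralD//.
  have h (r : R) : dotp mI (H r) (S (t - r) psi) = dotp mI (F r) (S (t - r) psi) + k (r - D).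
    rewrite dotpDl /k; congr (_ + dotp _ _ (S _ _)); ring.
  by apply: eq_Rintegral => r _; exact: h.
have alg (a b c : R) : a + (b + c) - (a + c) = b by ring.
exact: alg.
Qed.

Notation ker := (fun r => Cn * ((Num.sqrt r)^-1 * expR (omn * r))).

(** No derivative is taken under a vector integral: the gap is paired with [eta'], symmetry moves
    [S r] onto the forcing, and the derivative returns to [S r F], where the smoothing estimate
    bounds it. *)
Lemma gradient_gap (t : R) (uxt dy : X) : D <= t -> 0 <= Cn ->
  in_H01 (u t) uxt -> in_H01 (Y (t - D)) dy ->
  leb.-integrable `]0, D[ (EFin \o (fun r => ker r * nrm (F (t - r)))) ->
  nrm (uxt - dy) <= \int[leb]_(r in `]0, D[) (ker r * nrm (F (t - r))).
Proof.
move=> Dt Cn0 hu hY ik; have D0 := ltW D_gt0.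
have [t1 tD0 tt1] : [/\ 0 < t + 1, 0 <= t - D & t <= t + 1] by split; lra.
have ker0 (r : R) : 0 <= ker r by rewrite !mulr_ge0 ?invr_ge0 ?sqrtr_ge0 ?expR_ge0.
apply: nrm_dual_test.
  by apply: Rintegral_ge0 => r _; rewrite mulr_ge0 ?nrm_ge0.
move=> eta te; have hH := test_H01 l_gt0 te.
have B1 := H01_by_parts l_gt0 hH hu.1; have B2 := H01_by_parts l_gt0 hH hY.1.
have -> : dotp mI (uxt - dy) (toXI l eta) = - dotp mI (u t - Y (t - D)) (toXI l (derive1 eta)).
  by rewrite !dotpBl B1 B2; ring.
rewrite normrN predictor_gap//.
pose phi (s : R) := dotp mI (F s) (S (t - s) (toXI l (derive1 eta))).
have iphi : leb.-integrable `]t - D, t[ (EFin \o phi).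
  apply: (S_forcing_integrable l_gt0 e1_gt0 S_gen Cn_est).
  exact: Bochner_sub (F_B t1).
have i' : leb.-integrable `]t - D, t - 0[ (EFin \o phi) by rewrite subr0.
have -> : \int[leb]_(s in `]t - D, t[) phi s = \int[leb]_(r in `]0, D[) phi (t - r).
  by rewrite Rintegral_oo_reflect// subr0.
rewrite mulrC -(@RintegralZl _ _ _ leb _ (fun r => ker r * nrm (F (t - r))))//.
apply: norm_Rintegral_le; [exact: integrable_oo_reflect|exact: integrable_RZl|].
move=> r /andP[r0 rD]; rewrite /phi subKr -(S_sym l_gt0 S_gen Cn_est)//; last exact: ltW.
have [dphi hd bd] := Cn_est (F (t - r)) r0.
rewrite (H01_by_parts l_gt0 hH hd.1) normrN; apply: (le_trans (cauchy_schwarz _ _)).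
rewrite mulrC; apply: ler_wpM2l; first exact: nrm_ge0.
by apply: (le_trans bd); rewrite !mulrA.
Qed.

End predictor_gap.

(** * The small-gain argument *)

Section weighted_norm.
Context {R : realType}.
Notation leb := (@lebesgue_measure R).
Notation RR := (measurableTypeR R).
Implicit Types (a b c th : R) (f h k : R -> R).

(** Together with [wN] the scalar counterpart of weighted Bochner norms, applied to functions such
    as [t |-> nrm (u t)]. Real integrals are total, so [sqi] records when [wN] is meaningful. *)
Definition sqi a b h : Prop := measurable_fun (`]a, b[ : set RR) h /\
  leb.-integrable `]a, b[ (EFin \o (fun t => h t ^+ 2)).

Definition wN th a b h : R := Num.sqrt (\int[leb]_(t in `]a, b[) ((expR (th * t) * h t) ^+ 2)).

Lemma wsqrE th h t : (expR (th * t) * h t) ^+ 2 = expR (2 * th * t) * h t ^+ 2.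
Proof. by rewrite exprMn -expRM_natl mulrA. Qed.

Lemma sqi_sub a b a' b' h : a <= a' -> b' <= b -> sqi a b h -> sqi a' b' h.
Proof.
move=> aa bb [mh ih]; split; last exact: integrable_oo_sub ih.
exact: measurable_funS (oo_sub aa bb) mh.
Qed.

Lemma wexp_bound th a b (t : R) : a < t < b -> expR (th * t) <= expR (`|th| * (`|a| + `|b|)).
Proof.
move=> /andP[at_ tb]; rewrite ler_expR; apply: (le_trans (ler_norm _)).
rewrite normrM ler_wpM2l// ler_norml; have hb := ler_norm b; have ha := ler_norm (- a).
have a0 := normr_ge0 a; have b0 := normr_ge0 b; rewrite normrN in ha.
by apply/andP; split; lra.
Qed.

Lemma sqi_w th a b h : sqi a b h -> sqi a b (fun t => expR (th * t) * h t).
Proof.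
move=> [mh ih].
have mw : measurable_fun (`]a, b[ : set RR) (fun t : R => expR (th * t) * h t).
  by apply: measurable_funM => //; exact: measurable_wexp.
split=> //.
pose C := expR (`|th| * (`|a| + `|b|)).
apply: (@integrable_Rle _ _ _ leb `]a, b[ _ (fun t => C ^+ 2 * h t ^+ 2)) => //.
- exact: measurable_funX.
- move=> t; rewrite /= in_itv/= => tab; rewrite ger0_norm ?sqr_ge0// exprMn.
  apply: ler_wpM2r; first exact: sqr_ge0.
  by rewrite lerXn2r ?nnegrE ?expR_ge0// wexp_bound.
- exact: integrable_RZl.
Qed.

Lemma wsq_integrable th a b h : sqi a b h ->
  leb.-integrable `]a, b[ (EFin \o (fun t => expR (2 * th * t) * h t ^+ 2)).
Proof.
move=> /(sqi_w th)[_ ih]; apply: eq_integrable ih => // t _ /=; by rewrite wsqrE.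
Qed.

Lemma wN_ge0 th a b h : 0 <= wN th a b h. Proof. exact: sqrtr_ge0. Qed.

Lemma wN_sqr th a b h : wN th a b h ^+ 2 = \int[leb]_(t in `]a, b[) (expR (2 * th * t) * h t ^+ 2).
Proof.
rewrite /wN sqr_sqrtr; last by apply: Rintegral_ge0 => t _; exact: sqr_ge0.
by apply: eq_Rintegral => t _; rewrite wsqrE.
Qed.

Lemma sqiD a b h k : sqi a b h -> sqi a b k -> sqi a b (fun t => h t + k t).
Proof.
by move=> [mh ih] [mk ik]; split; [exact: measurable_funD|exact: integrable_sqrD].
Qed.

Lemma sqiZ c a b h : sqi a b h -> sqi a b (fun t => c * h t).
Proof.
move=> [mh ih]; split; first exact: measurable_funM.
have := integrable_RZl (mIoo a b) (c ^+ 2) ih.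
by apply: eq_integrable => // t _ /=; rewrite exprMn.
Qed.

Lemma wN_add th a b h k : sqi a b h -> sqi a b k ->
  wN th a b (fun t => h t + k t) <= wN th a b h + wN th a b k.
Proof.
move=> /(sqi_w th)[mh ih] /(sqi_w th)[mk ik].
have := Rintegral_minkowski (mIoo a b) mh mk ih ik; apply: le_trans.
by rewrite /wN le_eqVlt; apply/orP; left; apply/eqP; congr Num.sqrt;
  apply: eq_Rintegral => t _; rewrite mulrDr.
Qed.

Lemma wN_scale th c a b h : 0 <= c -> sqi a b h -> wN th a b (fun t => c * h t) = c * wN th a b h.
Proof.
move=> c0 /(sqi_w th)[_ ih]; rewrite -[X in X * _](ger0_norm c0) -sqrtr_sqr -sqrtrM ?sqr_ge0//.
congr Num.sqrt; rewrite -(@RintegralZl _ _ _ leb _ (fun t => (expR (th * t) * h t) ^+ 2))//.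
by apply: eq_Rintegral => t _; rewrite mulrCA exprMn.
Qed.

Lemma wN_le th a b h k : sqi a b h -> sqi a b k ->
  {ae leb, forall t, a < t < b -> `|h t| <= k t} -> wN th a b h <= wN th a b k.
Proof.
move=> /(sqi_w th)[_ ih] /(sqi_w th)[_ ik] hk; apply: ler_wsqrtr; apply: le_ae_Rintegral => //.
apply: filterS hk => t; rewrite /= in_itv/= => ht tab.
rewrite !exprMn ler_wpM2l ?sqr_ge0// -real_normK ?num_real// lerXn2r ?nnegrE//; last exact: ht.
by apply: le_trans (ht tab).
Qed.

Lemma sqrtrD_le (x y : R) : 0 <= x -> 0 <= y -> Num.sqrt (x + y) <= Num.sqrt x + Num.sqrt y.
Proof.
move=> x0 y0; rewrite -(@ler_pXn2r _ 2)// ?nnegrE ?addr_ge0 ?sqrtr_ge0//.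
rewrite sqr_sqrtr ?addr_ge0// sqrrD !sqr_sqrtr// lerD2r lerDl.
by rewrite mulrn_wge0// mulr_ge0 ?sqrtr_ge0.
Qed.

Lemma wN_cat th a b c h : a <= b -> b <= c -> sqi a c h ->
  wN th a c h <= wN th a b h + wN th b c h.
Proof.
move=> ab bc /(sqi_w th)[_ ih]; rewrite /wN (Rintegral_oo_cat ab bc ih).
by apply: sqrtrD_le; apply: Rintegral_ge0 => t _; exact: sqr_ge0.
Qed.

Lemma wN_sub th a b a' b' h : a <= a' -> a' <= b' -> b' <= b -> sqi a b h ->
  wN th a' b' h <= wN th a b h.
Proof.
move=> aa ab bb hh; have [_ ih] := sqi_w th hh.
have p (x y : R) : 0 <= \int[leb]_(t in `]x, y[) ((expR (th * t) * h t) ^+ 2).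
  by apply: Rintegral_ge0 => t _; exact: sqr_ge0.
have ab' : a <= b' by exact: le_trans ab.
apply: ler_wsqrtr; rewrite (Rintegral_oo_cat ab' bb ih).
rewrite (Rintegral_oo_cat aa ab (integrable_oo_sub (lexx a) bb ih)).
by rewrite -addrA addrCA lerDl addr_ge0.
Qed.

Lemma sqi_delay a b c h : sqi (a - c) (b - c) h -> sqi a b (fun t => h (t - c)).
Proof.
move=> [mh ih]; split; first exact: (@measurable_fun_shift R _ _ a b (- c)).
exact: (@integrable_shift R a b (- c) (EFin \o (fun t => h t ^+ 2))).
Qed.

(** Origin of the factor [expR (th * D)] in [G_ud]: the weight grows by it over one delay. *)
Lemma wN_delay th a b c h : sqi (a - c) (b - c) h ->
  wN th a b (fun t => h (t - c)) = expR (th * c) * wN th (a - c) (b - c) h.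
Proof.
move=> hh; have [_ ih] := sqi_w th hh.
rewrite -[X in X * _]ger0_norm ?expR_ge0// -sqrtr_sqr -sqrtrM ?sqr_ge0//.
congr Num.sqrt; rewrite -(@RintegralZl _ _ _ leb _ (fun t => (expR (th * t) * h t) ^+ 2))//.
rewrite -(@Rintegral_oo_shift _ a b c (fun t => expR (th * c) ^+ 2 * (expR (th * t) * h t) ^+ 2)).
  apply: eq_Rintegral => t _; rewrite -exprMn mulrA -expRD -mulrDr; congr ((expR (_ * _) * _) ^+ 2).
  ring.
exact: integrable_RZl.
Qed.

(** Writing [expR (th * t)] as [expR (th * r) * expR (th * (t - r))] moves one factor into the
    kernel, which explains [omn + th] in [G_D]. The function [m] is a measurable majorant of the
    convolution. *)
Lemma wN_conv (D T th c om : R) f : 0 < D -> D <= T -> 0 <= c -> sqi 0 T f ->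
  (forall t, 0 <= f t) ->
  exists m : R -> R, [/\ sqi D T m,
    wN th D T m <= (c * \int[leb]_(r in `]0, D[) ((Num.sqrt r)^-1 * expR ((om + th) * r))) * wN th 0 T f &
    {ae leb, forall t, D < t < T ->
      let k := fun r => c * ((Num.sqrt r)^-1 * expR (om * r)) * f (t - r) in
      leb.-integrable `]0, D[ (EFin \o k) /\ \int[leb]_(r in `]0, D[) k r <= m t}].
Proof.
move=> D0 DT c0 hf f0.
pose k r := c * ((Num.sqrt r)^-1 * expR ((om + th) * r)).
have ik : leb.-integrable `]0, D[ (EFin \o k) by exact: kernel_integrable.
have k0 r : 0 <= k r by rewrite !mulr_ge0 ?invr_ge0 ?sqrtr_ge0 ?expR_ge0.
have [mh ih] := sqi_w th hf.
pose h t := expR (th * t) * f t.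
have h0 t : 0 <= h t by rewrite mulr_ge0 ?expR_ge0.
have [Phi [iP Ple hP]] := young D0 ik k0 ih.
pose G := \int[leb]_(r in `]0, D[) k r.
have G0 : 0 <= G by apply: Rintegral_ge0 => r _.
have GE : G = c * \int[leb]_(r in `]0, D[) ((Num.sqrt r)^-1 * expR ((om + th) * r)).
  rewrite -(@RintegralZl _ _ _ leb _ (fun r => (Num.sqrt r)^-1 * expR ((om + th) * r)))//.
  have := kernel_integrable D 1 (om + th); apply: eq_integrable => // r _ /=; by rewrite mul1r.
pose m t := expR (- th * t) * Num.sqrt (G * Phi t).
have mP := integrable_measurable_fun iP.
have ms : sqi D T (fun t => Num.sqrt (G * Phi t)).
  have mm : measurable_fun (`]D, T[ : set RR) (fun t => Num.sqrt (G * Phi t)).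
    apply: (@measurableT_comp _ _ _ _ _ _ (@Num.sqrt R)); last exact: measurable_funM.
    by apply: continuous_measurable_fun; exact: sqrt_continuous.
  split=> //.
  apply: (@integrable_Rle _ _ _ leb `]D, T[ _ (fun t => `|G * Phi t|)) => //.
  - exact: measurable_funX.
  - move=> t _; rewrite ger0_norm ?sqr_ge0//.
    have [n|p] := ltP (G * Phi t) 0; first by rewrite ltr0_sqrtr// expr0n /= normr_ge0.
    by rewrite sqr_sqrtr// ler_norm.
  - by have := integrable_norm (integrable_RZl (mIoo D T) G iP); apply: eq_integrable.
exists m; split.
- exact: sqi_w.
- have E1 t : expR (th * t) * m t = Num.sqrt (G * Phi t).
    by rewrite /m mulrA -expRD mulNr subrr expR0 mul1r.
  rewrite -GE -[X in X * _](ger0_norm G0) -sqrtr_sqr -sqrtrM ?sqr_ge0//.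
  apply: ler_wsqrtr.
  have : \int[leb]_(t in `]D, T[) ((expR (th * t) * m t) ^+ 2) <= \int[leb]_(t in `]D, T[) (G * Phi t).
    apply: le_ae_Rintegral => //.
    + by have [_] := ms; apply: eq_integrable => // t _ /=; rewrite E1.
    + exact: integrable_RZl.
    apply: filterS hP => t hPt; rewrite /= in_itv/= => tDT; have [_ PE] := hPt tDT.
    rewrite E1 sqr_sqrtr// mulr_ge0// PE Rintegral_ge0// => r _.
    by rewrite mulr_ge0 ?sqr_ge0.
  move=> /le_trans; apply.
  rewrite (@RintegralZl _ _ _ leb _ Phi)// expr2 -mulrA ler_wpM2l//.
apply: filterS hP => t hPt tDT; have [ikh PE] := hPt tDT; move: (tDT) => /andP[Dt tT].
have mhr : measurable_fun (`]0, D[ : set RR) (fun r : R => h (t - r)).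
  have mh2 : measurable_fun (`]t - D, t - 0[ : set RR) h.
    apply: measurable_funS mh => //.
    by apply: oo_sub; [lra|rewrite subr0 ltW].
  exact: (measurable_fun_reflect mh2).
have [ikh1 cs] := weighted_cauchy_schwarz ik mhr k0 ikh.
have E2 r : k r * h (t - r) = expR (th * t) * (c * ((Num.sqrt r)^-1 * expR (om * r)) * f (t - r)).
  have -> : expR (th * t) = expR (th * r) * expR (th * (t - r)).
    by rewrite -expRD; congr expR; ring.
  by rewrite /k /h mulrDl expRD; ring.
have e0 : expR (th * t) != 0 by rewrite gt_eqF// expR_gt0.
have E3 r : c * ((Num.sqrt r)^-1 * expR (om * r)) * f (t - r) = expR (- th * t) * (k r * h (t - r)).
  by rewrite E2 mulrA -expRD mulNr addNr expR0 mul1r.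
have iE : leb.-integrable `]0, D[ (EFin \o (fun r => c * ((Num.sqrt r)^-1 * expR (om * r)) * f (t - r))).
  have := integrable_RZl (mIoo 0 D) (expR (- th * t)) ikh1.
  by apply: eq_integrable => // r _ /=; rewrite E3.
split=> //.
have -> : \int[leb]_(r in `]0, D[) (c * ((Num.sqrt r)^-1 * expR (om * r)) * f (t - r)) =
    expR (- th * t) * \int[leb]_(r in `]0, D[) (k r * h (t - r)).
  rewrite -(@RintegralZl _ _ _ leb _ (fun r => k r * h (t - r)))//.
  by apply: eq_Rintegral => r _; rewrite E3.
rewrite /m ler_wpM2l ?expR_ge0// PE -[leLHS]ger0_norm; last first.
  by apply: Rintegral_ge0 => r _; rewrite mulr_ge0.
by rewrite -sqrtr_sqr; apply: ler_wsqrtr.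
Qed.

End weighted_norm.

(** * The scalar small-gain estimates *)

Section scalar_estimates.
Context {R : realType}.
Notation leb := (@lebesgue_measure R).
Notation RR := (measurableTypeR R).
Variables (D mu th kap Cj kg bv lp ma m12 c om GY CY CU : R).
Hypotheses (D_gt0 : 0 < D) (th_gt0 : 0 < th) (th_mu : 2 * th < mu) (kap_gt0 : 0 < kap).
Hypotheses (Cj_ge0 : 0 <= Cj) (kg_ge0 : 0 <= kg) (bv_ge0 : 0 <= bv) (lp_ge0 : 0 <= lp).
Hypotheses (ma_ge0 : 0 <= ma) (m12_ge0 : 0 <= m12) (c_ge0 : 0 <= c) (GY_ge0 : 0 <= GY).
Hypotheses (CY_ge0 : 0 <= CY) (CU_ge0 : 0 <= CU).

Definition gap : R := Num.sqrt (mu - 2 * th).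
Definition Gdu : R := ma * lp + m12 * Num.sqrt (2 * bv / (mu - 2 * th)).
Definition Gud : R := expR (th * D) * GY +
  c * \int[leb]_(r in `]0, D[) ((Num.sqrt r)^-1 * expR ((om + th) * r)).
Hypothesis small : Gud * Gdu < 1.

(** None of these constants involves the data or the length of a time interval. [C_win] is a
    Gronwall factor for [(0, D)], [C_p] comes from the absorbed gain inequality, and the others
    result from inserting it. *)
Definition C_win : R := Num.sqrt (expR ((2 * th + Cj) * D) * (kap + 1 + kg)).
Definition C_p : R := (C_win + expR (th * D) * CY + Gud * (m12 / gap)) / (1 - Gud * Gdu).
Definition C_y : R := CY + GY * (Gdu * C_p + m12 / gap).
Definition C_U : R := 1 + (CU * C_y) ^+ 2.
Definition C_v : R := 1 + 2 * bv * C_p ^+ 2.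
Definition C_q : R := kap + 1 + (Cj + 2 * th) * kap * lp ^+ 2 * C_p ^+ 2 + kg * expR (2 * th * D) * C_U
  + 2 * th / (mu - 2 * th) * C_v.

(** The norms of [u], [u_x], [v], [v_x], the input and the forcing, in this order; [I0] is the size
    of the data. *)
Variables (a p b q U f : R -> R) (I0 : R).
Hypotheses (a0 : forall t, 0 <= a t) (p0 : forall t, 0 <= p t) (b0 : forall t, 0 <= b t)
  (q0 : forall t, 0 <= q t) (U0 : forall t, 0 <= U t) (f0 : forall t, 0 <= f t) (I0_ge0 : 0 <= I0).
Hypothesis a_cont : forall t e : R, 0 <= t -> 0 < e -> exists2 del : R, 0 < del &
  forall s, 0 <= s -> `|s - t| < del -> `|a s - a t| <= e.
Hypothesis b_cont : forall t e : R, 0 <= t -> 0 < e -> exists2 del : R, 0 < del &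
  forall s, 0 <= s -> `|s - t| < del -> `|b s - b t| <= e.
Hypotheses (a_sq : forall T, 0 < T -> sqi 0 T a) (p_sq : forall T, 0 < T -> sqi 0 T p)
  (b_sq : forall T, 0 < T -> sqi 0 T b) (q_sq : forall T, 0 < T -> sqi 0 T q)
  (f_sq : forall T, 0 < T -> sqi 0 T f) (U_sq : forall T, 0 < T -> sqi (- D) T U).
Hypothesis E_v : forall x y : R, 0 <= x -> x <= y -> b y ^+ 2 - b x ^+ 2 <=
  \int[leb]_(t in `]x, y[) (- mu * (b t ^+ 2 + q t ^+ 2) + 2 * bv * p t ^+ 2).
Hypothesis E_j : forall x y : R, 0 <= x -> x <= y ->
  kap * a y ^+ 2 + b y ^+ 2 - (kap * a x ^+ 2 + b x ^+ 2) <=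
  \int[leb]_(t in `]x, y[) (- p t ^+ 2 + Cj * kap * a t ^+ 2 + kg * U (t - D) ^+ 2).
Hypothesis poin : {ae leb, forall t, 0 < t -> a t <= lp * p t}.
Hypothesis f_le : {ae leb, forall t, 0 < t -> f t <= ma * a t + m12 * q t}.
Hypotheses (Ia : a 0 <= I0) (Ib : b 0 <= I0) (IU : \int[leb]_(t in `]- D, 0[) (U t ^+ 2) <= I0 ^+ 2).
(** [y] stands for the norm of [Y_x]: it obeys the mild estimate, controls the input through
    Poincare's inequality, and controls [p] up to the gap between state and delayed predictor. *)
Hypothesis Ypred : forall T, 0 < T -> exists y : R -> R,
  [/\ sqi 0 T y, wN th 0 T y <= CY * I0 + GY * wN th 0 T f,
      {ae leb, forall t, 0 < t < T -> 0 <= y t /\ U t <= CU * y t} &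
      {ae leb, forall t, D < t < T ->
        let k := fun r => c * ((Num.sqrt r)^-1 * expR (om * r)) * f (t - r) in
        leb.-integrable `]0, D[ (EFin \o k) -> p t <= y (t - D) + \int[leb]_(r in `]0, D[) k r}].

Lemma gap2_gt0 : 0 < mu - 2 * th. Proof. by rewrite subr_gt0. Qed.

Lemma gap_gt0 : 0 < gap. Proof. by rewrite sqrtr_gt0 gap2_gt0. Qed.

Lemma Gud_ge0 : 0 <= Gud.
Proof.
rewrite /Gud addr_ge0 ?mulr_ge0 ?expR_ge0//; apply: Rintegral_ge0 => r _.
by rewrite mulr_ge0 ?expR_ge0 ?invr_ge0 ?sqrtr_ge0.
Qed.

Lemma Gdu_ge0 : 0 <= Gdu.
Proof. by rewrite /Gdu addr_ge0 ?mulr_ge0 ?sqrtr_ge0. Qed.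

Lemma m12_gap_ge0 : 0 <= m12 / gap.
Proof. by apply: divr_ge0 => //; apply: ltW; exact: gap_gt0. Qed.

Lemma C_p_ge0 : 0 <= C_p.
Proof.
apply: divr_ge0; last by rewrite subr_ge0 ltW.
apply: addr_ge0; last by apply: mulr_ge0; [exact: Gud_ge0|exact: m12_gap_ge0].
by rewrite addr_ge0 ?sqrtr_ge0 ?mulr_ge0 ?expR_ge0.
Qed.

Lemma C_y_ge0 : 0 <= C_y.
Proof.
apply: addr_ge0 => //; apply: mulr_ge0 => //; apply: addr_ge0; last exact: m12_gap_ge0.
by apply: mulr_ge0; [exact: Gdu_ge0|exact: C_p_ge0].
Qed.

Lemma sqr_within (h : R -> R) (T : R) : {within `[0, T], continuous h} ->
  {within `[0, T], continuous (fun t => h t ^+ 2)}.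
Proof. by move=> ch x; apply: cvgM; exact: ch. Qed.

Lemma a_within T : {within `[0, T], continuous a}.
Proof.
apply: eps_within_continuous => t e /andP[t0 _] e0; have [del d0 hd] := a_cont t0 e0.
by exists del => // s /andP[s0 _]; exact: hd.
Qed.

Lemma b_within T : {within `[0, T], continuous b}.
Proof.
apply: eps_within_continuous => t e /andP[t0 _] e0; have [del d0 hd] := b_cont t0 e0.
by exists del => // s /andP[s0 _]; exact: hd.
Qed.

Lemma joint_within T : {within `[0, T], continuous (fun t => kap * a t ^+ 2 + b t ^+ 2)}.
Proof.
move=> x; apply: cvgD; last exact: (sqr_within (@b_within T)).
by apply: cvgM; [exact: cvg_cst|exact: (sqr_within (@a_within T))].
Qed.

Lemma Udelay_sq T : 0 < T -> sqi 0 T (fun t => U (t - D)).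
Proof.
move=> T0; apply: sqi_delay; apply: sqi_sub (U_sq T0); first by rewrite sub0r.
by rewrite gerBl ltW.
Qed.

Lemma joint_int T : 0 < T -> leb.-integrable `]0, T[
  (EFin \o (fun t => - p t ^+ 2 + Cj * kap * a t ^+ 2 + kg * U (t - D) ^+ 2)).
Proof.
move=> T0; apply: integrable_RD => //; [apply: integrable_RD => //|].
- by apply: integrable_RN => //; case: (p_sq T0).
- by apply: integrable_RZl => //; case: (a_sq T0).
- by apply: integrable_RZl => //; case: (Udelay_sq T0).
Qed.

(** For [t < D] there is no value [Y (t - D)]. The weight [expR (- Cj * t)] removes the growing term
    from the joint energy, and the delayed input is still the initial history. *)
Lemma first_window : wN th 0 D p <= C_win * I0.
Proof.
have [mp ip] := p_sq D_gt0; have [mU iU] := Udelay_sq D_gt0.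
have := weighted_energy (- Cj) (joint_within (T := D)) (joint_int D_gt0)
  (fun x y x0 xy _ => E_j x0 xy) (ltW D_gt0) (lexx D).
set q1 := kap * a 0 ^+ 2 + b 0 ^+ 2 => H.
have iw : leb.-integrable `]0, D[ (EFin \o (fun t => expR (- Cj * t) * p t ^+ 2)).
  have := wsq_integrable (- Cj / 2) (p_sq D_gt0); apply: eq_integrable => // t _ /=.
  by rewrite (_ : 2 * (- Cj / 2) = - Cj)//; field.
have iwm : leb.-integrable `]0, D[ (EFin \o (fun r => expR (- Cj * r) *
    (- p r ^+ 2 + Cj * kap * a r ^+ 2 + kg * U (r - D) ^+ 2 + - Cj * (kap * a r ^+ 2 + b r ^+ 2)))).
  have Ew (h : R -> R) : sqi 0 D h -> leb.-integrable `]0, D[ (EFin \o (fun t => expR (- Cj * t) * h t ^+ 2)).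
    move=> hh; have := wsq_integrable (- Cj / 2) hh; apply: eq_integrable => // t _ /=.
    by rewrite (_ : 2 * (- Cj / 2) = - Cj)//; field.
  have i1 := integrable_RN (mIoo 0 D) iw.
  have i2 := integrable_RZl (mIoo 0 D) kg (Ew _ (Udelay_sq D_gt0)).
  have i3 := integrable_RZl (mIoo 0 D) (- Cj) (Ew _ (b_sq D_gt0)).
  have := integrable_RD (mIoo 0 D) (integrable_RD (mIoo 0 D) i1 i2) i3.
  by apply: eq_integrable => // t _ /=; congr (_%:E); ring.
have H2 : \int[leb]_(r in `]0, D[) (expR (- Cj * r) *
    (- p r ^+ 2 + Cj * kap * a r ^+ 2 + kg * U (r - D) ^+ 2 + - Cj * (kap * a r ^+ 2 + b r ^+ 2))) <=
    - (\int[leb]_(r in `]0, D[) (expR (- Cj * r) * p r ^+ 2)) + kg * I0 ^+ 2.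
  apply: (@le_trans _ _ (\int[leb]_(r in `]0, D[) (-1 * (expR (- Cj * r) * p r ^+ 2) + kg * U (r - D) ^+ 2))).
    apply: le_ae_Rintegral => //.
      by apply: integrable_RD => //; exact: integrable_RZl.
    apply: aeW => r; rewrite /= in_itv/= => /andP[r0 rD].
    have e1 : expR (- Cj * r) <= 1.
      by rewrite -expR0 ler_expR mulNr oppr_le0 mulr_ge0// ltW.
    have e0 : 0 <= expR (- Cj * r) by exact: expR_ge0.
    have u0 : 0 <= kg * U (r - D) ^+ 2 by rewrite mulr_ge0 ?sqr_ge0.
    have k1 := ler_wpM2r u0 e1.
    have k2 : 0 <= expR (- Cj * r) * (Cj * b r ^+ 2) by rewrite !mulr_ge0 ?sqr_ge0.
    move: (expR _) e1 e0 k1 k2 => w e1 e0 k1 k2; lra.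
  rewrite RintegralD//; [|exact: integrable_RZl|exact: integrable_RZl].
  rewrite (@RintegralZl _ _ _ leb _ (fun r => expR (- Cj * r) * p r ^+ 2))// mulN1r lerD2l.
  rewrite (@RintegralZl _ _ _ leb _ (fun r => U (r - D) ^+ 2))//; apply: ler_wpM2l => //.
  rewrite (@Rintegral_oo_shift _ 0 D D (fun t => U t ^+ 2)) sub0r subrr//.
  by apply: (integrable_oo_sub (lexx _) _ (U_sq D_gt0).2); exact: ltW.
have q1I : q1 <= (kap + 1) * I0 ^+ 2.
  rewrite /q1 mulrDl mul1r; apply: lerD; [apply: ler_wpM2l; first exact: ltW|];
  by rewrite lerXn2r ?nnegrE.
have qD : 0 <= expR (- Cj * D) * (kap * a D ^+ 2 + b D ^+ 2).
  by rewrite mulr_ge0 ?expR_ge0// addr_ge0 ?mulr_ge0 ?sqr_ge0// ltW.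
have J : \int[leb]_(r in `]0, D[) (expR (- Cj * r) * p r ^+ 2) <= (kap + 1 + kg) * I0 ^+ 2.
  by move: H H2 q1I qD; set x1 := \int[leb]_(r in _) _; set x2 := \int[leb]_(r in _) _;
    move=> H H2 q1I qD; move: (le_trans H H2); clearbody x1 x2; lra.
rewrite -(@ler_pXn2r _ 2)// ?nnegrE ?wN_ge0 ?mulr_ge0 ?sqrtr_ge0//.
rewrite wN_sqr exprMn sqr_sqrtr; last first.
  by rewrite mulr_ge0 ?expR_ge0// addr_ge0// addr_ge0// ltW.
(* Exchanging the decaying weight for the growing one costs their largest ratio on [(0, D)]. *)
apply: (@le_trans _ _ (\int[leb]_(r in `]0, D[) (expR ((2 * th + Cj) * D) * (expR (- Cj * r) * p r ^+ 2)))).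
  apply: le_ae_Rintegral => //.
  - exact: wsq_integrable.
  - exact: integrable_RZl.
  apply: aeW => r; rewrite /= in_itv/= => /andP[r0 rD].
  rewrite mulrA -expRD ler_wpM2r ?sqr_ge0// ler_expR.
  have h1 : (2 * th + Cj) * r <= (2 * th + Cj) * D.
    by apply: ler_wpM2l; [rewrite addr_ge0// mulr_ge0// ltW|exact: ltW].
  lra.
rewrite (@RintegralZl _ _ _ leb _ (fun r => expR (- Cj * r) * p r ^+ 2))// -mulrA.
by apply: ler_wpM2l => //; exact: expR_ge0.
Qed.

(** The weight grows at the rate [2 th], below the decay rate [mu], which leaves the margin
    [mu - 2 th] in front of both integrals. *)
Lemma v_gain (T : R) : 0 < T ->
  expR (2 * th * T) * b T ^+ 2 + (mu - 2 * th) * (wN th 0 T b ^+ 2 + wN th 0 T q ^+ 2) <=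
  I0 ^+ 2 + 2 * bv * wN th 0 T p ^+ 2.
Proof.
move=> T0; have [mp ip] := p_sq T0; have [mb ib] := b_sq T0; have [mq iq] := q_sq T0.
have wp := wsq_integrable th (p_sq T0); have wb := wsq_integrable th (b_sq T0).
have wq := wsq_integrable th (q_sq T0).
have im : leb.-integrable `]0, T[ (EFin \o (fun t => - mu * (b t ^+ 2 + q t ^+ 2) + 2 * bv * p t ^+ 2)).
  apply: integrable_RD => //; apply: integrable_RZl => //; exact: integrable_RD.
have := weighted_energy (2 * th) (sqr_within (b_within (T := T))) im
  (fun x y x0 xy _ => E_v x0 xy) (ltW T0) (lexx T).
have i1 := integrable_RD (mIoo 0 T) wb wq.
have i2 := integrable_RZl (mIoo 0 T) (- (mu - 2 * th)) i1.
have i3 := integrable_RZl (mIoo 0 T) (2 * bv) wp.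
have iq' := integrable_RZl (mIoo 0 T) (- (2 * th)) wq.
have H : \int[leb]_(r in `]0, T[) (expR (2 * th * r) * (- mu * (b r ^+ 2 + q r ^+ 2) + 2 * bv * p r ^+ 2 +
     2 * th * b r ^+ 2)) <=
   - (mu - 2 * th) * (wN th 0 T b ^+ 2 + wN th 0 T q ^+ 2) + 2 * bv * wN th 0 T p ^+ 2.
  rewrite !wN_sqr -RintegralD// -(@RintegralZl _ _ _ leb _ (fun t =>
    expR (2 * th * t) * b t ^+ 2 + expR (2 * th * t) * q t ^+ 2))//.
  rewrite -(@RintegralZl _ _ _ leb _ (fun t => expR (2 * th * t) * p t ^+ 2))// -RintegralD//.
  apply: le_ae_Rintegral => //.
  - have := integrable_RD (mIoo 0 T) (integrable_RD (mIoo 0 T) i2 i3) iq'.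
    by apply: eq_integrable => // t _ /=; congr (_%:E); ring.
  - exact: integrable_RD.
  apply: aeW => r _ /=.
  have : 0 <= 2 * th * (expR (2 * th * r) * q r ^+ 2).
    by apply: mulr_ge0; [apply: mulr_ge0 => //; exact: ltW|rewrite mulr_ge0 ?expR_ge0 ?sqr_ge0].
  move: (expR _) => w; lra.
have bI : b 0 ^+ 2 <= I0 ^+ 2 by rewrite lerXn2r ?nnegrE.
move=> H1; move: (le_trans H1 H); lra.
Qed.

Lemma vx_gain (T : R) : 0 < T ->
  wN th 0 T q <= gap^-1 * I0 + Num.sqrt (2 * bv / (mu - 2 * th)) * wN th 0 T p.
Proof.
move=> T0; have g0 := gap2_gt0; have g1 := gap_gt0.
have H := v_gain T0.
have h1 : wN th 0 T q ^+ 2 <= (I0 / gap) ^+ 2 + (Num.sqrt (2 * bv / (mu - 2 * th)) * wN th 0 T p) ^+ 2.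
  have s1 : gap ^+ 2 = mu - 2 * th by rewrite sqr_sqrtr// ltW.
  have s2 : Num.sqrt (2 * bv / (mu - 2 * th)) ^+ 2 = 2 * bv / (mu - 2 * th).
    by rewrite sqr_sqrtr// divr_ge0 ?(ltW g0)// mulr_ge0.
  rewrite !exprMn exprVn s1 s2 -(ler_pM2l g0).
  have -> : (mu - 2 * th) * (I0 ^+ 2 / (mu - 2 * th) + 2 * bv / (mu - 2 * th) * wN th 0 T p ^+ 2) =
     I0 ^+ 2 + 2 * bv * wN th 0 T p ^+ 2 by field; rewrite gt_eqF.
  have k1 : 0 <= expR (2 * th * T) * b T ^+ 2 by rewrite mulr_ge0 ?expR_ge0 ?sqr_ge0.
  have k2 : 0 <= (mu - 2 * th) * wN th 0 T b ^+ 2 by rewrite mulr_ge0 ?sqr_ge0// ltW.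
  by move: H; rewrite mulrDr; lra.
have x0 : 0 <= I0 / gap by rewrite divr_ge0// ltW.
have y0 : 0 <= Num.sqrt (2 * bv / (mu - 2 * th)) * wN th 0 T p by rewrite mulr_ge0 ?sqrtr_ge0.
rewrite -(@ler_pXn2r _ 2)// ?nnegrE ?wN_ge0 ?addr_ge0//; last by rewrite mulrC.
apply: (le_trans h1); rewrite [gap^-1 * _]mulrC sqrrD -subr_ge0.
have : 0 <= I0 / gap * (Num.sqrt (2 * bv / (mu - 2 * th)) * wN th 0 T p) by exact: mulr_ge0.
move: (I0 / gap) (Num.sqrt _ * _) => x y; rewrite -mulr_natl; lra.
Qed.

Lemma f_gain (T : R) : 0 < T -> wN th 0 T f <= Gdu * wN th 0 T p + m12 / gap * I0.
Proof.
move=> T0; have hp := p_sq T0; have hq := q_sq T0; have hf := f_sq T0.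
have h1 := sqiZ (ma * lp) hp; have h2 := sqiZ m12 hq.
apply: (@le_trans _ _ (wN th 0 T (fun t => ma * lp * p t + m12 * q t))).
  apply: wN_le => //; first exact: sqiD.
  have := ae_and poin f_le; apply: filterS => t [h3 h4] /andP[t0 _].
  rewrite ger0_norm//; apply: (le_trans (h4 t0)); rewrite lerD2r -mulrA.
  by apply: ler_wpM2l => //; exact: h3.
apply: (le_trans (wN_add _ h1 h2)); rewrite !wN_scale ?mulr_ge0//.
have := ler_wpM2l m12_ge0 (vx_gain T0); rewrite /Gdu; lra.
Qed.

(** The estimate is run on [(0, T + D)], so that the first window fits. There the weighted norm of
    [p] is a finite number, and [Gud * Gdu < 1] lets its multiple on the right be absorbed. *)
Lemma p_gain (T : R) : 0 < T -> wN th 0 T p <= C_p * I0.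
Proof.
move=> T0; have T'0 : 0 < T + D by exact: addr_gt0.
have DT : D <= T + D by rewrite lerDr ltW.
have D0 := ltW D_gt0.
apply: (@le_trans _ _ (wN th 0 (T + D) p)).
  by apply: wN_sub (p_sq T'0) => //; rewrite ?(ltW T0)// lerDl.
set T' := T + D in T'0 DT *.
have [y [hy yN yU yp]] := Ypred T'0.
have [m [hm mN mk]] := wN_conv th om D_gt0 DT c_ge0 (f_sq T'0) f0.
have hp := p_sq T'0.
have hyD : sqi D T' (fun t => y (t - D)).
  by apply: sqi_delay; apply: sqi_sub hy; rewrite ?subrr// gerBl.
have hpD : sqi D T' p by exact: sqi_sub hp.
have k1 : wN th D T' p <= expR (th * D) * wN th 0 T' y + wN th D T' m.
  apply: (@le_trans _ _ (wN th D T' (fun t => y (t - D) + m t))).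
    apply: wN_le => //; first exact: sqiD.
    have := ae_and mk yp; apply: filterS => t [h1 h2] tDT; have [ik mle] := h1 tDT.
    rewrite ger0_norm//; apply: (le_trans (h2 tDT ik)); by rewrite lerD2l.
  apply: (le_trans (wN_add _ hyD hm)); rewrite lerD2r wN_delay.
    rewrite subrr; apply: ler_wpM2l; first exact: expR_ge0.
    by apply: wN_sub hy => //; rewrite ?subr_ge0// gerBl.
  by rewrite subrr; apply: sqi_sub hy => //; rewrite gerBl.
have k2 := wN_cat th D0 DT hp.
have fg := f_gain T'0.
have fw := first_window.
set x := wN th 0 T' p in k2 fg *; set F := wN th 0 T' f in yN mN fg.
have x0 : 0 <= x by exact: wN_ge0.
have e0 : 0 <= expR (th * D) by exact: expR_ge0.
have k3 := ler_wpM2l e0 yN.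
have k4 : x <= C_win * I0 + expR (th * D) * CY * I0 + Gud * F.
  by rewrite /Gud; move: k1 k2 k3 mN fw; rewrite mulrDl; lra.
have k5 := ler_wpM2l Gud_ge0 fg.
have k6 : x * (1 - Gud * Gdu) <= (C_win + expR (th * D) * CY + Gud * (m12 / gap)) * I0.
  by move: k4 k5; lra.
have s0 : 0 < 1 - Gud * Gdu by rewrite subr_gt0.
by rewrite /C_p mulrAC ler_pdivlMr.
Qed.

Lemma p_gain_sqr (T : R) : 0 < T -> wN th 0 T p ^+ 2 <= C_p ^+ 2 * I0 ^+ 2.
Proof.
move=> /p_gain h; have cp := C_p_ge0.
by rewrite -exprMn; apply: lerXn2r; rewrite ?nnegrE ?wN_ge0// mulr_ge0.
Qed.

(** On [(- D, 0)] the weight is at most [1] and the data bound the history; afterwards the feedback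
    is dominated by [y]. *)
Lemma U_gain (T : R) : 0 < T -> wN th (- D) T U ^+ 2 <= C_U * I0 ^+ 2.
Proof.
move=> T0; have [y [hy yN yU _]] := Ypred T0.
have hU := U_sq T0; have nD : - D <= 0 by rewrite oppr_le0 ltW.
have hU0 : sqi 0 T U by exact: sqi_sub hU.
have k1 : wN th 0 T U <= CU * C_y * I0.
  apply: (@le_trans _ _ (wN th 0 T (fun t => CU * y t))).
    apply: wN_le => //; first exact: sqiZ.
    by apply: filterS yU => t h /h[_]; rewrite ger0_norm.
  rewrite wN_scale// -mulrA; apply: ler_wpM2l => //; apply: (le_trans yN).
  have pg := ler_wpM2l Gdu_ge0 (p_gain T0).
  have := ler_wpM2l GY_ge0 (f_gain T0); have := ler_wpM2l GY_ge0 pg; rewrite /C_y; lra.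
have iU := wsq_integrable th hU.
rewrite wN_sqr (Rintegral_oo_cat nD (ltW T0) iU) -[X in _ + X]wN_sqr /C_U [leRHS]mulrDl mul1r.
apply: lerD; last by rewrite -exprMn lerXn2r ?nnegrE ?wN_ge0// !mulr_ge0// C_y_ge0.
apply: le_trans IU; apply: le_ae_Rintegral => //.
- by apply: integrable_oo_sub iU => //; exact: ltW.
- by apply: integrable_oo_sub hU.2 => //; exact: ltW.
apply: aeW => t; rewrite /= in_itv/= => /andP[_ t0].
apply: ler_piMl; first exact: sqr_ge0.
rewrite -[leRHS]expR0 ler_expR; apply: mulr_ge0_le0; last exact: ltW.
by rewrite mulr_ge0// ltW.
Qed.

(** The weighted joint energy at the end point is bounded by integrals that are already controlled:
    [a] by [p] through Poincare's inequality, the delayed input by [U_gain], and [b] by [v_gain]. *)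
Lemma q_bound (T : R) : 0 < T ->
  expR (2 * th * T) * (kap * a T ^+ 2 + b T ^+ 2) <= C_q * I0 ^+ 2.
Proof.
move=> T0; have g0 := gap2_gt0; have th0 : 0 <= 2 * th by rewrite mulr_ge0// ltW.
have := weighted_energy (2 * th) (joint_within (T := T)) (joint_int T0)
  (fun x y x0 xy _ => E_j x0 xy) (ltW T0) (lexx T).
have wp := wsq_integrable th (p_sq T0); have wb := wsq_integrable th (b_sq T0).
have wa := wsq_integrable th (a_sq T0); have wU := wsq_integrable th (Udelay_sq T0).
pose A := (Cj + 2 * th) * kap * lp ^+ 2.
have A0 : 0 <= A by rewrite !mulr_ge0 ?sqr_ge0 ?addr_ge0// ltW.
have i1 := integrable_RZl (mIoo 0 T) A wp.
have i2 := integrable_RZl (mIoo 0 T) kg wU.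
have i3 := integrable_RZl (mIoo 0 T) (2 * th) wb.
have i12 := integrable_RD (mIoo 0 T) i1 i2.
have H : \int[leb]_(r in `]0, T[) (expR (2 * th * r) * (- p r ^+ 2 + Cj * kap * a r ^+ 2 +
     kg * U (r - D) ^+ 2 + 2 * th * (kap * a r ^+ 2 + b r ^+ 2))) <=
   A * wN th 0 T p ^+ 2 + kg * wN th 0 T (fun t => U (t - D)) ^+ 2 + 2 * th * wN th 0 T b ^+ 2.
  rewrite !wN_sqr -(@RintegralZl _ _ _ leb _ (fun t => expR (2 * th * t) * p t ^+ 2))//.
  rewrite -(@RintegralZl _ _ _ leb _ (fun t => expR (2 * th * t) * U (t - D) ^+ 2))//.
  rewrite -(@RintegralZl _ _ _ leb _ (fun t => expR (2 * th * t) * b t ^+ 2))//.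
  rewrite -RintegralD// -RintegralD//; apply: le_ae_Rintegral => //.
  - have j1 := integrable_RN (mIoo 0 T) wp.
    have j2 := integrable_RZl (mIoo 0 T) ((Cj + 2 * th) * kap) wa.
    have := integrable_RD (mIoo 0 T) (integrable_RD (mIoo 0 T) (integrable_RD (mIoo 0 T) j1 j2) i2) i3.
    by apply: eq_integrable => // t _ /=; congr (_%:E); ring.
  - exact: integrable_RD.
  apply: filterS poin => r hr; rewrite /= in_itv/= => /andP[r0 _].
  have h1 : a r ^+ 2 <= lp ^+ 2 * p r ^+ 2.
    by rewrite -exprMn lerXn2r ?nnegrE ?mulr_ge0//; exact: hr.
  have c0 : 0 <= (Cj + 2 * th) * kap by rewrite mulr_ge0 ?addr_ge0// ltW.
  have e0 : 0 <= expR (2 * th * r) by exact: expR_ge0.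
  have h2 := ler_wpM2l e0 (ler_wpM2l c0 h1).
  have h3 : 0 <= expR (2 * th * r) * p r ^+ 2 by rewrite mulr_ge0 ?sqr_ge0.
  by move: h2 h3; rewrite /A; move: (expR _) => w; lra.
have kp : A * wN th 0 T p ^+ 2 <= A * C_p ^+ 2 * I0 ^+ 2.
  by rewrite -mulrA; apply: ler_wpM2l => //; exact: p_gain_sqr.
have TD : T - D <= T by rewrite gerBl ltW.
have kU : kg * wN th 0 T (fun t => U (t - D)) ^+ 2 <= kg * expR (2 * th * D) * C_U * I0 ^+ 2.
  rewrite -!mulrA; apply: ler_wpM2l => //.
  have hUD : sqi (0 - D) (T - D) U.
    by apply: sqi_sub (U_sq T0) => //; rewrite sub0r.
  rewrite wN_delay// exprMn -expRM_natl mulrA; apply: ler_wpM2l; first exact: expR_ge0.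
  apply: le_trans (U_gain T0); rewrite lerXn2r ?nnegrE ?wN_ge0// sub0r.
  by apply: wN_sub (U_sq T0) => //; rewrite ?lerBrDl ?subrr ?ltW//.
have kb : 2 * th * wN th 0 T b ^+ 2 <= 2 * th / (mu - 2 * th) * C_v * I0 ^+ 2.
  rewrite -!mulrA (mulrA 2) (mulrA 2 th); apply: ler_wpM2l => //.
  rewrite mulrC ler_pdivlMr// mulrC.
  have := v_gain T0.
  have k1 : 0 <= expR (2 * th * T) * b T ^+ 2 by rewrite mulr_ge0 ?expR_ge0 ?sqr_ge0.
  have k2 : 0 <= (mu - 2 * th) * wN th 0 T q ^+ 2 by rewrite mulr_ge0 ?sqr_ge0// ltW.
  have k3 : 2 * bv * wN th 0 T p ^+ 2 <= 2 * bv * (C_p ^+ 2 * I0 ^+ 2).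
    by apply: ler_wpM2l; [exact: mulr_ge0|exact: p_gain_sqr].
  rewrite (_ : C_v * I0 ^+ 2 = I0 ^+ 2 + 2 * bv * (C_p ^+ 2 * I0 ^+ 2)); last by rewrite /C_v; ring.
  by rewrite mulrDr; move: k3; lra.
have q1I : kap * a 0 ^+ 2 + b 0 ^+ 2 <= (kap + 1) * I0 ^+ 2.
  rewrite mulrDl mul1r; apply: lerD; [apply: ler_wpM2l; first exact: ltW|];
  by rewrite lerXn2r ?nnegrE.
move=> H1; move: (le_trans H1 H) kp kU kb q1I; rewrite /C_q -/A.
move: (A * _ ^+ 2) (kg * _ ^+ 2) (2 * th * _ ^+ 2) (expR _ * _) => x1 x2 x3 x4.
move: (kg * _ * _) (2 * th / _ * _) (A * _) => y1 y2 y3; lra.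
Qed.

Lemma C_U_ge0 : 0 <= C_U. Proof. by rewrite addr_ge0// sqr_ge0. Qed.

(** Covers [t = 0], which [q_bound] leaves out. *)
Lemma C_q_ge : kap + 1 <= C_q.
Proof.
have g0 := ltW gap2_gt0; have th0 : 0 <= 2 * th by rewrite mulr_ge0// ltW.
have k0 := ltW kap_gt0; have cp := sqr_ge0 C_p; have cu := C_U_ge0.
rewrite /C_q -!addrA lerD2l lerDl; apply: addr_ge0; last apply: addr_ge0.
- by apply: mulr_ge0 => //; rewrite !mulr_ge0// addr_ge0.
- by apply: mulr_ge0 => //; rewrite mulr_ge0 ?expR_ge0.
- by apply: mulr_ge0; [exact: divr_ge0|apply: addr_ge0 => //; apply: mulr_ge0 => //; exact: mulr_ge0].
Qed.

(** On the window the weight is at least [expR (2 * th * (t - D))], so the global weighted bound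
    localizes with the loss [expR (2 * th * D)]. *)
Lemma history_bound (t : R) : 0 <= t -> \int[leb]_(r in `]t - D, t[) (U r ^+ 2) <=
  expR (- (2 * th * t)) * (expR (2 * th * D) * C_U * I0 ^+ 2).
Proof.
move=> t0; have t1 : 0 < t + 1 by rewrite ltr_wpDl.
have hU := U_sq t1; have Dt : - D <= t - D by rewrite -[leLHS]add0r lerD2r.
have tt : t <= t + 1 by rewrite lerDl.
have iU := wsq_integrable th (sqi_sub Dt tt hU).
have tD : t - D <= t by rewrite gerBl ltW.
apply: (@le_trans _ _ (\int[leb]_(r in `]t - D, t[) (expR (- (2 * th * (t - D))) * (expR (2 * th * r) * U r ^+ 2)))).
  apply: le_ae_Rintegral => //.
  - exact: (sqi_sub Dt tt hU).2.
  - exact: integrable_RZl.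
  apply: aeW => r; rewrite /= in_itv/= => /andP[tr _].
  rewrite mulrA -expRD ler_peMl ?sqr_ge0// -expR0 ler_expR addrC -mulrBr.
  by rewrite mulr_ge0 ?subr_ge0 ?mulr_ge0// ltW.
rewrite (@RintegralZl _ _ _ leb _ (fun r => expR (2 * th * r) * U r ^+ 2))//.
have -> : expR (- (2 * th * (t - D))) = expR (- (2 * th * t)) * expR (2 * th * D).
  by rewrite -expRD; congr expR; ring.
rewrite -!mulrA; apply: ler_wpM2l; first exact: expR_ge0.
apply: ler_wpM2l; first exact: expR_ge0.
apply: le_trans (U_gain t1); rewrite -wN_sqr lerXn2r ?nnegrE ?wN_ge0//.
exact: wN_sub hU.
Qed.

(** [kap^-1 + 1] recovers [a^2 + b^2] from [kap a^2 + b^2]; the final [1] makes the constant at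
    least [1]. *)
Definition C_total : R := Num.sqrt ((kap^-1 + 1) * C_q + expR (2 * th * D) * C_U) + 1.

Lemma scalar_decay (t : R) : 0 <= t ->
  Num.sqrt (a t ^+ 2 + b t ^+ 2 + \int[leb]_(r in `]t - D, t[) (U r ^+ 2)) <=
  C_total * expR (- th * t) * I0.
Proof.
move=> t0; have k0 := ltW kap_gt0.
have qt : kap * a t ^+ 2 + b t ^+ 2 <= expR (- (2 * th * t)) * (C_q * I0 ^+ 2).
  move: t0; rewrite le_eqVlt => /predU1P[<-|t0]; last first.
    rewrite -(ler_pM2l (expR_gt0 (2 * th * t))) [leRHS]mulrA expRxMexpNx_1 mul1r; exact: q_bound.
  rewrite mulr0 oppr0 expR0 mul1r; apply: (@le_trans _ _ ((kap + 1) * I0 ^+ 2)).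
    rewrite mulrDl mul1r; apply: lerD; [apply: ler_wpM2l => //|]; by rewrite lerXn2r ?nnegrE.
  by apply: ler_wpM2r; [exact: sqr_ge0|exact: C_q_ge].
have C_q0 : 0 <= C_q by apply: le_trans C_q_ge; rewrite addr_ge0.
have z := history_bound t0.
set e := expR (- (2 * th * t) ) in qt z *.
have eE : e = expR (- th * t) ^+ 2.
  by rewrite -expRM_natl; congr expR; ring.
have kk : a t ^+ 2 + b t ^+ 2 <= (kap^-1 + 1) * (e * (C_q * I0 ^+ 2)).
  rewrite mulrDl mul1r; apply: lerD.
    rewrite -(ler_pM2l kap_gt0) [leRHS]mulrA divff ?gt_eqF// mul1r; apply: le_trans qt.
    by rewrite lerDl sqr_ge0.
  by apply: le_trans qt; rewrite lerDr mulr_ge0 ?sqr_ge0.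
have C0 : 0 <= (kap^-1 + 1) * C_q + expR (2 * th * D) * C_U.
  by rewrite addr_ge0 ?mulr_ge0 ?expR_ge0 ?C_U_ge0// addr_ge0 ?invr_ge0.
apply: (@le_trans _ _ (Num.sqrt (((kap^-1 + 1) * C_q + expR (2 * th * D) * C_U) * (expR (- th * t) * I0) ^+ 2))).
  by apply: ler_wsqrtr; apply: (le_trans (lerD kk z)); rewrite exprMn -eE; lra.
rewrite sqrtrM// sqrtr_sqr ger0_norm ?mulr_ge0 ?expR_ge0// /C_total -[leRHS]mulrA.
by apply: ler_wpM2r; [rewrite mulr_ge0 ?expR_ge0|rewrite lerDl].
Qed.

End scalar_estimates.

(** * From vector-valued functions to their scalar norms *)

Section assembly_tools.
Context {R : realType}.
Notation leb := (@lebesgue_measure R).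
Notation RR := (measurableTypeR R).

Lemma ae_shift (c : R) (Q : R -> Prop) : {ae leb, forall t, Q t} ->
  {ae leb, forall t, Q (t - c)}.
Proof.
move=> [N [mN N0 QN]]; exists (tshift (- c) @^-1` N); split.
- by rewrite -[X in measurable X]setTI; exact: measurable_tshift.
- by have := lebesgue_measure_shift (- c) mN; rewrite N0.
- by move=> t /= h; apply: QN.
Qed.

Section vector_valued.
Context {dT : measure_display} {T : measurableType dT}.
Variable mu : {measure set T -> \bar R}.
Implicit Types (f : R -> L2 mu).

Lemma within_eps f : (forall t0 : R, 0 <= t0 ->
    nrm (f t - f t0) @[t --> within `[0, +oo[ (nbhs t0)] --> (0 : R)) ->
  forall t e : R, 0 <= t -> 0 < e -> exists2 del : R, 0 < del &
    forall s, 0 <= s -> `|s - t| < del -> nrm (f s - f t) <= e.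
Proof.
move=> h t e t0 e0; have := h t t0 => /cvgrPdist_le/(_ e e0); rewrite near_withinE.
move=> /nbhs_ballP[del /= d0 hd]; exists del => // s s0 st.
have := hd s; rewrite /= /ball/= distrC => /(_ st).
by rewrite in_itv/= andbT => /(_ s0); rewrite sub0r normrN ger0_norm ?nrm_ge0.
Qed.

Lemma sqi_nrm (a b : R) f : Bochner_L2 a b f -> sqi a b (fun t => nrm (f t)).
Proof. by move=> fB; split; [apply: measurable_nrm => //; case: fB|exact: Bochner_nrm_sqr]. Qed.

Lemma wnorm_wN (th a b : R) f : Bochner_L2 a b f ->
  wnorm th a b f = (wN th a b (fun t => nrm (f t)))%:E.
Proof.
move=> fB; rewrite wnormE; last exact: Bochner_wnrm_sqr.
by rewrite /wN; congr (Num.sqrt _)%:E; apply: eq_Rintegral => t _;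
  exact: esym (wsqrE th (fun t => nrm (f t)) t).
Qed.

(** The weight is at least [1] on [(0, b)], so the weighted norm dominates the plain one. *)
Lemma Bochner_wnorm (th b : R) f : 0 <= th -> strongly_measurable `]0, b[ f ->
  (wnorm th 0 b f < +oo)%E -> Bochner_L2 0 b f.
Proof.
move=> th0 sf foo; apply: Bochner_sqr => //.
apply: (integrable_Rle (g := fun t : RR => expR (2 * th * t) * nrm (f t) ^+ 2)) => //.
- by apply: measurable_funX; exact: measurable_nrm.
- move=> t; rewrite /= in_itv/= => /andP[t0 _]; rewrite ger0_norm ?sqr_ge0//.
  rewrite ler_peMl ?sqr_ge0// -expR0 ler_expR; apply: mulr_ge0; last exact: ltW.
  exact: mulr_ge0.
- exact: wnorm_fin_integrable.
Qed.

End vector_valued.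

(** [Y 0] combines the initial state with the input history; Cauchy-Schwarz on [(- D, 0)] gives the
    factor [sqrt D]. *)
Lemma nrm_predictor_start (l D : R) (g : Linf (muI 0 l)) (S : R -> XI l -> XI l)
  (CS Cg I0 : R) (U u Y : R -> XI l) : 0 < D -> 0 <= CS -> 0 <= Cg -> 0 <= I0 ->
  (forall t x, 0 <= t <= D -> nrm (S t x) <= CS * nrm x) ->
  (forall x, nrm (mulop g x) <= Cg * nrm x) ->
  is_predictor D g S U u Y -> Bochner_L2 (- D) 0 U ->
  nrm (u 0) <= I0 -> \int[leb]_(t in `]- D, 0[) (nrm (U t) ^+ 2) <= I0 ^+ 2 ->
  nrm (Y 0) <= CS * (1 + Cg * Num.sqrt D) * I0.
Proof.
move=> D0 CS0 Cg0 I00 hS hg /(_ 0 (lexx 0))[J hJ YJ] UB u0 IU.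
rewrite (aeq_nrm YJ); apply: (le_trans (nrmD _ _)).
have DD : 0 <= D <= D by rewrite lexx ltW.
have k1 : nrm (S D (u 0)) <= CS * I0.
  by apply: (le_trans (hS _ _ DD)); apply: ler_wpM2l.
have iU := Bochner_nrm UB.
have mU := integrable_measurable_fun iU.
pose N := \int[leb]_(t in `]- D, 0[) nrm (U t).
have N0 : 0 <= N by apply: Rintegral_ge0 => t _; exact: nrm_ge0.
have NI : N <= Num.sqrt D * I0.
  have m1 : measurable_fun (`]- D, 0[ : set RR) (cst 1 : R -> R) by exact: measurable_cst.
  have := Rintegral_cauchy_schwarz (mIoo (- D) 0) m1 mU (cst1_sqr _ _) (Bochner_nrm_sqr UB).
  under eq_Rintegral do rewrite mul1r.
  rewrite -/N => h; rewrite -(@ler_pXn2r _ 2)// ?nnegrE ?mulr_ge0 ?sqrtr_ge0//.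
  apply: (le_trans h); rewrite exprMn sqr_sqrtr ?(ltW D0)//.
  have -> : \int[leb]_(x in `]- D, 0[) ((cst 1 x : R) ^+ 2) = D.
    under eq_Rintegral do rewrite /= expr1n.
    by rewrite Rintegral_oo_cst ?oppr_le0 ?(ltW D0)// sub0r opprK mul1r.
  by apply: ler_wpM2l => //; exact: ltW.
have k2 : nrm J <= CS * Cg * N.
  apply: nrm_dual; first by rewrite !mulr_ge0.
  move=> phi; have [iJ <-] := hJ phi.
  have E1 : 0 - D = - D by rewrite sub0r.
  have iUD : leb.-integrable `]0, D[ (EFin \o (fun s => nrm (U (s - D)))).
    by apply: (@integrable_shift R 0 D (- D) (EFin \o (fun s => nrm (U s)))); rewrite add0r subrr.
  have -> : CS * Cg * N * nrm phi = \int[leb]_(s in `]0, D[) (CS * Cg * nrm phi * nrm (U (s - D))).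
    rewrite (@RintegralZl _ _ _ leb _ (fun s => nrm (U (s - D))))//.
    rewrite (@Rintegral_oo_shift _ 0 D D (fun s => nrm (U s))) sub0r subrr// -/N; ring.
  apply: norm_Rintegral_le; [exact: iJ|exact: integrable_RZl|].
  move=> s /andP[s0 sD]; apply: (le_trans (cauchy_schwarz _ _)).
  rewrite [leRHS]mulrAC; apply: ler_wpM2r; first exact: nrm_ge0.
  have sd : 0 <= D - s <= D by apply/andP; split; lra.
  apply: (le_trans (hS _ _ sd)); rewrite -mulrA; apply: ler_wpM2l => //.
  by rewrite /zhist (_ : 0 - D + s = s - D); [exact: hg|ring].
have := ler_wpM2l (mulr_ge0 CS0 Cg0) NI; clearbody N; lra.
Qed.

End assembly_tools.

(** * The weak equation tested in the domain of the nominal operator *)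

Section weak_form.
Context {R : realType}.
Notation leb := (@lebesgue_measure R).
Notation RR := (measurableTypeR R).
Variables (l D e1 : R) (l_gt0 : 0 < l).
Notation mI := (muI 0 l).
Notation X := (XI l).
Variables (g a1bar : Linf mI) (U u ux F : R -> X) (w : R -> X -> R).
Hypothesis F_eq : {ae leb, forall t, 0 < t ->
    forall phi dphi : X, in_H01 phi dphi ->
    w t phi = - (e1 * dotp mI (ux t) dphi) + dotp mI (F t) phi +
      dotp mI (mulop a1bar (u t)) phi + dotp mI (mulop g (U (t - D))) phi}.
Hypothesis uH : {ae leb, forall t, 0 < t -> in_H01 (u t) (ux t)}.
Hypothesis w_inc : forall phi dphi, in_H01 phi dphi -> forall a b : R, 0 <= a -> a <= b ->
  leb.-integrable `]a, b[ (EFin \o (fun t => w t phi)) /\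
  dotp mI (u b) phi - dotp mI (u a) phi = \int[leb]_(t in `]a, b[) w t phi.
Hypothesis u_B : forall tau, 0 < tau -> Bochner_L2 0 tau u.
Hypothesis H_B : forall tau, 0 < tau -> Bochner_L2 0 tau (fun r => F r + mulop g (U (r - D)) : X).

(** A further integration by parts turns [- e1 <u_x, phi_x>] into [e1 <u, phi_xx>]: the nominal
    operator acts on [phi], and no derivative of [u] remains. *)
Lemma weak_form phi f : An e1 a1bar phi f -> forall a b : R, 0 <= a -> a <= b ->
  dotp mI (u b) phi - dotp mI (u a) phi =
  \int[leb]_(s in `]a, b[) (dotp mI (u s) f + dotp mI (F s + mulop g (U (s - D)) : X) phi).
Proof.
move=> [dphi [ddphi [h wd /An_mulop ef]]] a b a0 ab.
have [iw ->] := w_inc h a0 ab.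
have b1 : 0 < b + 1 by lra.
have bb : b <= b + 1 by rewrite lerDl.
have mu_ := (Bochner_sub a0 bb (u_B b1)).1; have mH := (Bochner_sub a0 bb (H_B b1)).1.
apply: eq_ae_Rintegral => //.
- exact: integrable_measurable_fun iw.
- by apply: measurable_funD; exact: measurable_dotp.
have := ae_and F_eq uH; apply: filterS => t [eqt Ht] tab.
have t0 : 0 < t.
  by move: tab; rewrite /= in_itv/= => /andP[at_ _]; exact: le_lt_trans at_.
rewrite (eqt t0 _ _ h) (aeq_dotpr _ ef) dotpDr dotpZr dotpDl -mulop_sym.
have := H01_by_parts l_gt0 (Ht t0) wd; rewrite [dotp mI dphi _]dotpC [dotp mI ddphi _]dotpC => ->; ring.
Qed.

End weak_form.

(** * Decay of closed-loop solutions *)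

Section closed_loop.
Context {R : realType}.
Notation leb := (@lebesgue_measure R).
Notation RR := (measurableTypeR R).
Variables (l d D e1 e2 e2b : R) (l_gt0 : 0 < l) (d_gt0 : 0 < d) (D_gt0 : 0 < D) (e1_gt0 : 0 < e1).
Notation mI := (muI 0 l).
Notation mO := (muOmega l d).
Notation X := (XI l).
Notation W := (XO l d).
Variables (al1 : Linf (muIt l)) (al2 : Linf (muOmegat l d)).
Variables (lam1 : Linf (muOmegat l d)) (lam2 : Linf (muIt l)) (g a1bar : Linf mI).
Variables (S SF : R -> X -> X) (P K : X -> X) (rho : R).
Hypothesis S_gen : is_semigroup setT (An e1 a1bar) S.
Hypothesis P_proj : orthogonal_projection (Xcr e1 a1bar rho) P.
Hypothesis K_lin : bounded_linear (Xcr e1 a1bar rho) K.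
Hypothesis SF_gen : is_semigroup setT (AF e1 a1bar g P K) SF.
Variable MF : R.
Hypothesis MF_gt0 : 0 < MF.
Hypothesis SF_bounded : forall t phi, 0 <= t -> nrm (SF t phi) <= MF * nrm phi.
Variables (mu_v : R) (mu_v_gt0 : 0 < mu_v).
Hypothesis coercive : {ae leb, forall t : R, 0 <= t ->
     forall phi px py : W, in_H1 phi px py ->
     mu_v * (nrm phi ^+ 2 + nrm px ^+ 2 + nrm py ^+ 2) <=
       e2 * nrm px ^+ 2 + e2b * nrm py ^+ 2
       - \int[mO]_p (al2 (p, t) * `|phi p| ^+ 2)}.
Variables (th : R) (th_gt0 : 0 < th) (th_mu : 2 * th < mu_v).
Variables (Cn omn : R) (Cn_gt0 : 0 < Cn).
Hypothesis Cn_est : smoothing_estimate S Cn omn.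
Variables (CY1 GYd : R) (CY1_gt0 : 0 < CY1) (GYd_gt0 : 0 < GYd).
Hypothesis CY_est : mild_estimate D S SF th CY1 GYd.
Hypothesis small_gain : G_ud D Cn omn GYd th * G_du al1 a1bar lam1 lam2 mu_v th < 1.
Variables (Ca Cg CK CS : R) (Ca_ge0 : 0 <= Ca) (Cg_ge0 : 0 <= Cg) (CK_gt0 : 0 < CK) (CS_gt0 : 0 < CS).
Hypothesis Ca_bound : forall f : X, nrm (mulop a1bar f) <= Ca * nrm f.
Hypothesis Cg_bound : forall f : X, nrm (mulop g f) <= Cg * nrm f.
Hypothesis CK_bound : forall f : X, nrm (K (P f)) <= CK * nrm f.
Hypothesis CS_bound : forall (t : R) (f : X), 0 <= t <= D -> nrm (S t f) <= CS * nrm f.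

Notation kap := (kappa d e1 lam2 mu_v).
Notation Cj := (growth e1 al1 lam1 lam2 a1bar mu_v Ca Cg).
Notation bv := (b_v d lam2 mu_v).
Notation ma := (m_alpha al1 a1bar).
Notation m12 := (M12 lam1).
Notation CY := (CY1 * (CS * (1 + Cg * Num.sqrt D))).
Notation Ctot := (C_total D mu_v th kap Cj (kap * Cg) bv (l / pi) ma m12 Cn omn GYd CY (CK * (l / pi))).

Lemma closed_loop_decay (u0 : X) (v0 : W) (U0 U u : R -> X) (v : R -> W) :
  Bochner_L2 (- D) 0 U0 ->
  closed_loop_solution D e1 e2 e2b al1 al2 lam1 lam2 g S P K u0 v0 U0 U u v ->
  forall t : R, 0 <= t ->
  state_norm D U u v t <=
    Ctot * expR (- th * t) * (Hnorm u0 v0 + fine (wnorm 0 (- D) 0 U0)).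
Proof.
move=> U0_B [[[U_B U_hist] [uv_cont [u_init v_init]]
  [ux [vx [vy [w [Bs uv_V w_d equation]]]]]] [Y Y_pred UKPY]].
have D0 := ltW D_gt0; have k_gt0 := kappa_gt0 d_gt0 e1_gt0 lam2 mu_v_gt0.
have dense := test_dense l_gt0 S_gen Cn_est.
have u_cont := within_eps (fun t0 h => (uv_cont t0 h).1).
have v_cont := within_eps (fun t0 h => (uv_cont t0 h).2).
have w_dual tau (h : 0 < tau) := (w_d tau h).1.
have w_deriv tau (h : 0 < tau) := (w_d tau h).2.
have u_B tau : 0 < tau -> Bochner_L2 0 tau u by move=> /Bs[].
have ux_B tau : 0 < tau -> Bochner_L2 0 tau ux by move=> /Bs[].
have v_B tau : 0 < tau -> Bochner_L2 0 tau v by move=> /Bs[].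
have vx_B tau : 0 < tau -> Bochner_L2 0 tau vx by move=> /Bs[].
have vy_B tau : 0 < tau -> Bochner_L2 0 tau vy by move=> /Bs[].
have uH : {ae leb, forall t, 0 < t -> in_H01 (u t) (ux t)}.
  by apply: filterS uv_V => t h /h[].
have lp0 : 0 <= l / pi by rewrite divr_ge0 ?pi_ge0// ltW.
have ma0 : 0 <= ma by exact: m_alpha_ge0.
have m120 : 0 <= m12 by exact: M12_ge0.
have bv0 : 0 <= bv by exact: bv_ge0.
set I0 := _ + fine _.
have uvV_phi (phi dphi : X) : in_H01 phi dphi -> in_V phi dphi (0 : W) 0 0.
  by move=> h; split => //; exact: (@H1_0 R l d).
(* The test pair has a zero [v]-component, so [w t phi 0] is the time derivative of [<u t, phi>]
   alone. *)
have [F [F_B F_le]] : exists F : R -> X, (forall tau, 0 < tau -> Bochner_L2 0 tau F) /\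
    {ae leb, forall t, 0 < t -> nrm (F t) <= ma * nrm (u t) + m12 * nrm (vx t) /\
      forall phi dphi : X, in_H01 phi dphi ->
      w t phi 0 = - (e1 * dotp mI (ux t) dphi) + dotp mI (F t) phi +
        dotp mI (mulop a1bar (u t)) phi + dotp mI (mulop g (U (t - D))) phi}.
  apply: (forcing_exists l_gt0 D_gt0 dense U_B u_B ux_B _ _ (u_equation d_gt0 a1bar equation)).
    by move=> phi dphi /uvV_phi hV tau /w_dual[_ + _]; apply; exact: hV.
  move=> tau tau0; apply: (sqiD _ _).2; apply: sqiZ; apply: sqi_nrm; [exact: u_B|exact: vx_B].
have F_eq : {ae leb, forall t, 0 < t -> forall phi dphi : X, in_H01 phi dphi ->
      w t phi 0 = - (e1 * dotp mI (ux t) dphi) + dotp mI (F t) phi +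
        dotp mI (mulop a1bar (u t)) phi + dotp mI (mulop g (U (t - D))) phi}.
  by apply: filterS F_le => t h /h[].
have w_inc (phi dphi : X) : in_H01 phi dphi -> forall a b : R, 0 <= a -> a <= b ->
    leb.-integrable `]a, b[ (EFin \o (fun t => w t phi 0)) /\
    dotp mI (u b) phi - dotp mI (u a) phi = \int[leb]_(t in `]a, b[) w t phi 0.
  move=> /uvV_phi hV a b a0 ab.
  have [iw wE] := weak_increment l_gt0 dense u_cont v_cont w_dual w_deriv hV a0 ab.
  by split=> //; rewrite -wE !dotp_raw0 !addr0.
have H_B := total_forcing_B l_gt0 g S_gen Cn_est U_B F_B.
have weak := weak_form l_gt0 F_eq uH w_inc u_B H_B.
have Y_inc := predictor_increment l_gt0 D_gt0 e1_gt0 S_gen Cn_est U_B F_B u_cont weak Y_pred.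
have Q_B tau : 0 < tau -> Bochner_L2 0 tau (fun r => S D (F r)).
  move=> tau0; have DD : 0 <= D <= D by rewrite D0 lexx.
  apply: (@Bochner_op _ _ _ l_gt0 _ _ S_gen _ _ Cn_est _ _ CS F (S D) (S D)) => //.
  - by move=> x psi; exact: (S_sym l_gt0 S_gen Cn_est).
  - by move=> x; exact: CS_bound.
  - exact: F_B.
have G_B tau : 0 < tau -> Bochner_L2 0 tau (fun r => mulop g (U r)).
  by move=> _; apply: (G_BI l_gt0 g S_gen Cn_est U_B); rewrite oppr_le0.
have GY : {ae leb, forall r, 0 <= r -> aeq mI (mulop g (U r)) (feedback g P K (Y r))}.
  by apply: filterS UKPY => r h r0; apply: mulop_congr; exact: h.
have mild tau : mild_solution D S SF tau (Y 0) F Y.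
  move=> t /andP[t0 _].
  exact: (closed_loop_is_mild l_gt0 e1_gt0 P_proj K_lin S_gen Cn_est SF_gen MF_gt0 SF_bounded Q_B G_B Y_inc GY t0).
have U0B : wnorm 0 (- D) 0 U0 = (wN 0 (- D) 0 (fun t => nrm (U0 t)))%:E by exact: wnorm_wN.
have U1 : 0 < 1 :> R by [].
have UB0 : Bochner_L2 (- D) 0 U by exact: (Bochner_sub (lexx _) ler01 (U_B 1 U1)).
have IU0 : \int[leb]_(t in `]- D, 0[) (nrm (U t) ^+ 2) = wN 0 (- D) 0 (fun t => nrm (U0 t)) ^+ 2.
  rewrite wN_sqr; apply: eq_ae_Rintegral => //.
  - exact: integrable_measurable_fun (Bochner_nrm_sqr UB0).
  - exact: integrable_measurable_fun (wsq_integrable 0 (sqi_nrm U0_B)).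
  apply: filterS U_hist => t h; rewrite /= in_itv/= => /h/aeq_nrm ->.
  by rewrite mulr0 mul0r expR0 mul1r.
have Hn0 : 0 <= Hnorm u0 v0 by exact: sqrtr_ge0.
have wN0 : 0 <= wN 0 (- D) 0 (fun t => nrm (U0 t)) by exact: wN_ge0.
have I0E : I0 = Hnorm u0 v0 + wN 0 (- D) 0 (fun t => nrm (U0 t)) by rewrite /I0 U0B.
have I0_ge0 : 0 <= I0 by rewrite I0E addr_ge0.
have Ia : nrm (u 0) <= I0.
  rewrite (aeq_nrm u_init) I0E; apply: (@le_trans _ _ (Hnorm u0 v0)); last by rewrite lerDl.
  by rewrite -[leLHS]ger0_norm ?nrm_ge0// -sqrtr_sqr; apply: ler_wsqrtr; rewrite lerDl sqr_ge0.
have Ib : nrm (v 0) <= I0.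
  rewrite (aeq_nrm v_init) I0E; apply: (@le_trans _ _ (Hnorm u0 v0)); last by rewrite lerDl.
  by rewrite -[leLHS]ger0_norm ?nrm_ge0// -sqrtr_sqr; apply: ler_wsqrtr; rewrite lerDr sqr_ge0.
have IU : \int[leb]_(t in `]- D, 0[) (nrm (U t) ^+ 2) <= I0 ^+ 2.
  by rewrite IU0 lerXn2r ?nnegrE// I0E lerDr.
have Y0_le := nrm_predictor_start D_gt0 (ltW CS_gt0) Cg_ge0 I0_ge0 CS_bound Cg_bound Y_pred UB0 Ia IU.
have Ypred T : 0 < T -> exists y : R -> R,
  [/\ sqi 0 T y, wN th 0 T y <= CY * I0 + GYd * wN th 0 T (fun t => nrm (F t)),
      {ae leb, forall t, 0 < t < T -> 0 <= y t /\ nrm (U t) <= CK * (l / pi) * y t} &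
      {ae leb, forall t, D < t < T ->
        let k := fun r => Cn * ((Num.sqrt r)^-1 * expR (omn * r)) * nrm (F (t - r)) in
        leb.-integrable `]0, D[ (EFin \o k) ->
        nrm (ux t) <= y (t - D) + \int[leb]_(r in `]0, D[) k r}].
  move=> T0; have [dY [sdY dY_H dY_le]] := CY_est T0 (F_B T T0) (mild T).
  rewrite (wnorm_wN _ (F_B T T0)) -EFinM -EFinD in dY_le.
  have dYB : Bochner_L2 0 T dY.
    by apply: (Bochner_wnorm (ltW th_gt0)) => //; exact: le_lt_trans dY_le (ltry _).
  rewrite (wnorm_wN _ dYB) lee_fin in dY_le.
  exists (fun t => nrm (dY t)); split.
  - exact: sqi_nrm.
  - apply: (le_trans dY_le); rewrite lerD2r -mulrA; apply: ler_wpM2l => //; exact: ltW.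
  - have := ae_and UKPY dY_H; apply: filterS => t [hU hH] /[dup] tT /andP[t0 _].
    rewrite nrm_ge0; split=> //; rewrite (aeq_nrm (hU (ltW t0))); apply: (le_trans (CK_bound _)).
    by rewrite -mulrA; apply: ler_wpM2l; [exact: ltW|exact: poincare (hH tT)].
  (* [Y (t - D)] lies in [H_0^1] for almost every [t] by translating the exceptional null set. *)
  have := ae_and uH (ae_shift D dY_H); apply: filterS => t [hu hY] /andP[Dt tT] /= ik.
  have t0 : 0 < t by exact: lt_trans Dt.
  have tD : 0 < t - D < T by rewrite subr_gt0 Dt /=; apply: le_lt_trans tT; rewrite gerBl.
  have gap_le := gradient_gap l_gt0 D_gt0 e1_gt0 S_gen Cn_est U_B F_B u_cont weak Y_pred
    (ltW Dt) (ltW Cn_gt0) (hu t0) (hY tD) ik.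
  by apply: (le_trans (nrm_le_dist (ux t) (dY (t - D)))); rewrite lerD2l.
have cont dT (T : measurableType dT) (mu : {measure set T -> \bar R}) (f : R -> L2 mu) :
    (forall t e : R, 0 <= t -> 0 < e -> exists2 del : R, 0 < del &
      forall s, 0 <= s -> `|s - t| < del -> nrm (f s - f t) <= e) ->
    forall t e : R, 0 <= t -> 0 < e -> exists2 del : R, 0 < del &
      forall s, 0 <= s -> `|s - t| < del -> `|nrm (f s) - nrm (f t)| <= e.
  move=> h t e t0 e0; have [del d0 hd] := h t e t0 e0; exists del => // s s0 st.
  by apply: (le_trans (ler_dist_nrm _ _)); exact: hd.
have E_v := v_energy l_gt0 d_gt0 dense u_cont v_cont w_dual w_deriv uv_V ux_B v_B vx_B vy_B
  equation mu_v_gt0 coercive Ca_bound Cg_bound.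
have E_j := joint_energy l_gt0 d_gt0 D_gt0 e1_gt0 dense U_B u_cont v_cont w_dual w_deriv uv_V
  u_B ux_B v_B vx_B vy_B equation mu_v_gt0 coercive Cg_ge0 Ca_bound Cg_bound.
have Cj0 : 0 <= Cj.
  rewrite /growth; apply: addr_ge0; first by rewrite !addr_ge0// mulr_ge0.
  by apply: divr_ge0; [apply: mulr_ge0; [exact: ltW|exact: sqr_ge0]|exact: ltW].
have poin : {ae leb, forall t, 0 < t -> nrm (u t) <= l / pi * nrm (ux t)}.
  by apply: filterS uH => t h /h; exact: poincare.
have f_le : {ae leb, forall t, 0 < t -> nrm (F t) <= ma * nrm (u t) + m12 * nrm (vx t)}.
  by apply: filterS F_le => t h /h[].
have CY0 : 0 <= CY.
  rewrite mulr_ge0 ?(ltW CY1_gt0)// mulr_ge0 ?(ltW CS_gt0)// addr_ge0// mulr_ge0//; exact: sqrtr_ge0.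
have CU0 : 0 <= CK * (l / pi) by rewrite mulr_ge0// ltW.
have kg0 : 0 <= kap * Cg by rewrite mulr_ge0// ltW.
move=> t t0.
have n0 dT (T : measurableType dT) (mu : {measure set T -> \bar R}) (f : R -> L2 mu) (s : R) :
  0 <= nrm (f s) by exact: nrm_ge0.
have := scalar_decay D_gt0 th_gt0 th_mu k_gt0 Cj0 kg0 bv0 lp0 ma0 m120 (ltW Cn_gt0) (ltW GYd_gt0) CY0 CU0
  small_gain (n0 _ _ _ u) (n0 _ _ _ ux) (n0 _ _ _ v) (n0 _ _ _ U) (n0 _ _ _ F) I0_ge0
  (cont _ _ _ _ u_cont) (cont _ _ _ _ v_cont)
  (fun T h => sqi_nrm (u_B T h)) (fun T h => sqi_nrm (ux_B T h)) (fun T h => sqi_nrm (v_B T h))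
  (fun T h => sqi_nrm (vx_B T h)) (fun T h => sqi_nrm (F_B T h)) (fun T h => sqi_nrm (U_B T h))
  E_v E_j poin f_le Ia Ib IU Ypred t0.
apply: le_trans; rewrite le_eqVlt; apply/orP; left; apply/eqP.
rewrite /state_norm; congr Num.sqrt; congr (_ + _).
  by rewrite /Hnorm sqr_sqrtr// addr_ge0 ?sqr_ge0.
(* What remains is to recognize the history norm over [(0, D)] as the integral of the squared input
   norm over [(t - D, t)]. *)
have t1 : 0 < t + 1 by rewrite ltr_wpDl.
have UBt : Bochner_L2 (t - D) t U.
  by apply: Bochner_sub (U_B _ t1); [rewrite -[leLHS]add0r lerD2r|rewrite lerDl].
have [E1 E2] : 0 - (D - t) = t - D /\ D - (D - t) = t by split; ring.
have iU : leb.-integrable `]0 - (D - t), D - (D - t)[ (EFin \o (fun s => nrm (U s) ^+ 2)).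
  by rewrite E1 E2; exact: Bochner_nrm_sqr.
have Ez s : zhist D U t s = U (s - (D - t)) by rewrite /zhist; congr U; ring.
rewrite wnormE; last first.
  have := @integrable_shift R 0 D (- (D - t)) (EFin \o (fun s => nrm (U s) ^+ 2)) iU.
  by apply: eq_integrable => // s _ /=; rewrite Ez mulr0 mul0r expR0 mul1r.
rewrite /= sqr_sqrtr; last by apply: Rintegral_ge0 => s _; rewrite mulr_ge0 ?expR_ge0 ?sqr_ge0.
have EI := Rintegral_oo_shift iU; rewrite E1 E2 in EI; rewrite -[RHS]EI.
by apply: eq_Rintegral => s _; rewrite Ez mulr0 mul0r expR0 mul1r.
Qed.

End closed_loop.

Theorem theorem11 (R : realType)
  (l d D e1 e2 e2b : R)
  (l_gt0 : 0 < l) (d_gt0 : 0 < d) (D_gt0 : 0 < D)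
  (e1_gt0 : 0 < e1) (e2_gt0 : 0 < e2) (e2b_gt0 : 0 < e2b)
  (al1 : Linf (muIt l)) (al2 : Linf (muOmegat l d))
  (lam1 : Linf (muOmegat l d)) (lam2 : Linf (muIt l))
  (g : Linf (muI 0 l)) (g_neq0 : (0 < muI 0 l [set x | (g x != 0)%R])%E)
  (* the nominal operator, its semigroup and its spectral projection *)
  (a1bar : Linf (muI 0 l))
  (S : R -> XI l -> XI l) (S_gen : is_semigroup setT (An e1 a1bar) S)
  (rho : R) (rho_gt0 : 0 < rho)
  (P : XI l -> XI l) (P_proj : orthogonal_projection (Xcr e1 a1bar rho) P)
  (* the feedback gain *)
  (K : XI l -> XI l) (K_lin : bounded_linear (Xcr e1 a1bar rho) K)
  (K_Hurwitz : Hurwitz (Xcr e1 a1bar rho) (Acr_cl e1 a1bar g rho P K))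
  (Scr : R -> XI l -> XI l)
  (Scr_gen : is_semigroup (Xcr e1 a1bar rho) (Acr_cl e1 a1bar g rho P K) Scr)
  (Mcr omcr : R) (Mcr_ge1 : 1 <= Mcr) (omcr_gt0 : 0 < omcr)
  (Scr_decay : forall t phi, 0 <= t -> Xcr e1 a1bar rho phi ->
     nrm (Scr t phi) <= Mcr * expR (- omcr * t) * nrm phi)
  (SF : R -> XI l -> XI l)
  (SF_gen : is_semigroup setT (AF e1 a1bar g P K) SF)
  (MF omF : R) (MF_ge1 : 1 <= MF)
  (omF_gt0 : 0 < omF) (omF_lt : omF < Num.min rho omcr)
  (SF_decay : forall t phi, 0 <= t ->
     nrm (SF t phi) <= MF * expR (- omF * t) * nrm phi)
  (* coercivity of the v-equation *)
  (mu_v : R) (mu_v_gt0 : 0 < mu_v)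
  (coercive : {ae @lebesgue_measure R, forall t : R, 0 <= t ->
     forall phi px py : XO l d, in_H1 phi px py ->
     mu_v * (nrm phi ^+ 2 + nrm px ^+ 2 + nrm py ^+ 2) <=
       e2 * nrm px ^+ 2 + e2b * nrm py ^+ 2
       - \int[muOmega l d]_p (al2 (p, t) * `|phi p| ^+ 2)})
  (* the gains and the small-gain condition *)
  (th : R) (th_gt0 : 0 < th) (th_lt : th < Num.min omF (mu_v / 2))
  (Cn omn : R) (Cn_gt0 : 0 < Cn) (Cn_est : smoothing_estimate S Cn omn)
  (CY1 GYd : R) (CY1_gt0 : 0 < CY1) (GYd_gt0 : 0 < GYd)
  (CY_est : mild_estimate D S SF th CY1 GYd)
  (small_gain :
     G_ud D Cn omn GYd th * G_du al1 a1bar lam1 lam2 mu_v th < 1) :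
  exists2 M : R, 1 <= M &
    forall (u0 : XI l) (v0 : XO l d) (U0 : R -> XI l),
      Bochner_L2 (- D) 0 U0 ->
    forall (U u : R -> XI l) (v : R -> XO l d),
      closed_loop_solution D e1 e2 e2b al1 al2 lam1 lam2 g S P K
        u0 v0 U0 U u v ->
    forall t : R, 0 <= t ->
      state_norm D U u v t <=
        M * expR (- th * t) * (Hnorm u0 v0 + fine (wnorm 0 (- D) 0 U0)).
Proof.
have [Ca Ca0 Ca_bound] := mulop_bounded a1bar; have [Cg Cg0 Cg_bound] := mulop_bounded g.
have [CK CK0 CK_bound] := KP_bounded P_proj K_lin.
have [CS CS0 CS_bound] := S_bounded l_gt0 e1_gt0 S_gen Cn_est D.
have MF0 : 0 < MF by exact: lt_le_trans MF_ge1.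
have SF_bounded t phi : 0 <= t -> nrm (SF t phi) <= MF * nrm phi.
  move=> t0; apply: (le_trans (SF_decay t phi t0)); apply: ler_wpM2r; first exact: nrm_ge0.
  rewrite ler_piMr ?(ltW MF0)// -expR0 ler_expR mulNr oppr_le0.
  by apply: mulr_ge0 => //; exact: ltW.
have th_mu : 2 * th < mu_v by move: th_lt; rewrite lt_min => /andP[_]; lra.
(* The constant is read off from [closed_loop_decay], whose ingredients are all fixed before the
   data. *)
eexists; last first.
  move=> u0 v0 U0 U0_B U u v sol t t0.
  exact: (closed_loop_decay l_gt0 d_gt0 D_gt0 e1_gt0 S_gen P_proj K_lin SF_gen MF0 SF_bounded
    mu_v_gt0 coercive th_gt0 th_mu Cn_gt0 Cn_est CY1_gt0 GYd_gt0 CY_est small_gain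
    Ca0 Cg0 CK0 CS0 Ca_bound Cg_bound CK_bound CS_bound U0_B sol t0).
by rewrite /C_total lerDr sqrtr_ge0.
Qed.
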